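(* Assume Assumption A and the design-point setting. Then \[ \sup_{t\in\mathbb{R}}\left|P\Big(\max_{1\le\ell\le N}|W_n(x_\ell)|\le t\Big)-P\Big(\max_{1\le\ell\le N}|Y_\ell|\le t\Big)\right|\to0\quad(n\to\infty), \] where $Y=(Y_1,\dots,Y_N)^\top$ is a standard normal random vector in $\mathbb{R}^N$ (i.e. with identity covariance).
   Context: Model: Let $\lambda>0$. Let $J_t=\sum_{j=1}^{N_t}U_j$ be a compound Poisson process, where $(N_t)$ is a Poisson process with intensity $\alpha>0$ and $(U_j)$ are i.i.d. positive random variables with distribution $F$, independent of $N$; its Lévy measure is $\nu=\alpha F$. Let $X=(X_t)_{t\ge0}$ be the stationary solution of $dX_t=-\lambda X_t\,dt+dJ_{\lambda t}$. Put $k(x)=\nu((x,\infty))$ for $x\ge0$ (and $k(x)=0$ for $x<0$), and $k_\sharp(x)=k(|x|)$. The stationary distribution $\pi$ has characteristic function $\varphi(t)=\exp\big(\int_0^\infty(e^{itx}-1)\frac{k(x)}{x}dx\big)$; $\varphi_k(u)=\int_0^\infty e^{iux}k(x)dx$. One observes $X_\Delta,\dots,X_{n\Delta}$ with $\Delta=\Delta_n$. Let $\theta_n\sim n^{1/2}(\log n)^{-3}$. $W$ is a kernel with Fourier transform $\varphi_W(u)=\int e^{iux}W(x)dx$, $h=h_n\to0$ a bandwidth. Definitions: $K_n(x)=\frac1{2\pi}\int e^{-itx}\frac{\varphi_W(t)}{\varphi(t/h)}dt$, $Z_{n,j}(x)=X_{j\Delta}1\{|X_{j\Delta}|\le\theta_n\}K_n(\frac{x-X_{j\Delta}}h)$,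 $Z_n(x)=\frac1{nh}\sum_{j=1}^n(Z_{n,j}(x)-E[Z_{n,1}(x)])$, $\sigma_n^2(x)=\mathrm{Var}(\sqrt n\,hZ_n(x))$, $W_n(x)=\frac{1}{\sigma_n(x)\sqrt n}\sum_{j=1}^n(Z_{n,j}(x)-E[Z_{n,1}(x)])=\sqrt n\,hZ_n(x)/\sigma_n(x)$. Assumption A: (i) $\int_0^\infty(1\vee|x|^{2+\epsilon})k(x)dx<\infty$ for some $\epsilon>0$. (ii) $k(0)=\alpha$ with $2<\alpha<\infty$. (iii) For some $r>1/2$, with $p$ the integer satisfying $p<r\le p+1$, $k_\sharp$ is $p$ times differentiable and $k_\sharp^{(p)}$ is $(r-p)$-Hölder continuous on $\mathbb{R}$. (iv) $|\varphi_k(u)|\lesssim(1+|u|)^{-1}$, $|\varphi_k'(u)|\vee|\varphi_k''(u)|\lesssim(1+|u|)^{-2}$. (v) $W$ integrable, $\int W=1$, $\int|x|^{p+1}|W|<\infty$, $\int x^\ell W(x)dx=0$ for $\ell=1,\dots,p$, $\varphi_W(u)=0$ for $|u|>1$, $\varphi_W\in C^3$. (vi) $\Delta_n\gtrsim\log n$, $n/\Delta_n\to\infty$, and for some $\delta\in(0,1/12)$, $((\log n)^5/n)^{1/(2+2\alpha-\delta)}\ll h\ll(1/(n\log n))^{1/(1+2r+2\alpha-\delta)}$. Design-point setting: $I=[a,b]\subset(0,\infty)$ is a compact interval, and $x_1<\cdots<x_N$ are points of $I$, where $N=N_n$ may depend on $n$ (possibly $N\to\infty$), satisfying $\min_{1\le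 k\ne\ell\le N}|x_k-x_\ell|/h^{1-2\delta}\to\infty$ with $\delta$ from (vi). *)

(* Defs.v *)
From HB Require Import structures.
From mathcomp Require Import all_boot all_order all_algebra.
From mathcomp Require Import all_classical all_reals all_analysis.
Set Implicit Arguments. Unset Strict Implicit. Unset Printing Implicit Defensive.
Import Order.TTheory GRing.Theory Num.Theory.
Import numFieldNormedType.Exports.
Local Open Scope classical_set_scope.
Local Open Scope ring_scope.

Section Defs.
Context {R : realType}.

Definition RintR (f : R -> R) : R :=
  fine (\int[lebesgue_measure]_(x in [set: R]) (f x)%:E)%E.
Definition Rint0inf (f : R -> R) : R :=
  fine (\int[lebesgue_measure]_(x in `]0%R, +oo[%classic) (f x)%:E)%E.

Definition mutually_independent d (T : measurableType d) (P : probability T R)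
  (I : eqType) (X : I -> T -> R) : Prop :=
  forall (J : seq I) (B : I -> set R), uniq J -> (forall i, measurable (B i)) ->
    fine (P (\bigcap_(i in [set` J]) (X i @^-1` B i))) =
    \prod_(i <- J) fine (P (X i @^-1` B i)).

Definition std_normal_vector d (T : measurableType d) (Q : probability T R)
  (N : nat) (Y : 'I_N -> T -> R) : Prop :=
  (forall l, measurable_fun [set: T] (Y l)) /\ mutually_independent Q Y /\
  (forall l (A : set R), measurable A -> Q (Y l @^-1` A) = normal_prob 0 1 A).

Definition kf (alpha : R) (F : probability R R) (x : R) : R :=
  if 0 <= x then alpha * fine (F `]x, +oo[%classic) else 0.
Definition ksharp alpha F (x : R) : R := kf alpha F `|x|.

(** phi(t) = exp( int_0^oo (e^{itx}-1) k(x)/x dx ) = exp(A t + i B t). *)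
Definition phiA alpha F (t : R) : R :=
  Rint0inf (fun x => (cos (t * x) - 1) * kf alpha F x / x).
Definition phiB alpha F (t : R) : R :=
  Rint0inf (fun x => sin (t * x) * kf alpha F x / x).
Definition phi_re alpha F (t : R) : R := expR (phiA alpha F t) * cos (phiB alpha F t).
Definition phi_im alpha F (t : R) : R := expR (phiA alpha F t) * sin (phiB alpha F t).

Definition phik_re alpha F (u : R) : R := Rint0inf (fun x => cos (u * x) * kf alpha F x).
Definition phik_im alpha F (u : R) : R := Rint0inf (fun x => sin (u * x) * kf alpha F x).

Definition phiW_re (W : R -> R) (u : R) : R := RintR (fun x => cos (u * x) * W x).
Definition phiW_im (W : R -> R) (u : R) : R := RintR (fun x => sin (u * x) * W x).

(** K_n(x) = (1/2pi) int e^{-itx} phi_W(t)/phi(t/h) dt.  The integrand is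
    Hermitian, so K_n is real; we integrate its real part:
    Re(e^{-itx}(a+ib)/(c+id)) = (cos(tx)(ac+bd) + sin(tx)(bc-ad))/(c^2+d^2). *)
Definition Kn alpha F (W : R -> R) (h x : R) : R :=
  (2 * pi)^-1 * RintR (fun t =>
    let a := phiW_re W t in let b := phiW_im W t in
    let c := phi_re alpha F (t / h) in let d := phi_im alpha F (t / h) in
    (cos (t * x) * (a * c + b * d) + sin (t * x) * (b * c - a * d)) / (c ^+ 2 + d ^+ 2)).

Definition arrival {T : Type} (E : nat -> T -> R) (j : nat) (w : T) : R :=
  \sum_(i < j.+1) E i w.

(** Pathwise solution of dX_t = -lam X_t dt + dJ_{lam t}, J_s = sum_{T_j <= s} U_j:
    X_t = e^{-lam t} X_0 + sum_{j : T_j <= lam t} e^{-lam t + T_j} U_j. *)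
Definition OUproc {T : Type} (lam : R) (X0 : T -> R) (E U : nat -> T -> R)
  (t : R) (w : T) : R :=
  expR (- (lam * t)) * X0 w +
  limn (fun m => \sum_(j < m)
     ((if arrival E j w <= lam * t then 1 else 0) * expR (- (lam * t) + arrival E j w) * U j w)).

Definition Znj {T : Type} lam X0 E U alpha F W (Delta theta h : R) (j : nat) (x : R)
  (w : T) : R :=
  let Xj := OUproc lam X0 E U (j%:R * Delta) w in
  Xj * (if `|Xj| <= theta then 1 else 0) * Kn alpha F W h ((x - Xj) / h).

Definition sqrtn_h_Zn d (T : measurableType d) (P : probability T R)
  lam X0 E U alpha F W (n : nat) (Delta theta h x : R) (w : T) : R :=
  let EZ := fine ('E_P[Znj lam X0 E U alpha F W Delta theta h 1 x])%E in
  (Num.sqrt n%:R)^-1 *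
  \sum_(1 <= j < n.+1) (Znj lam X0 E U alpha F W Delta theta h j x w - EZ).

Definition Wn d (T : measurableType d) (P : probability T R)
  lam X0 E U alpha F W (n : nat) (Delta theta h x : R) (w : T) : R :=
  let S := sqrtn_h_Zn P lam X0 E U alpha F W n Delta theta h x in
  S w / Num.sqrt (fine ('V_P[S])%E).

End Defs.

(* Main.v *)
(* Sampled at spacing Delta_n, the process is an autoregression X_k = rho X_{k-1} + zeta_k
   with rho = exp (- lambda Delta_n) a negative power of n and, by the characteristic-function
   identity for self-decomposable laws, independent innovations. Since |phi| behaves like
   (1 + |t|)^(-alpha), the kernel K_n is of exact order h^(-alpha) and decays like 1/|x|, while
   alpha > 2 makes the law of X_k have bounded concentration at every scale; hence design points
   separated by h^(1-2 delta) are asymptotically uncorrelated and the variances are of exact order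
   h^(1-2 alpha). The indicator of the maximum is sandwiched between smooth functions
   exp (- sum_l c (e^(b x_l) + e^(- b x_l))), whose derivatives up to order three are bounded
   independently of the number of points, and Lindeberg's replacement argument with Rademacher
   signs, with blocks of bounded length, compares them with a product of one-dimensional Gaussian
   expectations. *)
Require Import Defs.
From HB Require Import structures.
From mathcomp Require Import all_boot all_order all_algebra.
From mathcomp Require Import all_classical all_reals all_analysis measurable_realfun.
From mathcomp Require Import ring lra zify.
Set Implicit Arguments. Unset Strict Implicit. Unset Printing Implicit Defensive.
Import Order.TTheory GRing.Theory Num.Theory.
Import numFieldNormedType.Exports.
Local Open Scope classical_set_scope.
Local Open Scope ring_scope.

(** No density of the innovations is available. Their independence is read off a joint
    characteristic function: the truncated shot noise and its conjectured limit obey the same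
    one-jump recursion. Every passage from characteristic functions to laws goes through Poisson
    kernels, which are integrable mixtures of cosines. Small-ball bounds for innovations are
    inherited from the stationary law at the price of an additive [rho]. The block length [q] can
    stay fixed because [q * lam * c >= 12] forces [rho ^+ q <= n^-12], small enough to absorb the
    other powers of [n]. Since the number of points may grow like a power of [n], a factor [N] is
    affordable only next to a negative power of [n]: derivatives of the soft indicator are
    controlled through [y^k * exp (- y)], and anticoncentration uses that [N p^(N-1) (1 - p)] is a
    probability. With [L = ln n] the sharpness is [L^3], the threshold shift [L^-2] and the Gaussian
    cut [2 L]; the errors are then powers of [L] times [n^-gam], except for an anticoncentration
    term of order [1 / L], which fixes the rate. *)

Notation leb := (@lebesgue_measure _).

(** * Integrals of real-valued functions *)

Definition itg {R : realType} {d} {T : measurableType d} (mu : set T -> \bar R) (f : T -> R) : Prop :=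
 measurable_fun setT f /\ (\int[mu]_x `|(f x)%:E| < +oo)%E.

(** [fine] sends an infinite integral to 0, which is why the linearity lemmas below carry [itg]
    premises. *)
Definition J {R : realType} {d} {T : measurableType d} (mu : set T -> \bar R) (f : T -> R) : R :=
 fine (\int[mu]_x (f x)%:E)%E.

Definition bmf {R : realType} {d} {T : measurableType d} (f : T -> R) : Prop :=
 measurable_fun setT f /\ exists M, forall x, `|f x| <= M.

Section integral_api.
Context {R : realType} {d} {T : measurableType d}.
Variable mu : {measure set T -> \bar R}.
Implicit Types f g : T -> R.

Lemma itgP f : itg mu f <-> mu.-integrable setT (EFin \o f).
Proof.
split=> [[mf fo]|/integrableP[mf fo]].
 by apply/integrableP; split => //; exact/measurable_EFinP.
by split => //; exact/measurable_EFinP.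
Qed.

Lemma itg_meas f : itg mu f -> measurable_fun setT f. Proof. by case. Qed.

Lemma J_fin f : itg mu f -> (\int[mu]_x (f x)%:E)%E = (J mu f)%:E.
Proof.
move=> /itgP fi; rewrite /J fineK//; exact: integrable_fin_num.
Qed.

Lemma itgD f g : itg mu f -> itg mu g -> itg mu (fun x => f x + g x).
Proof. by move=> /itgP fi /itgP gi; apply/itgP; exact: (integrableD _ fi gi). Qed.

Lemma itgZ c f : itg mu f -> itg mu (fun x => c * f x).
Proof. by move=> /itgP fi; apply/itgP; exact: (integrableZl _ c fi). Qed.

Lemma itgZr c f : itg mu f -> itg mu (fun x => f x * c).
Proof. by move=> /(itgZ c); under eq_fun do rewrite mulrC. Qed.

Lemma itgN f : itg mu f -> itg mu (fun x => - f x).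
Proof. by move=> /(itgZ (-1)); under eq_fun do rewrite mulN1r. Qed.

Lemma itgB f g : itg mu f -> itg mu g -> itg mu (fun x => f x - g x).
Proof. by move=> fi gi; apply: itgD => //; exact: itgN. Qed.

Lemma itg_dom f g : measurable_fun setT f -> (forall x, `|f x| <= g x) -> itg mu g -> itg mu f.
Proof.
move=> mf fg [mg gi]; split => //; apply: le_lt_trans gi.
apply: ge0_le_integral => //.
- by do 2 apply: measurableT_comp => //.
- by do 2 apply: measurableT_comp => //.
- by move=> x _; rewrite lee_fin (le_trans (fg x))// ler_norm.
Qed.

Lemma itg_norm f : itg mu f -> itg mu (fun x => `|f x|).
Proof.
move=> fi; apply: (@itg_dom _ (fun x => `|f x|)).
- by apply: measurableT_comp => //; exact: itg_meas fi.
- by move=> x; rewrite normr_id.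
- move: fi => [mf fo]; split; first by apply: measurableT_comp.
 by under eq_integral do rewrite /= normr_id.
Qed.

Lemma itg0 : itg mu (fun=> 0).
Proof.
split; first exact: measurable_cst.
by under eq_integral do rewrite /= normr0; rewrite integral0.
Qed.

Lemma itg_sum (I : eqType) (s : seq I) (F : I -> T -> R) :
 (forall i, i \in s -> itg mu (F i)) -> itg mu (fun x => \sum_(i <- s) F i x).
Proof.
elim: s => [|i s ih] h; first by under eq_fun do rewrite big_nil; exact: itg0.
under eq_fun do rewrite big_cons.
apply: itgD; first by apply: h; rewrite mem_head.
by apply: ih => j js; apply: h; rewrite in_cons js orbT.
Qed.

Lemma J_D f g : itg mu f -> itg mu g -> J mu (fun x => f x + g x) = J mu f + J mu g.
Proof.
move=> fi gi; rewrite /J.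
under eq_integral do rewrite EFinD.
by rewrite integralD ?J_fin//; exact/itgP.
Qed.

Lemma J_Z c f : itg mu f -> J mu (fun x => c * f x) = c * J mu f.
Proof.
move=> fi; rewrite /J; under eq_integral do rewrite EFinM.
by rewrite integralZl ?J_fin//; exact/itgP.
Qed.

Lemma J_Zr c f : itg mu f -> J mu (fun x => f x * c) = J mu f * c.
Proof. by move=> fi; rewrite [RHS]mulrC -J_Z//; congr J; apply/funext => x; rewrite mulrC. Qed.

Lemma J_N f : itg mu f -> J mu (fun x => - f x) = - J mu f.
Proof. by move=> fi; rewrite -mulN1r -J_Z//; congr J; apply/funext => x; rewrite mulN1r. Qed.

Lemma J_B f g : itg mu f -> itg mu g -> J mu (fun x => f x - g x) = J mu f - J mu g.
Proof. by move=> fi gi; rewrite J_D ?J_N//; exact: itgN. Qed.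

Lemma J0 : J mu (fun=> 0) = 0.
Proof. by rewrite /J integral0. Qed.

Lemma J_sum (I : eqType) (s : seq I) (F : I -> T -> R) :
 (forall i, i \in s -> itg mu (F i)) ->
 J mu (fun x => \sum_(i <- s) F i x) = \sum_(i <- s) J mu (F i).
Proof.
elim: s => [|i s ih] h.
 by rewrite big_nil; under eq_fun do rewrite big_nil; exact: J0.
under eq_fun do rewrite big_cons; rewrite big_cons J_D ?ih//.
- by move=> j js; apply: h; rewrite in_cons js orbT.
- by apply: h; rewrite mem_head.
- by apply: itg_sum => j js; apply: h; rewrite in_cons js orbT.
Qed.

Lemma J_ge0 f : (forall x, 0 <= f x) -> 0 <= J mu f.
Proof. by move=> f0; apply: fine_ge0; apply: integral_ge0 => x _; rewrite lee_fin. Qed.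

Lemma J_le f g : itg mu f -> itg mu g -> (forall x, f x <= g x) -> J mu f <= J mu g.
Proof.
move=> fi gi fg; rewrite -subr_ge0 -J_B//; apply: J_ge0 => x.
by rewrite subr_ge0.
Qed.

Lemma J_abs f g : measurable_fun setT f -> itg mu g -> (forall x, `|f x| <= g x) ->
 `|J mu f| <= J mu g.
Proof.
move=> mf gi fg; have fi := itg_dom mf fg gi.
rewrite ler_norml -J_N//; apply/andP; split; apply: J_le => //; try exact: itgN.
- by move=> x; have := fg x; rewrite ler_norml => /andP[].
- by move=> x; have := fg x; rewrite ler_norml => /andP[].
Qed.

Lemma J_dct (F : nat -> T -> R) f g : (forall n, measurable_fun setT (F n)) -> itg mu g ->
 (forall n x, `|F n x| <= g x) -> (forall x, F ^~ x @ \oo --> f x) ->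
 itg mu f /\ J mu (F n) @[n --> \oo] --> J mu f.
Proof.
move=> mF gi Fg Ff.
have mf : measurable_fun setT f by apply: (measurable_fun_cvg mF) => x _; exact: Ff.
have fg x : `|f x| <= g x.
 have h : (fun n => `|F n x|) @ \oo --> `|f x| by apply: cvg_norm; exact: Ff.
 rewrite -(cvg_lim _ h)//; apply: limr_le; first by apply/cvg_ex; exists `|f x|.
 by near=> n; exact: Fg.
have fi := itg_dom mf fg gi.
split => //.
have := @dominated_cvg _ _ _ mu setT measurableT (fun n x => (F n x)%:E) (EFin \o f) (EFin \o g)
 (fun n => (measurable_EFinP _ _).2 (mF n)).
have h2 x : [set: T] x -> (fun n => (F n x)%:E) @ \oo --> (EFin \o f) x.
 by move=> _; apply/cvg_EFin; [exact: nearW|exact: Ff].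
have h3 x : [set: T] x -> (EFin \o g) x \is a fin_num by [].
have h4 n x : [set: T] x -> (`|(F n x)%:E| <= (EFin \o g) x)%E.
 by move=> _; rewrite lee_fin.
move=> /(_ h2 h3 ((itgP g).1 gi) h4) h5.
rewrite /J; apply: (@fine_cvg _ _ _ _ (fun n => \int[mu]_x (F n x)%:E)%E).
by rewrite J_fin// in h5.
Unshelve. all: by end_near. Qed.

End integral_api.

(** * Measurability of composite expressions *)

Section measurability.
Context {R : realType} {d} {T : measurableType d}.
Implicit Types f g : T -> R.

Lemma meas_D f g : measurable_fun setT f -> measurable_fun setT g ->
 measurable_fun setT (fun x => f x + g x).
Proof. exact: measurable_funD. Qed.
Lemma meas_M f g : measurable_fun setT f -> measurable_fun setT g ->
 measurable_fun setT (fun x => f x * g x).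
Proof. exact: measurable_funM. Qed.
Lemma meas_N f : measurable_fun setT f -> measurable_fun setT (fun x => - f x).
Proof. exact: measurable_funN. Qed.
Lemma meas_X n f : measurable_fun setT f -> measurable_fun setT (fun x => f x ^+ n).
Proof. exact: measurable_funX. Qed.
Lemma meas_comp (h : R -> R) f : measurable_fun setT h -> measurable_fun setT f ->
 measurable_fun setT (fun x => h (f x)).
Proof. by move=> mh mf; apply: (measurableT_comp mh mf). Qed.
Lemma meas_cont (h : R -> R) f : continuous h -> measurable_fun setT f ->
 measurable_fun setT (fun x => h (f x)).
Proof. by move=> /continuous_measurable_fun; exact: meas_comp. Qed.
Lemma meas_exp f : measurable_fun setT f -> measurable_fun setT (fun x => expR (f x)).
Proof. exact: meas_cont (@continuous_expR R). Qed.
Lemma meas_cos f : measurable_fun setT f -> measurable_fun setT (fun x => cos (f x)).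
Proof. exact: meas_cont (@continuous_cos R). Qed.
Lemma meas_sin f : measurable_fun setT f -> measurable_fun setT (fun x => sin (f x)).
Proof. exact: meas_cont (@continuous_sin R). Qed.
Lemma meas_atan f : measurable_fun setT f -> measurable_fun setT (fun x => atan (f x)).
Proof. by apply: meas_cont; apply: continuous_atan. Qed.
Lemma meas_norm f : measurable_fun setT f -> measurable_fun setT (fun x => `|f x|).
Proof. by move=> mf; apply: (measurableT_comp _ mf). Qed.
Lemma meas_if (b : T -> bool) f g : measurable_fun setT b -> measurable_fun setT f ->
 measurable_fun setT g -> measurable_fun setT (fun x => if b x then f x else g x).
Proof. exact: measurable_fun_ifT. Qed.
Lemma meas_le f g : measurable_fun setT f -> measurable_fun setT g ->
 measurable_fun setT (fun x => f x <= g x).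
Proof. exact: measurable_fun_ler. Qed.
Lemma meas_lt f g : measurable_fun setT f -> measurable_fun setT g ->
 measurable_fun setT (fun x => f x < g x).
Proof. exact: measurable_fun_ltr. Qed.
Lemma meas_max f g : measurable_fun setT f -> measurable_fun setT g ->
 measurable_fun setT (fun x => Num.max (f x) (g x)).
Proof. exact: measurable_maxr. Qed.
(** Inversion is discontinuous at 0, where its value is 0 by convention; splitting by sign reduces
    it to [expR (- ln x)], a composite of measurable functions. *)
Lemma meas_inv f : measurable_fun setT f -> measurable_fun setT (fun x => (f x)^-1).
Proof.
apply: (@meas_comp (fun x => x^-1)).
rewrite (_ : (fun x => x^-1) = (fun x : R => if 0 < x then expR (- ln x) else
  if x < 0 then - expR (- ln (- x)) else 0)); last first.
 apply/funext => x; case: (ltgtP x 0) => h.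
 - by rewrite expRN lnK ?posrE ?oppr_gt0// invrN opprK.
 - by rewrite expRN lnK.
 - by rewrite h invr0.
have mln (h : R -> R) : measurable_fun setT h -> measurable_fun setT (fun x => ln (h x)).
 by move=> mh; exact: (measurableT_comp (@measurable_ln R) mh).
have mexp (h : R -> R) : measurable_fun setT h -> measurable_fun setT (fun x => expR (h x)).
 by move=> mh; exact: (measurableT_comp (@measurable_expR R) mh).
have mopp (h : R -> R) : measurable_fun setT h -> measurable_fun setT (fun x => - h x).
 exact: measurable_funN.
apply: measurable_fun_ifT; first exact: measurable_fun_ltr.
 by apply: (mexp (fun x => - ln x)); apply: (mopp (fun x => ln x)); exact: measurable_ln.
apply: measurable_fun_ifT => //; first exact: measurable_fun_ltr.
apply: (mopp (fun x => expR (- ln (- x)))); apply: (mexp (fun x => - ln (- x))).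
by apply: (mopp (fun x => ln (- x))); apply: (mln (fun x => - x)); apply: (mopp id).
Qed.
Lemma meas_sum (I : Type) (s : seq I) (F : I -> T -> R) :
 (forall i, measurable_fun setT (F i)) -> measurable_fun setT (fun x => \sum_(i <- s) F i x).
Proof. exact: measurable_sum. Qed.
Lemma meas_prod (I : Type) (s : seq I) (F : I -> T -> R) :
 (forall i, measurable_fun setT (F i)) -> measurable_fun setT (fun x => \prod_(i <- s) F i x).
Proof.
move=> mF; elim: s => [|i s ih].
 by under eq_fun do rewrite big_nil; exact: measurable_cst.
by under eq_fun do rewrite big_cons; exact: meas_M.
Qed.
Lemma meas_indic_comp {d'} {S : measurableType d'} (A : set S) (f : T -> S) : measurable A ->
 measurable_fun setT f -> measurable_fun setT (fun x => \1_A (f x) : R).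
Proof. by move=> mA mf; apply: (measurableT_comp _ mf); exact: measurable_indic. Qed.
End measurability.

Ltac mf1 := lazymatch goal with
 | |- measurable _ => by []
 | |- measurable_fun _ (fun x => x) => exact: measurable_id
 | |- measurable_fun _ (fun x => x.1) => exact: measurable_fst
 | |- measurable_fun _ (fun x => x.2) => exact: measurable_snd
 | |- measurable_fun _ (fun x => @?f x + @?g x) => apply: (@meas_D _ _ _ f g)
 | |- measurable_fun _ (fun x => @?f x * @?g x) => apply: (@meas_M _ _ _ f g)
 | |- measurable_fun _ (fun x => - @?f x) => apply: (@meas_N _ _ _ f)
 | |- measurable_fun _ (fun x => @?f x ^+ ?n) => apply: (@meas_X _ _ _ n f)
 | |- measurable_fun _ (fun x => (@?f x)^-1) => apply: (@meas_inv _ _ _ f)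
 | |- measurable_fun _ (fun x => expR (@?f x)) => apply: (@meas_exp _ _ _ f)
 | |- measurable_fun _ (fun x => cos (@?f x)) => apply: (@meas_cos _ _ _ f)
 | |- measurable_fun _ (fun x => sin (@?f x)) => apply: (@meas_sin _ _ _ f)
 | |- measurable_fun _ (fun x => atan (@?f x)) => apply: (@meas_atan _ _ _ f)
 | |- measurable_fun _ (+%R ?a) => apply: (@meas_D _ _ _ (fun=> a) id)
 | |- measurable_fun _ ( *%R ?a) => apply: (@meas_M _ _ _ (fun=> a) id)
 | |- measurable_fun _ (@Order.lt _ _ ?a) => apply: (@meas_lt _ _ _ (fun=> a) id)
 | |- measurable_fun _ (@Order.le _ _ ?a) => apply: (@meas_le _ _ _ (fun=> a) id)
 | |- measurable_fun _ (fun x => `|@?f x|) => apply: (@meas_norm _ _ _ f)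
 | |- measurable_fun _ (fun x => Num.max (@?f x) (@?g x)) => apply: (@meas_max _ _ _ f g)
 | |- measurable_fun _ (fun x => if _ then _ else _) => apply: meas_if
 | |- measurable_fun _ (fun x => @?f x <= @?g x) => apply: (@meas_le _ _ _ f g)
 | |- measurable_fun _ (fun x => @?f x < @?g x) => apply: (@meas_lt _ _ _ f g)
 | |- measurable_fun _ (fun x => \1_(?A) (@?f x)) => apply: (@meas_indic_comp _ _ _ _ _ A f)
 | |- measurable_fun _ (fun x => bigop.body _ _ _) => first [apply: meas_sum => ? | apply: meas_prod => ?]
 | H : measurable_fun _ ?h |- measurable_fun _ (fun x => ?h (@?f x)) => first [exact: H | apply: (measurableT_comp H)]
 | H : forall k, measurable_fun _ (?h k) |- measurable_fun _ (?h ?k) => exact: (H k)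
 | H : forall k, measurable_fun _ (?h k) |- measurable_fun _ (fun x => ?h ?k (@?f x)) => first [exact: (H k) | apply: (measurableT_comp (H k))]
 end.
Ltac mf := repeat (first [assumption | exact: measurable_id | exact: measurable_cst | mf1]).

(** * Bounded measurable functions *)

Section bounded.
Context {R : realType} {d} {T : measurableType d}.
Implicit Types f g : T -> R.

Lemma bmf_meas f : bmf f -> measurable_fun setT f. Proof. by case. Qed.

Lemma bmf_intro M f : measurable_fun setT f -> (forall x, `|f x| <= M) -> bmf f.
Proof. by move=> mf fM; split => //; exists M. Qed.

Lemma bmf_cst (c : R) : bmf (fun _ : T => c).
Proof. by apply: (@bmf_intro `|c|) => //; mf. Qed.

Lemma bmfD f g : bmf f -> bmf g -> bmf (fun x => f x + g x).
Proof.
move=> [mf [M fM]] [mg [M' gM]]; apply: (@bmf_intro (M + M')); first by mf.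
by move=> x; apply: le_trans (ler_normD _ _) _; exact: lerD.
Qed.

Lemma bmfM f g : bmf f -> bmf g -> bmf (fun x => f x * g x).
Proof.
move=> [mf [M fM]] [mg [M' gM]]; apply: (@bmf_intro (M * M')); first by mf.
by move=> x; rewrite normrM ler_pM.
Qed.

Lemma bmfN f : bmf f -> bmf (fun x => - f x).
Proof. by move=> [mf [M fM]]; apply: (@bmf_intro M); [by mf|move=> x; rewrite normrN]. Qed.

Lemma bmf_cos f : measurable_fun setT f -> bmf (fun x => cos (f x)).
Proof. by move=> mf; apply: (@bmf_intro 1); [by mf|move=> x; rewrite ler_norml cos_geN1 cos_le1]. Qed.

Lemma bmf_sin f : measurable_fun setT f -> bmf (fun x => sin (f x)).
Proof. by move=> mf; apply: (@bmf_intro 1); [by mf|move=> x; rewrite ler_norml sin_geN1 sin_le1]. Qed.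

Lemma bmf_if (b : T -> bool) f g : measurable_fun setT b -> bmf f -> bmf g ->
 bmf (fun x => if b x then f x else g x).
Proof.
move=> mb [mf [M fM]] [mg [M' gM]]; apply: (@bmf_intro (Num.max M M')); first by mf.
by move=> x; case: ifP => _; rewrite le_max ?fM ?gM ?orbT.
Qed.

Lemma bmf_norm f : bmf f -> bmf (fun x => `|f x|).
Proof. by move=> [mf [M fM]]; apply: (@bmf_intro M); [by mf|move=> x; rewrite normr_id]. Qed.

Lemma bmf_indic (A : set T) : measurable A -> bmf (\1_A : T -> R).
Proof.
move=> mA; apply: (@bmf_intro 1); first exact: measurable_indic.
by move=> x; rewrite indicE; case: (_ \in _); rewrite ?normr1 ?normr0.
Qed.

Lemma bmf_comp {d'} {S : measurableType d'} (f : T -> R) (X : S -> T) : bmf f ->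
 measurable_fun setT X -> bmf (fun w => f (X w)).
Proof. by move=> [mf [M fM]] mX; split; [exact: (measurableT_comp mf mX)|exists M]. Qed.

Lemma bmf_sum (I : Type) (s : seq I) (F : I -> T -> R) :
 (forall i, bmf (F i)) -> bmf (fun x => \sum_(i <- s) F i x).
Proof.
move=> h; elim: s => [|i s ih]; first by under eq_fun do rewrite big_nil; exact: bmf_cst.
by under eq_fun do rewrite big_cons; exact: bmfD.
Qed.

Lemma bmf_prod (I : Type) (s : seq I) (F : I -> T -> R) :
 (forall i, bmf (F i)) -> bmf (fun x => \prod_(i <- s) F i x).
Proof.
move=> h; elim: s => [|i s ih]; first by under eq_fun do rewrite big_nil; exact: bmf_cst.
by under eq_fun do rewrite big_cons; exact: bmfM.
Qed.

End bounded.

Ltac bm1 := lazymatch goal with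
 | |- bmf (fun x => @?f x + @?g x) => apply: (@bmfD _ _ _ f g)
 | |- bmf (fun x => @?f x * @?g x) => apply: (@bmfM _ _ _ f g)
 | |- bmf (fun x => - @?f x) => apply: (@bmfN _ _ _ f)
 | |- bmf (fun x => `|@?f x|) => apply: (@bmf_norm _ _ _ f)
 | |- bmf (fun x => cos (@?f x)) => apply: (@bmf_cos _ _ _ f); mf
 | |- bmf (fun x => sin (@?f x)) => apply: (@bmf_sin _ _ _ f); mf
 | |- bmf (fun x => if _ then _ else _) => apply: bmf_if; [by mf| |]
 | |- bmf (fun x => \1_(?A) (@?f x)) => apply: (@bmf_comp _ _ _ _ _ (\1_A) f); [exact: bmf_indic|mf]
 | |- bmf (fun x => bigop.body _ _ _) => first [apply: bmf_sum => ? | apply: bmf_prod => ?]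
 | H : bmf ?h |- bmf (fun x => ?h (@?f x)) => apply: (@bmf_comp _ _ _ _ _ h f H); mf
 end.
Ltac bm := repeat (first [assumption | exact: bmf_cst | exact: bmf_indic | bm1]).

(** * Expectations under a probability *)

Section probability.
Context {R : realType} {d} {T : measurableType d} (P : probability T R).
Implicit Types f g : T -> R.

Lemma itg_cst c : itg P (fun=> c).
Proof.
split; first exact: measurable_cst.
rewrite integral_cst//. set x := (X in (_ * X)%E); have -> : x = 1%E by exact: probability_setT. by rewrite mule1 ltry.
Qed.

Lemma bmf_itg f : bmf f -> itg P f.
Proof. by move=> [mf [M fM]]; apply: itg_dom (itg_cst M). Qed.

Lemma Ex_cst c : J P (fun=> c) = c.
Proof.
rewrite /J integral_cst//; set x := (X in (_ * X)%E).
by have -> : x = 1%E by [exact: probability_setT]; rewrite mule1.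
Qed.

Lemma Ex_indic (A : set T) : measurable A -> J P (\1_A) = fine (P A).
Proof. by move=> mA; rewrite /J integral_indic// setIT. Qed.

Lemma Ex_bound M f : measurable_fun setT f -> (forall x, `|f x| <= M) -> `|J P f| <= M.
Proof. by move=> mf fM; rewrite -[leRHS](Ex_cst M); apply: J_abs => //; exact: itg_cst. Qed.

Lemma prob_le (A B : set T) : measurable A -> measurable B -> A `<=` B -> fine (P A) <= fine (P B).
Proof.
move=> mA mB AB; apply: fine_le; try exact: fin_num_measure.
by apply: le_measure => //; rewrite inE.
Qed.

End probability.

Lemma J_ae {R : realType} {d} {T : measurableType d} (mu : {measure set T -> \bar R}) (A : set T) (f g : T -> R) :
 measurable_fun setT f -> measurable_fun setT g -> measurable A -> mu A = 0%E ->
 (forall x, ~ A x -> f x = g x) -> J mu f = J mu g.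
Proof.
move=> mf mg mA PA fA; rewrite /J; congr fine.
apply: ae_eq_integral => //; try exact/measurable_EFinP.
by exists A; split => // x /=; apply: contra_notP => nAx _; rewrite fA.
Qed.

(** * Change of variables and Fubini *)

Section pushforward.
Context {R : realType} {d d'} {T : measurableType d} {S : measurableType d'}.

(** The image measure is given by its values on measurable sets, so that the same statement serves
    for a translation of Lebesgue measure, for equality in law and for the diagonal map into a
    product measure. *)
Lemma J_push (mu : {measure set T -> \bar R}) (nu : {measure set S -> \bar R}) (X : T -> S) (f : S -> R) :
 measurable_fun setT X -> (forall A, measurable A -> mu (X @^-1` A) = nu A) ->
 itg nu f -> itg mu (fun w => f (X w)) /\ J mu (fun w => f (X w)) = J nu f.
Proof.
move=> mX h [mf fi].
have e (g : S -> \bar R) : (\int[pushforward mu X]_x g x = \int[nu]_x g x)%E.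
 by apply: eq_measure_integral => A mA _; exact: h.
have mfX : measurable_fun setT (fun w => f (X w)) by exact: (measurableT_comp mf mX).
have i1 : itg mu (fun w => f (X w)).
 split => //; move: fi; rewrite -e ge0_integral_pushforward//.
 by do 2 apply: measurableT_comp => //.
split => //; rewrite /J -e integral_pushforward//; first exact/measurable_EFinP.
exact/itgP.
Qed.

End pushforward.

Section fubini.
Context {R : realType} {d1 d2} {T1 : measurableType d1} {T2 : measurableType d2}.
Variables (m1 : {sigma_finite_measure set T1 -> \bar R}) (m2 : {sigma_finite_measure set T2 -> \bar R}).

(** The majorant bounds the inner absolute integral only, for integrands without a convenient
    product majorant; [J_swap] is the product case. *)
Lemma J_fubini (f : T1 -> T2 -> R) :
 measurable_fun setT (fun z : T1 * T2 => f z.1 z.2) ->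
 (forall x, itg m2 (f x)) -> (forall y, itg m1 (f ^~ y)) ->
 (exists2 g, itg m1 g & forall x, J m2 (fun y => `|f x y|) <= g x) ->
 [/\ itg m1 (fun x => J m2 (f x)), itg m2 (fun y => J m1 (f ^~ y)),
   J m1 (fun x => J m2 (f x)) = J m2 (fun y => J m1 (f ^~ y)) &
   J (m1 \x m2)%E (fun z => f z.1 z.2) = J m1 (fun x => J m2 (f x))].
Proof.
move=> mf fx fy [g ig Jg].
pose F z : \bar R := (f z.1 z.2)%:E.
have mF : measurable_fun setT F by exact/measurable_EFinP.
have FL x : fubini_F m2 F x = (J m2 (f x))%:E by exact: (J_fin (fx x)).
have GL y : fubini_G m1 F y = (J m1 (f ^~ y))%:E by exact: (J_fin (fy y)).
have iF : (m1 \x m2)%E.-integrable setT F.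
 apply/integrable12ltyP => //.
 apply: (@le_lt_trans _ _ (\int[m1]_x `|(g x)%:E|)%E); last exact: ig.2.
 apply: ge0_le_integral => //.
 - by move=> x _; apply: integral_ge0.
 - apply: (@measurable_fun_fubini_tonelli_F _ _ _ _ _ m2 (fun z => `|F z|)%E) => //.
  exact: measurableT_comp.
 - by do 2 apply: measurableT_comp => //; exact: itg_meas ig.
 by move=> x _; rewrite (J_fin (itg_norm (fx x))) lee_fin (le_trans (Jg x))// ler_norm.
have iX : itg m1 (fun x => J m2 (f x)).
 apply/itgP; rewrite (_ : _ \o _ = fubini_F m2 F); last by apply/funext => x; rewrite FL.
 exact: integrable_fubini_F.
have e1 := integral12_prod_meas1 iF; have e2 := integral21_prod_meas1 iF.
have e1' : (\int[m1]_x fubini_F m2 F x = (J m1 (fun x => J m2 (f x)))%:E)%E.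
 by rewrite -J_fin//; apply: eq_integral => x _; rewrite FL.
have iY : itg m2 (fun y => J m1 (f ^~ y)).
 have h := (@integrable21ltyP _ _ _ _ _ m1 m2 F mF).1 iF.
 split.
  apply/measurable_EFinP; rewrite (_ : _ \o _ = fubini_G m1 F); last by apply/funext => x; rewrite GL.
  exact: (measurable_fubini_G iF).
 apply: le_lt_trans h; apply: ge0_le_integral => //.
 - do 2 apply: measurableT_comp => //.
  apply/measurable_EFinP; rewrite (_ : _ \o _ = fubini_G m1 F); last by apply/funext => x; rewrite GL.
  exact: (measurable_fubini_G iF).
 - apply: (@measurable_fun_fubini_tonelli_G _ _ _ _ _ m1 (fun z => `|F z|)%E) => //.
  exact: measurableT_comp.
 by move=> y _; rewrite -GL; apply: le_abse_integral => //; exact/measurable_EFinP/(itg_meas (fy y)).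
have e2' : (\int[m2]_x fubini_G m1 F x = (J m2 (fun y => J m1 (f ^~ y)))%:E)%E.
 by rewrite -J_fin//; apply: eq_integral => x _; rewrite GL.
split => //; first by apply: EFin_inj; rewrite -e1' -e2' e1 e2.
by rewrite {1}/J -e1 e1'.
Qed.

Lemma J_swap (f : T1 -> T2 -> R) (g1 : T1 -> R) (g2 : T2 -> R) :
 measurable_fun setT (fun z : T1 * T2 => f z.1 z.2) -> itg m1 g1 -> itg m2 g2 ->
 (forall x y, `|f x y| <= g1 x * g2 y) ->
 [/\ itg m1 (fun x => J m2 (f x)), itg m2 (fun y => J m1 (f ^~ y)),
   J m1 (fun x => J m2 (f x)) = J m2 (fun y => J m1 (f ^~ y)) &
   J (m1 \x m2)%E (fun z => f z.1 z.2) = J m1 (fun x => J m2 (f x))].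
Proof.
move=> mf i1 i2 fg.
have fx x : itg m2 (f x).
 apply: itg_dom (itgZ (g1 x) i2) => //.
 by apply: (measurableT_comp mf (measurable_pair1 x)).
apply: J_fubini => //.
 move=> y; apply: itg_dom (itgZr (g2 y) i1) => //.
 by apply: (measurableT_comp mf (measurable_pair2 y)).
exists (fun x => g1 x * J m2 g2); first exact: itgZr.
by move=> x; rewrite -J_Z//; apply: J_le => //; [exact: itg_norm|exact: itgZ].
Qed.

End fubini.

(** * Derivatives and mean value bounds *)

Section derivation.
Context {R : realType}.
Implicit Types (f g : R -> R) (x : R).

(** The derivative is an explicit argument: [dauto] synthesizes it from the shape of [f] and leaves
    an equation for [ring] or [field]. *)
Definition dd f x a := is_derive x (1 : R) f a.

Lemma dd_eq f x a b : dd f x a -> a = b -> dd f x b.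
Proof. by move=> h <-. Qed.
Lemma dd_id x : dd (fun y => y) x 1. Proof. exact: is_derive_id. Qed.
Lemma dd_cst (c : R) x : dd (fun=> c) x 0. Proof. exact: is_derive_cst. Qed.
Lemma dd_D f g x a b : dd f x a -> dd g x b -> dd (fun y => f y + g y) x (a + b).
Proof. by move=> h1 h2; exact: (@is_deriveD _ _ _ f g x 1 a b h1 h2). Qed.
Lemma dd_N f x a : dd f x a -> dd (fun y => - f y) x (- a).
Proof. by move=> h; exact: (@is_deriveN _ _ _ f x 1 a h). Qed.
Lemma dd_M f g x a b : dd f x a -> dd g x b -> dd (fun y => f y * g y) x (f x * b + g x * a).
Proof. by move=> h1 h2; exact: (@is_deriveM _ _ f g x 1 a b h1 h2). Qed.
Lemma dd_comp f g x a b : dd f (g x) a -> dd g x b -> dd (fun y => f (g y)) x (a * b).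
Proof. by move=> h1 h2; exact: (@is_derive1_comp _ f g x a b h1 h2). Qed.
Lemma dd_V f x a : f x != 0 -> dd f x a -> dd (fun y => (f y)^-1) x (- (f x) ^- 2 * a).
Proof. by move=> f0 h; exact: (@is_deriveV _ f x a 1 f0 h). Qed.
Lemma dd_exp f x a : dd f x a -> dd (fun y => expR (f y)) x (expR (f x) * a).
Proof. exact: dd_comp (is_derive_expR _). Qed.
Lemma dd_cos f x a : dd f x a -> dd (fun y => cos (f y)) x (- sin (f x) * a).
Proof. exact: dd_comp (is_derive_cos _). Qed.
Lemma dd_sin f x a : dd f x a -> dd (fun y => sin (f y)) x (cos (f x) * a).
Proof. exact: dd_comp (is_derive_sin _). Qed.
Lemma dd_atan f x a : dd f x a -> dd (fun y => atan (f y)) x ((1 + f x ^+ 2)^-1 * a).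
Proof. exact: dd_comp (is_derive1_atan _). Qed.
Lemma dd_X f x a n : dd f x a -> dd (fun y => f y ^+ n) x (n%:R * f x ^+ n.-1 * a).
Proof.
move=> h; elim: n => [|n ih].
 by rewrite mul0r mul0r; under eq_fun do rewrite expr0; exact: dd_cst.
under eq_fun do rewrite exprS.
apply: dd_eq (dd_M h ih) _; case: n ih => [|n] _ /=; first by rewrite expr0; ring.
by rewrite (natrD _ 1 n.+1) exprS; ring.
Qed.
Lemma dd_derivable f x : derivable f x 1 -> dd f x (derive1 f x).
Proof. by move=> h; rewrite derive1E; exact: derivableP. Qed.

Lemma dd_cont1 f x a : dd f x a -> {for x, continuous f}.
Proof.
move=> h; apply/differentiable_continuous; apply/derivable1_diffP; exact: (@ex_derive _ _ _ _ _ _ _ h).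
Qed.

Lemma dd_cont f (g : R -> R) : (forall x, dd f x (g x)) -> continuous f.
Proof. by move=> h x; exact: dd_cont1 (h x). Qed.

Lemma dd_derive1 f x a : dd f x a -> derive1 f x = a.
Proof. by move=> h; rewrite derive1E; exact: (@derive_val _ _ _ _ _ _ _ h). Qed.

Lemma dd_mvt f (g : R -> R) a b : a <= b -> (forall x, a <= x <= b -> dd f x (g x)) ->
 exists2 c, a <= c <= b & f b - f a = g c * (b - a).
Proof.
move=> ab h.
have [||c cab ->] := @MVT_segment _ f g a b ab.
- by move=> x; rewrite in_itv/= => /andP[ax xb]; apply: h; rewrite !ltW.
- apply: continuous_in_subspaceT => x; rewrite inE/= in_itv/= => xab; exact: dd_cont1 (h _ xab).
by exists c => //; move: cab; rewrite in_itv.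
Qed.

Lemma dd_lip f (g : R -> R) C a b : a <= b -> (forall x, a <= x <= b -> dd f x (g x)) ->
 (forall x, a <= x <= b -> `|g x| <= C) -> `|f b - f a| <= C * (b - a).
Proof.
move=> ab h gC; have [c cab ->] := dd_mvt ab h.
by rewrite normrM (@ger0_norm _ (b - a)) ?subr_ge0// ler_wpM2r ?subr_ge0// gC.
Qed.

Lemma dd_nondec f (g : R -> R) a b : a <= b -> (forall x, a <= x <= b -> dd f x (g x)) ->
 (forall x, a <= x <= b -> 0 <= g x) -> f a <= f b.
Proof.
move=> ab h gC; have [c cab e] := dd_mvt ab h.
by rewrite -subr_ge0 e mulr_ge0 ?gC ?subr_ge0.
Qed.

(** The difference quotient misses [a] by at most [C * |y|]. This stands in for differentiation
    under the integral sign: a second-order bound on the integrand can be integrated directly. *)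
Lemma dd_quad f x a C : (forall y, `|f (x + y) - f x - y * a| <= C * y ^+ 2) -> dd f x a.
Proof.
move=> h.
have C0 : 0 <= C by have := h 1; rewrite expr1n mulr1; exact: le_trans.
have cv : (fun y : R => y^-1 *: (f (y *: (1 : R^o) + x) - f x)) @ 0^' --> a.
 apply/cvgrPdist_le => e e0; near=> y.
 have y0 : y != 0 by near: y; exact: nbhs_dnbhs_neq.
 rewrite /GRing.scale/= mulr1 (addrC y).
 rewrite (_ : a - _ = - (y^-1 * (f (x + y) - f x - y * a))); last by field.
 rewrite normrN normrM normfV ler_pdivrMl ?normr_gt0//.
 apply: le_trans (h y) _; rewrite -[y ^+ 2]ger0_norm ?sqr_ge0// normrX expr2 mulrA mulrC.
 rewrite ler_wpM2l//.
 (* [C + 1] is positive even when [C] is 0, so that [e / (C + 1)] is a legitimate radius. *)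
 apply: le_trans (_ : (C + 1) * `|y| <= _); first by rewrite ler_wpM2r// lerDl.
 rewrite mulrC -ler_pdivlMr ?ltr_wpDl//.
 by near: y; apply: dnbhs0_le; rewrite divr_gt0// ltr_wpDl.
rewrite /dd; split; first by apply/cvg_ex; exists a.
exact: cvg_lim cv.
Unshelve. all: by end_near. Qed.

End derivation.

Ltac dd1 := lazymatch goal with
 | |- dd (fun y => y) _ _ => exact: dd_id
 | |- dd (fun y => @?f y + @?g y) _ _ => eapply (@dd_D _ f g)
 | |- dd (fun y => - @?f y) _ _ => eapply (@dd_N _ f)
 | |- dd (fun y => @?f y * @?g y) _ _ => eapply (@dd_M _ f g)
 | |- dd (fun y => @?f y ^+ ?n) _ _ => eapply (@dd_X _ f _ _ n)
 | |- dd (fun y => (@?f y)^-1) _ _ => eapply (@dd_V _ f)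
 | |- dd (fun y => expR (@?f y)) _ _ => eapply (@dd_exp _ f)
 | |- dd (fun y => cos (@?f y)) _ _ => eapply (@dd_cos _ f)
 | |- dd (fun y => sin (@?f y)) _ _ => eapply (@dd_sin _ f)
 | |- dd (fun y => atan (@?f y)) _ _ => eapply (@dd_atan _ f)
 | H : forall x, dd ?h x _ |- dd (fun y => ?h (@?f y)) _ _ => eapply (@dd_comp _ h f _ _ _ (H _))
 end.
Ltac dder := repeat (first [eassumption | exact: dd_cst | exact: dd_id | dd1]).
Ltac dauto := eapply dd_eq; [dder |].

(** * Trigonometric remainders *)

Section quad.
Context {R : realType}.

Lemma sin_lip (c e : R) : `|sin c - sin e| <= `|c - e|.
Proof.
wlog ec : c e / e <= c.
 by move=> W; have [|/ltW ce] := leP e c; [exact: W|rewrite distrC (distrC c) W].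
have := @dd_lip R sin cos 1 e c ec _ _.
rewrite mul1r (@ger0_norm _ (c - e)) ?subr_ge0//; apply => x _; last by rewrite ler_norml cos_geN1 cos_le1.
exact: is_derive_sin.
Qed.

Lemma cos_lip (c e : R) : `|cos c - cos e| <= `|c - e|.
Proof.
have h (x : R) : cos x = sin (x + pi / 2) by rewrite sinD sin_pihalf cos_pihalf mulr0 add0r mulr1.
by rewrite !h (le_trans (sin_lip _ _))// (_ : c + pi / 2 - (e + pi / 2) = c - e)//; ring.
Qed.

(** The mean value theorem for [cos (a + y) + y * sin a] turns the remainder into [b] times an
    increment of the sine. The constant is not optimal; only the quadratic order matters. *)
Lemma cos_quad (a b : R) : `|cos (a + b) - cos a - b * (- sin a)| <= b ^+ 2.
Proof.
have s1 (c e : R) : `|sin (c + e) - sin c| <= `|e|.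
 by apply: le_trans (sin_lip _ _) _; rewrite addrAC subrr add0r.
have [c [ce ->]] : exists c, `|c| <= `|b| /\ cos (a + b) - cos a - b * (- sin a) = - b * (sin (a + c) - sin a).
 have d y : dd (fun y => cos (a + y) + y * sin a) y (- (sin (a + y) - sin a)) by dauto; ring.
 have [b0|b0] := leP 0 b.
  have [c /andP[c0 cb] e] := dd_mvt b0 (fun y _ => d y); exists c.
  by rewrite !ger0_norm//; split => //; move: e; rewrite !addr0 mul0r subr0 => e; lra.
 have [c /andP[c0 cb] e] := dd_mvt (ltW b0) (fun y _ => d y); exists c.
 by rewrite (ltr0_norm b0) (ler0_norm cb) lerN2; split => //; move: e; rewrite !addr0 mul0r => e; lra.
rewrite normrM normrN -[b ^+ 2]ger0_norm ?sqr_ge0// normrX expr2 ler_wpM2l//.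
exact: le_trans (s1 _ _) _.
Qed.

Lemma sin_quad (a b : R) : `|sin (a + b) - sin a - b * cos a| <= b ^+ 2.
Proof.
have := cos_quad (a - pi / 2) b.
have cs (x : R) : cos (x - pi / 2) = sin x by rewrite cosB cos_pihalf sin_pihalf mulr0 add0r mulr1.
have -> : sin (a - pi / 2) = - cos a by rewrite sinB cos_pihalf sin_pihalf mulr0 add0r mulr1.
by rewrite (_ : a - pi / 2 + b = a + b - pi / 2) ?cs ?opprK//; ring.
Qed.

End quad.

Lemma cvg_abs_le {R : realType} (u : nat -> R) (l C : R) : u @ \oo --> l -> (forall n, `|u n| <= C) -> `|l| <= C.
Proof.
move=> ul uC; have h : (fun n => `|u n|) @ \oo --> `|l| by apply: cvg_norm.
rewrite -(cvg_lim _ h)//; apply: limr_le; first by apply/cvg_ex; exists `|l|.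
exact: nearW.
Qed.

(** * Fundamental theorem of calculus and the Poisson kernel *)

Section ftc.
Context {R : realType}.
Implicit Types (f F : R -> R) (a b : R).
Local Notation leb := (@lebesgue_measure R).

Lemma itg_itv_on f a b : measurable_fun setT f -> (forall x, a <= x <= b -> {for x, continuous f}) ->
 itg leb (fun x => \1_(`[a, b]%classic) x * f x).
Proof.
move=> mf cf; apply/itgP.
have hi : leb.-integrable `[a, b] (EFin \o f).
 apply: continuous_compact_integrable; first exact: segment_compact.
 by apply: continuous_in_subspaceT => x; rewrite inE/= in_itv/=; exact: cf.
have := (@integrable_mkcond _ (measurableTypeR R) R leb _ (EFin \o f) (measurable_itv `[a, b])).1 hi.
rewrite (_ : _ \_ _ = EFin \o (fun x => \1_`[a, b] x * f x))//.
apply/funext => x /=; rewrite patchE indicE; case: (x \in _) => /=; first by rewrite mul1r.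
by rewrite mul0r.
Qed.

Lemma itg_itv f a b : continuous f -> itg leb (fun x => \1_(`[a, b]%classic) x * f x).
Proof. by move=> cf; apply: itg_itv_on; [exact: continuous_measurable_fun|move=> x _; exact: cf]. Qed.

Lemma itg_itv_bd f M a b : measurable_fun setT f -> (forall x, a <= x <= b -> `|f x| <= M) ->
 itg leb (fun x => \1_(`[a, b]%classic) x * f x).
Proof.
move=> mf fM; have c : continuous (fun _ : R => M) by move=> x; exact: cvg_cst.
apply: itg_dom (itg_itv a b c).
 by mf; exact: measurable_indic.
move=> x; rewrite indicE; case: (boolP (x \in _)) => xI; rewrite ?mul0r ?normr0// !mul1r fM//.
by move: xI; rewrite inE/= in_itv.
Qed.

Lemma FTC2_on F f a b : a <= b -> (forall x, a <= x <= b -> dd F x (f x)) ->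
 (forall x, a <= x <= b -> {for x, continuous f}) ->
 J leb (fun x => \1_(`[a, b]%classic) x * f x) = F b - F a.
Proof.
have e (c : R) : (\int[leb]_x (\1_(`[c, b]%classic) x * f x)%:E = \int[leb]_(x in `[c, b]) (f x)%:E)%E.
 rewrite [RHS]integral_mkcond; apply: eq_integral => x _; rewrite patchE indicE.
 by case: (x \in _); rewrite ?mul1r ?mul0r.
rewrite /J e le_eqVlt => /predU1P[->|ab] dF cf.
 by rewrite subrr set_itv1 integral_set1.
rewrite (@continuous_FTC2 _ f F a b ab)//.
- by apply: continuous_in_subspaceT => x; rewrite inE/= in_itv/=; exact: cf.
- split.
 + move=> x; rewrite in_itv/= => /andP[ax xb]; have h : a <= x <= b by rewrite !ltW.
  exact: (@ex_derive _ _ _ _ _ _ _ (dF x h)).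
 + by apply: cvg_at_right_filter; apply: dd_cont1 (dF a _); rewrite lexx ltW.
 + by apply: cvg_at_left_filter; apply: dd_cont1 (dF b _); rewrite lexx ltW.
- by move=> x; rewrite in_itv/= => /andP[ax xb]; apply: dd_derive1; apply: dF; rewrite !ltW.
Qed.

Lemma FTC2 F f a b : a <= b -> (forall x, dd F x (f x)) -> continuous f ->
 J leb (fun x => \1_(`[a, b]%classic) x * f x) = F b - F a.
Proof. by move=> ab dF cf; apply: FTC2_on => // x _; exact: cf. Qed.

Lemma indic_cc a b x : \1_(`[a, b]%classic) x = ((a <= x <= b)%R : nat)%:R :> R.
Proof. by rewrite indicE; congr ((nat_of_bool _)%:R); apply/idP/idP; rewrite inE/= in_itv. Qed.

Lemma indic_cy a x : \1_(`[a, +oo[%classic) x = ((a <= x)%R : nat)%:R :> R.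
Proof. by rewrite indicE; congr ((nat_of_bool _)%:R); apply/idP/idP; rewrite inE/= in_itv/= andbT. Qed.

Lemma J_itvy f a : itg leb (fun x => \1_(`[a, +oo[%classic) x * f x) -> measurable_fun setT f ->
 J leb (fun x => \1_(`[a, a + n%:R]%classic) x * f x) @[n --> \oo] -->
 J leb (fun x => \1_(`[a, +oo[%classic) x * f x).
Proof.
move=> fi mf.
apply: (J_dct _ (itg_norm fi) _ _).2.
- by move=> n; mf; exact: measurable_indic.
- move=> n x; rewrite !normrM ler_wpM2r// indic_cc indic_cy !ger0_norm// ler_nat.
 by case: (a <= x) => //=; rewrite leq_b1.
move=> x; apply: cvgM; last exact: cvg_cst.
apply: cvg_near_cst.
near=> n; rewrite indic_cc indic_cy; have [ax|//] := leP a x.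
rewrite (_ : x <= a + n%:R)// -lerBlDl.
by near: n; exact: nbhs_infty_ger.
Unshelve. all: by end_near. Qed.

Lemma FTC2y F f a l : (forall x, dd F x (f x)) -> continuous f ->
 itg leb (fun x => \1_(`[a, +oo[%classic) x * f x) -> F (a + n%:R) @[n --> \oo] --> l ->
 J leb (fun x => \1_(`[a, +oo[%classic) x * f x) = l - F a.
Proof.
move=> dF cf fi Fl.
have h := J_itvy fi (continuous_measurable_fun cf).
have h2 : J leb (fun x => \1_(`[a, a + n%:R]%classic) x * f x) @[n --> \oo] --> l - F a.
 rewrite (_ : (fun n => _) = (fun n => F (a + n%:R) - F a)).
  by apply: cvgB => //; exact: cvg_cst.
 by apply/funext => n; rewrite (FTC2 _ dF cf)// lerDl.
by rewrite -(cvg_lim _ h)// (cvg_lim _ h2).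
Qed.

Lemma itg_exp u : 0 < u ->
 itg leb (fun s => \1_(`[0, +oo[%classic) s * expR (- (u * s))) /\
 J leb (fun s => \1_(`[0, +oo[%classic) s * expR (- (u * s))) = u^-1.
Proof.
move=> u0.
have e : (fun s => \1_(`[0, +oo[%classic) s * expR (- (u * s))) = (fun s => u^-1 * exponential_pdf u s).
 apply/funext => s; rewrite /exponential_pdf patchE indicE; case: (s \in _) => /=.
  by rewrite mul1r mulrA mulVf ?gt_eqF// mul1r mulNr.
 by rewrite mul0r mulr0.
have i : itg leb (exponential_pdf u).
 by apply/itgP; exact: integrable_exponential_pdf.
rewrite e; split; first exact: itgZ.
by rewrite J_Z// /J integral_exponential_pdf// mulr1.
Qed.

Lemma cvg_exp_nat u : 0 < u -> expR (- (u * n%:R)) @[n --> \oo] --> (0 : R).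
Proof.
move=> u0; apply/cvgrPdist_lt => e e0; near=> n.
rewrite sub0r normrN ger0_norm ?expR_ge0//.
rewrite expRN -[e]invrK ltf_pV2 ?posrE ?expR_gt0 ?invr_gt0//.
apply: lt_le_trans (expR_ge1Dx _); rewrite -ltrBlDl.
apply: lt_le_trans (_ : (u * ((e^-1) / u)) <= _); last first.
 rewrite ler_pM2l//; near: n; exact: nbhs_infty_ger.
by rewrite mulrC divfK ?gt_eqF// ltrBlDl ltrDr.
Unshelve. all: by end_near. Qed.

(** Laplace transform of the cosine. The Poisson kernel is thus a mixture of cosines with an
    integrable weight, and carries information from characteristic functions to laws without any
    integrability of the former. It serves for uniqueness, small balls, tails and the lower bound on
    the kernel. *)
Lemma poisson_int u y : 0 < u ->
 J leb (fun s => \1_(`[0, +oo[%classic) s * (expR (- (u * s)) * cos (s * y))) = u / (u ^+ 2 + y ^+ 2).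
Proof.
move=> u0.
have uy : u ^+ 2 + y ^+ 2 != 0 by rewrite gt_eqF// ltr_pwDl ?exprn_gt0// sqr_ge0.
(* Real part of the antiderivative of [exp ((- u + i y) s)]. *)
pose F s := expR (- (u * s)) * (y * sin (s * y) - u * cos (s * y)) / (u ^+ 2 + y ^+ 2).
have dF s : dd F s (expR (- (u * s)) * cos (s * y)) by rewrite /F; dauto; field.
rewrite (@FTC2y F _ 0 0) //.
- by rewrite /F mulr0 oppr0 expR0 mul0r sin0 cos0; field.
- apply: (@dd_cont _ _ (fun s => - u * expR (- (u * s)) * cos (s * y) - expR (- (u * s)) * (y * sin (s * y)))).
 by move=> s; dauto; ring.
- apply: itg_dom (itg_exp u0).1; first by mf; exact: measurable_indic.
 move=> s; rewrite normrM ger0_norm ?ler_wpM2l// normrM ger0_norm ?expR_ge0//.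
 by rewrite ler_piMr ?expR_ge0// ler_norml cos_geN1 cos_le1.
- have h : (`|y| + u) / (u ^+ 2 + y ^+ 2) * expR (- (u * n%:R)) @[n --> \oo] --> (0 : R).
  rewrite -(mulr0 ((`|y| + u) / (u ^+ 2 + y ^+ 2))).
  by apply: cvgM; [exact: cvg_cst|exact: cvg_exp_nat].
 apply/norm_cvg0P; apply: (squeeze_cvgr _ (cvg_cst 0) h).
 near=> n; rewrite normr_ge0/= /F add0r !normrM (ger0_norm (expR_ge0 _)) -mulrA mulrC.
 rewrite ler_wpM2r ?expR_ge0// normfV (@ger0_norm _ (u ^+ 2 + y ^+ 2)) ?addr_ge0 ?sqr_ge0//.
 rewrite ler_wpM2r ?invr_ge0 ?addr_ge0 ?sqr_ge0//.
 apply: le_trans (ler_normB _ _) _; rewrite !normrM (gtr0_norm u0).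
 rewrite lerD// ?ler_piMr ?(ltW u0)// ler_norml ?sin_geN1 ?sin_le1 ?cos_geN1 ?cos_le1//.
Unshelve. all: by end_near. Qed.

Lemma J_shift f c : itg leb f -> itg leb (fun x => f (x + c)) /\ J leb (fun x => f (x + c)) = J leb f.
Proof.
move=> fi.
have mc : measurable_fun [set: R] (fun x => x + c) by mf.
apply: (@J_push R _ _ _ _ leb leb (fun x => x + c)) => // A mA.
apply/esym; apply: (@lebesgue_measure_unique R (pushforward leb (fun x : measurableTypeR R => x + c : measurableTypeR R))) => //.
move=> _ [[a b]] _ <-.
transitivity (leb `]a - c, b - c]%classic).
 rewrite /= !lebesgue_measure_itv/= !lte_fin ltrD2r; case: ifP => // _.
 by rewrite -!EFinB; congr (_%:E); ring.
rewrite [RHS]/= /pushforward; congr (lebesgue_measure _).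
by apply/seteqP; split => x /=; rewrite !in_itv/= ltrBlDr lerBrDr.
Qed.

End ftc.

(** * Uniqueness of laws from characteristic functions *)

Lemma dynkin_fun {R : realType} {d} {T : measurableType d} (G : set (set T)) (S : (T -> R) -> Prop) :
 @measurable _ T = <<s G >> -> setI_closed G -> S (fun=> 1) ->
 (forall B, G B -> S (\1_B)) ->
 (forall c g1 g2, bmf g1 -> bmf g2 -> S g1 -> S g2 -> S (fun x => g1 x + c * g2 x)) ->
 (forall (g : nat -> T -> R) g0, (forall n, measurable_fun setT (g n)) ->
  (forall n x, `|g n x| <= 1) -> (forall x, g n x @[n --> \oo] --> g0 x) ->
  (forall n, S (g n)) -> S g0) ->
 forall A, measurable A -> S (\1_A).
Proof.
move=> mG GI S1 SG SD Sl A mA.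
have bi (B : set T) : measurable B -> bmf (\1_B : T -> R) by exact: bmf_indic.
apply: (@dynkin_induction _ T G (fun B => S (\1_B))) => //; last by rewrite -mG.
- by rewrite indicT.
- move=> B mB sB; rewrite (_ : \1_(~` B) = (fun y => 1 + -1 * \1_B y)).
  by apply: SD => //; [exact: bmf_cst|exact: bi].
 by apply/funext => y; rewrite !indicE in_setC; case: (y \in B); rewrite ?mulr1 ?mulr0 ?subrr ?addr0.
(* Partial sums over disjoint sets are indicators of finite unions; this is why the limit hypothesis
   only concerns sequences bounded by 1. *)
- move=> F mF tF sF.
 apply: (Sl (fun n y => \sum_(i < n) \1_(F i) y)).
 + by move=> n; apply: meas_sum => i; exact: measurable_indic.
 + move=> n x.
  have h : \sum_(i < n) \1_(F i) x = \1_(\big[setU/set0]_(i < n) F i) x :> R.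
   elim: n => [|n ih]; first by rewrite !big_ord0 indic0.
   rewrite !big_ord_recr/= ih !indicE in_setU; case: (boolP (x \in F n)) => xF; last by rewrite orbF addr0.
   rewrite memNset ?add0r ?orbT//.
   rewrite -bigcup_mkord => -[i /= ni Fi].
   have := tF i n Logic.I Logic.I; rewrite /= => h.
   by have e : i = n by [apply: h; exists x; split => //; exact: set_mem]; rewrite e ltnn in ni.
  by rewrite h indicE; case: (_ \in _); rewrite ?normr0 ?normr1.
 + move=> x; apply: cvg_near_cst.
  have [[i _ Fi]|nF] := pselect ((\bigcup_k F k) x).
   exists i.+1 => // n /= ni; rewrite [RHS]indicE mem_set; last by exists i.
   rewrite (bigD1 (Ordinal ni))//= indicE mem_set// big1 ?addr0// => j ji.
   rewrite indicE memNset// => Fj; move/negP: ji; apply; apply/eqP; apply: val_inj => /=.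
   by apply: tF => //; exists x.
  near=> n; rewrite [RHS]indicE memNset// big1// => i _; rewrite indicE memNset// => Fi.
  by apply: nF; exists (i : nat).
 + elim => [|n ih].
   rewrite (_ : (fun y => _) = (fun y => 1 + -1 * 1)); first by apply: SD => //; exact: bmf_cst.
   by apply/funext => y; rewrite big_ord0 mulr1 subrr.
  rewrite (_ : (fun y => _) = (fun y => \sum_(i < n) \1_(F i) y + 1 * \1_(F n) y)).
   by apply: SD => //; [apply: bmf_sum => i; exact: bi|exact: bi].
  by apply/funext => y; rewrite big_ord_recr mul1r.
Unshelve. all: by end_near. Qed.

Section cf_unique.
Context {R : realType} {d d'} {T : measurableType d} {T' : measurableType d'}.
Variables (P : probability T R) (P' : probability T' R).
Variables (H X : T -> R) (H' X' : T' -> R).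
Hypotheses (bH : bmf H) (mX : measurable_fun setT X) (bH' : bmf H') (mX' : measurable_fun setT X').

(** The bounded weights [H] and [H'] may change sign: signed image measures are compared, as needed
    for the conditioning in [innov_prod]. *)
Let same (g : R -> R) := J P (fun w => H w * g (X w)) = J P' (fun w => H' w * g (X' w)).

Lemma same_lim (g : nat -> R -> R) g0 C : (forall n, measurable_fun setT (g n)) ->
 (forall n x, `|g n x| <= C) -> (forall x, g n x @[n --> \oo] --> g0 x) ->
 (forall n, same (g n)) -> same g0.
Proof.
move=> mg gC gl sg.
have mH := bmf_meas bH; have mH' := bmf_meas bH'.
have [M HM] := bH.2; have [M' HM'] := bH'.2.
have h1 : J P (fun w => H w * g n (X w)) @[n --> \oo] --> J P (fun w => H w * g0 (X w)).
 apply: (J_dct _ (itg_cst P (M * C)) _ _).2.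
 - by move=> n; mf.
 - by move=> n w; rewrite normrM ler_pM.
 - by move=> w; apply: cvgM; [exact: cvg_cst|exact: gl].
have h2 : J P' (fun w => H' w * g n (X' w)) @[n --> \oo] --> J P' (fun w => H' w * g0 (X' w)).
 apply: (J_dct _ (itg_cst P' (M' * C)) _ _).2.
 - by move=> n; mf.
 - by move=> n w; rewrite normrM ler_pM.
 - by move=> w; apply: cvgM; [exact: cvg_cst|exact: gl].
rewrite (_ : (fun n => _) = (fun n => J P' (fun w => H' w * g n (X' w)))) in h1; last by apply/funext => n; exact: sg.
by rewrite /same -(cvg_lim _ h1)// -(cvg_lim _ h2).
Qed.

Lemma same_D g1 g2 : bmf g1 -> bmf g2 -> same g1 -> same g2 -> same (fun x => g1 x + g2 x).
Proof.
move=> b1 b2; rewrite /same => e1 e2.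
under eq_fun do rewrite mulrDr; under [in RHS]eq_fun do rewrite mulrDr.
by rewrite !J_D ?e1 ?e2//; apply: bmf_itg; bm.
Qed.

Lemma same_Z c g : bmf g -> same g -> same (fun x => c * g x).
Proof.
move=> b1; rewrite /same => e1.
under eq_fun do rewrite mulrCA; under [in RHS]eq_fun do rewrite mulrCA.
by rewrite !J_Z ?e1//; apply: bmf_itg; bm.
Qed.

Hypothesis cfE : forall th t, same (fun x => cos (th + t * x)).

(** Integrating the cosine identities in the frequency against [expR (- (u * s))] gives the Poisson
    kernel of width [u]. *)
Lemma same_pois u x : 0 < u -> same (fun y => u / (u ^+ 2 + (y - x) ^+ 2)).
Proof.
move=> u0.
have l e (S : measurableType e) (Q : probability S R) (G Y : S -> R) : bmf G -> measurable_fun setT Y ->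
  J Q (fun w => G w * (u / (u ^+ 2 + (Y w - x) ^+ 2))) =
  J leb (fun s => \1_(`[0, +oo[%classic) s * expR (- (u * s)) * J Q (fun w => G w * cos (- (s * x) + s * Y w))).
 move=> bG mY; have mG := bmf_meas bG; have [M GM] := bG.2.
 have [||||_ _ e1 _] := @J_swap R _ _ _ _ Q leb (fun w s => G w * (\1_(`[0, +oo[%classic) s * (expR (- (u * s)) * cos (s * (Y w - x)))))
  (fun=> M) (fun s => \1_(`[0, +oo[%classic) s * expR (- (u * s))).
 - by mf.
 - exact: itg_cst.
 - exact: (itg_exp u0).1.
 - move=> w s; rewrite normrM ler_pM// !normrM ger0_norm// ler_wpM2l// ger0_norm ?expR_ge0//.
  by rewrite ler_piMr ?expR_ge0// ler_norml cos_geN1 cos_le1.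
 transitivity (J Q (fun w => J leb (fun s => G w * (\1_(`[0, +oo[%classic) s * (expR (- (u * s)) * cos (s * (Y w - x))))))).
  congr J; apply/funext => w; rewrite J_Z ?poisson_int//.
  apply: itg_dom (itg_exp u0).1; first by mf; exact: measurable_indic.
  by move=> s; rewrite !normrM ger0_norm// ler_wpM2l// ger0_norm ?expR_ge0// ler_piMr ?expR_ge0// ler_norml cos_geN1 cos_le1.
 rewrite e1; congr J; apply/funext => s.
 rewrite -J_Z; last by apply: bmf_itg; bm.
 by congr J; apply/funext => w; rewrite mulrBr [- _ + _]addrC; ring.
rewrite /same (l _ _ P)// (l _ _ P')//; congr J; apply/funext => s; congr (_ * _).
exact: cfE.
Qed.

(** Integrating the Poisson kernel over its centre in [[a, b]] gives a difference of arctangents, an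
    indicator of the interval smoothed at scale [u]. *)
Lemma same_atan u a b : 0 < u -> a <= b -> same (fun y => atan (u^-1 * (b - y)) - atan (u^-1 * (a - y))).
Proof.
move=> u0 ab.
have u2 y x : u ^+ 2 + (y - x) ^+ 2 != 0 by rewrite gt_eqF// ltr_pwDl ?exprn_gt0// sqr_ge0.
have pb y x : `|u / (u ^+ 2 + (y - x) ^+ 2)| <= u^-1.
 rewrite ger0_norm ?divr_ge0 ?addr_ge0 ?sqr_ge0 ?(ltW u0)//.
 rewrite ler_pdivrMr ?ltr_pwDl ?exprn_gt0 ?sqr_ge0//.
 by rewrite mulrDr expr2 mulKf ?gt_eqF// lerDl mulr_ge0 ?sqr_ge0// invr_ge0 ltW.
have c1 : continuous (fun _ : R => u^-1) by move=> ?; exact: cvg_cst.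
have l e (S : measurableType e) (Q : probability S R) (G Y : S -> R) : bmf G -> measurable_fun setT Y ->
  J Q (fun w => G w * (atan (u^-1 * (b - Y w)) - atan (u^-1 * (a - Y w)))) =
  J leb (fun x => \1_(`[a, b]%classic) x * J Q (fun w => G w * (u / (u ^+ 2 + (Y w - x) ^+ 2)))).
 move=> bG mY; have mG := bmf_meas bG; have [M GM] := bG.2.
 have [||||_ _ e1 _] := @J_swap R _ _ _ _ Q leb (fun w x => G w * (\1_(`[a, b]%classic) x * (u / (u ^+ 2 + (Y w - x) ^+ 2))))
  (fun=> M) (fun s => \1_(`[a, b]%classic) s * u^-1).
 - by mf.
 - exact: itg_cst.
 - exact: (itg_itv a b c1).
 - by move=> w s; rewrite normrM ler_pM// normrM ger0_norm// ler_wpM2l//.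
 transitivity (J Q (fun w => J leb (fun x => G w * (\1_(`[a, b]%classic) x * (u / (u ^+ 2 + (Y w - x) ^+ 2)))))).
  congr J; apply/funext => w; rewrite J_Z.
   congr (_ * _); rewrite (@FTC2 R (fun x => atan (u^-1 * (x - Y w))))//.
   - move=> x; dauto; have := u2 (Y w) x.
    have -> : u / (u ^+ 2 + (Y w - x) ^+ 2) = (u ^+ 2 + (Y w - x) ^+ 2)^-1 * u by rewrite mulrC.
    move=> h; have u0' : u != 0 by rewrite gt_eqF.
    have -> : 1 + (u^-1 * (x - Y w)) ^+ 2 = (u ^+ 2 + (Y w - x) ^+ 2) / u ^+ 2 by field.
    by field; rewrite h u0'.
   - apply: (@dd_cont _ _ (fun x => - (u ^+ 2 + (Y w - x) ^+ 2) ^- 2 * (2%:R * (Y w - x) ^+ 1 * -1) * u)).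
    by move=> x; dauto; [exact: u2|rewrite /=; ring].
  by apply: (@itg_itv_bd _ _ u^-1) => //; mf.
 rewrite e1; congr J; apply/funext => x; rewrite -J_Z.
  by congr J; apply/funext => w; ring.
 apply: bmf_itg; apply: bmfM => //.
 by apply: (@bmf_intro _ _ _ u^-1) => //; mf.
rewrite /same (l _ _ P)// (l _ _ P')//; congr J; apply/funext => x; congr (_ * _).
exact: same_pois.
Qed.

Lemma atan_abs (x : R) : `|atan x| <= pi / 2.
Proof. by rewrite ler_norml !ltW// ?atan_ltpi2// atan_gtNpi2. Qed.

Lemma cvg_atan_sg (x : R) : atan (n.+1%:R * x) @[n --> \oo] --> pi / 2 * Num.sg x.
Proof.
have pos (y : R) : 0 < y -> atan (n.+1%:R * y) @[n --> \oo] --> pi / 2.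
 move=> y0; apply: (@cvg_comp _ _ _ (fun n => n.+1%:R * y) atan _ (pinfty_nbhs R)); last exact: cvgy_atan.
 apply/cvgryPge => A; near=> n.
 rewrite -ler_pdivrMr//; apply: (@le_trans _ _ n%:R); last by rewrite ler_nat.
 by near: n; exact: nbhs_infty_ger.
have [x0|x0|->] := ltgtP x 0.
- rewrite (ltr0_sg x0) mulrN1 -[x]opprK.
 under eq_fun do rewrite mulrN atanN.
 by apply: cvgN; apply: pos; rewrite oppr_gt0.
- by rewrite (gtr0_sg x0) mulr1; exact: pos.
- rewrite sgr0 mulr0; under eq_fun do rewrite mulr0 atan0; exact: cvg_cst.
Unshelve. all: by end_near. Qed.

Lemma meas_sg : measurable_fun setT (fun x : R => Num.sg x).
Proof.
rewrite (_ : (fun x => _) = (fun x : R => if 0 < x then 1 else if x < 0 then -1 else 0)); first by mf.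
by apply/funext => x; case: sgrP => //.
Qed.

Lemma bmf_sg c : bmf (fun x : R => Num.sg (c - x)).
Proof.
have ms := meas_sg; apply: (@bmf_intro _ _ _ 1).
 by apply: (@meas_comp _ _ _ (fun x => Num.sg x)) => //; mf.
by move=> x; rewrite normr_sg; case: (_ != _).
Qed.

(** As the width tends to 0 the arctangents tend to [pi / 2] times signs. *)
Lemma same_sg2 a b : a <= b -> same (fun y => Num.sg (b - y) - Num.sg (a - y)).
Proof.
move=> ab.
have -> : (fun y => Num.sg (b - y) - Num.sg (a - y)) =
  (fun y => (pi / 2)^-1 * (pi / 2 * Num.sg (b - y) - pi / 2 * Num.sg (a - y))).
 by apply/funext => y; rewrite -mulrBr mulKf// gt_eqF// divr_gt0// pi_gt0.
have bm c : bmf (fun x : R => pi / 2 * Num.sg (c - x)).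
 by apply: bmfM; [exact: bmf_cst|exact: bmf_sg].
apply: same_Z; first by apply: bmfD => //; exact: bmfN.
apply: (@same_lim (fun n y => atan (n.+1%:R * (b - y)) - atan (n.+1%:R * (a - y))) _ (pi / 2 + pi / 2)).
- by move=> n; mf.
- by move=> n x; apply: le_trans (ler_normB _ _) _; rewrite lerD// atan_abs.
- by move=> x; apply: cvgB; exact: cvg_atan_sg.
- by move=> n; rewrite -[n.+1%:R]invrK; apply: same_atan.
Qed.

Lemma same_1 : same (fun=> 1).
Proof.
have := cfE 0 0; rewrite /same.
by under eq_fun do rewrite mul0r addr0 cos0; under [in RHS]eq_fun do rewrite mul0r addr0 cos0.
Qed.

Lemma same_sg b : same (fun y => Num.sg (b - y) + 1).
Proof.
have ms c := bmf_meas (bmf_sg c).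
apply: (@same_lim (fun n y => Num.sg (b - y) - Num.sg ((b - n%:R) - y)) _ 2).
- by move=> n; apply: measurable_funB => //; exact: ms.
- move=> n x; apply: le_trans (ler_normB _ _) _; rewrite !normr_sg.
 by rewrite (_ : 2 = 1 + 1)// lerD//; case: (_ != _).
- move=> x; apply: cvg_near_cst; near=> n.
 rewrite [Num.sg (b - n%:R - x)]ltr0_sg ?opprK// subr_lt0 ltrBlDl -ltrBlDr.
 by near: n; exact: nbhs_infty_gtr.
- by move=> n; apply: same_sg2; rewrite gerBl.
Unshelve. all: by end_near. Qed.

(** The sign-based indicator takes an intermediate value at its threshold. Approaching [b] by
    thresholds [b + 1 / (n + 1)] from the right produces the closed half-line. *)
Lemma same_ray b : same (fun y => ((y <= b)%R : nat)%:R).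
Proof.
have ms c := bmf_meas (bmf_sg c).
have -> : (fun y => ((y <= b)%R : nat)%:R) = (fun y => 2^-1 * (2 * (((y <= b)%R : nat)%:R : R))).
 by apply/funext => y; rewrite mulrA mulVf ?mul1r.
have mi : measurable_fun setT (fun y : R => ((y <= b)%R : nat)%:R : R).
 rewrite (_ : (fun y => _) = (fun y : R => if y <= b then 1 else 0)); first by mf.
 by apply/funext => y; case: (y <= b).
apply: same_Z.
 by apply: (@bmf_intro _ _ _ 2); [mf|move=> x; case: (x <= b); rewrite ?mulr1 ?mulr0 ?normr0// ger0_norm].
apply: (@same_lim (fun n y => Num.sg ((b + n.+1%:R^-1) - y) + 1) _ 2).
- by move=> n; apply: measurable_funD => //; exact: ms.
- move=> n x; apply: le_trans (ler_normD _ _) _; rewrite !normr_sg normr1.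
 by rewrite (_ : 2 = 1 + 1)// lerD//; case: (_ != _).
- move=> x; apply: cvg_near_cst.
 have [xb|bx] := leP x b.
  near=> n; rewrite gtr0_sg ?mulr1// subr_gt0 (le_lt_trans xb)// ltrDl invr_gt0//.
 have h : n.+1%:R^-1 @[n --> \oo] --> (0 : R) by exact: cvg_harmonic.
 have e0 : 0 < x - b by rewrite subr_gt0.
 near=> n; rewrite ltr0_sg ?addNr ?mulr0// subr_lt0 -ltrBrDl.
 near: n; move/cvgrPdist_lt : h => /(_ _ e0); apply: filterS => n.
 by rewrite sub0r normrN ger0_norm.
- by move=> n; exact: same_sg.
Unshelve. all: by end_near. Qed.

Theorem cf_unique_set (A : set R) : measurable A -> same (\1_A).
Proof.
move=> mA.
apply: (@dynkin_fun R _ R (@RGenOInfty.G R) same) => //.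
- exact: RGenOInfty.measurableE.
- move=> _ _ [x ->] [y ->]; exists (Num.max x y).
 by apply/seteqP; split => z /=; rewrite !in_itv/= !andbT gt_max; [move=> [-> ->]|move=> /andP].
- exact: same_1.
- move=> _ [x ->].
 rewrite (_ : \1_ _ = (fun y => 1 + -1 * (((y <= x)%R : nat)%:R : R))).
  apply: same_D; first exact: bmf_cst.
  + apply: (@bmf_intro _ _ _ 1) => [|y]; last by case: (y <= x); rewrite ?mulr1 ?mulr0 ?normr0// normrN1.
   rewrite (_ : (fun y => _) = (fun y : R => if y <= x then -1 else 0)); first by mf.
   by apply/funext => y; case: (y <= x); rewrite ?mulr1 ?mulr0.
  + exact: same_1.
  + apply: same_Z; last exact: same_ray.
   apply: (@bmf_intro _ _ _ 1) => [|y]; last by case: (y <= x); rewrite ?normr0 ?normr1.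
   rewrite (_ : (fun y => _) = (fun y : R => if y <= x then 1 else 0)); first by mf.
   by apply/funext => y; case: (y <= x).
 apply/funext => y; rewrite indicE.
 have [yx|xy] := leP y x; first by rewrite memNset ?mulr1 ?subrr// /= in_itv/= andbT; apply/negP; rewrite -leNgt.
 by rewrite mem_set /= ?in_itv/= ?andbT// mulr0 addr0.
- by move=> c g1 g2 b1 b2 s1 s2; apply: same_D => //; [apply: bmfM => //; exact: bmf_cst|exact: same_Z].
- by move=> g g0 mg g1 gl sg; exact: same_lim mg g1 gl sg.
Qed.

End cf_unique.

(** * Independence of sigma-algebras generated by disjoint index sets *)

Section indep.
Context {R : realType} {d} {T : measurableType d} (P : probability T R) {I : eqType} (X : I -> T -> R).
Hypotheses (mX : forall i, measurable_fun setT (X i)) (iX : mutually_independent P X).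

Definition cyl (A : pred I) : set (set T) :=
 [set C | exists (s : seq I) (B : I -> set R), [/\ uniq s, {subset s <= A},
   (forall i, measurable (B i)) & C = \bigcap_(i in [set` s]) X i @^-1` B i]].

(** The same space with the sigma-algebra generated by the variables indexed by [A]; measurability
    over it expresses dependence on these variables only. *)
Definition sigT (A : pred I) := g_sigma_algebraType (cyl A).

Lemma cyl_measurable A C : cyl A C -> measurable C.
Proof.
move=> [s [B [_ _ mB ->]]]; elim: s => [|i s ih].
 by rewrite (_ : [set` [::]] = set0) ?bigcap_set0//; apply/seteqP; split.
rewrite (_ : \bigcap_(j in [set` i :: s]) X j @^-1` B j = (X i @^-1` B i) `&` \bigcap_(j in [set` s]) X j @^-1` B j).
 apply: measurableI => //; rewrite -[X in measurable X]setTI; exact: mX.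
apply/seteqP; split => [x h|x [h1 h2] j /=].
 by split => [|j /= js]; apply: h; rewrite /= inE ?eqxx// js orbT.
by rewrite inE => /predU1P[->//|js]; exact: h2.
Qed.

Lemma cylI A : setI_closed (cyl A).
Proof.
move=> _ _ [s [B [us sA mB ->]]] [s' [B' [us' sA' mB' ->]]].
pose D (t : seq I) (B : I -> set R) i := if i \in t then B i else setT.
exists (undup (s ++ s')), (fun i => D s B i `&` D s' B' i); split.
- exact: undup_uniq.
- by move=> i; rewrite mem_undup mem_cat => /orP[/sA|/sA'].
- by move=> i; apply: measurableI; rewrite /D; case: ifP.
apply/seteqP; split => [x [h1 h2] i /= _|x h].
 by split; rewrite /D; case: ifP => // j; [exact: h1|exact: h2].
split => i /= is_.
 have /h /= [] : i \in undup (s ++ s') by rewrite mem_undup mem_cat is_.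
 by rewrite /D is_.
have /h /= [_] : i \in undup (s ++ s') by rewrite mem_undup mem_cat is_ orbT.
by rewrite /D is_.
Qed.

Lemma sig_measurable A (C : set (sigT A)) : measurable C -> measurable (C : set T).
Proof.
move=> mC; have : <<s cyl A >> C by exact: mC.
apply: smallest_sub => [|D]; last exact: cyl_measurable.
by split; [exact: measurable0|move=> D mD; rewrite setTD; exact: measurableC|move=> F mF; exact: bigcup_measurable].
Qed.

Lemma sig_meas_fun A (f : sigT A -> R) : measurable_fun setT f -> measurable_fun [set: T] f.
Proof. by move=> mf _ B mB; have := mf measurableT _ mB; exact: sig_measurable. Qed.

Lemma sig_X (A : pred I) i : i \in A -> measurable_fun [set: sigT A] (X i).
Proof.
move=> iA _ B mB; rewrite setTI; apply: sub_sigma_algebra.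
exists [:: i], (fun=> B); split => //; first by move=> j; rewrite inE => /eqP ->.
apply/seteqP; split => [x h j /=|x h]; first by rewrite inE => /eqP ->.
by apply: (h i); rewrite /= inE.
Qed.

Variables (A B : pred I).
Hypothesis disj : forall i, i \in A -> i \in B -> false.

Lemma indep_cyl C D : cyl A C -> cyl B D ->
 J P (fun w => \1_C w * \1_D w) = J P (\1_C) * J P (\1_D).
Proof.
move=> cC cD; have mC := cyl_measurable cC; have mD := cyl_measurable cD.
rewrite (_ : (fun w => _) = \1_(C `&` D)); last by apply/funext => w; rewrite indicI.
rewrite !Ex_indic//; last exact: measurableI.
case: cC cD => [s [E [us sA mE eC]]] [s' [E' [us' sA' mE' eD]]].
pose E'' i := if i \in A then E i else E' i.
have h (t : seq I) : {subset t <= A} -> \bigcap_(i in [set` t]) X i @^-1` E'' i = \bigcap_(i in [set` t]) X i @^-1` E i.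
 move=> tA; apply: eq_bigcapr => i /= it; rewrite /E''; by rewrite (tA _ it).
have h' (t : seq I) : {subset t <= B} -> \bigcap_(i in [set` t]) X i @^-1` E'' i = \bigcap_(i in [set` t]) X i @^-1` E' i.
 move=> tA; apply: eq_bigcapr => i /= it; rewrite /E''; case: ifP => // iA; by have := disj iA (tA _ it).
have mE'' i : measurable (E'' i) by rewrite /E''; case: ifP.
have uss : uniq (s ++ s').
 rewrite cat_uniq us us' andbT; apply/hasPn => i /sA' iB; apply/negP => /sA iA; by have := disj iA iB.
have e : C `&` D = \bigcap_(i in [set` s ++ s']) X i @^-1` E'' i.
 rewrite eC eD -(h s sA) -(h' s' sA'); apply/seteqP; split => [x [h1 h2] i /=|x hx].
  by rewrite mem_cat => /orP[|]; [exact: h1|exact: h2].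
 by split => i /= is_; apply: hx; rewrite /= mem_cat is_ ?orbT.
rewrite e iX// big_cat/= -!iX//; congr (fine (P _) * fine (P _)).
 by rewrite h.
by rewrite h'.
Qed.

(** Two successive Dynkin arguments, one factor at a time; [fixB] freezes the other factor as a
    bounded weight [H]. *)
Lemma indep_sig (C : set (sigT A)) (D : set (sigT B)) : measurable C -> measurable D ->
 J P (fun w : T => \1_C w * \1_D w) = J P (\1_C : T -> R) * J P (\1_D : T -> R).
Proof.
move=> mC mD.
have fixB (S : pred I) (H : T -> R) (bH : bmf H) :
  (forall C, cyl S C -> J P (fun w : T => \1_C w * H w) = J P (\1_C : T -> R) * J P H) ->
  forall C : set (sigT S), measurable C -> J P (fun w : T => \1_C w * H w) = J P (\1_C : T -> R) * J P H.
 move=> hS; have mH := bmf_meas bH; have [M HM] := bH.2.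
 have sb (g : sigT S -> R) : bmf g -> bmf (g : T -> R).
  by move=> [mg bg]; split => //; exact: sig_meas_fun mg.
 apply: (@dynkin_fun R _ (sigT S) (cyl S) (fun g : sigT S -> R => J P (fun w : T => g w * H w) = J P (g : T -> R) * J P H)).
 - by [].
 - exact: cylI.
 - by rewrite Ex_cst mul1r; congr J; apply/funext => w; rewrite mul1r.
 - exact: hS.
 - move=> c g1 g2 /sb b1 /sb b2 e1 e2.
  have b3 : bmf (fun w : T => c * g2 w) by apply: bmfM => //; exact: bmf_cst.
  rewrite (@J_D _ _ _ P g1 (fun w => c * g2 w)) ?J_Z; [|exact: bmf_itg..].
  rewrite mulrDl -mulrA -e1 -e2 -J_Z; last by apply: bmf_itg; exact: bmfM.
  rewrite -J_D; [|apply: bmf_itg; exact: bmfM|apply: itgZ; apply: bmf_itg; exact: bmfM].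
  by congr J; apply/funext => w; rewrite mulrDl mulrA.
 - move=> g g0 mg g1 gl sg.
  have mgT n : measurable_fun [set: T] (g n) by exact: sig_meas_fun.
  have l1 : J P (fun w : T => g n w * H w) @[n --> \oo] --> J P (fun w : T => g0 w * H w).
   apply: (J_dct _ (itg_cst P M) _ _).2.
   + by move=> n; mf.
   + by move=> n w; rewrite normrM -[leRHS]mul1r ler_pM.
   + by move=> w; apply: cvgM; [exact: gl|exact: cvg_cst].
  have l2 : J P (g n : T -> R) @[n --> \oo] --> J P (g0 : T -> R).
   by apply: (J_dct _ (itg_cst P 1) _ _).2.
  have l3 : J P (fun w : T => g n w * H w) @[n --> \oo] --> J P (g0 : T -> R) * J P H.
   rewrite (_ : (fun n => _) = (fun n => J P (g n : T -> R) * J P H)); last by apply/funext => n; exact: sg.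
   by apply: cvgM => //; exact: cvg_cst.
  by rewrite -(cvg_lim _ l1)// (cvg_lim _ l3).
apply: (fixB) => //; first by apply: bmf_indic; exact: sig_measurable mD.
move=> {mC}C cC; rewrite [RHS]mulrC.
rewrite (_ : (fun w => _) = (fun w => \1_D w * \1_C w)); last by apply/funext => w; rewrite mulrC.
apply: (fixB) => //; first by apply: bmf_indic; exact: cyl_measurable cC.
move=> {mD}D cD; rewrite mulrC -indep_cyl//.
by congr J; apply/funext => w; rewrite mulrC.
Qed.

(** Freezing: for disjoint index sets the diagonal map sends [P] to the product of its two
    restrictions, so the variables indexed by [B] may be replaced by an independent copy and
    integrated first. The inner expectation is returned as a [bmf] function because callers
    integrate it again. *)
Lemma Ex_copy (Phi : T -> T -> R) (M : R) :
 measurable_fun setT (fun z : sigT A * sigT B => Phi z.1 z.2) ->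
 (forall w w', `|Phi w w'| <= M) ->
 bmf (fun w => J P (Phi w)) /\ J P (fun w => Phi w w) = J P (fun w => J P (Phi w)).
Proof.
move=> mPhi PM.
have mid S : measurable_fun [set: T] (fun w => w : sigT S).
 by move=> _ C mC; rewrite setTI; exact: sig_measurable mC.
pose fA : {mfun T >-> sigT A} := HB.pack (fun w : T => w : sigT A) (isMeasurableFun.Build _ _ _ _ _ (mid A)).
pose fB : {mfun T >-> sigT B} := HB.pack (fun w : T => w : sigT B) (isMeasurableFun.Build _ _ _ _ _ (mid B)).
pose PA : probability (sigT A) R := distribution P fA.
pose PB : probability (sigT B) R := distribution P fB.
have mdiag : measurable_fun [set: T] (fun w => (w : sigT A, w : sigT B)).
 by apply/measurable_fun_pairP; split; exact: mid.
have bPhi z : `|(fun z : sigT A * sigT B => Phi z.1 z.2) z| <= M by [].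
have [i1 _ _ e1] := @J_swap R _ _ _ _ PA PB (fun w w' => Phi w w') (fun=> M) (fun=> 1) mPhi
 (itg_cst PA M) (itg_cst PB 1) ltac:(by move=> *; rewrite mulr1).
have eB w : J PB (Phi w) = J P (Phi w).
 apply/esym; apply: (@J_push R _ _ T (sigT B) P PB (fun w => w) (Phi w) (mid B) _ _).2 => //.
 apply: itg_dom (itg_cst PB M) => //.
 exact: (measurableT_comp mPhi (@measurable_pair1 _ _ (sigT A) (sigT B) w)).
have eB' : (fun w => J P (Phi w)) = (fun w => J PB (Phi w)) by apply/funext => w; rewrite eB.
have mJ : measurable_fun [set: sigT A] (fun w => J PB (Phi w)) by exact: itg_meas i1.
have bJ : bmf (fun w => J P (Phi w)).
 apply: (@bmf_intro _ _ _ M).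
  by rewrite eB'; apply: (@sig_meas_fun A).
 move=> w; rewrite -eB; apply: Ex_bound => //.
 exact: (measurableT_comp mPhi (@measurable_pair1 _ _ (sigT A) (sigT B) w)).
split=> //.
(* Measures on the product agree once they agree on rectangles, and there the equality is
   [indep_sig]. *)
have pu (Z : set (sigT A * sigT B)%type) : measurable Z -> P ((fun w => (w : sigT A, w : sigT B)) @^-1` Z) = (PA \x PB)%E Z.
 pose fD : {mfun T >-> (sigT A * sigT B)%type} := HB.pack (fun w : T => (w : sigT A, w : sigT B)) (isMeasurableFun.Build _ _ _ _ _ mdiag).
 move=> mZ; rewrite (@product_measure_unique _ _ _ _ _ PA PB (distribution P fD))// => C D mC mD.
 rewrite /distribution /pushforward /=.
 have := indep_sig mC mD.
 have mC' := sig_measurable mC; have mD' := sig_measurable mD.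
 rewrite (_ : (fun w : T => _) = \1_(C `&` D)); last by apply/funext => w; rewrite indicI.
 rewrite (Ex_indic P mC') (Ex_indic P mD') Ex_indic; last exact: measurableI.
 move=> e.
 have f1 := fin_num_measure P _ mC'; have f2 := fin_num_measure P _ mD'.
 have f3 := fin_num_measure P _ (measurableI _ _ mC' mD').
 by apply/eqP; rewrite -[X in _ == X]/(P C * P D)%E -[X in X == _]/(P (C `&` D)) -(fineK f3) e EFinM !fineK.
have [_ e2] := J_push mdiag pu (@itg_dom _ _ _ (PA \x PB)%E _ _ mPhi bPhi (itg_cst (PA \x PB)%E M)).
rewrite e2 e1 eB'.
by apply/esym; apply: (@J_push R _ _ T (sigT A) P PA (fun w => w) _ (mid A) _ _).2.
Qed.

End indep.

(** * The characteristic exponent of the stationary law *)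

Section phi.
Context {R : realType} (alpha : R) (F : probability R R) (eps : R).
Hypotheses (al0 : 0 < alpha) (F1 : F (`]0%R, +oo[%classic) = 1%E) (eps0 : 0 < eps).
Hypothesis mom : (\int[lebesgue_measure]_(x in `]0%R, +oo[%classic)
    (Num.max 1 (`|x| `^ (2 + eps)) * kf alpha F x)%:E < +oo)%E.
Local Notation k := (kf alpha F).
Local Notation leb := (@lebesgue_measure R).

Definition io (x : R) : R := \1_(`]0, +oo[%classic) x.

Lemma ioE x : io x = ((0 < x)%R : nat)%:R.
Proof. by rewrite /io indicE; congr ((nat_of_bool _)%:R); apply/idP/idP; rewrite inE/= in_itv/= andbT. Qed.

Lemma io_meas : measurable_fun setT io. Proof. exact: measurable_indic. Qed.
Lemma io_ge0 x : 0 <= io x. Proof. by rewrite ioE. Qed.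

Lemma Rint0infE (f : R -> R) : Rint0inf f = J leb (fun x => io x * f x).
Proof.
rewrite /Rint0inf /J integral_mkcond; congr fine; apply: eq_integral => x _.
by rewrite patchE /io indicE; case: (x \in _); rewrite ?mul1r ?mul0r.
Qed.

Lemma Fneg : F (`]-oo, 0%R]%classic) = 0%E.
Proof.
rewrite (_ : `]-oo, 0%R]%classic = ~` `]0%R, +oo[%classic); last by rewrite setCitvr.
set x := LHS; have -> : x = (1 - F `]0%R, +oo[%classic)%E by exact: probability_setC.
by rewrite F1 subee.
Qed.

Lemma kE x : 0 <= x -> k x = alpha * J F (fun u => if x < u then 1 else 0).
Proof.
move=> x0; rewrite /kf x0; congr (_ * _).
rewrite -Ex_indic//; congr J; apply/funext => u; rewrite indicE.
by case: ifP => xu; [rewrite mem_set//= in_itv/= xu|rewrite memNset//= in_itv/= xu].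
Qed.

Lemma J01 (A : R -> bool) : measurable_fun setT A -> 0 <= J F (fun u => if A u then 1 else 0) <= 1.
Proof.
move=> mA; rewrite J_ge0; last by move=> u; case: ifP.
rewrite -[leRHS](Ex_cst F 1); apply: J_le.
- by apply: bmf_itg; bm.
- exact: itg_cst.
- by move=> u; case: ifP.
Qed.

Lemma k_neg x : x < 0 -> k x = 0.
Proof. by move=> x0; rewrite /kf leNgt x0. Qed.

Lemma k_ge0 x : 0 <= k x.
Proof.
have [x0|x0] := leP 0 x; last by rewrite k_neg.
by rewrite kE// mulr_ge0 ?(ltW al0)//; have /andP[] := @J01 (fun u : R => x < u) ltac:(mf).
Qed.

Lemma k_le x : k x <= alpha.
Proof.
have [x0|x0] := leP 0 x; last by rewrite k_neg// ltW.
by rewrite kE// ler_piMr ?(ltW al0)//; have /andP[] := @J01 (fun u : R => x < u) ltac:(mf).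
Qed.

Lemma k_0 : k 0 = alpha.
Proof. by rewrite /kf lexx F1 mulr1. Qed.

(** Up to the factor [alpha * expR x], [k] is a partial integral of an integrable function of
    [(x, u)], so its measurability is a by-product of Fubini's theorem. *)
Lemma k_meas : measurable_fun setT k.
Proof.
pose G (x u : R) := \1_(`[0, +oo[%classic) x * expR (- (1 * x)) * (if x < u then 1 else 0).
have [||||i _ _ _] := @J_swap R _ _ _ _ leb F G (fun x => \1_(`[0, +oo[%classic) x * expR (- (1 * x))) (fun=> 1).
- by rewrite /G; mf.
- by apply: (itg_exp _).1.
- exact: itg_cst.
- move=> x u; rewrite mulr1 /G normrM ger0_norm ?mulr_ge0 ?expR_ge0// ler_piMr ?mulr_ge0 ?expR_ge0//.
 by case: ifP; rewrite ?normr1 ?normr0.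
have m := itg_meas i.
rewrite (_ : k = fun x => if 0 <= x then alpha * (expR x * J F (G x)) else 0); first by mf.
apply/funext => x; case: ifP => x0; last by rewrite /kf x0.
rewrite kE//; congr (_ * _); rewrite /G J_Z; last by apply: bmf_itg; bm; mf.
by rewrite indic_cy x0 mul1r mulrA mul1r -expRD subrr expR0 mul1r.
Qed.

Lemma itg_max : itg leb (fun x => io x * (Num.max 1 (`|x| `^ (2 + eps)) * k x)).
Proof.
have mk := k_meas; have mi := io_meas.
have mp : measurable_fun [set: R] (fun x : R => x `^ (2 + eps)) by exact: measurable_powR.
have mm : measurable_fun [set: R] (fun x => io x * (Num.max 1 (`|x| `^ (2 + eps)) * k x)).
 by mf; apply: (@meas_comp _ _ _ (fun x => x `^ (2 + eps))) => //; mf.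
split => //; move: mom; rewrite integral_mkcond/=; apply: le_lt_trans.
apply: ge0_le_integral => //.
- by do 2 apply: measurableT_comp => //.
- rewrite (_ : _ \_ _ = EFin \o (fun x => io x * (Num.max 1 (`|x| `^ (2 + eps)) * k x))).
  exact/measurable_EFinP.
 by apply/funext => x /=; rewrite patchE /io indicE; case: (x \in _); rewrite ?mul1r ?mul0r.
move=> x _; rewrite patchE /io indicE; case: (x \in _); rewrite ?mul1r ?mul0r; last first.
 by rewrite normr0; exact: lexx.
by rewrite lee_fin ger0_norm// mulr_ge0 ?k_ge0// le_max ler01.
Qed.

Lemma itg_k : itg leb (fun x => io x * k x).
Proof.
have mk := k_meas; have mi := io_meas.
apply: itg_dom itg_max; first by mf.
move=> x; rewrite ger0_norm ?mulr_ge0 ?io_ge0 ?k_ge0// ler_wpM2l ?io_ge0// ler_peMl ?k_ge0//.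
by rewrite le_max lexx.
Qed.

Lemma itg_xk : itg leb (fun x => io x * (x * k x)).
Proof.
have mk := k_meas; have mi := io_meas.
apply: itg_dom itg_max; first by mf.
move=> x; rewrite ioE; have [x0|x0] := ltP 0 x; last by rewrite !mul0r normr0.
rewrite !mul1r ger0_norm ?mulr_ge0 ?k_ge0 ?(ltW x0)// ler_wpM2r ?k_ge0// le_max.
rewrite (gtr0_norm x0); have [x1|x1] := leP x 1 => //=.
rewrite -[leLHS]powRr1 ?(ltW x0)//; apply: ler_powR; first exact: ltW.
have h := eps0. nra.
Qed.

Lemma itg_bk (g : R -> R) M : measurable_fun setT g -> (forall x, 0 < x -> `|g x| <= M) -> itg leb (fun x => io x * (g x * k x)).
Proof.
have mk := k_meas; have mi := io_meas.
move=> mg gM; apply: itg_dom (itgZ M itg_k); first by mf.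
move=> x; rewrite ioE; have [x0|x0] := ltP 0 x; last by rewrite !mul0r normr0 mulr0.
by rewrite !mul1r normrM (ger0_norm (k_ge0 _)) ler_wpM2r ?k_ge0 ?gM.
Qed.

Lemma phik_reE t : phik_re alpha F t = J leb (fun x => io x * (cos (t * x) * k x)).
Proof. by rewrite -Rint0infE. Qed.
Lemma phik_imE t : phik_im alpha F t = J leb (fun x => io x * (sin (t * x) * k x)).
Proof. by rewrite -Rint0infE. Qed.
Lemma phiAE t : phiA alpha F t = J leb (fun x => io x * ((cos (t * x) - 1) / x * k x)).
Proof. by rewrite /phiA Rint0infE; congr J; apply/funext => x; ring. Qed.
Lemma phiBE t : phiB alpha F t = J leb (fun x => io x * (sin (t * x) / x * k x)).
Proof. by rewrite /phiB Rint0infE; congr J; apply/funext => x; ring. Qed.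

Let cos1_abs (t x : R) : 0 < x -> `|(cos (t * x) - 1) / x| <= `|t|.
Proof.
move=> x0; rewrite normrM normfV (gtr0_norm x0) ler_pdivrMr//.
by have := cos_lip (t * x) 0; rewrite cos0 subr0 normrM (gtr0_norm x0).
Qed.
Let sin1_abs (t x : R) : 0 < x -> `|sin (t * x) / x| <= `|t|.
Proof.
move=> x0; rewrite normrM normfV (gtr0_norm x0) ler_pdivrMr//.
by have := sin_lip (t * x) 0; rewrite sin0 !subr0 normrM (gtr0_norm x0).
Qed.

Lemma phiA_abs t : `|phiA alpha F t| <= `|t| * J leb (fun x => io x * k x).
Proof.
have mk := k_meas; have mi := io_meas.
rewrite phiAE -J_Z; last exact: itg_k.
apply: J_abs; [by mf|exact: itgZ itg_k|].
move=> x; rewrite ioE; have [x0|x0] := ltP 0 x; last by rewrite !mul0r normr0 mulr0.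
by rewrite !mul1r normrM (ger0_norm (k_ge0 _)) ler_wpM2r ?k_ge0 ?cos1_abs.
Qed.
Lemma phiB_abs t : `|phiB alpha F t| <= `|t| * J leb (fun x => io x * k x).
Proof.
have mk := k_meas; have mi := io_meas.
rewrite phiBE -J_Z; last exact: itg_k.
apply: J_abs; [by mf|exact: itgZ itg_k|].
move=> x; rewrite ioE; have [x0|x0] := ltP 0 x; last by rewrite !mul0r normr0 mulr0.
by rewrite !mul1r normrM (ger0_norm (k_ge0 _)) ler_wpM2r ?k_ge0 ?sin1_abs.
Qed.

Lemma phiA_even t : phiA alpha F (- t) = phiA alpha F t.
Proof. by rewrite !phiAE; congr J; apply/funext => x; rewrite mulNr cosN. Qed.
Lemma phiB_odd t : phiB alpha F (- t) = - phiB alpha F t.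
Proof.
have mk := k_meas; have mi := io_meas.
rewrite !phiBE -J_N; last by apply: (@itg_bk _ `|t|) => [|x x0]; [mf|exact: sin1_abs].
by congr J; apply/funext => x; rewrite mulNr sinN; ring.
Qed.
Lemma phiA0 : phiA alpha F 0 = 0.
Proof. by have := phiA_abs 0; rewrite normr0 mul0r normr_le0 => /eqP. Qed.
Lemma phiB0 : phiB alpha F 0 = 0.
Proof. by have := phiB_abs 0; rewrite normr0 mul0r normr_le0 => /eqP. Qed.

(** [dd_quad] under the integral: the second-order remainder of the cosine, divided by [x], is at
    most [y ^+ 2 * x], and [x * k x] is integrable by the moment assumption. *)
Lemma dd_phiA t : dd (phiA alpha F) t (- phik_im alpha F t).
Proof.
have mk := k_meas; have mi := io_meas.
have i1 s : itg leb (fun x => io x * ((cos (s * x) - 1) / x * k x)).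
 by apply: (@itg_bk _ `|s|) => [|x x0]; [mf|exact: cos1_abs].
have i2 : itg leb (fun x => io x * (sin (t * x) * k x)).
 by apply: (@itg_bk _ 1) => [|x x0]; [mf|rewrite ler_norml sin_geN1 sin_le1].
apply: (@dd_quad _ _ _ _ (J leb (fun x => io x * (x * k x)))) => y.
rewrite !phiAE phik_imE mulrN opprK -J_B; [|exact: i1..].
rewrite -J_Z// -J_D; [|by apply: itgB; exact: i1|exact: itgZ].
rewrite mulrC -J_Z; last exact: itg_xk.
apply: J_abs; [by mf|exact: itgZ itg_xk|].
move=> x; rewrite ioE; have [x0|x0] := ltP 0 x; last by rewrite !mul0r !subr0 mulr0 !addr0 normr0 mulr0.
have x0' : x != 0 by rewrite gt_eqF.
rewrite !mul1r [(t + y) * x]mulrDl (_ : _ - _ + _ = (cos (t * x + y * x) - cos (t * x) - (y * x) * (- sin (t * x))) / x * k x); last first.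
 by field.
rewrite normrM (ger0_norm (k_ge0 _)) mulrA ler_wpM2r ?k_ge0// normrM normfV (gtr0_norm x0).
rewrite ler_pdivrMr//; apply: le_trans (cos_quad _ _) _; rewrite exprMn.
by rewrite [x ^+ 2]expr2 mulrA.
Qed.

Lemma dd_phiB t : dd (phiB alpha F) t (phik_re alpha F t).
Proof.
have mk := k_meas; have mi := io_meas.
have i1 s : itg leb (fun x => io x * (sin (s * x) / x * k x)).
 by apply: (@itg_bk _ `|s|) => [|x x0]; [mf|exact: sin1_abs].
have i2 : itg leb (fun x => io x * (cos (t * x) * k x)).
 by apply: (@itg_bk _ 1) => [|x x0]; [mf|rewrite ler_norml cos_geN1 cos_le1].
apply: (@dd_quad _ _ _ _ (J leb (fun x => io x * (x * k x)))) => y.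
rewrite !phiBE phik_reE -J_B; [|exact: i1..].
rewrite -J_Z// -J_B; [|by apply: itgB; exact: i1|exact: itgZ].
rewrite mulrC -J_Z; last exact: itg_xk.
apply: J_abs; [by mf|exact: itgZ itg_xk|].
move=> x; rewrite ioE; have [x0|x0] := ltP 0 x; last by rewrite !mul0r !subr0 mulr0 !subr0 normr0 mulr0.
have x0' : x != 0 by rewrite gt_eqF.
rewrite !mul1r [(t + y) * x]mulrDl (_ : _ - _ - _ = (sin (t * x + y * x) - sin (t * x) - (y * x) * cos (t * x)) / x * k x); last first.
 by field.
rewrite normrM (ger0_norm (k_ge0 _)) mulrA ler_wpM2r ?k_ge0// normrM normfV (gtr0_norm x0).
rewrite ler_pdivrMr//; apply: le_trans (sin_quad _ _) _; rewrite exprMn.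
by rewrite [x ^+ 2]expr2 mulrA.
Qed.

Definition psir (s : R) := J F (fun u => cos (s * u)).
Definition psii (s : R) := J F (fun u => sin (s * u)).

Lemma leb1 (c : R) : leb [set c] = 0%E. Proof. exact: lebesgue_measure_set1. Qed.

(** Fubini applied to [k x = alpha * F (x, oo)]: integrating [f] against [k] first integrates [f]
    over [[0, u]] and then averages over a jump [u] of law [F]. *)
Let fub (f G : R -> R) : continuous f -> (forall x, `|f x| <= 1) -> (forall x, dd G x (f x)) ->
 J leb (fun x => io x * (f x * k x)) = alpha * (J F (fun u => if 0 < u then G u - G 0 else 0)).
Proof.
move=> cf f1 dG.
have mk := k_meas; have mi := io_meas; have mfm := continuous_measurable_fun cf.
have cG := dd_cont dG; have mG := continuous_measurable_fun cG.
pose H x u := io x * f x * (if x < u then 1 else 0).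
have mH : measurable_fun setT (fun z : R * R => H z.1 z.2) by rewrite /H; mf.
have [|||i1 _ e _] := @J_fubini R _ _ _ _ leb F H mH.
- by move=> x; apply: bmf_itg; rewrite /H; bm; mf.
- move=> u; have c1 : continuous (fun _ : R => 1 : R) by move=> ?; exact: cvg_cst.
 apply: itg_dom (itg_itv 0 `|u| c1); first by rewrite /H; mf.
 move=> x; rewrite /H ioE indic_cc; have [x0|x0] := ltP 0 x; last by rewrite !mul0r normr0 mulr1.
 case: ifP => xu; last by rewrite mulr0 normr0 mulr1.
 by rewrite mul1r !mulr1 (ltW x0)/= (le_trans (ltW xu)) ?ler_norm.
- exists (fun x => alpha^-1 * (io x * k x)); first exact: itgZ itg_k.
 move=> x; rewrite /H; under eq_fun do rewrite normrM.
 rewrite J_Z; last by apply: bmf_itg; bm; mf.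
 rewrite ioE; have [x0|x0] := ltP 0 x; last by rewrite !mul0r normr0 mul0r mulr0.
 rewrite !mul1r kE ?(ltW x0)// mulKf ?gt_eqF//.
 rewrite (_ : (fun u => `|_|) = (fun u => if x < u then 1 else 0)); last first.
  by apply/funext => u; case: ifP; rewrite ?normr1 ?normr0.
 rewrite ler_piMl//; have /andP[] := @J01 (fun u : R => x < u) ltac:(mf) => //.
rewrite (_ : J leb _ = alpha * J leb (fun x => J F (H x))).
 rewrite e; congr (_ * _); congr J; apply/funext => u; case: ifP => u0.
  rewrite -(@FTC2 R G f 0 u (ltW u0) dG cf).
  (* The set [0 < x < u] and the closed interval of [FTC2] differ by two points. *)
  apply: (@J_ae _ _ _ leb ([set 0] `|` [set u])).
  + by rewrite /H; mf.
  + by mf; exact: measurable_indic.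
  + exact: measurableU.
  + by transitivity (leb [set 0 : R]); [apply: measureU0 => //; exact: leb1|exact: leb1].
  move=> x /= /not_orP[x0 xu]; rewrite /H ioE indic_cc !lt_neqAle.
  have -> : (0 != x) by rewrite eq_sym; apply/eqP.
  have -> : (x != u) by apply/eqP.
  by case: (0 <= x) => /=; case: (x <= u); rewrite ?mul1r ?mul0r ?mulr1 ?mulr0.
 rewrite (_ : (fun x => _) = (fun=> 0)) ?J0//; apply/funext => x; rewrite /H ioE.
 have [x0|x0] := ltP 0 x; last by rewrite !mul0r.
 by rewrite ifF ?mulr0//; apply: contraFF u0; exact: lt_trans.
rewrite -J_Z//.
congr J; apply/funext => x; rewrite /H J_Z; last by apply: bmf_itg; bm; mf.
rewrite ioE; have [x0|x0] := ltP 0 x; last by rewrite !mul0r mulr0.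
by rewrite kE ?(ltW x0)// !mul1r mulrCA.
Qed.

Let Fpos (f : R -> R) : measurable_fun setT f -> J F (fun u => if 0 < u then f u else 0) = J F f.
Proof.
move=> mfu; apply: (@J_ae _ _ _ F (`]-oo, 0%R]%classic)) => //; [by mf|exact: Fneg|].
by move=> x; rewrite /= in_itv/= => /negP; rewrite -ltNge => ->.
Qed.

(** [fub] with the antiderivative of [sin (s * x)], an integration by parts in disguise. This
    relation and [phik_reP] are what turn the window integrals of [win_ident] into exact
    derivatives. *)
Lemma phik_imP s : s * phik_im alpha F s = alpha * (1 - psir s).
Proof.
have mk := k_meas; have mi := io_meas.
have [->|s0] := eqVneq s 0.
 rewrite mul0r /psir; under eq_fun do rewrite mul0r cos0.
 by rewrite Ex_cst subrr mulr0.
rewrite phik_imE (@fub (fun x => sin (s * x)) (fun x => - s^-1 * cos (s * x))).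
- rewrite Fpos; last by mf.
 rewrite mulr0 cos0 mulr1 opprK J_D; [|by apply: bmf_itg; bm|exact: itg_cst].
 rewrite Ex_cst J_Z; last by apply: bmf_itg; bm.
 by rewrite /psir; field.
- by apply: (@dd_cont _ _ (fun x => cos (s * x) * s)) => x; dauto; ring.
- by move=> x; rewrite ler_norml sin_geN1 sin_le1.
- by move=> x; dauto; field.
Qed.

Lemma phik_reP s : s * phik_re alpha F s = alpha * psii s.
Proof.
have mk := k_meas; have mi := io_meas.
have [->|s0] := eqVneq s 0.
 rewrite mul0r /psii; under eq_fun do rewrite mul0r sin0.
 by rewrite J0 mulr0.
rewrite phik_reE (@fub (fun x => cos (s * x)) (fun x => s^-1 * sin (s * x))).
- rewrite Fpos; last by mf.
 under eq_fun do rewrite mulr0 sin0 mulr0 subr0.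
 rewrite J_Z; last by apply: bmf_itg; bm.
 by rewrite /psii; field.
- by apply: (@dd_cont _ _ (fun x => - sin (s * x) * s)) => x; dauto; ring.
- by move=> x; rewrite ler_norml cos_geN1 cos_le1.
- by move=> x; dauto; field.
Qed.

Section holder.
Variable Ch : R.
Hypothesis holder : forall x : R, 0 < x <= 1 -> `|k x - alpha| <= Ch * Num.sqrt x.

Let o1 (x : R) : R := io x * \1_(`[0, 1]%classic) x.

Let o1E x : o1 x = ((0 < x <= 1)%R : nat)%:R.
Proof. by rewrite /o1 ioE indic_cc; have [x0|x0] := ltP 0 x; rewrite ?mul0r// mul1r (ltW x0). Qed.

Let o1_meas : measurable_fun setT o1.
Proof. have mi := io_meas; rewrite /o1; mf; exact: measurable_indic. Qed.

Let itg1 (g : R -> R) (M : R) : measurable_fun setT g -> (forall x, 0 < x -> `|g x| <= M) -> itg leb (fun x => o1 x * g x).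
Proof.
have cM : continuous (fun _ : R => M) by move=> ?; exact: cvg_cst.
have mo := o1_meas; move=> mg gM; apply: itg_dom (itg_itv 0 1 cM); first by mf.
move=> x; rewrite o1E indic_cc; have [x0|x0] := ltP 0 x; last first.
 by rewrite !mul0r normr0 mulr_ge0// (le_trans _ (gM 1 ltr01)).
by rewrite (ltW x0)/=; case: (x <= 1); rewrite ?mul1r ?mul0r ?normr0//; exact: gM.
Qed.

(** Near 0 the deviation of [k] from [alpha] is of order [sqrt x] and compensates the factor
    [1 / x]: the integrand is at most [2 * |Ch| / sqrt x], whose integral over [(0, 1]] is
    [4 * |Ch|] whatever [t]. Cutting at [1 / (n + 1)] keeps the majorant continuous. *)
Let part1 t : `|J leb (fun x => o1 x * ((cos (t * x) - 1) / x * (k x - alpha)))| <= 4 * `|Ch|.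
Proof.
have mk := k_meas; have mi := io_meas; have mo := o1_meas.
pose f x := (cos (t * x) - 1) / x * (k x - alpha).
have mfm : measurable_fun setT f by rewrite /f; mf.
pose a n : R := n.+1%:R^-1.
have a0 n : 0 < a n by rewrite invr_gt0.
have a1 n : a n <= 1 by rewrite invf_le1// ler1n.
have fi : itg leb (fun x => o1 x * f x).
 apply: (@itg1 f (`|t| * (alpha + alpha)) mfm) => x x0; rewrite normrM ler_pM ?cos1_abs//.
 by rewrite (le_trans (ler_normB _ _))// lerD// ger0_norm ?k_ge0 ?k_le ?(ltW al0).
have cv : J leb (fun x => \1_(`[a n, 1]%classic) x * f x) @[n --> \oo] --> J leb (fun x => o1 x * f x).
 apply: (J_dct _ (itg_norm fi) _ _).2.
 - by move=> n; mf; exact: measurable_indic.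
 - move=> n x; rewrite normrM [leRHS]normrM ler_wpM2r// o1E indic_cc !ger0_norm// ler_nat.
  have [h|//] := leP (a n) x; rewrite (lt_le_trans (a0 n) h)/=; exact: leqnn.
 move=> x; apply: cvgM; last exact: cvg_cst.
 apply: cvg_near_cst; near=> n; rewrite o1E indic_cc.
 have [x0|x0] := ltP 0 x; last by rewrite leNgt (le_lt_trans x0 (a0 n)).
 rewrite (_ : a n <= x)// /a -[leRHS]invrK lef_pV2 ?posrE ?invr_gt0//.
 apply: (@le_trans _ _ n%:R); last by rewrite ler_nat.
 by near: n; exact: nbhs_infty_ger.
apply: (cvg_abs_le cv) => n.
 apply: (@le_trans _ _ (J leb (fun x => \1_(`[a n, 1]%classic) x * (2 * `|Ch| / Num.sqrt x)))).
  have cs (x : R) : 0 < x -> {for x, continuous (fun x => 2 * `|Ch| / Num.sqrt x)}.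
   move=> x0; apply: continuousM; first exact: cst_continuous.
   apply: (@continuousV _ _ Num.sqrt); last exact: sqrt_continuous.
   by rewrite gt_eqF// sqrtr_gt0.
  apply: J_abs; first by mf; exact: measurable_indic.
   apply: itg_itv_on.
    by mf; apply: continuous_measurable_fun; exact: sqrt_continuous.
   by move=> x /andP[h _]; apply: cs; exact: lt_le_trans h.
  move=> x; rewrite normrM ger0_norm// indic_cc; have [h|h] := leP (a n) x; last by rewrite !mul0r.
  case: (leP x 1) => x1; last by rewrite !mul0r.
  have x0 := lt_le_trans (a0 n) h; rewrite !mul1r /f !normrM normfV (gtr0_norm x0).
  apply: (@le_trans _ _ (2 / x * (`|Ch| * Num.sqrt x))).
   apply: ler_pM => //; first by rewrite mulr_ge0// invr_ge0 ltW.
    rewrite ler_wpM2r ?invr_ge0 ?(ltW x0)// (le_trans (ler_normB _ _))// normr1 -[2]/(1 + 1) lerD2r.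
    by rewrite ler_norml cos_geN1 cos_le1.
   apply: le_trans (holder _) _; first by rewrite x0.
   by rewrite ler_wpM2r ?sqrtr_ge0// ler_norm.
  have sx : Num.sqrt x != 0 by rewrite gt_eqF// sqrtr_gt0.
  by rewrite -[X in 2 / X]sqr_sqrtr ?(ltW x0)// le_eqVlt; apply/orP; left; apply/eqP; field.
 rewrite (@FTC2_on R (fun x => 4 * `|Ch| * Num.sqrt x))//.
 - by rewrite sqrtr1 mulr1 gerBl mulr_ge0 ?sqrtr_ge0// mulr_ge0.
 - move=> x /andP[h _]; have x0 := lt_le_trans (a0 n) h.
  have ds : dd (@Num.sqrt R) x (2 * Num.sqrt x)^-1 := is_derive1_sqrt x0.
  have sx : Num.sqrt x != 0 by rewrite gt_eqF// sqrtr_gt0.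
  by dauto; field.
 - move=> x /andP[h _]; have x0 := lt_le_trans (a0 n) h.
  apply: continuousM; first exact: cst_continuous.
  apply: (@continuousV _ _ Num.sqrt); last exact: sqrt_continuous.
  by rewrite gt_eqF// sqrtr_gt0.
Unshelve. all: by end_near. Qed.

(** This is a cosine integral. Its derivative in [t] is [- (1 - cos t) / t]; adding [ln t] cancels
    the part that is not integrable at infinity. *)
Let part2 : exists C, forall t, 1 <= t -> `|J leb (fun x => o1 x * ((cos (t * x) - 1) / x)) + ln t| <= C.
Proof.
have mo := o1_meas.
pose g t := J leb (fun x => o1 x * ((cos (t * x) - 1) / x)).
have dg (t : R) : 0 < t -> dd g t (- ((1 - cos t) / t)).
 move=> t0; have i1 s : itg leb (fun x => o1 x * ((cos (s * x) - 1) / x)).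
  by apply: (@itg1 _ `|s|) => [|x x0]; [mf|exact: cos1_abs].
 have cs : continuous (fun x => - sin (t * x)).
  by apply: (@dd_cont _ _ (fun x => - (cos (t * x) * t))) => x; dauto; ring.
 have e : J leb (fun x => o1 x * - sin (t * x)) = - ((1 - cos t) / t).
  rewrite (@J_ae _ _ _ leb [set 0] _ (fun x => \1_(`[0, 1]%classic) x * - sin (t * x))).
  - rewrite (@FTC2 R (fun x => t^-1 * cos (t * x)))//.
   + by rewrite mulr1 mulr0 cos0; ring.
   + by move=> x; dauto; field; rewrite gt_eqF.
  - by mf.
  - by mf; exact: measurable_indic.
  - by [].
  - exact: leb1.
  - move=> x /= /eqP x0; rewrite o1E indic_cc lt_neqAle eq_sym x0.
   by case: (0 <= x).
 rewrite -e; apply: (@dd_quad _ _ _ _ (J leb (fun x => \1_(`[0, 1]%classic) x * 1))) => y.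
 have c1 : continuous (fun _ : R => 1 : R) by move=> ?; exact: cvg_cst.
 have i2 : itg leb (fun x => o1 x * - sin (t * x)).
  by apply: (@itg1 _ 1) => [|x x0]; [mf|rewrite normrN ler_norml sin_geN1 sin_le1].
 rewrite /g -J_B; [|exact: i1..].
 rewrite -J_Z// -J_B; [|by apply: itgB; exact: i1|exact: itgZ].
 rewrite mulrC -J_Z; last exact: itg_itv.
 apply: J_abs; [by mf|by apply: itgZ; exact: itg_itv|].
 move=> x; rewrite o1E indic_cc; have [x0|x0] := ltP 0 x; last first.
  by rewrite !mul0r !subr0 mulr0 oppr0 addr0 normr0 mulr1 mulr_ge0 ?sqr_ge0.
 have x0' : x != 0 by rewrite gt_eqF.
 rewrite (ltW x0) /=; have [x1|x1] := leP x 1; last by rewrite !mul0r !mulr0 !subr0 normr0.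
 rewrite !mul1r [(t + y) * x]mulrDl (_ : _ - _ - _ = (cos (t * x + y * x) - cos (t * x) - (y * x) * (- sin (t * x))) / x); last by field.
 rewrite normrM normfV (gtr0_norm x0) ler_pdivrMr//; apply: le_trans (cos_quad _ _) _.
 by rewrite mulr1 exprMn ler_wpM2l ?sqr_ge0// expr2 ler_piMl ?(ltW x0).
(* Subtracting [sin t / t] leaves the derivative [sin t / t ^+ 2], so that [D] moves by at most 1 on
   [[1, oo)]. *)
pose D t := g t + ln t - sin t / t.
have dD (t : R) : 0 < t -> dd D t (sin t / t ^+ 2).
 move=> t0; have dl : dd (@ln R) t t^-1 := is_derive1_ln t0.
 have h := dg t t0.
 rewrite /D; dauto; first by rewrite gt_eqF.
 by field; rewrite gt_eqF.
have bnd (t : R) : 0 < t -> `|sin t / t ^+ 2| <= t ^- 2.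
 move=> t0; rewrite normrM normfV (@ger0_norm _ (t ^+ 2)) ?sqr_ge0// ler_piMl ?invr_ge0 ?sqr_ge0//.
 by rewrite ler_norml sin_geN1 sin_le1.
exists (`|D 1| + 2) => t t1; have t0 : 0 < t by exact: lt_le_trans t1.
have h1 : D 1 - 1 <= D t - t^-1.
 have H := @dd_nondec R (fun t => D t - t^-1) (fun t => sin t / t ^+ 2 + t ^- 2) 1 t t1.
 rewrite invr1 in H; apply: (H) => x /andP[x1 _]; have x0 : 0 < x by exact: lt_le_trans x1.
  have h := dD x x0; dauto; first by rewrite gt_eqF.
  by ring.
 by have := bnd x x0; rewrite ler_norml => /andP[h _]; rewrite -lerBlDr sub0r.
have h2 : D t + t^-1 <= D 1 + 1.
 have H := @dd_nondec R (fun t => - (D t + t^-1)) (fun t => - (sin t / t ^+ 2 - t ^- 2)) 1 t t1.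
 rewrite invr1 lerN2 in H; apply: (H) => x /andP[x1 _]; have x0 : 0 < x by exact: lt_le_trans x1.
  have h := dD x x0; dauto; first by rewrite gt_eqF.
  by ring.
 by have := bnd x x0; rewrite ler_norml => /andP[_ h]; rewrite oppr_ge0 subr_le0.
have h3 : `|sin t / t| <= 1.
 rewrite normrM normfV (gtr0_norm t0) ler_pdivrMr// mul1r (le_trans _ t1)//.
 by rewrite ler_norml sin_geN1 sin_le1.
have t2 : 0 <= t^-1 by rewrite invr_ge0 ltW.
have t3 : t^-1 <= 1 by rewrite invf_le1.
have -> : g t + ln t = D t + sin t / t by rewrite /D subrK.
have h4 : `|D t| <= `|D 1| + 1.
 have := ler_norm (D 1); have := ler_norm (- D 1); rewrite normrN => a b.
 by rewrite ler_norml; lra.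
by apply: le_trans (ler_normD _ _) _; rewrite (_ : 2 = 1 + 1)// addrA lerD.
Qed.

(** Logarithmic form of the power decay of [|phi|]. On [(0, 1]], [k] is split into the constant
    [alpha], which yields the logarithm ([part2]), and a remainder ([part1]); beyond 1 the integrand
    is at most [2 * k x]. *)
Lemma phiA_asymp : exists2 C, 0 < C & forall t, `|phiA alpha F t + alpha * ln (1 + `|t|)| <= C.
Proof.
have mk := k_meas; have mi := io_meas; have mo := o1_meas.
have [C2 h2] := part2.
pose K := J leb (fun x => io x * k x).
have K0 : 0 <= K by apply: J_ge0 => x; rewrite mulr_ge0 ?io_ge0 ?k_ge0.
have C20 : 0 <= C2 by apply: le_trans (h2 1 _).
have big t : 1 <= t -> `|phiA alpha F t + alpha * ln t| <= 4 * `|Ch| + alpha * C2 + 2 * K.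
 move=> t1; have t0 : 0 < t by exact: lt_le_trans t1.
 have i1 : itg leb (fun x => o1 x * ((cos (t * x) - 1) / x * (k x - alpha))).
  apply: (@itg1 _ (`|t| * (alpha + alpha))) => [|x x0]; [by mf|].
  rewrite normrM ler_pM ?cos1_abs// (le_trans (ler_normB _ _))// lerD// ger0_norm ?k_ge0 ?k_le ?(ltW al0)//.
 have i2 : itg leb (fun x => o1 x * ((cos (t * x) - 1) / x)).
  by apply: (@itg1 _ `|t|) => [|x x0]; [mf|exact: cos1_abs].
 have i3 : itg leb (fun x => io x * (((1 - o1 x) * ((cos (t * x) - 1) / x)) * k x)).
  apply: (@itg_bk _ `|t|) => [|x x0]; [by mf|].
  rewrite normrM -[leRHS]mul1r ler_pM ?cos1_abs// o1E; case: (_ && _); rewrite ?subrr ?subr0 ?normr0 ?normr1//.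
 have e : phiA alpha F t + alpha * ln t =
   J leb (fun x => o1 x * ((cos (t * x) - 1) / x * (k x - alpha))) +
   alpha * (J leb (fun x => o1 x * ((cos (t * x) - 1) / x)) + ln t) +
   J leb (fun x => io x * (((1 - o1 x) * ((cos (t * x) - 1) / x)) * k x)).
  suff -> : phiA alpha F t = J leb (fun x => o1 x * ((cos (t * x) - 1) / x * (k x - alpha))) +
    alpha * J leb (fun x => o1 x * ((cos (t * x) - 1) / x)) +
    J leb (fun x => io x * (((1 - o1 x) * ((cos (t * x) - 1) / x)) * k x)) by ring.
  rewrite phiAE -J_Z// -J_D//; last exact: itgZ.
  rewrite -J_D//; last by apply: itgD => //; exact: itgZ.
  congr J; apply/funext => x; rewrite o1E ioE.
  by have [x0|x0] := ltP 0 x; case: (x <= 1); rewrite /= ?mul1r ?mul0r ?subrr ?subr0 ?mul0r ?mulr0 ?addr0 ?add0r ?mul1r//; ring.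
 rewrite e; apply: le_trans (ler_normD _ _) _; apply: lerD.
  apply: le_trans (ler_normD _ _) _; apply: lerD; first exact: part1.
  by rewrite normrM gtr0_norm// ler_wpM2l ?h2// ltW.
 rewrite -J_Z; last exact: itg_k.
 apply: J_abs; [exact: itg_meas i3|exact: itgZ itg_k|].
 move=> x; rewrite o1E ioE; have [x0|x0] := ltP 0 x; last by rewrite !mul0r normr0 mulr0.
 rewrite /= !mul1r normrM (ger0_norm (k_ge0 _)) ler_wpM2r ?k_ge0//.
 have [x1|x1] := leP x 1; first by rewrite subrr mul0r normr0.
 rewrite subr0 mul1r normrM normfV (gtr0_norm x0) ler_pdivrMr// (@le_trans _ _ (2 * 1))//; last by rewrite ler_wpM2l// ltW.
 rewrite mulr1 (le_trans (ler_normB _ _))// normr1 -[leRHS]/(1 + 1) lerD2r.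
 by rewrite ler_norml cos_geN1 cos_le1.
exists (4 * `|Ch| + alpha * C2 + 2 * K + alpha * ln 2 + 1).
 by rewrite ltr_wpDl// !addr_ge0 ?mulr_ge0 ?(ltW al0)// ln_ge0// ler1n.
have l2 : 0 <= alpha * ln 2 by rewrite mulr_ge0 ?(ltW al0)// ln_ge0// ler1n.
have p1 : 0 <= 4 * `|Ch| + alpha * C2 by rewrite addr_ge0// mulr_ge0// ltW.
suff h t : 0 <= t -> `|phiA alpha F t + alpha * ln (1 + `|t|)| <= 4 * `|Ch| + alpha * C2 + 2 * K + alpha * ln 2 + 1.
 move=> t; have [|/ltW t0] := leP 0 t; first exact: h.
 by have := h (- t); rewrite phiA_even normrN; apply; rewrite oppr_ge0.
move=> t0; rewrite (ger0_norm t0); have [t1|/ltW t1] := leP t 1.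
 apply: le_trans (ler_normD _ _) _.
 have := phiA_abs t; rewrite (ger0_norm t0) -/K => hA.
 have : `|alpha * ln (1 + t)| <= alpha * ln 2.
  rewrite ger0_norm ?mulr_ge0 ?(ltW al0) ?ln_ge0 ?lerDl// ler_wpM2l ?(ltW al0)//.
  by rewrite ler_ln ?posrE ?ltr_wpDr// (_ : 2 = 1 + 1)// lerD2l.
 have : t * K <= 1 * K by rewrite ler_wpM2r.
 by lra.
have tp : 0 < t by exact: lt_le_trans t1.
have -> : phiA alpha F t + alpha * ln (1 + t) = phiA alpha F t + alpha * ln t + alpha * (ln (1 + t) - ln t) by ring.
apply: le_trans (ler_normD _ _) _.
have : `|alpha * (ln (1 + t) - ln t)| <= alpha * ln 2.
 rewrite ger0_norm; last by rewrite mulr_ge0 ?(ltW al0)// subr_ge0 ler_ln ?posrE ?ltr_wpDl ?lerDr// ltW.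
 rewrite ler_wpM2l ?(ltW al0)// lerBlDr -lnM ?posrE//.
 have t3 : 1 + t <= 2 * t by lra.
 by rewrite ler_ln ?posrE//; lra.
by have := big t t1; lra.
Qed.

End holder.

End phi.

(** * Monotone classes, equality in law, limits *)

Section class.
Context {R : realType} {d} {T : measurableType d}.

(** For [y >= 0], the integer part of [y] capped at [n]. *)
Let step (y : R) (n : nat) : R := \sum_(j < n) (if (j.+1)%:R <= y then 1 else 0).

Let stepP (y : R) n : 0 <= y -> (n%:R <= y -> step y n = n%:R) /\ (y < n%:R -> y - 1 <= step y n <= y).
Proof.
move=> y0; elim: n => [|n [ih1 ih2]].
 by split => [_|]; [rewrite /step big_ord0|rewrite ltNge y0].
rewrite /step big_ord_recr/= -/(step y n); split=> h.
 by rewrite h ih1 -?natr1// (le_trans _ h)// ler_nat.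
rewrite [n.+1%:R <= y]leNgt h addr0; have [ny|yn] := leP n%:R y; last exact: ih2.
by rewrite ih1// ny andbT lerBlDr natr1 ltW.
Qed.

(** After an affine normalisation to [[0, 1]], [g] is the uniform limit of staircases with steps
    [1 / (n + 1)], each a finite sum of indicators of superlevel sets. *)
Lemma bmf_class (S : (T -> R) -> Prop) :
 S (fun=> 1) -> (forall A, measurable A -> S (\1_A)) ->
 (forall c g1 g2, bmf g1 -> bmf g2 -> S g1 -> S g2 -> S (fun x => g1 x + c * g2 x)) ->
 (forall (g : nat -> T -> R) g0 (M : R), (forall n, measurable_fun setT (g n)) ->
  (forall n x, `|g n x| <= M) -> (forall x, g n x @[n --> \oo] --> g0 x) ->
  (forall n, S (g n)) -> S g0) ->
 forall g, bmf g -> S g.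
Proof.
move=> S1 SI SD Sl.
have S0 : S (fun=> 0).
 by rewrite (_ : (fun=> 0) = (fun _ : T => 1 + -1 * 1)); [apply: SD => //; exact: bmf_cst|apply/funext => x; rewrite mulr1 subrr].
have SZ c g : bmf g -> S g -> S (fun x => c * g x).
 move=> bg sg; rewrite (_ : (fun x => _) = (fun x => 0 + c * g x)); first by apply: SD => //; exact: bmf_cst.
 by apply/funext => x; rewrite add0r.
have main (g : T -> R) : measurable_fun setT g -> (forall x, 0 <= g x <= 1) -> S g.
 move=> mg g01.
 have bs (j : nat) (n : nat) : bmf (fun x => if (j.+1)%:R <= n.+1%:R * g x then 1 else 0 : R) by bm.
 apply: (Sl (fun n x => n.+1%:R^-1 * step (n.+1%:R * g x) n.+1) _ 1).
 - by move=> n; rewrite /step; mf.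
 - move=> n x; rewrite /step ger0_norm; last by rewrite mulr_ge0 ?invr_ge0// sumr_ge0// => i _; case: ifP.
  rewrite ler_pdivrMl// mulr1; apply: (@le_trans _ _ (\sum_(j < n.+1) 1)).
   by apply: ler_sum => i _; case: ifP.
  by rewrite sumr_const card_ord.
 - move=> x; apply/cvgrPdist_le => e e0; near=> n.
  have /andP[g0 g1] := g01 x.
  have y0 : 0 <= n.+1%:R * g x by rewrite mulr_ge0.
  have [h1 h2] := stepP n.+1 y0.
  have h3 : n.+1%:R * g x - 1 <= step (n.+1%:R * g x) n.+1 <= n.+1%:R * g x.
   have [h|h] := leP n.+1%:R (n.+1%:R * g x); last exact: h2.
   by rewrite h1// h andbT lerBlDr (@le_trans _ _ n.+1%:R) ?ler_piMr// lerDl.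
  rewrite -(ler_pM2l (ltr0Sn R n)) -[X in X * `|_|]ger0_norm// -normrM mulrBr mulVKf//.
  apply: (@le_trans _ _ 1).
   by case/andP: h3 => h4 h5; rewrite ger0_norm; lra.
  rewrite -ler_pdivrMr// mul1r (@le_trans _ _ n%:R)//; last by rewrite ler_nat.
  by near: n; exact: nbhs_infty_ger.
 - move=> n; apply: SZ; first by rewrite /step; bm.
  suff H m : S (fun x => \sum_(j < m) (if (j.+1)%:R <= n.+1%:R * g x then 1 else 0)) by exact: H.
  elim: m => [|m ih]; first by under eq_fun do rewrite big_ord0.
  under eq_fun do rewrite big_ord_recr/=.
  rewrite (_ : (fun x => _) = (fun x => \sum_(j < m) (if (j.+1)%:R <= n.+1%:R * g x then 1 else 0) + 1 * (if (m.+1)%:R <= n.+1%:R * g x then 1 else 0))); last first.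
   by apply/funext => x; rewrite mul1r.
  apply: SD => //; first by apply: bmf_sum => i; exact: bs.
  have mA : measurable [set x | (m.+1)%:R <= n.+1%:R * g x].
   have mb : measurable_fun setT (fun x => (m.+1)%:R <= n.+1%:R * g x) by mf.
   by have := mb measurableT [set true] I; rewrite setTI; congr measurable.
  rewrite (_ : (fun x => _) = \1_[set x | (m.+1)%:R <= n.+1%:R * g x]); first exact: SI.
  apply/funext => x; rewrite indicE; case: ifP => h; first by rewrite mem_set.
  by rewrite memNset//= h.
move=> g [mg [M gM]].
have M0 : 0 < `|M| + 1 by rewrite ltr_wpDl.
rewrite (_ : g = (fun x => (fun x => (`|M| + 1) * 2 * ((g x + (`|M| + 1)) / ((`|M| + 1) * 2))) x + (- (`|M| + 1)) * 1)); last first.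
 by apply/funext => x; field; rewrite gt_eqF.
have b : bmf (fun x => (g x + (`|M| + 1)) / ((`|M| + 1) * 2)) by bm; split => //; exists M.
apply: SD => //; [by bm|exact: bmf_cst|].
apply: SZ => //; apply: main; first exact: bmf_meas.
move=> x; have := gM x; rewrite ler_norml => /andP[g1 g2]; have := ler_norm M.
by move=> h; rewrite divr_ge0 ?mulr_ge0 ?(ltW M0)//= ?ler_pdivrMr ?mulr_gt0//; lra.
Unshelve. all: by end_near. Qed.

End class.

Section laws.
Context {R : realType} {d} {T : measurableType d} (P : probability T R).

Lemma J_law {d'} {T' : measurableType d'} (P' : probability T' R) (X : T -> R) (X' : T' -> R) :
 measurable_fun setT X -> measurable_fun setT X' ->
 (forall A, measurable A -> fine (P (X @^-1` A)) = fine (P' (X' @^-1` A))) ->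
 forall g, bmf g -> J P (fun w => g (X w)) = J P' (fun w => g (X' w)).
Proof.
move=> mX mX' h; apply: bmf_class.
- by rewrite !Ex_cst.
- move=> A mA.
 have m1 : measurable (X @^-1` A) by rewrite -[Y in measurable Y]setTI; exact: mX.
 have m2 : measurable (X' @^-1` A) by rewrite -[Y in measurable Y]setTI; exact: mX'.
 rewrite (_ : (fun w => \1_A (X w)) = \1_(X @^-1` A)); last by apply/funext => w; rewrite !indicE.
 rewrite (_ : (fun w => \1_A (X' w)) = \1_(X' @^-1` A)); last by apply/funext => w; rewrite !indicE.
 by rewrite !Ex_indic ?h.
- move=> c g1 g2 b1 b2 e1 e2.
 by rewrite !J_D ?J_Z ?e1 ?e2//; try (apply: bmf_itg; bm); apply: itgZ; apply: bmf_itg; bm.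
- move=> g g0 M mg gM gl e.
 have l1 : J P (fun w => g n (X w)) @[n --> \oo] --> J P (fun w => g0 (X w)).
  by apply: (J_dct _ (itg_cst P M) _ _).2 => // n; mf.
 have l2 : J P' (fun w => g n (X' w)) @[n --> \oo] --> J P' (fun w => g0 (X' w)).
  by apply: (J_dct _ (itg_cst P' M) _ _).2 => // n; mf.
 rewrite (_ : (fun n => _) = (fun n => J P' (fun w => g n (X' w)))) in l1; last by apply/funext => n; exact: e.
 by rewrite -(cvg_lim _ l1)// (cvg_lim _ l2).
Qed.

Lemma J_density (X : T -> R) (f : R -> R) : measurable_fun setT X -> itg leb f ->
 (forall A, measurable A -> P (X @^-1` A) = (\int[leb]_(x in A) (f x)%:E)%E) ->
 forall g, bmf g -> J P (fun w => g (X w)) = J leb (fun x => f x * g x).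
Proof.
move=> mX fi h.
have mfm := itg_meas fi.
have ig (g : R -> R) : bmf g -> itg leb (fun x => f x * g x).
 move=> [mg [M gM]]; apply: itg_dom (itgZr M (itg_norm fi)); first by mf.
 by move=> x; rewrite normrM ler_wpM2l.
have hA (A : set R) : measurable A -> J P (fun w => \1_A (X w)) = J leb (fun x => f x * \1_A x).
 move=> mA; rewrite (_ : (fun w => _) = \1_(X @^-1` A)); last by apply/funext => w; rewrite !indicE.
 rewrite Ex_indic; last by rewrite -[X in measurable X]setTI; exact: mX.
 rewrite h// /J integral_mkcond; congr fine; apply: eq_integral => x _.
 by rewrite patchE indicE; case: (x \in A); rewrite ?mulr1 ?mulr0.
apply: bmf_class => //.
- by have := hA setT measurableT; rewrite indicT.
- move=> c g1 g2 b1 b2 e1 e2.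
 rewrite J_D; [|by apply: bmf_itg; bm|by apply: itgZ; apply: bmf_itg; bm].
 rewrite J_Z ?e1 ?e2; last by apply: bmf_itg; bm.
 rewrite -(J_Z c (ig _ b2)) -(J_D (ig _ b1) (itgZ c (ig _ b2))).
 by congr J; apply/funext => x; ring.
- move=> g g0 M mg gM gl e.
 have l1 : J P (fun w => g n (X w)) @[n --> \oo] --> J P (fun w => g0 (X w)).
  by apply: (J_dct _ (itg_cst P M) _ _).2 => // n; mf.
 have l2 : J leb (fun x => f x * g n x) @[n --> \oo] --> J leb (fun x => f x * g0 x).
  apply: (J_dct _ (itgZr M (itg_norm fi)) _ _).2.
  - by move=> n; mf.
  - by move=> n x; rewrite normrM ler_wpM2l.
  - by move=> x; apply: cvgM; [exact: cvg_cst|exact: gl].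
 rewrite (_ : (fun n => _) = (fun n => J leb (fun x => f x * g n x))) in l1; last by apply/funext => n; exact: e.
 by rewrite -(cvg_lim _ l1)// (cvg_lim _ l2).
Qed.

(** [limn] returns a default point where the sequence diverges. The convergence set, written as a
    Cauchy condition, is measurable, and off it the terms are replaced by that point. *)
Lemma meas_limn (u : nat -> T -> R) : (forall n, measurable_fun setT (u n)) ->
 measurable_fun setT (fun w => limn (fun n => u n w)).
Proof.
move=> mu.
pose C : set T := \bigcap_k \bigcup_n \bigcap_(i in [set i | (n <= i)%N]) [set w | `|u n w - u i w| <= k.+1%:R^-1].
have mC : measurable C.
 apply: bigcapT_measurable => k; apply: bigcupT_measurable => n; apply: bigcap_measurable; first by exists n => /=.
 move=> i _; have mb : measurable_fun setT (fun w => `|u n w - u i w| <= k.+1%:R^-1) by mf.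
 by have := mb measurableT [set true] I; rewrite setTI; congr measurable.
have CP w : C w <-> cvg (u n w @[n --> \oo]).
 split => [Cw|/cvg_ex[/= l ul] k _].
  apply/cauchy_cvgP/cauchy_exP => e e0.
  have [k ke] : exists k : nat, k.+1%:R^-1 < e.
   have h : n.+1%:R^-1 @[n --> \oo] --> (0 : R) by exact: cvg_harmonic.
   move/cvgrPdist_lt : h => /(_ _ e0)[k _ hk]; exists k.
   by have := hk k (leqnn k); rewrite /= sub0r normrN ger0_norm.
  have [n _ hn] := Cw k I; exists (u n w); exists n => // i /= ni.
  by rewrite /ball/=; exact: le_lt_trans (hn i ni) ke.
 have e0 : 0 < k.+1%:R^-1 / 2 :> R by rewrite divr_gt0// invr_gt0.
 move/cvgrPdist_le : (ul) => /(_ _ e0)[n _ hn]; exists n => // i /= ni.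
 have h1 := hn n (leqnn n); have h2 := hn i ni; rewrite /= in h1 h2.
 rewrite (_ : u n w - u i w = (l - u i w) - (l - u n w)); last by ring.
 rewrite (le_trans (ler_normB _ _))// (splitr k.+1%:R^-1) lerD//.
pose v n w := if `[< C w >] then u n w else point.
have mv n : measurable_fun setT (v n).
 apply: measurable_fun_ifT => //.
 apply: (measurable_fun_bool true); rewrite setTI (_ : _ @^-1` _ = C)//.
 by apply/seteqP; split => w /=; [move/asboolP|move=> h; apply/asboolP].
apply: (measurable_fun_cvg mv) => w _; rewrite /v.
case: asboolP => [/CP cw|nC]; first exact: cw.
rewrite (_ : limn _ = point); first exact: cvg_cst.
by apply: dvgP => /CP.
Qed.

End laws.

(** * Characteristic function of shot noise, one jump at a time *)

Section shot_noise.
Context {R : realType} {d : measure_display} {Omega : measurableType d} (P : probability Omega R).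
Variables (alpha eps : R) (F : probability R R) (X0 : Omega -> R) (E U : nat -> Omega -> R).
Hypotheses (al0 : 0 < alpha) (F1 : F (`]0%R, +oo[%classic) = 1%E) (eps0 : 0 < eps).
Hypothesis mom : (\int[lebesgue_measure]_(x in `]0%R, +oo[%classic)
    (Num.max 1 (`|x| `^ (2 + eps)) * kf alpha F x)%:E < +oo)%E.
Hypotheses (cre : continuous (phik_re alpha F)) (cim : continuous (phik_im alpha F)).
Hypotheses (mX0 : measurable_fun setT X0) (mE : forall j, measurable_fun setT (E j))
 (mU : forall j, measurable_fun setT (U j)).

Definition driver (i : option (nat + nat)) : Omega -> R :=
 match i with None => X0 | Some (inl j) => E j | Some (inr j) => U j end.

Hypothesis ind : mutually_independent P driver.
Hypothesis lawE : forall j (A : set R), measurable A -> P (E j @^-1` A) = exponential_prob alpha A.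
Hypothesis lawU : forall j (A : set R), measurable A -> P (U j @^-1` A) = F A.

Lemma driver_meas i : measurable_fun setT (driver i).
Proof. by case: i => [[j|j]|] /=. Qed.

Lemma J_E j (g : R -> R) : bmf g ->
 J P (fun w => g (E j w)) = J leb (fun s => \1_(`[0, +oo[%classic) s * (alpha * expR (- (alpha * s)) * g s)).
Proof.
move=> bg; rewrite (@J_density _ _ _ P (E j) (exponential_pdf alpha)) //.
- congr J; apply/funext => s; rewrite /exponential_pdf patchE indicE mulNr.
 by case: (s \in _); rewrite ?mul1r ?mul0r.
- by apply/itgP; exact: integrable_exponential_pdf.
- by move=> A mA; rewrite lawE.
Qed.

Lemma J_U j (g : R -> R) : bmf g -> J P (fun w => g (U j w)) = J F g.
Proof.
move=> bg; rewrite (@J_law _ _ _ P _ _ F (U j) id)// => A mA.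
by rewrite lawU.
Qed.

Lemma psir_meas : measurable_fun setT (psir F).
Proof.
have mi := continuous_measurable_fun cim.
rewrite (_ : psir F = fun s => 1 + - (s * phik_im alpha F s / alpha)); first by mf.
apply/funext => s; rewrite (phik_imP al0 F1 mom) mulrAC mulfV ?gt_eqF//; ring.
Qed.
Lemma psii_meas : measurable_fun setT (psii F).
Proof.
have mi := continuous_measurable_fun cre.
rewrite (_ : psii F = fun s => s * phik_re alpha F s / alpha); first by mf.
by apply/funext => s; rewrite (phik_reP al0 F1 mom) mulrAC mulfV ?gt_eqF// mul1r.
Qed.
Lemma psir_abs s : `|psir F s| <= 1.
Proof. by apply: Ex_bound => [|x]; [mf|rewrite ler_norml cos_geN1 cos_le1]. Qed.
Lemma psii_abs s : `|psii F s| <= 1.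
Proof. by apply: Ex_bound => [|x]; [mf|rewrite ler_norml sin_geN1 sin_le1]. Qed.

(** Time of the jump number [k + j], counted from the moment at which the waiting time [E k]
    starts. *)
Definition arr k j w := \sum_(i < j.+1) E (k + i)%N w.

Lemma arr0 k w : arr k 0 w = E k w. Proof. by rewrite /arr big_ord_recl big_ord0 addr0 addn0. Qed.
Lemma arrS k j w : arr k j.+1 w = E k w + arr k.+1 j w.
Proof.
rewrite /arr big_ord_recl/= addn0; congr (_ + _); apply: eq_bigr => i _.
by rewrite /bump leq0n addnA addn1.
Qed.

Section recursion.
Variables (c : R -> R) (mc : measurable_fun setT c).

(** Only cosines occur: a phase [th] is carried along, and shifting it recovers the sine. [tau] is
    the time already elapsed and [m] the number of jumps kept. *)
Definition shotcf k m (tau th : R) :=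
 J P (fun w => cos (th + \sum_(j < m) c (tau + arr k j w) * U (k + j)%N w)).

(** Renewal at the first jump: given [E k] and [U k], the remaining jumps are an independent copy
    started at the new time with the new phase. *)
Lemma shotcf_rec k m tau th :
 bmf (fun w => shotcf k.+1 m (tau + E k w) (th + c (tau + E k w) * U k w)) /\
 shotcf k m.+1 tau th = J P (fun w => shotcf k.+1 m (tau + E k w) (th + c (tau + E k w) * U k w)).
Proof.
pose A : pred (option (nat + nat)) := fun i => match i with Some (inl j) | Some (inr j) => j == k | None => false end.
pose B : pred (option (nat + nat)) := fun i => match i with Some (inl j) | Some (inr j) => (k < j)%N | None => false end.
have mEA : measurable_fun [set: sigT driver A] (E k) by apply: (@sig_X _ _ _ _ driver A (Some (inl k))); exact: eqxx.
have mUA : measurable_fun [set: sigT driver A] (U k) by apply: (@sig_X _ _ _ _ driver A (Some (inr k))); exact: eqxx.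
pose Eb i : sigT driver B -> R := E (k.+1 + i)%N.
pose Ub i : sigT driver B -> R := U (k.+1 + i)%N.
have mEB i : measurable_fun setT (Eb i) by apply: (@sig_X _ _ _ _ driver B (Some (inl (k.+1 + i)%N))); rewrite /in_mem/= leq_addr.
have mUB i : measurable_fun setT (Ub i) by apply: (@sig_X _ _ _ _ driver B (Some (inr (k.+1 + i)%N))); rewrite /in_mem/= leq_addr.
have dj i : i \in A -> i \in B -> false.
 by case: i => [[j|j]|] //; rewrite /in_mem/= => /eqP ->; rewrite ltnn.
have [||b e] := @Ex_copy R _ _ P _ driver driver_meas ind A B dj
  (fun w w' => cos (th + c (tau + E k w) * U k w + \sum_(j < m) c (tau + E k w + arr k.+1 j w') * U (k.+1 + j)%N w')) 1.
- rewrite (_ : (fun z => _) = (fun z : sigT driver A * sigT driver B =>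
  cos (th + c (tau + E k z.1) * U k z.1 + \sum_(j < m) c (tau + E k z.1 + \sum_(i < j.+1) Eb i z.2) * Ub j z.2)))//.
 by mf.
- by move=> w w'; rewrite ler_norml cos_geN1 cos_le1.
split => //; rewrite -e /shotcf; congr J; apply/funext => w; congr cos.
rewrite big_ord_recl/= addn0 arr0 addrA; congr (_ + _); apply: eq_bigr => j _.
by rewrite /bump leq0n arrS addrA addnA addn1.
Qed.

Variables (L : R) (A B : R -> R) (M : R).
Hypotheses (mA : measurable_fun setT A) (mB : measurable_fun setT B).
Hypothesis (AM : forall s, expR (A s) <= M).
Hypothesis (AB0 : forall s, L < s -> A s = 0 /\ B s = 0).

(** Conjectured limit of [shotcf] as [m] grows: the real part of [exp (A tau + i (th + B tau))]. [A]
    and [B] are tied to the weight [c] by the renewal equation [ident]. *)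
Definition cand tau th := expR (A tau) * cos (th + B tau).
(** Mean of [cand] just after a jump of law [F], expanded by the addition formula for the cosine. *)
Definition jump_mean tau th :=
 expR (A tau) * (cos (th + B tau) * psir F (c tau) - sin (th + B tau) * psii F (c tau)).

Hypothesis ident : forall tau th, 0 <= tau ->
 J leb (fun s => \1_(`[0, +oo[%classic) s * (alpha * expR (- (alpha * s)) * jump_mean (tau + s) th)) = cand tau th.

Lemma cand_abs tau th : `|cand tau th| <= M.
Proof.
rewrite normrM ger0_norm ?expR_ge0// -[leRHS]mulr1 ler_pM ?expR_ge0//.
by rewrite ler_norml cos_geN1 cos_le1.
Qed.

Lemma cand_rec k tau th : 0 <= tau ->
 J P (fun w => cand (tau + E k w) (th + c (tau + E k w) * U k w)) = cand tau th.
Proof.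
move=> tau0.
have mpr := psir_meas; have mpi := psii_meas.
pose A' : pred (option (nat + nat)) := fun i => i == Some (inl k).
pose B' : pred (option (nat + nat)) := fun i => i == Some (inr k).
have mEA : measurable_fun [set: sigT driver A'] (E k) by apply: (@sig_X _ _ _ _ driver A' (Some (inl k))); exact: eqxx.
have mUB : measurable_fun [set: sigT driver B'] (U k) by apply: (@sig_X _ _ _ _ driver B' (Some (inr k))); exact: eqxx.
have dj i : i \in A' -> i \in B' -> false by move=> /eqP -> /eqP.
have [||b e] := @Ex_copy R _ _ P _ driver driver_meas ind A' B' dj
  (fun w w' => cand (tau + E k w) (th + c (tau + E k w) * U k w')) M.
- by rewrite /cand; mf.
- by move=> w w'; exact: cand_abs.
clear mEA mUB; rewrite e -(ident th tau0) -(@J_E k (fun s => jump_mean (tau + s) th)); last first.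
 apply: (@bmf_intro _ _ _ (M * 2)); first by rewrite /jump_mean; mf.
 move=> s; rewrite /jump_mean normrM ger0_norm ?expR_ge0// ler_pM ?expR_ge0//.
 rewrite (le_trans (ler_normB _ _))// (_ : 2 = 1 * 1 + 1 * 1 :> R); last by ring.
 rewrite !normrM lerD// ler_pM ?psir_abs ?psii_abs// ler_norml ?cos_geN1 ?cos_le1 ?sin_geN1 ?sin_le1//.
congr J; apply/funext => w.
set s := tau + E k w; rewrite /cand /jump_mean.
rewrite (_ : (fun w' => _) = (fun w' => expR (A s) * cos (th + B s) * cos (c s * U k w') +
  - (expR (A s) * sin (th + B s)) * sin (c s * U k w'))); last first.
 by apply/funext => w'; rewrite (addrAC th) cosD; ring.
rewrite J_D ?J_Z; try (by apply: bmf_itg; bm); try (by apply: itgZ; apply: bmf_itg; bm).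
rewrite (@J_U k (fun u => cos (c s * u))); last by bm.
rewrite (@J_U k (fun u => sin (c s * u))); last by bm.
by rewrite /psir /psii; ring.
Qed.

Definition short := J leb (fun s => \1_(`[0, +oo[%classic) s * (alpha * expR (- (alpha * s)) * (if s <= L then 1 else 0))).

Lemma short_E k : J P (fun w => if E k w <= L then 1 else 0) = short.
Proof. by rewrite (@J_E k (fun s => if s <= L then 1 else 0))//; bm. Qed.

Lemma E_neg k : P (E k @^-1` `]-oo, 0%R[%classic) = 0%E.
Proof.
rewrite lawE// /exponential_prob; apply: integral0_eq => x /=; rewrite in_itv/= => x0.
by rewrite lt0_exponential_pdf.
Qed.

(** [shotcf] and [cand] satisfy the same one-jump recursion, so each step multiplies their distance
    by the probability that the waiting time stays below [L]. Once it exceeds [L] the two coincide,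
    since [A] and [B] vanish there. *)
Lemma shotcf_cand k m tau th : 0 <= tau -> `|shotcf k m tau th - cand tau th| <= (1 + M) * short ^+ m.
Proof.
have M0 : 0 <= M by apply: le_trans (AM 0); exact: expR_ge0.
have bd k' m' tau' th' : `|shotcf k' m' tau' th' - cand tau' th'| <= 1 + M.
 rewrite (le_trans (ler_normB _ _))// lerD ?cand_abs// /shotcf; apply: Ex_bound.
  by rewrite /arr; mf.
 by move=> w; rewrite ler_norml cos_geN1 cos_le1.
have late k' m' tau' th' : L < tau' -> 0 <= tau' -> shotcf k' m' tau' th' = cand tau' th'.
 elim: m' k' tau' th' => [|m' ih] k' tau' th' Lt t0.
  rewrite /shotcf /cand; under eq_fun do rewrite big_ord0 addr0.
  by rewrite Ex_cst; have [-> ->] := AB0 Lt; rewrite expR0 mul1r addr0.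
 have [b ->] := shotcf_rec k' m' tau' th'.
 rewrite -(cand_rec k' th' t0); apply: (@J_ae _ _ _ P (E k' @^-1` `]-oo, 0%R[%classic)).
 - exact: bmf_meas b.
 - by rewrite /cand; mf.
 - by rewrite -[X in measurable X]setTI; exact: mE.
 - exact: E_neg.
 - move=> w /=; rewrite in_itv/= => /negP; rewrite -leNgt => Ew.
  by apply: ih; [rewrite (lt_le_trans Lt)// lerDl|rewrite addr_ge0].
elim: m k tau th => [|m ih] k tau th t0; first by rewrite expr0 mulr1.
have [b ->] := shotcf_rec k m tau th.
have bc : bmf (fun w => cand (tau + E k w) (th + c (tau + E k w) * U k w)).
 by apply: (@bmf_intro _ _ _ M); [rewrite /cand; mf|move=> w; exact: cand_abs].
rewrite -(cand_rec k th t0) -J_B; [|exact: bmf_itg..].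
pose g w := (1 + M) * short ^+ m * (if E k w <= L then 1 else 0).
have -> : (1 + M) * short ^+ m.+1 = J P g.
 by rewrite /g J_Z ?short_E ?exprSr ?mulrA//; apply: bmf_itg; bm.
(* The induction hypothesis needs a nonnegative time; on the null event of a negative waiting time
   the integrand is set to 0. *)
pose f w := if 0 <= E k w then shotcf k.+1 m (tau + E k w) (th + c (tau + E k w) * U k w) - cand (tau + E k w) (th + c (tau + E k w) * U k w) else 0.
have mfm : measurable_fun setT f.
 by rewrite /f; apply: meas_if; [mf| |mf]; apply: meas_D; [exact: bmf_meas b|apply: meas_N; exact: bmf_meas bc].
rewrite (@J_ae _ _ _ P (E k @^-1` `]-oo, 0%R[%classic) _ f); first last.
- by move=> w /=; rewrite in_itv/= => /negP; rewrite -leNgt /f => ->.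
- exact: E_neg.
- by rewrite -[X in measurable X]setTI; exact: mE.
- by [].
- by apply: meas_D; [exact: bmf_meas b|apply: meas_N; exact: bmf_meas bc].
apply: J_abs => //.
 by apply: bmf_itg; rewrite /g; bm.
have q0 : 0 <= short.
 by apply: J_ge0 => s; rewrite !mulr_ge0 ?expR_ge0 ?(ltW al0)//; case: ifP.
move=> w; rewrite /f /g; case: ifP => E0; last first.
 by rewrite normr0 mulr_ge0 ?mulr_ge0 ?exprn_ge0 ?addr_ge0//; case: ifP.
case: (leP (E k w) L) => EL; first by rewrite mulr1 ih// addr_ge0.
rewrite late ?subrr ?normr0 ?mulr0//; first by rewrite (lt_le_trans EL)// lerDr.
by rewrite addr_ge0.
Qed.

End recursion.

Lemma short_lt1 L : 0 <= L -> short L < 1.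
Proof.
move=> L0.
have -> : short L = 1 - expR (- (alpha * L)).
 rewrite /short (_ : (fun s => _) = (fun s => \1_(`[0, L]%classic) s * (alpha * expR (- (alpha * s))))).
  rewrite (@FTC2 R (fun s => - expR (- (alpha * s))))//.
  - by rewrite mulr0 oppr0 expR0; ring.
  - by move=> x; dauto; ring.
  - apply: (@dd_cont _ _ (fun x => - alpha ^+ 2 * expR (- (alpha * x)))) => x.
   by dauto; ring.
 apply/funext => s; rewrite indic_cc indic_cy.
 by case: (0 <= s); case: (s <= L); rewrite ?mulr1 ?mulr0 ?mul0r.
by rewrite ltrBlDr ltrDl expR_gt0.
Qed.

End shot_noise.

(** * Windows of one sampling step and their exponents *)

Section windows.
Context {R : realType} (alpha eps : R) (F : probability R R) (s0 : R).
Hypotheses (al0 : 0 < alpha) (F1 : F (`]0%R, +oo[%classic) = 1%E) (eps0 : 0 < eps).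
Hypothesis mom : (\int[lebesgue_measure]_(x in `]0%R, +oo[%classic)
    (Num.max 1 (`|x| `^ (2 + eps)) * kf alpha F x)%:E < +oo)%E.
Hypotheses (cre : continuous (phik_re alpha F)) (cim : continuous (phik_im alpha F)).
Hypothesis s00 : 0 < s0.

(* Time is cut into windows of length s0; a jump at time s of the i-th window enters
  the i-th innovation with weight exp(s - end of the window). *)
Fixpoint win (ts : seq R) (s : R) : R :=
 if ts is t :: ts' then if s <= s0 then t * expR (s - s0) else win ts' (s - s0) else 0.
(** Exponent of the jumps still to come at time [s]: the rest of the current window gives
    [f t - f (t * expR (s - s0))], and each later window is counted in full, from its time 0. *)
Fixpoint winf (f : R -> R) (ts : seq R) (s : R) : R :=
 if ts is t :: ts' then
  if s <= s0 then f t - f (t * expR (s - s0)) + winf f ts' 0 else winf f ts' (s - s0)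
 else 0.
Local Notation winA := (winf (phiA alpha F)).
Local Notation winB := (winf (phiB alpha F)).

Lemma phiA_cont : continuous (phiA alpha F).
Proof. exact: (dd_cont (dd_phiA al0 eps0 mom)). Qed.
Lemma phiB_cont : continuous (phiB alpha F).
Proof. exact: (dd_cont (dd_phiB al0 eps0 mom)). Qed.

Lemma win_meas ts : measurable_fun setT (win ts).
Proof.
elim: ts => [|t ts ih] /=; first by mf.
by apply: meas_if; mf.
Qed.

Lemma winf_meas f ts : continuous f -> measurable_fun setT (winf f ts).
Proof.
move=> /continuous_measurable_fun cf; elim: ts => [|t ts ih] /=; first by mf.
by apply: meas_if; mf.
Qed.

Lemma win_late ts s : (size ts)%:R * s0 < s -> winA ts s = 0 /\ winB ts s = 0.
Proof.
elim: ts s => [|t ts ih] s //= h.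
have h1 : (size ts)%:R * s0 < s - s0 by rewrite ltrBrDr (le_lt_trans _ h)// -natr1 mulrDl mul1r.
rewrite leNgt (_ : s0 < s); first exact: ih.
by rewrite -subr_gt0 (le_lt_trans _ h1)// mulr_ge0// ltW.
Qed.

Lemma winA_bounded ts : exists M, forall s, expR (winA ts s) <= M.
Proof.
suff [M h] : exists M, forall s, `|winA ts s| <= M.
 by exists (expR M) => s; rewrite ler_expR (le_trans (ler_norm _)).
elim: ts => [|t ts [M ih]] /=; first by exists 0 => s; rewrite normr0.
pose K := J leb (fun x => io x * kf alpha F x).
exists (`|t| * K + `|t| * K + M) => s.
have K0 : 0 <= K by apply: J_ge0 => x; rewrite mulr_ge0 ?io_ge0// (k_ge0 F al0).
have tK : 0 <= `|t| * K by rewrite mulr_ge0.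
case: ifP => h; last by rewrite (le_trans (ih _))// lerDr addr_ge0.
rewrite (le_trans (ler_normD _ _))// lerD// (le_trans (ler_normB _ _))// lerD//; first exact: (phiA_abs al0 mom).
rewrite (le_trans (phiA_abs al0 mom _))// ler_wpM2r// normrM ler_piMr// ger0_norm ?expR_ge0//.
by rewrite -expR0 ler_expR subr_le0.
Qed.

(** Verification of the renewal equation by induction on the windows. Inside the current window the
    integrand is an exact derivative; beyond it, a shift of the integration variable and the loss of
    memory of the exponential law reduce to the later windows. *)
Lemma win_ident ts tau th : 0 <= tau ->
 J leb (fun s => \1_(`[0, +oo[%classic) s * (alpha * expR (- (alpha * s)) * jump_mean F (win ts) (winA ts) (winB ts) (tau + s) th)) =
 cand (winA ts) (winB ts) tau th.
Proof.
have mpr := psir_meas al0 F1 mom cim; have mpi := psii_meas al0 F1 mom cre.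
have dA := dd_phiA al0 eps0 mom; have dB := dd_phiB al0 eps0 mom.
have eA v := phik_imP al0 F1 mom v; have eB v := phik_reP al0 F1 mom v.
have jm (A B c : R -> R) M th' : measurable_fun setT A -> measurable_fun setT B -> measurable_fun setT c ->
  (forall s, expR (A s) <= M) -> itg leb (fun s => \1_(`[0, +oo[%classic) s * (alpha * expR (- (alpha * s)) * jump_mean F c A B s th')).
 move=> mA mB mc AM; apply: itg_dom (itgZr (alpha * (M * 2)) (itg_exp al0).1).
  by rewrite /jump_mean; mf; exact: measurable_indic.
 move=> s; rewrite normrM ger0_norm// -[leRHS]mulrA ler_wpM2l//.
 rewrite normrM ger0_norm ?mulr_ge0 ?expR_ge0 ?(ltW al0)// mulrA [leRHS]mulrA (mulrC _ alpha) -!mulrA.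
 rewrite ler_wpM2l ?(ltW al0)// ler_wpM2l ?expR_ge0//.
 rewrite /jump_mean normrM ger0_norm ?expR_ge0// ler_pM ?expR_ge0//.
 rewrite (le_trans (ler_normB _ _))// (_ : 2 = 1 * 1 + 1 * 1 :> R); last by ring.
 by rewrite !normrM lerD// ler_pM ?psir_abs ?psii_abs// ler_norml ?cos_geN1 ?cos_le1 ?sin_geN1 ?sin_le1.
elim: ts tau th => [|t ts ih] tau th tau0.
 have pr0 : psir F 0 = 1 by rewrite /psir; under eq_fun do rewrite mul0r cos0; rewrite Ex_cst.
 have pi0 : psii F 0 = 0 by rewrite /psii; under eq_fun do rewrite mul0r sin0; rewrite J0.
 rewrite /jump_mean /cand /= pr0 pi0.
 rewrite (_ : (fun s => _) = (fun s => (alpha * cos th) * (\1_(`[0, +oo[%classic) s * expR (- (alpha * s))))).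
  by rewrite (J_Z _ (itg_exp al0).1) (itg_exp al0).2 expR0 addr0; field; rewrite gt_eqF.
 by apply/funext => s; rewrite expR0 addr0; ring.
have [M AM] := winA_bounded ts; have [M' AM'] := winA_bounded (t :: ts).
have mw := win_meas ts; have mwA := winf_meas ts phiA_cont; have mwB := winf_meas ts phiB_cont.
have mw' := win_meas (t :: ts); have mwA' := winf_meas (t :: ts) phiA_cont; have mwB' := winf_meas (t :: ts) phiB_cont.
have [ts0|ts0] := leP tau s0; last first.
 have -> : cand (winA (t :: ts)) (winB (t :: ts)) tau th = cand (winA ts) (winB ts) (tau - s0) th.
  by rewrite /cand /= leNgt ts0.
 rewrite -ih; last by rewrite subr_ge0 ltW.
 congr J; apply/funext => s; rewrite indic_cy; case: (leP 0 s) => s0'; last by rewrite !mul0r.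
 congr (_ * (_ * _)); rewrite /jump_mean /= leNgt (lt_le_trans ts0) ?lerDl//=.
 by rewrite (addrAC tau).
(* Time left in the current window. *)
pose s1 := s0 - tau; have s10 : 0 <= s1 by rewrite subr_ge0.
pose v s := t * expR (tau + s - s0).
pose a s := phiA alpha F t - phiA alpha F (v s) + winA ts 0.
pose b s := phiB alpha F t - phiB alpha F (v s) + winB ts 0.
pose G s := alpha * expR (- (alpha * s)) * (expR (a s) * (cos (th + b s) * psir F (v s) - sin (th + b s) * psii F (v s))).
(* Since the weight satisfies [v' = v], the derivatives of [a] and [b] are [phi_k] at [v] times [v];
   [phik_imP] and [phik_reP] turn them into [psir] and [psii], which makes [H] an antiderivative of
   [G]. *)
pose H s := - (expR (- (alpha * s)) * (expR (a s) * cos (th + b s))).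
have dv s : dd v s (v s) by rewrite /v; dauto; ring.
have da s : dd a s (phik_im alpha F (v s) * v s) by rewrite /a; dauto; ring.
have db s : dd b s (- phik_re alpha F (v s) * v s) by rewrite /b; dauto; ring.
have dH s : dd H s (G s).
 rewrite /H; dauto; rewrite /G.
 have -> : psir F (v s) = 1 - v s * phik_im alpha F (v s) / alpha by rewrite eA; field; rewrite gt_eqF.
 have -> : psii F (v s) = v s * phik_re alpha F (v s) / alpha by rewrite eB; field; rewrite gt_eqF.
 by field; rewrite gt_eqF.
have cG : continuous G.
 have cv := dd_cont dv; have ca := dd_cont da; have cb := dd_cont db.
 have cc (f g : R -> R) : continuous f -> continuous g -> continuous (fun x => f (g x)).
  by move=> cf cg x; apply: (continuous_comp (cg x) (cf _)).
 have cM (f g : R -> R) : continuous f -> continuous g -> continuous (fun x => f x * g x).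
  by move=> cf cg x; apply: cvgM; [exact: cf|exact: cg].
 have cr : continuous (fun s => psir F (v s)).
  rewrite (_ : (fun s => _) = (fun s => 1 - v s * phik_im alpha F (v s) / alpha)).
   by move=> x; apply: cvgB; [exact: cvg_cst|apply: cvgM; [exact: (cM v (fun s => phik_im alpha F (v s)) cv (cc _ _ cim cv) x)|exact: cvg_cst]].
  by apply/funext => s; rewrite eA; field; rewrite gt_eqF.
 have ci : continuous (fun s => psii F (v s)).
  rewrite (_ : (fun s => _) = (fun s => v s * phik_re alpha F (v s) / alpha)).
   by move=> x; apply: cvgM; [exact: (cM v (fun s => phik_re alpha F (v s)) cv (cc _ _ cre cv) x)|exact: cvg_cst].
  by apply/funext => s; rewrite eB; field; rewrite gt_eqF.
 have cthb : continuous (fun s => th + b s) by move=> x; apply: cvgD; [exact: cvg_cst|exact: cb].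
 have ce : continuous (fun s => alpha * expR (- (alpha * s))).
  by apply: (@dd_cont _ _ (fun x => - alpha ^+ 2 * expR (- (alpha * x)))) => x; dauto; ring.
 apply: (cM) => //; apply: (cM); first by apply: (cc) => //; exact: continuous_expR.
 have c1 := cM _ _ (cc _ _ (@continuous_cos R) cthb) cr.
 have c2 := cM _ _ (cc _ _ (@continuous_sin R) cthb) ci.
 by move=> x; apply: cvgB; [exact: c1|exact: c2].
pose rest x := \1_(`[0, +oo[%classic) x * (alpha * expR (- (alpha * x)) * jump_mean F (win ts) (winA ts) (winB ts) x th).
have irest : itg leb rest by exact: jm.
have Jrest : J leb rest = cand (winA ts) (winB ts) 0 th.
 by rewrite -ih//; congr J; apply/funext => s; rewrite /rest add0r.
have [ish Jsh] := J_shift (- s1) irest.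
(* The end of the window belongs to both pieces, hence an equality off one point. *)
rewrite (@J_ae _ _ _ leb [set s1] _ (fun s => \1_(`[0, s1]%classic) s * G s + expR (- (alpha * s1)) * rest (s - s1))).
- rewrite J_D; [|exact: itg_itv|exact: itgZ].
 rewrite J_Z// Jsh Jrest (FTC2 s10 dH cG) /H /cand /= ts0 mulr0 oppr0 expR0 mul1r opprK.
 have -> : a s1 = winA ts 0 by rewrite /a /v /s1 (_ : tau + (s0 - tau) - s0 = 0) ?expR0 ?mulr1 ?subrr ?add0r//; ring.
 have -> : b s1 = winB ts 0 by rewrite /b /v /s1 (_ : tau + (s0 - tau) - s0 = 0) ?expR0 ?mulr1 ?subrr ?add0r//; ring.
 rewrite /a /b /v addr0; ring.
- by rewrite /jump_mean; mf; exact: measurable_indic.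
- have mG := continuous_measurable_fun cG; have mr := itg_meas ish.
 by mf; exact: measurable_indic.
- by [].
- exact: leb1.
- move=> s /= /eqP ss1; rewrite indic_cc indic_cy.
 case: (leP 0 s) => sp; last first.
  by rewrite !mul0r add0r /rest indic_cy leNgt subr_lt0 (lt_le_trans sp s10) mul0r mulr0.
 rewrite /= /rest indic_cy subr_ge0.
 case: (ltgtP s s1) => h; last by rewrite h eqxx in ss1.
  have h' : tau + s <= s0 by rewrite -lerBrDl; exact: ltW h.
  rewrite /jump_mean /= h' !mul1r !mul0r mulr0 addr0 /G /a /b /v //.
 have h' : s0 < tau + s by rewrite -ltrBlDl; exact: h.
 rewrite mul0r add0r !mul1r mulrA [X in _ = X * _]mulrCA -expRD.
 rewrite (_ : - (alpha * s1) + - (alpha * (s - s1)) = - (alpha * s)); last by ring.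
 rewrite /jump_mean /= leNgt h' /=.
 by rewrite (_ : s - s1 = tau + s - s0) // /s1; ring.
Qed.

Lemma winf0 f ts : winf f ts 0 = \sum_(i < size ts) (f ts`_i - f (ts`_i * expR (- s0))).
Proof.
elim: ts => [|t ts ih] /=; first by rewrite big_ord0.
by rewrite ltW// sub0r big_ord_recl/= ih.
Qed.

(** Weight of a jump at time [s] in the process sampled at time [i * s0]. *)
Definition gate (i : nat) (s : R) := (if s <= i%:R * s0 then 1 else 0) * expR (- (i%:R * s0) + s).

(** Weight of the same jump in the innovation number [i + 1]. For [i = 0] nothing is subtracted,
    since the initial value contains no jump. *)
Definition kern (i : nat) (s : R) := gate i.+1 s - (if i is 0%N then 0 else expR (- s0) * gate i s).

(** A jump counts in at most one window: in later ones the two gates of [kern] cancel, the process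
    being damped by [expR (- s0)] per window, and in earlier ones both vanish. *)
Lemma winE ts s : win ts s = \sum_(i < size ts) ts`_i * kern i s.
Proof.
elim: ts s => [|t ts ih] s /=; first by rewrite big_ord0.
rewrite big_ord_recl/= {1}/kern subr0 {1}/gate mul1r; case: (leP s s0) => h.
 rewrite mul1r big1 ?addr0; first by rewrite addrC.
 move=> i _; rewrite /bump leq0n add1n/= /kern /gate.
 have h1 : s <= (i.+1)%:R * s0 by rewrite (le_trans h)// ler_peMl ?(ltW s00)// ler1n.
 have h2 : s <= (i.+2)%:R * s0 by rewrite (le_trans h)// ler_peMl ?(ltW s00)// ler1n.
 rewrite h1 h2 !mul1r -expRD (_ : - s0 + (- (i.+1%:R * s0) + s) = - (i.+2%:R * s0) + s) ?subrr ?mulr0//.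
 by rewrite -(natr1 i.+1); ring.
rewrite mul0r mulr0 add0r ih; apply: eq_bigr => i _; rewrite /bump leq0n add1n/= /kern; congr (_ * _).
have g j : gate j.+1 s = gate j (s - s0).
 rewrite /gate lerBlDr -(natr1 j) mulrDl mul1r; congr (_ * expR _); ring.
rewrite !g; case: (i : nat) => [|j] //.
have -> : gate 0 (s - s0) = 0 by rewrite /gate mul0r subr_le0 leNgt h mul0r.
by rewrite mulr0.
Qed.

End windows.

(** * Independence of the innovations and stationarity *)

Section innovations.
Context {R : realType} {d : measure_display} {Omega : measurableType d} (P : probability Omega R).
Variables (alpha eps lam Delta : R) (F : probability R R) (X0 : Omega -> R) (E U : nat -> Omega -> R).
Hypotheses (al0 : 0 < alpha) (F1 : F (`]0%R, +oo[%classic) = 1%E) (eps0 : 0 < eps).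
Hypothesis mom : (\int[lebesgue_measure]_(x in `]0%R, +oo[%classic)
    (Num.max 1 (`|x| `^ (2 + eps)) * kf alpha F x)%:E < +oo)%E.
Hypotheses (cre : continuous (phik_re alpha F)) (cim : continuous (phik_im alpha F)).
Hypotheses (mX0 : measurable_fun setT X0) (mE : forall j, measurable_fun setT (E j))
 (mU : forall j, measurable_fun setT (U j)).
Hypothesis ind : mutually_independent P (driver X0 E U).
Hypothesis lawE : forall j (A : set R), measurable A -> P (E j @^-1` A) = exponential_prob alpha A.
Hypothesis lawU : forall j (A : set R), measurable A -> P (U j @^-1` A) = F A.
Hypothesis cfX0 : forall t, J P (fun w => cos (t * X0 w)) = phi_re alpha F t /\
 J P (fun w => sin (t * X0 w)) = phi_im alpha F t.
Hypothesis lD : 0 < lam * Delta.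
Local Notation s0 := (lam * Delta).
Local Notation rho := (expR (- (lam * Delta))).
Local Notation pA := (phiA alpha F).
Local Notation pB := (phiB alpha F).

(** At index 0 the value is [X0] itself: [OUproc] at time 0 agrees with it only off the event of
    arrivals at nonpositive times. *)
Definition ouX (i : nat) (w : Omega) : R :=
 if i is 0%N then X0 w else OUproc lam X0 E U (i%:R * Delta) w.

Definition innov (i : nat) (w : Omega) : R :=
 if i is i'.+1 then ouX i w - rho * ouX i' w else X0 w.

Lemma ouX_sum n w : ouX n w = \sum_(i < n.+1) rho ^+ (n - i) * innov i w.
Proof.
elim: n => [|n ih]; first by rewrite big_ord_recl big_ord0 expr0 mul1r addr0.
rewrite big_ord_recr/= subnn expr0 mul1r.
rewrite (eq_bigr (fun i : 'I_n.+1 => rho * (rho ^+ (n - i) * innov i w))); last first.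
 by move=> i _; rewrite subSn ?exprS ?mulrA// -ltnS.
by rewrite -mulr_sumr -ih; ring.
Qed.

Let S i m w := \sum_(j < m) ((if arrival E j w <= lam * (i%:R * Delta) then 1 else 0) *
 expR (- (lam * (i%:R * Delta)) + arrival E j w) * U j w).

Let S_meas i m : measurable_fun setT (S i m).
Proof. by rewrite /S /arrival; mf. Qed.

Lemma ouX_meas i : measurable_fun setT (ouX i).
Proof.
case: i => [|i] //; rewrite /ouX /OUproc; apply: meas_D; first by mf.
exact: (meas_limn (S_meas i.+1)).
Qed.

Lemma innov_meas i : measurable_fun setT (innov i).
Proof. by case: i => [//|i]; have m1 := ouX_meas i.+1; have m2 := ouX_meas i; rewrite /innov; mf. Qed.

(** Off a null set the waiting times are nonnegative and unbounded, as the probability that the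
    first [m] of them are below a given level is geometric in [m]. One waiting time above [L] pushes
    all later arrivals above [L]. *)
Lemma good_event : exists2 N : set Omega, measurable N /\ P N = 0%E &
 forall w, ~ N w -> forall L : R, exists m, forall j, (m <= j)%N -> L < arrival E j w.
Proof.
have mpre j (B : set R) : measurable B -> measurable (E j @^-1` B).
 by move=> mB; rewrite -[X in measurable X]setTI; exact: mE.
pose q (L : R) := short alpha L.
pose N1 := \bigcup_k (E k @^-1` `]-oo, 0%R[%classic).
pose N2 (L : nat) := \bigcap_k (E k @^-1` `]-oo, L%:R]%classic).
have mN2 L : measurable (N2 L) by apply: bigcapT_measurable => k; exact: mpre.
have nN1 : P.-negligible N1.
 apply: negligible_bigcup => k; apply/negligibleP; first exact: mpre.
 exact: (E_neg lawE).
have pE j (L : nat) : fine (P (E j @^-1` `]-oo, L%:R]%classic)) = q L%:R.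
 rewrite -Ex_indic; last exact: mpre.
 rewrite /q -(short_E al0 mE lawE L%:R j); congr J; apply/funext => w; rewrite indicE.
 by case: ifP => h; [rewrite mem_set//= in_itv|rewrite memNset//= in_itv/= h].
have nN2 L : P.-negligible (N2 L).
 apply/negligibleP => //.
 have le m : fine (P (N2 L)) <= q L%:R ^+ m.
  pose B (i : option (nat + nat)) : set R := `]-oo, L%:R]%classic.
  pose J0 : seq (option (nat + nat)) := [seq Some (inl i) | i <- iota 0 m].
  have us : uniq J0 by rewrite map_inj_in_uniq ?iota_uniq// => i j _ _ [].
  have mB i : measurable (B i) by exact: measurable_itv.
  have := ind us mB.
  rewrite big_map (eq_bigr (fun=> q L%:R)); last by move=> i _; exact: pE.
  rewrite big_const_seq count_predT size_iota iter_mulr_1 => <-.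
  apply: prob_le => //.
   apply: (@cyl_measurable _ _ _ _ (driver X0 E U) (driver_meas mX0 mE mU) predT).
   by exists J0, B; split.
  by move=> w hw i /= /mapP[j _ ->]; exact: hw.
 have q0 : 0 <= q L%:R by rewrite -(pE 0%N) fine_ge0.
 have q1 : q L%:R < 1 by apply: short_lt1; rewrite ler0n.
 have cv : q L%:R ^+ m @[m --> \oo] --> (0 : R) by apply: cvg_expr; rewrite ger0_norm.
 have h : fine (P (N2 L)) <= 0.
  by rewrite -(cvg_lim _ cv)//; apply: limr_ge; [apply/cvg_ex; exists 0|apply: nearW].
 have f1 := fin_num_measure P _ (mN2 L).
 by apply/eqP; rewrite eq_le measure_ge0 andbT; have := h; rewrite -lee_fin fineK.
have [A [mA PA NA]] : P.-negligible (N1 `|` \bigcup_L N2 L).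
 by apply: negligibleU => //; apply: negligible_bigcup.
exists A => // w nA L.
have w0 k : 0 <= E k w.
 rewrite leNgt; apply/negP => h; apply: nA; apply: NA; left; exists k; first by [].
 by rewrite /preimage/= in_itv/=.
have [k hk] : exists k, L < E k w.
 have [K hK] : exists K : nat, L <= K%:R.
  exists (Num.trunc `|L|).+1; rewrite (le_trans (ler_norm L))// ltW//.
  exact: truncnS_gt.
 apply: contrapT => nk; apply: nA; apply: NA; right; exists K => // k _ /=.
 rewrite in_itv/= leNgt; apply/negP => h; apply: nk; exists k; exact: le_lt_trans hK h.
exists k => j kj; apply: lt_le_trans hk _; rewrite /arrival.
rewrite (bigD1 (Ordinal (n := j.+1) (m := k) kj))//= lerDl; apply: sumr_ge0 => i _; exact: w0.
Qed.

Let W0 ts m w := \sum_(j < m) win s0 ts (arrival E j w) * U j w.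

(** Only finitely many jumps fall into the windows, so the limits defining the process are
    eventually constant and a weighted sum of innovations becomes one sum over jumps. *)
Let innov_sum w (ts : seq R) : (forall L : R, exists m, forall j, (m <= j)%N -> L < arrival E j w) ->
 exists m0, forall m, (m0 <= m)%N -> \sum_(i < size ts) ts`_i * innov i.+1 w = W0 ts m w.
Proof.
move=> good; have [m0 hm0] := good ((size ts).+1%:R * s0); exists m0 => m m0m.
have gateE i s : gate s0 i s = (if s <= lam * (i%:R * Delta) then 1 else 0) * expR (- (lam * (i%:R * Delta)) + s).
 by rewrite /gate mulrCA.
have SE i : (i <= size ts)%N -> ouX i.+1 w = rho ^+ i.+1 * X0 w + S i.+1 m w.
 move=> ilt; rewrite /ouX /OUproc; congr (_ * _ + _).
  by rewrite -expRM_natl; congr expR; ring.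
 have cv : (fun m => S i.+1 m w) @ \oo --> S i.+1 m w.
  apply: cvg_near_cst; exists m => // n /= mn; rewrite /S [in RHS](@big_ord_widen _ _ _ m n (fun j => (if arrival E j w <= lam * (i.+1%:R * Delta) then 1 else 0) *
 expR (- (lam * (i.+1%:R * Delta)) + arrival E j w) * U j w))// [RHS]big_mkcond/=.
  apply: eq_bigr => j _; case: ltnP => // mj.
  rewrite leNgt (_ : _ < _) ?mul0r//; apply: le_lt_trans (hm0 j (leq_trans m0m mj)).
  by rewrite mulrCA ler_wpM2r ?(ltW lD)// ler_nat.
 exact: (cvg_lim _ cv).
have IE (i : 'I_(size ts)) : innov i.+1 w = \sum_(j < m) kern s0 i (arrival E j w) * U j w.
 case: i => [[|i] ilt].
  transitivity (ouX 1 w - rho * X0 w) => //.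
  rewrite SE// expr1 addrC /= addKr /S; apply: eq_bigr => j _.
  by rewrite /kern subr0 gateE.
 transitivity (ouX i.+2 w - rho * ouX i.+1 w) => //.
 have ilt1 := ltnW ilt; have ilt2 : (i <= size ts)%N by exact: ltnW.
 rewrite !SE //.
 rewrite mulrDr mulrA -exprS opprD addrACA subrr add0r /S mulr_sumr -sumrB; apply: eq_bigr => j _.
 rewrite /kern [nat_of_ord _]/= !gateE; set a := arrival E j w; set e1 := expR _; set e2 := expR _; set e3 := expR _; case: ifP => _ /=; case: ifP => _ /=; ring.
rewrite /W0 (eq_bigr (fun i : 'I_(size ts) => \sum_(j < m) ts`_i * kern s0 i (arrival E j w) * U j w)); last first.
 by move=> i _; rewrite IE mulr_sumr; apply: eq_bigr => j _; rewrite mulrA.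
rewrite exchange_big/=; apply: eq_bigr => j _.
by rewrite (winE lD) mulr_suml.
Qed.

(** [shotcf_cand] with the window weights, as the number of jumps grows. [X0], independent of the
    jumps, is frozen as a phase by [Ex_copy] and then integrated with the stationary characteristic
    function. *)
Lemma innov_cf_seq (ts : seq R) (t th : R) :
 J P (fun w => cos (th + t * X0 w + \sum_(i < size ts) ts`_i * innov i.+1 w)) =
 expR (pA t + winf s0 pA ts 0) * cos (th + pB t + winf s0 pB ts 0).
Proof.
have [N [mN PN] good] := good_event.
have mi := innov_meas.
have mc := win_meas s0 ts.
have mA := winf_meas s0 ts (phiA_cont al0 eps0 mom).
have mB := winf_meas s0 ts (phiB_cont al0 eps0 mom).
have [M AM] := winA_bounded s0 al0 mom ts.
pose L := (size ts)%:R * s0.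
have L0 : 0 <= L by rewrite mulr_ge0// ltW.
have sc k m th' := @shotcf_cand _ _ _ P alpha eps F X0 E U al0 F1 mom cre cim mX0 mE mU ind lawE lawU
 (win s0 ts) mc L (winf s0 pA ts) (winf s0 pB ts) M mA mB
 AM
 (fun s h => win_late alpha F lD h)
 (@win_ident R alpha eps F s0 al0 F1 eps0 mom cre cim ts) k m 0 th' (lexx 0).
pose G m w := cos (th + t * X0 w + W0 ts m w).
have mG m : measurable_fun setT (G m) by rewrite /G /W0 /arrival; mf.
pose C := fun w => cand (winf s0 pA ts) (winf s0 pB ts) 0 (th + t * X0 w).
have bC : bmf C by rewrite /C /cand; bm.
have JC : J P C = expR (pA t + winf s0 pA ts 0) * cos (th + pB t + winf s0 pB ts 0).
 rewrite /C /cand.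
 rewrite (_ : (fun w => _) = (fun w => expR (winf s0 pA ts 0) * cos (th + winf s0 pB ts 0) * cos (t * X0 w) +
   - (expR (winf s0 pA ts 0) * sin (th + winf s0 pB ts 0)) * sin (t * X0 w))); last first.
  by apply/funext => w; rewrite (addrAC th (t * X0 w)) (cosD (th + winf s0 pB ts 0)); ring.
 have [c1 c2] := cfX0 t.
 rewrite J_D ?J_Z ?c1 ?c2; try (by apply: bmf_itg; bm); try (by apply: itgZ; apply: bmf_itg; bm).
 rewrite /phi_re /phi_im expRD (addrAC th) (cosD (th + _)); ring.
have l1 : J P (G m) @[m --> \oo] --> J P C.
 have h : (1 + M) * short alpha L ^+ m @[m --> \oo] --> (0 : R).
  rewrite -(mulr0 (1 + M)); apply: cvgM; first exact: cvg_cst.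
  apply: cvg_expr; rewrite ger0_norm ?short_lt1//.
  by rewrite -(short_E al0 mE lawE L 0%N); apply: J_ge0 => w; case: ifP.
 apply/cvgrPdist_le => e e0; move/cvgrPdist_le : h => /(_ _ e0); apply: filterS => m /=.
 rewrite sub0r normrN => h; apply: le_trans h; apply: le_trans (ler_norm _).
 pose A : pred (option (nat + nat)) := fun i => i == None.
 pose B : pred (option (nat + nat)) := fun i => i != None.
 have dj i : i \in A -> i \in B -> false by move=> /eqP ->.
 pose Xa : sigT (driver X0 E U) A -> R := X0.
 have mXA : measurable_fun setT Xa by apply: (@sig_X _ _ _ _ (driver X0 E U) A None).
 pose Eb i : sigT (driver X0 E U) B -> R := E i.
 pose Ub i : sigT (driver X0 E U) B -> R := U i.
 have mEB i : measurable_fun setT (Eb i) by apply: (@sig_X _ _ _ _ (driver X0 E U) B (Some (inl i))).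
 have mUB i : measurable_fun setT (Ub i) by apply: (@sig_X _ _ _ _ (driver X0 E U) B (Some (inr i))).
 have [||b ee] := @Ex_copy R _ _ P _ (driver X0 E U) (driver_meas mX0 mE mU) ind A B dj
  (fun w w' => cos (th + t * X0 w + W0 ts m w')) 1.
 - rewrite (_ : (fun z => _) = (fun z : sigT (driver X0 E U) A * sigT (driver X0 E U) B =>
   cos (th + t * Xa z.1 + \sum_(j < m) win s0 ts (\sum_(i < j.+1) Eb i z.2) * Ub j z.2)))//.
  by mf.
 - by move=> w w'; rewrite ler_norml cos_geN1 cos_le1.
 rewrite distrC /G ee -J_B; [|exact: bmf_itg..].
 rewrite -[leRHS](Ex_cst P); apply: J_abs; [|exact: itg_cst|].
  by apply: meas_D; [exact: bmf_meas b|apply: meas_N; exact: bmf_meas bC].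
 move=> w; rewrite -/(C w); apply: le_trans (sc 0%N m (th + t * X0 w)).
 rewrite le_eqVlt; apply/orP; left; apply/eqP; congr (`|_ - _|); congr J; apply/funext => w'.
 by rewrite /W0; congr (cos (_ + _)); apply: eq_bigr => j _; rewrite add0r.
pose V w := cos (th + t * X0 w + \sum_(i < size ts) ts`_i * innov i.+1 w).
have mV : measurable_fun setT V by rewrite /V; mf.
have mNb : measurable_fun setT (\1_N : Omega -> R) by exact: measurable_indic.
have l2 : J P (fun w => (1 - \1_N w) * G m w) @[m --> \oo] --> J P (fun w => (1 - \1_N w) * V w).
 apply: (J_dct _ (itg_cst P 1) _ _).2.
 - by move=> m; mf.
 - move=> m w; rewrite normrM -[leRHS]mul1r ler_pM//; last by rewrite ler_norml cos_geN1 cos_le1.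
  by rewrite indicE; case: (_ \in _); rewrite ?subrr ?subr0 ?normr0 ?normr1.
 - move=> w; apply: cvg_near_cst; rewrite indicE; case: (boolP (w \in N)) => wN.
   by rewrite subrr; apply: nearW => m; rewrite !mul0r.
  have [m0 h] := innov_sum ts (good w (fun h => ltac:(by move/negP : wN; apply; rewrite inE))).
  by exists m0 => // m /= mm; rewrite /G /V (h m mm).
have ae (f : Omega -> R) : measurable_fun setT f -> J P (fun w => (1 - \1_N w) * f w) = J P f.
 move=> mfm; apply: (@J_ae _ _ _ P N) => //; first by mf.
 by move=> w nw; rewrite indicE memNset// subr0 mul1r.
rewrite (_ : (fun m => _) = (fun m => J P (G m))) in l2; last by apply/funext => m; rewrite ae.
by rewrite -/V -ae// -(cvg_lim _ l2)// (cvg_lim _ l1).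
Qed.

(** Real part of the exponent of innovation [i]: the stationary exponent for [i = 0], otherwise that
    of the self-decomposable factor [phi t / phi (rho t)]. *)
Let ca (i : nat) (t : R) := if i is 0%N then pA t else pA t - pA (t * rho).
Let cb (i : nat) (t : R) := if i is 0%N then pB t else pB t - pB (t * rho).

Lemma innov_cf n (t : nat -> R) th :
 J P (fun w => cos (th + \sum_(i < n) t i * innov i w)) =
 expR (\sum_(i < n) ca i (t i)) * cos (th + \sum_(i < n) cb i (t i)).
Proof.
case: n => [|n].
 rewrite !big_ord0 expR0 mul1r addr0; under eq_fun do rewrite big_ord0 addr0.
 by rewrite Ex_cst.
pose ts := mkseq (fun i => t i.+1) n.
have sz : size ts = n by rewrite size_mkseq.
have := innov_cf_seq ts (t 0%N) th; rewrite !(winf0 lD) sz.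
have e (f g : nat -> R -> R) : (forall i x, f i.+1 x = g i x) ->
  \sum_(i < n.+1) f i (t i) = f 0%N (t 0%N) + \sum_(i < n) g i ts`_i.
 move=> fg; rewrite big_ord_recl; congr (_ + _); apply: eq_bigr => i _.
 by rewrite lift0 nth_mkseq ?fg.
rewrite (e ca (fun _ x => pA x - pA (x * rho)))// (e cb (fun _ x => pB x - pB (x * rho)))//= addrA => <-.
congr J; apply/funext => w; congr cos; rewrite -addrA; congr (_ + _).
by rewrite (e (fun i x => x * innov i w) (fun i x => x * innov i.+1 w)).
Qed.

Let ca_even i t : ca i (- t) = ca i t.
Proof. by case: i => [|i]; rewrite /ca ?mulNr !phiA_even. Qed.
Let cb_odd i t : cb i (- t) = - cb i t.
Proof. by case: i => [|i]; rewrite /cb ?mulNr !(phiB_odd al0 mom)//; ring. Qed.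
Let ca0 i : ca i 0 = 0.
Proof. by case: i => [|i]; rewrite /ca ?mul0r ?subrr ?(phiA0 al0 mom). Qed.
Let cb0 i : cb i 0 = 0.
Proof. by case: i => [|i]; rewrite /cb ?mul0r ?subrr ?(phiB0 al0 mom). Qed.

(** Cosine tests are turned into indicators one coordinate at a time: with the other coordinates
    frozen in a signed weight [H], the identity for all frequencies in innovation [k] is the
    hypothesis of [cf_unique_set]. The condition [t i = 0] says that converted coordinates no longer
    carry a frequency. *)
Lemma innov_prod n (B : nat -> set R) k (t : nat -> R) th : (forall i, measurable (B i)) -> (k <= n)%N ->
 (forall i, (i < k)%N -> t i = 0) ->
 J P (fun w => (\prod_(i < k) \1_(B i) (innov i w)) * cos (th + \sum_(i < n) t i * innov i w)) =
 (\prod_(i < k) J P (fun w => \1_(B i) (innov i w))) * J P (fun w => cos (th + \sum_(i < n) t i * innov i w)).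
Proof.
move=> mB; have mi := innov_meas.
elim: k t th => [|k ih] t th kn t0.
 by rewrite big_ord0 mul1r; congr J; apply/funext => w; rewrite big_ord0 mul1r.
have tk : t k = 0 by exact: t0.
pose kap := (\prod_(i < k) J P (fun w => \1_(B i) (innov i w))) * J P (fun w => cos (th + \sum_(i < n) t i * innov i w)).
pose H w := (\prod_(i < k) \1_(B i) (innov i w)) * cos (th + \sum_(i < n) t i * innov i w).
have bB i : bmf (fun w => \1_(B i) (innov i w) : R) by bm.
have bH : bmf H by rewrite /H; bm.
have sumE (f : nat -> R -> R) c s : f k 0 = 0 ->
  \sum_(i < n) f i (if i == k :> nat then s else c * t i) = f k s + \sum_(i < n) f i (c * t i).
 move=> f0; rewrite (bigD1 (Ordinal kn))//= eqxx; congr (_ + _).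
 rewrite [RHS](bigD1 (Ordinal kn))//= tk mulr0 f0 add0r; apply: eq_bigr => i.
 by rewrite -val_eqE /= => /negbTE ->.
(* Frequency [s] at coordinate [k], the others multiplied by a sign [c]; the cases [c = 1] and
   [c = -1] are recombined by the product formula for cosines. *)
pose tt c s i := if i == k then s else c * t i.
have cfk c s th' : c = 1 \/ c = -1 -> J P (fun w => (\prod_(i < k) \1_(B i) (innov i w)) * cos (th' + c * th + \sum_(i < n) tt c s i * innov i w)) =
  (\prod_(i < k) J P (fun w => \1_(B i) (innov i w))) *
  (expR (ca k s + \sum_(i < n) ca i (t i)) * cos (th' + cb k s + c * (th + \sum_(i < n) cb i (t i)))).
 move=> c1; rewrite ih ?(ltnW kn)//; last first.
  by move=> i ik; rewrite /tt ltn_eqF// t0 ?mulr0// ltnW.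
 have ea : \sum_(i < n) ca i (c * t i) = \sum_(i < n) ca i (t i).
  by apply: eq_bigr => i _; case: c1 => ->; rewrite ?mul1r ?mulN1r ?ca_even.
 have eb : \sum_(i < n) cb i (c * t i) = c * \sum_(i < n) cb i (t i).
  by rewrite mulr_sumr; apply: eq_bigr => i _; case: c1 => ->; rewrite ?mul1r ?mulN1r ?cb_odd.
 rewrite innov_cf /tt (@sumE ca c s (ca0 k)) (@sumE cb c s (cb0 k)) ea eb.
 move: (\sum_(i < n) cb i (t i)) (\sum_(i < n) ca i (t i)) (\prod_(i < k) J P _) => Sb Sa KK.
 apply: (congr1 (fun z : R => KK * (expR (ca k s + Sa) * cos z))); ring.
have cfE th' s : J P (fun w => H w * cos (th' + s * innov k w)) = J P (fun w => kap * cos (th' + s * innov k w)).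
 pose G c w := (\prod_(i < k) \1_(B i) (innov i w)) * cos (th' + c * th + \sum_(i < n) tt c s i * innov i w).
 have bG c : bmf (G c) by rewrite /G; bm.
 rewrite (_ : (fun w => _) = (fun w => 2^-1 * (G 1 w + G (-1) w))); last first.
  apply/funext => w; rewrite /H /G.
  rewrite !(sumE (fun i x => x * innov i w)) ?mul0r//.
  have e1 c : \sum_(i < n) c * t i * innov i w = c * \sum_(i < n) t i * innov i w.
   by rewrite mulr_sumr; apply: eq_bigr => i _; rewrite mulrA.
  rewrite !e1.
  set X1 := \sum_(i < n) _; rewrite !mul1r !mulN1r.
  rewrite (_ : th' + th + (s * innov k w + X1) = (th' + s * innov k w) + (th + X1)); last by ring.
  rewrite (_ : th' - th + (s * innov k w - X1) = (th' + s * innov k w) - (th + X1)); last by ring.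
  by move: (th + X1) (th' + _) => y x; rewrite (cosD x y) (cosB x y); field.
 rewrite J_Z; last by apply: bmf_itg; bm.
 rewrite J_D; [|exact: bmf_itg..].
 rewrite /G !cfk; [|by right|by left].
 rewrite J_Z; last by apply: bmf_itg; bm.
 rewrite /kap !innov_cf.
 have -> : J P (fun w => cos (th' + s * innov k w)) = expR (ca k s) * cos (th' + cb k s).
  have := innov_cf n (tt 0 s) th'.
  rewrite /tt (sumE ca)// (sumE cb)//.
  rewrite !big1; [|by move=> i _; rewrite mul0r ?cb0 ?ca0..].
  rewrite !addr0 => <-; congr J; apply/funext => w.
  rewrite (sumE (fun i x => x * innov i w)) ?mul0r// big1 ?addr0// => i _; by rewrite !mul0r.
 by rewrite expRD !mul1r !mulN1r; move: (th + \sum_(i < n) _) (th' + _) => y x; rewrite (cosD x y) (cosB x y); field.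
have cfs := cf_unique_set bH (mi k) (bmf_cst kap) (mi k) cfE (mB k).
rewrite (big_ord_recr k)/= [RHS]mulrAC -/kap -J_Z; last by apply: bmf_itg.
by rewrite -cfs; congr J; apply/funext => w; rewrite big_ord_recr/= /H; ring.
Qed.

Lemma innov_indep : mutually_independent P innov.
Proof.
move=> s B us mB; have mi := innov_meas.
have mpre i (A : set R) : measurable A -> measurable (innov i @^-1` A).
 by move=> mA; rewrite -[X in measurable X]setTI; exact: mi.
pose n := (\max_(i <- s) i).+1.
have sn i : i \in s -> (i < n)%N.
 by move=> is_; rewrite ltnS (big_rem i)//= leq_maxl.
pose B' i := if i \in s then B i else setT.
have mB' i : measurable (B' i) by rewrite /B'; case: ifP.
have := @innov_prod n B' n (fun=> 0) 0 mB' (leqnn n) (fun _ _ => erefl).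
have z w : 0 + \sum_(i < n) 0 * innov i w = 0 :> R by rewrite big1 ?addr0// => i _; rewrite mul0r.
rewrite [X in _ * X](_ : _ = 1); last first.
 by rewrite -[RHS](Ex_cst P 1); congr J; apply/funext => w; rewrite z cos0.
rewrite mulr1 => e.
have eL : fine (P (\bigcap_(i in [set` s]) innov i @^-1` B i)) =
  J P (fun w => (\prod_(i < n) \1_(B' i) (innov i w)) * cos (0 + \sum_(i < n) 0 * innov i w)).
 rewrite -Ex_indic; last first.
  apply: (@cyl_measurable _ _ _ _ innov innov_meas predT).
  by exists s, B; split.
 congr J; apply/funext => w; rewrite z cos0 mulr1 indicE.
 case: (pselect ((\bigcap_(i in [set` s]) innov i @^-1` B i) w)) => h.
  rewrite mem_set// big1// => i _; rewrite indicE mem_set// /B'; case: ifP => // is_.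
  exact: h.
 rewrite memNset//; apply/esym/eqP; rewrite prodf_seq_eq0.
 have [i [is_ nB]] : exists i, i \in s /\ ~ B i (innov i w).
  apply: contrapT => nE; apply: h => i /= is_; apply: contrapT => nB; apply: nE; by exists i.
 apply/hasP; exists (Ordinal (sn i is_)); rewrite ?mem_index_enum//=.
 by rewrite /B' is_ indicE memNset.
rewrite eL e.
rewrite (eq_bigr (fun i : 'I_n => if (i : nat) \in s then fine (P (innov i @^-1` B i)) else 1)); last first.
 move=> i _; rewrite /B'; case: ifP => h.
  rewrite -Ex_indic; last exact: mpre.
  by congr J; apply/funext => w; rewrite !indicE.
 by rewrite -[RHS](Ex_cst P 1); congr J; apply/funext => w; rewrite indicT.
rewrite -big_mkcond/= -(big_mkord (fun i => i \in s) (fun i => fine (P (innov i @^-1` B i)))).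
rewrite -big_filter; apply: perm_big; apply: uniq_perm => //; first by rewrite filter_uniq// iota_uniq.
by move=> i; rewrite mem_filter mem_index_iota /=; case: (boolP (i \in s)) => // /sn ->.
Qed.

(** The exponents of the weighted innovations telescope to that of [X0], so equality in law on the
    grid follows from uniqueness of characteristic functions. *)
Lemma ouX_law n (A : set R) : measurable A -> fine (P (ouX n @^-1` A)) = fine (P (X0 @^-1` A)).
Proof.
move=> mA; have mX := ouX_meas n.
have tel (f : R -> R) t : \sum_(i < n.+1) (if nat_of_ord i is i'.+1 then f (t * rho ^+ (n - i)) - f (t * rho ^+ (n - i) * rho) else f (t * rho ^+ (n - i))) = f t.
 elim: (n : nat) t => [|m ih] t; first by rewrite big_ord_recl big_ord0 expr0 mulr1 addr0.
 rewrite big_ord_recr /= subnn expr0 mulr1 -[X in _ = X](subrK (f (t * rho))) addrC; congr (_ + _).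
 rewrite -[RHS]ih; apply: eq_bigr => i _ /=.
 by rewrite subSn ?exprS ?mulrA// -ltnS.
have cfX th t : J P (fun w => cos (th + t * ouX n w)) = expR (pA t) * cos (th + pB t).
 have := innov_cf n.+1 (fun i => t * rho ^+ (n - i)) th.
 rewrite (_ : \sum_(i < n.+1) ca i _ = pA t); last by rewrite -[RHS](tel pA); apply: eq_bigr => -[[|i] ?].
 rewrite (_ : \sum_(i < n.+1) cb i _ = pB t); last by rewrite -[RHS](tel pB); apply: eq_bigr => -[[|i] ?].
 move=> <-; congr J; apply/funext => w; rewrite ouX_sum mulr_sumr; congr (cos (_ + _)).
 by apply: eq_bigr => i _; rewrite mulrA.
have cf0 th t : J P (fun w => cos (th + t * X0 w)) = expR (pA t) * cos (th + pB t).
 have := innov_cf 1 (fun i => t) th; rewrite !big_ord_recl !big_ord0 !addr0 => <-.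
 by congr J; apply/funext => w; rewrite big_ord_recl big_ord0 addr0.
have cfE th t : J P (fun w => 1 * cos (th + t * ouX n w)) = J P (fun w => 1 * cos (th + t * X0 w)).
 under eq_fun do rewrite mul1r; under [in RHS]eq_fun do rewrite mul1r; by rewrite cfX cf0.
have := cf_unique_set (bmf_cst 1) mX (bmf_cst 1) mX0 cfE mA.
have e (Z : Omega -> R) : measurable_fun setT Z -> J P (fun w => 1 * \1_A (Z w)) = fine (P (Z @^-1` A)).
 move=> mZ; rewrite -Ex_indic; last by rewrite -[X in measurable X]setTI; exact: mZ.
 by congr J; apply/funext => w; rewrite mul1r !indicE.
by rewrite !e.
Qed.

End innovations.

(** * Upper and lower bounds for the deconvolution kernel *)

Section kernel.
Context {R : realType}.
Variables (alpha CA Ck Cw : R) (pA pB kr ki a b a' b' : R -> R).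
Hypotheses (al1 : 1 <= alpha) (dA : forall t, dd pA t (- ki t)) (dB : forall t, dd pB t (kr t)).
Hypotheses (cr : continuous kr) (ci : continuous ki).
Hypotheses (krb : forall t, `|kr t| <= Ck / (1 + `|t|)) (kib : forall t, `|ki t| <= Ck / (1 + `|t|)).
Hypothesis asy : forall t, `|pA t + alpha * ln (1 + `|t|)| <= CA.
Hypotheses (Ae : forall t, pA (- t) = pA t) (Bo : forall t, pB (- t) = - pB t).
Hypotheses (da : forall t, dd a t (a' t)) (db : forall t, dd b t (b' t)).
Hypotheses (ca : continuous a') (cb : continuous b').
Hypotheses (ae : forall t, a (- t) = a t) (bo : forall t, b (- t) = - b t).
Hypotheses (a1 : a 1 = 0) (b1 : b 1 = 0).
Hypotheses (aC : forall t, `|a t| <= Cw) (bC : forall t, `|b t| <= Cw)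
 (a'C : forall t, `|a' t| <= Cw) (b'C : forall t, `|b' t| <= Cw).
Local Notation leb := (@lebesgue_measure R).

(** [pk] and [qk] are the real and imaginary parts of [phi_W t / phi (t / h)], where
    [phi = exp (pA + i pB)] and [phi_W = a + i b]. *)
Definition pk h t := expR (- pA (t / h)) * (a t * cos (pB (t / h)) + b t * sin (pB (t / h))).
Definition qk h t := expR (- pA (t / h)) * (b t * cos (pB (t / h)) - a t * sin (pB (t / h))).
Let pk' h t := expR (- pA (t / h)) * (ki (t / h) / h * (a t * cos (pB (t / h)) + b t * sin (pB (t / h)))
 + (a' t * cos (pB (t / h)) + b' t * sin (pB (t / h)))
 + kr (t / h) / h * (b t * cos (pB (t / h)) - a t * sin (pB (t / h)))).
Let qk' h t := expR (- pA (t / h)) * (ki (t / h) / h * (b t * cos (pB (t / h)) - a t * sin (pB (t / h)))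
 + (b' t * cos (pB (t / h)) - a' t * sin (pB (t / h)))
 + kr (t / h) / h * (- b t * sin (pB (t / h)) - a t * cos (pB (t / h)))).
Definition Kern h x := J leb (fun t : R => \1_(`[-1, 1]%classic) t * (cos (t * x) * pk h t + sin (t * x) * qk h t)).
(** The power [h^(- alpha)]. *)
Definition hal (h : R) := expR (- (alpha * ln h)).

Lemma hal_gt0 h : 0 < hal h. Proof. exact: expR_gt0. Qed.

Lemma dd_pk h t : dd (pk h) t (pk' h t).
Proof. rewrite /pk /pk'; dauto; ring. Qed.

Lemma dd_qk h t : dd (qk h) t (qk' h t).
Proof. rewrite /qk /qk'; dauto; ring. Qed.

Let cA : continuous pA. Proof. exact: dd_cont dA. Qed.
Let cB : continuous pB. Proof. exact: dd_cont dB. Qed.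
Let ca0 : continuous a. Proof. exact: dd_cont da. Qed.
Let cb0 : continuous b. Proof. exact: dd_cont db. Qed.

Let cth h (f : R -> R) : continuous f -> continuous (fun t : R => f (t / h)).
Proof. by move=> cf x; apply: (@continuous_comp _ _ _ (fun t : R => t / h) f); [exact: mulrr_continuous|exact: cf]. Qed.

Let cexpA h : continuous (fun t : R => expR (- pA (t / h))).
Proof.
by move=> x; apply: (@continuous_comp _ _ _ (fun t : R => - pA (t / h)) expR);
 [apply: cvgN; exact: cth|exact: continuous_expR].
Qed.
Let ccos h : continuous (fun t : R => cos (pB (t / h))).
Proof.
by move=> x; apply: (@continuous_comp _ _ _ (fun t : R => pB (t / h)) cos);
 [exact: cth|exact: continuous_cos].
Qed.
Let csin h : continuous (fun t : R => sin (pB (t / h))).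
Proof.
by move=> x; apply: (@continuous_comp _ _ _ (fun t : R => pB (t / h)) sin);
 [exact: cth|exact: continuous_sin].
Qed.

Let cpk h : continuous (pk h). Proof. exact: dd_cont (dd_pk h). Qed.
Let cqk h : continuous (qk h). Proof. exact: dd_cont (dd_qk h). Qed.

Let cont_ckh h (f : R -> R) : continuous f -> continuous (fun t : R => f (t / h) / h).
Proof. by move=> cf x; apply: cvgMl; exact: cth. Qed.

Let crot h (u v : R -> R) : continuous u -> continuous v ->
 continuous (fun t : R => u t * cos (pB (t / h)) + v t * sin (pB (t / h))) /\
 continuous (fun t : R => u t * cos (pB (t / h)) - v t * sin (pB (t / h))).
Proof.
move=> cu cv; split=> x; [apply: cvgD|apply: cvgB]; apply: cvgM;
 by [exact: cu|exact: cv|exact: ccos|exact: csin].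
Qed.

Let ctri h (u v w : R -> R) : continuous u -> continuous v -> continuous w ->
 continuous (fun t : R => expR (- pA (t / h)) * (ki (t / h) / h * u t + v t + kr (t / h) / h * w t)).
Proof.
move=> cu cv cw x; apply: cvgM; first exact: cexpA.
apply: cvgD; first apply: cvgD; first (apply: cvgM; first exact: cont_ckh); [exact: cu|exact: cv|].
by apply: cvgM; [exact: cont_ckh|exact: cw].
Qed.

Let cna : continuous (fun t : R => - a t). Proof. by move=> x; apply: cvgN; exact: ca0. Qed.
Let cnb : continuous (fun t : R => - b t). Proof. by move=> x; apply: cvgN; exact: cb0. Qed.

Let cpk' h : continuous (pk' h).
Proof. exact: (ctri (crot h ca0 cb0).1 (crot h ca cb).1 (crot h cb0 ca0).2). Qed.

Let cqk' h : continuous (qk' h).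
Proof.
apply: (ctri (crot h cb0 ca0).2 (crot h cb ca).2).
rewrite (_ : (fun t : R => _) = (fun t : R => (- a t) * cos (pB (t / h)) + (- b t) * sin (pB (t / h)))).
 exact: (crot h cna cnb).1.
by apply/funext => t; rewrite !mulNr addrC.
Qed.

Let C0 := expR (CA + alpha * ln 2).

(** [1 / |phi (t / h)|] is at most a constant times [(1 + |t| / h)^alpha], hence times
    [(2 / h)^alpha]. In the second bound a derivative costs [1 / h] but gains [1 / (1 + |t| / h)]
    from the decay of [phi_k]; as [alpha >= 1] the remaining power is still nonnegative and the
    order is unchanged. *)
Let expA_bound h t : 0 < h <= 1 -> `|t| <= 1 ->
 expR (- pA (t / h)) <= C0 * hal h /\ expR (- pA (t / h)) / ((1 + `|t / h|) * h) <= C0 * hal h.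
Proof.
move=> /andP[h0 h1] t1.
have s0 : 0 < 1 + `|t / h| by rewrite ltr_pwDl.
have ls : ln (1 + `|t / h|) <= ln 2 - ln h.
 rewrite -ln_div ?posrE//; rewrite ler_ln ?posrE ?divr_gt0//.
 rewrite normrM (gtr0_norm (_ : 0 < h^-1)) ?invr_gt0// ler_pdivlMr// mulrDl mul1r divfK ?gt_eqF//.
 by rewrite (le_trans (lerD h1 t1))//.
have := asy (t / h); rewrite ler_norml => /andP[l _].
have e : expR (- pA (t / h)) / ((1 + `|t / h|) * h) = expR (- pA (t / h) - ln (1 + `|t / h|) - ln h).
 by rewrite 2!expRD !expRN !lnK ?posrE// invfM mulrA.
have lh : ln h <= 0 by apply: ln_le0.
have ls0 : 0 <= ln (1 + `|t / h|) by apply: ln_ge0; rewrite lerDl.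
have l2 : 0 <= ln 2 :> R by apply: ln_ge0; lra.
have h2 : alpha * ln (1 + `|t / h|) <= alpha * (ln 2 - ln h) by rewrite ler_wpM2l// (le_trans ler01 al1).
have h3 : (alpha - 1) * ln (1 + `|t / h|) <= (alpha - 1) * (ln 2 - ln h) by rewrite ler_wpM2l// subr_ge0.
rewrite e /C0 /hal -!expRD !ler_expR; split; lra.
Qed.

Let Cw0 : 0 <= Cw. Proof. exact: le_trans (aC 0). Qed.
Let Ck0 : 0 <= Ck.
Proof. by have := le_trans (normr_ge0 _) (krb 0); rewrite normr0 addr0 divr1. Qed.

Let rot (u v x : R) : `|u| <= Cw -> `|v| <= Cw -> `|u * cos x + v * sin x| <= 2 * Cw /\ `|u * cos x - v * sin x| <= 2 * Cw.
Proof.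
move=> hu hv.
have hc : `|u * cos x| <= Cw by rewrite normrM -[leRHS]mulr1 ler_pM// ler_norml cos_geN1 cos_le1.
have hs : `|v * sin x| <= Cw by rewrite normrM -[leRHS]mulr1 ler_pM// ler_norml sin_geN1 sin_le1.
by rewrite mulr2n mulrDl mul1r; split; [apply: le_trans (ler_normD _ _) _|apply: le_trans (ler_normB _ _) _]; apply: lerD.
Qed.

Let C1 := C0 * (2 * Cw + 4 * Ck * Cw).

Let C10 : 0 <= C1.
Proof. by rewrite /C1 mulr_ge0 ?expR_ge0// addr_ge0 ?mulr_ge0. Qed.

Let prod_bound h t (x y z : R) : 0 < h <= 1 -> `|t| <= 1 -> `|x| <= 2 * Cw -> `|y| <= 2 * Cw -> `|z| <= 2 * Cw ->
 `|expR (- pA (t / h)) * (ki (t / h) / h * x + y + kr (t / h) / h * z)| <= C1 * hal h.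
Proof.
move=> hh t1 xC yC zC; have [e1 e2] := expA_bound hh t1.
have /andP[h0 _] := hh.
rewrite normrM (ger0_norm (expR_ge0 _)).
have kk (k u : R) : `|k| <= Ck / (1 + `|t / h|) -> `|u| <= 2 * Cw ->
 expR (- pA (t / h)) * `|k / h * u| <= C0 * hal h * (2 * Ck * Cw).
 move=> hk hu; rewrite !normrM (gtr0_norm (_ : 0 < h^-1)) ?invr_gt0//.
 apply: le_trans (_ : expR (- pA (t / h)) / ((1 + `|t / h|) * h) * (Ck * (2 * Cw)) <= _).
  rewrite [leRHS](_ : _ = expR (- pA (t / h)) * (Ck / (1 + `|t / h|) / h * (2 * Cw))); last by rewrite invfM; ring.
  rewrite ler_pM2l ?expR_gt0//.
  by rewrite ler_pM ?mulr_ge0 ?invr_ge0 ?(ltW h0)// ler_wpM2r ?invr_ge0 ?(ltW h0).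
 by rewrite (_ : 2 * Ck * Cw = Ck * (2 * Cw)) ?ler_wpM2r ?mulr_ge0//; ring.
have := kk _ _ (kib _) xC; have := kk _ _ (krb _) zC.
have : expR (- pA (t / h)) * `|y| <= C0 * hal h * (2 * Cw) by apply: ler_pM => //; exact: expR_ge0.
move=> l1 l2 l3.
apply: le_trans (_ : expR (- pA (t / h)) * (`|ki (t / h) / h * x| + `|y| + `|kr (t / h) / h * z|) <= _).
 rewrite ler_pM2l ?expR_gt0//; apply: le_trans (ler_normD _ _) _; rewrite lerD2r; exact: ler_normD.
rewrite !mulrDr (le_trans (lerD (lerD l3 l1) l2))// /C1 le_eqVlt; apply/orP; left; apply/eqP; ring.
Qed.

Lemma pk_bound h t : 0 < h <= 1 -> `|t| <= 1 ->
 [/\ `|pk h t| <= C1 * hal h, `|qk h t| <= C1 * hal h, `|pk' h t| <= C1 * hal h & `|qk' h t| <= C1 * hal h].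
Proof.
move=> hh t1.
have [r1 r2] := rot (pB (t / h)) (aC t) (bC t).
have [r3 r4] := rot (pB (t / h)) (bC t) (aC t).
have [r5 r6] := rot (pB (t / h)) (a'C t) (b'C t).
have [r7 r8] := rot (pB (t / h)) (b'C t) (a'C t).
have z0 : `|0 : R| <= 2 * Cw by rewrite normr0 mulr_ge0.
split; [have := prod_bound hh t1 z0 r1 z0|have := prod_bound hh t1 z0 r4 z0| |]; rewrite ?mulr0 ?addr0 ?add0r//.
- exact: prod_bound.
- apply: prod_bound => //.
 rewrite (_ : _ - _ = - (a t * cos (pB (t / h)) + b t * sin (pB (t / h)))) ?normrN//; ring.
Qed.

Lemma pk_meas h : measurable_fun setT (pk h). Proof. apply: continuous_measurable_fun; exact: cpk. Qed.
Lemma qk_meas h : measurable_fun setT (qk h). Proof. apply: continuous_measurable_fun; exact: cqk. Qed.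

Let I1 := \1_(`[-1, 1]%classic) : R -> R.
Let itgI (f : R -> R) : continuous f -> itg leb (fun t : R => I1 t * f t).
Proof. exact: itg_itv. Qed.

Let J_I1 : J leb I1 = 2.
Proof.
rewrite (_ : I1 = fun t : R => \1_(`[-1, 1]%classic) t * 1); last by apply/funext => t; rewrite mulr1.
have -> := @FTC2 R (fun x => x) (fun=> 1) (-1) 1; first by rewrite opprK.
- exact: (@le_trans _ _ 0 _ _ (lerN10 _) ler01).
- by move=> x; exact: dd_id.
- by move=> x; exact: cvg_cst.
Qed.

Let J_I1_le (f : R -> R) M : measurable_fun setT f -> (forall t, `|t| <= 1 -> `|f t| <= M) ->
 `|J leb (fun t : R => I1 t * f t)| <= 2 * M.
Proof.
move=> mf0 fM.
have iI : itg leb (fun t : R => I1 t * M) by apply: itgI => x; exact: cvg_cst.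
have mI : measurable_fun setT I1 by exact: measurable_indic.
rewrite (_ : 2 * M = J leb (fun t : R => I1 t * M)); last first.
 rewrite J_Zr ?J_I1//; rewrite (_ : I1 = fun t : R => I1 t * 1); last by apply/funext => t; rewrite mulr1.
 by apply: itgI => x; exact: cvg_cst.
apply: J_abs => //; first by mf.
move=> t; rewrite /I1 indic_cc; case: (boolP (_ <= _ <= _)) => h; rewrite ?mul0r ?normr0// !mul1r.
by apply: fM; rewrite ler_norml.
Qed.

Let trig_le (x u v : R) M : `|u| <= M -> `|v| <= M -> `|cos x * u + sin x * v| <= 2 * M.
Proof.
move=> hu hv; rewrite mulr2n mulrDl mul1r (le_trans (ler_normD _ _))// lerD// normrM -[leRHS]mul1r ler_pM//;
 by rewrite ler_norml ?cos_geN1 ?cos_le1 ?sin_geN1 ?sin_le1.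
Qed.

Let ct x : continuous (fun t : R => cos (t * x)).
Proof. by move=> t; apply: (@dd_cont1 _ _ _ (- sin (t * x) * x)); dauto; ring. Qed.
Let st x : continuous (fun t : R => sin (t * x)).
Proof. by move=> t; apply: (@dd_cont1 _ _ _ (cos (t * x) * x)); dauto; ring. Qed.

Let cK h x : continuous (fun t : R => cos (t * x) * pk h t + sin (t * x) * qk h t).
Proof. by move=> t; apply: cvgD; apply: cvgM; [exact: ct|exact: cpk|exact: st|exact: cqk]. Qed.

Let pk_out h : [/\ pk h 1 = 0, pk h (-1) = 0, qk h 1 = 0 & qk h (-1) = 0].
Proof. by rewrite /pk /qk ae bo a1 b1 !(mul0r, oppr0, mulr0, addr0, subr0). Qed.

(** The decay comes from one integration by parts, whose boundary terms vanish because [a] and [b]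
    vanish at 1 and -1. The Lipschitz bound uses [|t| <= 1] on the support. The factor 4 is the
    length of the interval times the two trigonometric terms. *)
Lemma Kern_bounds h x y : 0 < h <= 1 ->
 [/\ `|Kern h x| <= 4 * C1 * hal h, `|x * Kern h x| <= 4 * C1 * hal h &
  `|Kern h x - Kern h y| <= 4 * C1 * hal h * `|x - y|].
Proof.
move=> hh; have mp := pk_meas h; have mq := qk_meas h.
have e4 : 4 * C1 * hal h = 2 * (2 * (C1 * hal h)) by ring.
rewrite e4; split.
- apply: J_I1_le; first by mf.
 by move=> t t1; have [? ? _ _] := pk_bound hh t1; exact: trig_le.
- have [p1 p2 p3 p4] := pk_out h; have dpk := dd_pk h; have dqk := dd_qk h.
 have cr2 : continuous (fun t : R => cos (t * x) * (- qk' h t) + sin (t * x) * pk' h t).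
  by move=> t; apply: cvgD; apply: cvgM; [exact: ct|apply: cvgN; exact: cqk'|exact: st|exact: cpk'].
 have d1 t : dd (fun t : R => sin (t * x) * pk h t - cos (t * x) * qk h t) t
  (x * (cos (t * x) * pk h t + sin (t * x) * qk h t) + (cos (t * x) * (- qk' h t) + sin (t * x) * pk' h t)).
  by dauto; ring.
 have c1 : continuous (fun t : R => x * (cos (t * x) * pk h t + sin (t * x) * qk h t) + (cos (t * x) * (- qk' h t) + sin (t * x) * pk' h t)).
  by move=> t; apply: cvgD; [apply: cvgM; [exact: cvg_cst|exact: cK]|exact: cr2].
 have := FTC2 (@le_trans _ _ 0 _ _ (lerN10 _) ler01) d1 c1.
 rewrite p1 p2 p3 p4 !mulr0 subrr.
 rewrite (_ : (fun t : R => _) = (fun t : R => x * (I1 t * (cos (t * x) * pk h t + sin (t * x) * qk h t)) +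
  I1 t * (cos (t * x) * (- qk' h t) + sin (t * x) * pk' h t))); last by apply/funext => t; rewrite /I1; ring.
 rewrite J_D; [|by apply: itgZ; exact: itgI|exact: itgI].
 rewrite J_Z; last exact: itgI.
 rewrite -/(Kern h x) => /eqP; rewrite addr_eq0 => /eqP ->; rewrite normrN.
 apply: J_I1_le; first by apply: continuous_measurable_fun.
 by move=> t t1; have [_ _ ? ?] := pk_bound hh t1; apply: trig_le; rewrite ?normrN.
- rewrite /Kern -J_B; [|exact: itgI..].
 rewrite (_ : (fun t : R => _) = (fun t : R => I1 t * ((cos (t * x) - cos (t * y)) * pk h t + (sin (t * x) - sin (t * y)) * qk h t))); last first.
  by apply/funext => t; rewrite /I1; ring.
 rewrite (_ : _ * `|_| = 2 * (`|x - y| * (C1 * hal h) + `|x - y| * (C1 * hal h))); last by ring.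
 apply: J_I1_le; first by mf.
 move=> t t1; have [b2 b3 _ _] := pk_bound hh t1.
 have tl : `|t * x - t * y| <= `|x - y| by rewrite -mulrBr normrM -[leRHS]mul1r ler_wpM2r.
 apply: le_trans (ler_normD _ _) _; apply: lerD; rewrite normrM ler_pM//.
  exact: le_trans (cos_lip _ _) tl.
 exact: le_trans (sin_lip _ _) tl.
Qed.

Section lower.
Variables (t0 : R).
Hypotheses (t00 : 0 < t0) (t01 : t0 < 1).
Let I0 := \1_(`[0, +oo[%classic) : R -> R.
Let Po (e s : R) := e / (e ^+ 2 + s ^+ 2).

Let Po_ge0 (e s : R) : 0 < e -> 0 <= Po e s.
Proof. by move=> e0; rewrite divr_ge0 ?(ltW e0)// addr_ge0 ?sqr_ge0. Qed.
Let I01 t : 0 <= I1 t <= 1. Proof. by rewrite /I1 indicE; case: (_ \in _); rewrite ?lexx ?ler01. Qed.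
Let mI1 : measurable_fun setT I1. Proof. exact: measurable_indic. Qed.
Let mI0 : measurable_fun setT I0. Proof. exact: measurable_indic. Qed.
Let mPo e c : measurable_fun setT (fun t : R => Po e (t - c)).
Proof. by rewrite /Po; mf. Qed.

Let Po_bd (e s : R) : 0 < e -> Po e s <= e^-1.
Proof.
move=> e0; rewrite /Po ler_pdivrMr; last by rewrite ltr_pwDl ?exprn_gt0 ?sqr_ge0.
by rewrite mulrDr expr2 mulKf ?gt_eqF// lerDl mulr_ge0 ?sqr_ge0 ?invr_ge0 ?(ltW e0).
Qed.

Let itgP1 e c (f : R -> R) M : 0 < e -> measurable_fun setT f -> (forall t, `|t| <= 1 -> `|f t| <= M) ->
 itg leb (fun t : R => I1 t * (f t * Po e (t - c))).
Proof.
move=> e0 mf0 fM; apply: (@itg_itv_bd _ _ (M * e^-1)).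
 by have mP := mPo e c; mf.
move=> t t1; rewrite normrM ler_pM//; first by apply: fM; rewrite ler_norml.
by rewrite ger0_norm ?Po_ge0// Po_bd.
Qed.

Let J_cc (c r : R) : 0 <= r -> itg leb (\1_(`[c - r, c + r]%classic) : R -> R) /\ J leb (\1_(`[c - r, c + r]%classic) : R -> R) = 2 * r.
Proof.
move=> r0; rewrite (_ : \1__ = fun t : R => \1_(`[c - r, c + r]%classic) t * 1); last by apply/funext => t; rewrite mulr1.
have c1 : continuous (fun _ : R => 1 : R) by move=> x; exact: cvg_cst.
split; first exact: itg_itv.
have cr' : c - r <= c + r by lra.
rewrite (@FTC2 R (fun x => x) (fun=> 1) _ _ cr' (fun x => dd_id x) c1); ring.
Qed.

(** Poisson averages concentrate at [c]. Within [sqrt e] of [c], [|t - c|] times the kernel is at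
    most 1/2 by the arithmetic-geometric inequality, and beyond it at most [sqrt e]; the lengths
    [2 * sqrt e] and 2 give the constant 3. The mass is at least 1 already on [[c - e, c + e]]. *)
Let conc e c (f : R -> R) L : 0 < e -> `|c| + e <= 1 -> measurable_fun setT f ->
 (forall t, `|t| <= 1 -> `|f t - f c| <= L * `|t - c|) ->
 `|J leb (fun t : R => I1 t * (f t * Po e (t - c))) - f c * J leb (fun t : R => I1 t * Po e (t - c))| <= 3 * L * Num.sqrt e
 /\ 1 <= J leb (fun t : R => I1 t * Po e (t - c)).
Proof.
move=> e0 ce mf0 fL; have mP := mPo e c.
have c1 : `|c| <= 1 by have := normr_ge0 c; lra.
have L0 : 0 <= L.
 have := le_trans (normr_ge0 _) (fL (if 0 <= c then -1 else 1) _).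
 case: ifP => c0; rewrite ?normrN normr1 => /(_ (lexx _)).
  by rewrite pmulr_lge0// normr_gt0; lra.
 by rewrite pmulr_lge0// normr_gt0; lra.
have iP : itg leb (fun t : R => I1 t * Po e (t - c)).
 rewrite (_ : (fun t : R => _) = fun t : R => I1 t * (1 * Po e (t - c))); last by apply/funext => t; rewrite mul1r.
 by apply: (@itgP1 _ _ _ 1) => //; rewrite normr1.
have [i1 j1] := J_cc c (ltW e0).
split; last first.
 rewrite (_ : 1 = J leb (fun t : R => (2 * e)^-1 * (\1_(`[c - e, c + e]%classic) t))); last first.
  by rewrite J_Z// j1 mulVf// mulf_neq0// gt_eqF.
 apply: J_le => //; first exact: itgZ.
 move=> t; rewrite /I1 !indic_cc; case: (boolP (_ <= _ <= _)) => [/andP[h1 h2]|_]; last first.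
  by rewrite mulr0 mulr_ge0 ?Po_ge0.
 have -> : -1 <= t <= 1 by move: ce; rewrite -lerBrDr ler_norml => /andP[]; lra.
 have De : (t - c) ^+ 2 <= e ^+ 2 by rewrite -[leLHS]real_normK ?num_real// lerXn2r ?nnegrE ?(ltW e0)// ler_norml; lra.
 have D0 : 0 < e ^+ 2 + (t - c) ^+ 2 by rewrite ltr_pwDl ?exprn_gt0 ?sqr_ge0.
 by rewrite mulr1 mul1r /Po ler_pdivlMr// ler_pdivrMl ?mulr_gt0//; move: De; rewrite !expr2; lra.
have ifP0 : itg leb (fun t : R => I1 t * (f t * Po e (t - c))).
 apply: (@itgP1 _ _ _ (`|f c| + 2 * L)) => // t t1.
 rewrite -(subrK (f c) (f t)) addrC (le_trans (ler_normD _ _))// lerD2l (le_trans (fL _ t1))// mulrC ler_wpM2r//.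
 by rewrite (le_trans (ler_normB _ _))//; lra.
have [i2 j2] := J_cc c (sqrtr_ge0 e).
rewrite -J_Z// -J_B//; last exact: itgZ.
pose g t := (L * Num.sqrt e) * I1 t + (L / 2) * \1_(`[c - Num.sqrt e, c + Num.sqrt e]%classic) t.
have iI : itg leb I1 by rewrite (_ : I1 = fun t : R => I1 t * 1); [apply: itgI => x; exact: cvg_cst|apply/funext => t; rewrite mulr1].
rewrite (_ : 3 * L * _ = J leb g); last first.
 by rewrite /g J_D ?J_Z ?J_I1 ?j2//; [field|exact: itgZ..].
apply: J_abs; [by mf|by apply: itgD; exact: itgZ|move=> t].
rewrite (_ : _ - _ = I1 t * ((f t - f c) * Po e (t - c))); last by ring.
rewrite /g normrM (ger0_norm (_ : 0 <= I1 t)); last by case/andP: (I01 t).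
rewrite /I1 !indic_cc; case: (boolP (-1 <= t <= 1)) => t1; last by rewrite !(mul0r, mulr0) add0r mulr_ge0 ?divr_ge0.
rewrite mul1r mulr1 normrM (ger0_norm (Po_ge0 _ e0)).
apply: le_trans (_ : L * (`|t - c| * Po e (t - c)) <= _).
 by rewrite mulrA ler_wpM2r ?Po_ge0// fL// ler_norml.
rewrite -!mulrA -mulrDr ler_wpM2l//.
have D0 : 0 < e ^+ 2 + (t - c) ^+ 2 by rewrite ltr_pwDl ?exprn_gt0 ?sqr_ge0.
have n2 : `|t - c| ^+ 2 = (t - c) ^+ 2 by rewrite real_normK ?num_real.
have s2 : Num.sqrt e ^+ 2 = e by rewrite sqr_sqrtr// ltW.
have s0 : 0 < Num.sqrt e by rewrite sqrtr_gt0.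
have n0 : 0 <= `|t - c| by [].
rewrite /Po mulrA ler_pdivrMr// -n2.
case: (boolP (_ <= _ <= _)) => h.
 rewrite mulr1; have : 0 <= (e - `|t - c|) ^+ 2 by exact: sqr_ge0.
 have : 0 <= Num.sqrt e * (e ^+ 2 + `|t - c| ^+ 2) by rewrite mulr_ge0 ?(ltW s0)// n2 ltW.
 by nra.
have hs : Num.sqrt e < `|t - c|.
 rewrite ltNge; apply: contra h; rewrite ler_norml; lra.
rewrite mulr0 addr0 mulrDr -[X in _ * X <= _]s2.
have : Num.sqrt e * (Num.sqrt e * `|t - c|) <= Num.sqrt e * (`|t - c| * `|t - c|).
 by rewrite ler_pM2l// ler_wpM2r// ltW.
have : 0 <= Num.sqrt e * e ^+ 2 by rewrite mulr_ge0 ?sqr_ge0// ltW.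
by rewrite !expr2; lra.
Qed.

(** After exchanging the integrals, the Abel mean of the cosines over [y] is a Poisson kernel
    centred at [t0] and another at [- t0]; [sg] carries the parity of [r]. *)
Let pair (e sg : R) (r : R -> R) M : 0 < e -> measurable_fun setT r -> (forall t, `|t| <= 1 -> `|r t| <= M) ->
 let G y := J leb (fun t : R => I1 t * ((cos (y * (t - t0)) + sg * cos (y * (t + t0))) * r t)) in
 itg leb (fun y : R => I0 y * expR (- (e * y)) * G y) /\
 J leb (fun y : R => I0 y * expR (- (e * y)) * G y) =
 J leb (fun t : R => I1 t * (r t * Po e (t - t0))) + sg * J leb (fun t : R => I1 t * (r t * Po e (t - - t0))).
Proof.
move=> e0 mr rM G.
pose f (y t : R) := (I0 y * expR (- (e * y))) * (I1 t * ((cos (y * (t - t0)) + sg * cos (y * (t + t0))) * r t)).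
have [iE _] := itg_exp e0.
have ir : itg leb (fun t : R => I1 t * ((1 + `|sg|) * r t)).
 by apply: (@itg_itv_bd _ _ ((1 + `|sg|) * M)); [mf|move=> t t1; rewrite normrM ger0_norm ?addr_ge0// ler_wpM2l ?addr_ge0// rM// ler_norml].
have cc (x y : R) : `|cos x + sg * cos y| <= 1 + `|sg|.
 by rewrite (le_trans (ler_normD _ _))// lerD ?normrM ?ler_piMr// ler_norml cos_geN1 cos_le1.
have [||i1 _ j1 _] := @J_swap _ _ _ _ _ leb leb f (fun y : R => I0 y * expR (- (e * y))) (fun t : R => `|I1 t * ((1 + `|sg|) * r t)|) _ iE (itg_norm ir).
- by rewrite /f; mf.
- move=> y t; rewrite /f normrM (ger0_norm (_ : 0 <= I0 y * _)); last by rewrite mulr_ge0 ?expR_ge0// /I0 indicE.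
 rewrite ler_wpM2l//; first by rewrite mulr_ge0 ?expR_ge0// /I0 indicE.
 by rewrite !normrM ler_wpM2l// ler_wpM2r// (ger0_norm (_ : 0 <= 1 + `|sg|)) ?addr_ge0.
have eG y : J leb (f y) = I0 y * expR (- (e * y)) * G y.
 rewrite /f J_Z//; apply: itg_dom (itg_norm ir); first by mf.
 by move=> t; rewrite !normrM ler_wpM2l// ler_wpM2r// (ger0_norm (_ : 0 <= 1 + `|sg|)) ?addr_ge0.
rewrite (_ : (fun y : R => J leb (f y)) = (fun y : R => I0 y * expR (- (e * y)) * G y)) in i1 j1; last by apply/funext.
split=> //; rewrite j1 -J_Z; last exact: (itgP1 _ e0 mr rM).
rewrite -J_D; [|exact: (itgP1 _ e0 mr rM)|by apply: itgZ; exact: (itgP1 _ e0 mr rM)].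
congr J; apply/funext => t.
have ie z : itg leb (fun y : R => I0 y * (expR (- (e * y)) * cos (y * z))).
 apply: itg_dom iE; first by mf.
 move=> y; rewrite mulrA normrM ger0_norm; last by rewrite mulr_ge0 ?expR_ge0// /I0 indicE.
 by rewrite ler_piMr// ?mulr_ge0 ?expR_ge0// /I0 ?indicE// ler_norml cos_geN1 cos_le1.
rewrite (_ : f ^~ t = fun y : R => (I1 t * r t) * (I0 y * (expR (- (e * y)) * cos (y * (t - t0)))) + (I1 t * r t * sg) * (I0 y * (expR (- (e * y)) * cos (y * (t + t0))))); last first.
 by apply/funext => y; rewrite /f; ring.
rewrite J_D; [|exact: itgZ..].
by rewrite !J_Z// !poisson_int// /Po opprK; ring.
Qed.

(** Fourier inversion at one point without integrability: a bound [B] on the transform costs [B / e]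
    after Abel summation, and Poisson smoothing costs a Lipschitz term. The parity condition makes
    the contributions of [t0] and [- t0] add up. *)
Let lower1 (e sg : R) (r : R -> R) L B : 0 < e -> t0 + e <= 1 -> sg ^+ 2 = 1 -> measurable_fun setT r ->
 r (- t0) = sg * r t0 ->
 (forall t c, `|t| <= 1 -> `|c| <= 1 -> `|r t - r c| <= L * `|t - c|) ->
 (forall y, `|J leb (fun t : R => I1 t * ((cos (y * (t - t0)) + sg * cos (y * (t + t0))) * r t))| <= B) ->
 `|r t0| <= 3 * L * Num.sqrt e + B / e.
Proof.
move=> e0 te sg2 mr rs rL GB.
have t0a : `|t0| = t0 by rewrite gtr0_norm.
have t0b : `|t0| <= 1 by rewrite t0a ltW.
have rM t : `|t| <= 1 -> `|r t| <= `|r t0| + `|L| * 2.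
 move=> t1; rewrite -(subrK (r t0) (r t)) addrC (le_trans (ler_normD _ _))// lerD2l (le_trans (rL _ _ t1 t0b))//.
 rewrite (le_trans (ler_norm _))// normrM ler_wpM2l// normr_id (le_trans (ler_normB _ _))//; lra.
pose G (y : R) := J leb (fun t : R => I1 t * ((cos (y * (t - t0)) + sg * cos (y * (t + t0))) * r t)).
have [i j] : itg leb (fun y : R => I0 y * expR (- (e * y)) * G y) /\
 J leb (fun y : R => I0 y * expR (- (e * y)) * G y) =
 J leb (fun t : R => I1 t * (r t * Po e (t - t0))) + sg * J leb (fun t : R => I1 t * (r t * Po e (t - - t0))) := pair sg e0 mr rM.
have {}GB y : `|G y| <= B := GB y.
have [c1 c2] : `|J leb (fun t : R => I1 t * (r t * Po e (t - t0))) - r t0 * J leb (fun t : R => I1 t * Po e (t - t0))| <= 3 * L * Num.sqrt e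
 /\ 1 <= J leb (fun t : R => I1 t * Po e (t - t0)).
 by apply: conc => //; rewrite ?t0a// => t t1; exact: rL.
have [c3 c4] : `|J leb (fun t : R => I1 t * (r t * Po e (t - - t0))) - r (- t0) * J leb (fun t : R => I1 t * Po e (t - - t0))| <= 3 * L * Num.sqrt e
 /\ 1 <= J leb (fun t : R => I1 t * Po e (t - - t0)).
 by apply: conc => //; rewrite ?normrN ?t0a// => t t1; apply: rL => //; rewrite normrN.
have [iE jE] := itg_exp e0.
have jB : `|J leb (fun y : R => I0 y * expR (- (e * y)) * G y)| <= B / e.
 rewrite -jE -J_Z//; apply: J_abs; [exact: itg_meas i|exact: itgZ|].
 move=> y; rewrite normrM ger0_norm; last by rewrite mulr_ge0 ?expR_ge0// /I0 indicE.
 by rewrite mulrC ler_wpM2r// mulr_ge0 ?expR_ge0// /I0 indicE.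
rewrite j in jB; rewrite rs in c3.
set X := J leb _ in jB c1; set Y := J leb _ in jB c3; set m := J leb _ in c1 c2; set m' := J leb _ in c3 c4.
have sgn : `|sg| = 1 by apply/eqP; rewrite -sqrp_eq1// real_normK ?num_real// sg2.
have c5 : `|sg * Y - r t0 * m'| <= 3 * L * Num.sqrt e.
 rewrite (_ : _ - _ = sg * (Y - sg * r t0 * m')) ?normrM ?sgn ?mul1r//.
 by rewrite mulrBr !mulrA -expr2 sg2 mul1r.
have : `|r t0 * (m + m')| <= 6 * L * Num.sqrt e + B / e.
 rewrite (_ : r t0 * _ = - (X - r t0 * m) - (sg * Y - r t0 * m') + (X + sg * Y)); last by ring.
 rewrite (le_trans (ler_normD _ _))// lerD// (le_trans (ler_normB _ _))// normrN.
 by apply: le_trans (lerD c1 c5) _; lra.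
have h2 : 2 <= m + m' by lra.
rewrite normrM (ger0_norm (_ : 0 <= m + m')); last by lra.
have : `|r t0| * 2 <= `|r t0| * (m + m') by rewrite ler_wpM2l.
have : 0 <= B / e by exact: le_trans jB.
lra.
Qed.

Let e0v := expR (- CA + alpha * ln t0).

Let expA_lower h : 0 < h <= 1 -> e0v * hal h <= expR (- pA (t0 / h)).
Proof.
move=> /andP[h0 h1]; rewrite /e0v /hal -expRD ler_expR.
have := asy (t0 / h); rewrite ler_norml => /andP[_ l].
have : alpha * (ln t0 - ln h) <= alpha * ln (1 + `|t0 / h|).
 rewrite ler_wpM2l ?(le_trans ler01)// -ln_div ?posrE// ler_ln ?posrE ?divr_gt0//.
  by rewrite gtr0_norm ?divr_gt0// lerDr.
by lra.
Qed.

(** By contradiction: a kernel too small on [[- M, M]] is small everywhere thanks to its decay, so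
    inversion at [t0] makes [pk] and [qk] small there, whereas their modulus at [t0] is that of
    [phi_W t0 / phi (t0 / h)], of order [hal h]. *)
Lemma Kern_lower : 0 < a t0 ^+ 2 + b t0 ^+ 2 ->
 exists M c, [/\ 0 < M, 0 < c & forall h, 0 < h <= 1 -> exists2 y, `|y| <= M & c * hal h <= `|Kern h y|].
Proof.
move=> ab; set v := Num.sqrt (a t0 ^+ 2 + b t0 ^+ 2).
have v0 : 0 < v by rewrite sqrtr_gt0.
have w0 : 0 < e0v * v by rewrite mulr_gt0 ?expR_gt0.
set w := e0v * v in w0.
have [e [ep e1 e2]] : exists e, [/\ 0 < e, t0 + e <= 1 & 6 * C1 * Num.sqrt e <= w / 4].
 (* The first bound keeps the Poisson window inside [[-1, 1]], the second makes the smoothing error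
    at most [w / 4]; [e] is the square of [s] because the error involves [sqrt e]. *)
 pose s := Num.min (1 - t0) (w / 4 / (6 * C1 + 1)).
 have d0 : 0 < 6 * C1 + 1 by rewrite ltr_wpDl// mulr_ge0.
 have s0 : 0 < s by rewrite lt_min subr_gt0 t01 !divr_gt0.
 have s1 : s <= 1 - t0 by rewrite ge_min lexx.
 have s2 : s <= w / 4 / (6 * C1 + 1) by rewrite ge_min lexx orbT.
 exists (s ^+ 2); split; first exact: exprn_gt0.
 - apply: le_trans (_ : t0 + s <= _); last by rewrite -lerBrDl.
  rewrite lerD2l expr2 ler_piMr ?(ltW s0)// (le_trans s1)// gerBl ltW//.
 - rewrite sqrtr_sqr gtr0_norm// mulrC; move: s2; rewrite ler_pdivlMr// => /(le_trans _); apply.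
  by rewrite ler_pM2l// lerDl.
(* Were [Kern] below [c] on [[- M, M]], the decay [4 * C1 / M] beyond would give
   [B / e <= w / 4 * hal h]; the total [3 / 4 * w] contradicts the lower bound [w]. *)
pose M := 8 * (8 * C1) / (e * w) + 1; pose c := w * e / 32.
have C81 : 0 <= 8 * (8 * C1) by apply: mulr_ge0 => //; apply: mulr_ge0.
have ew0 : 0 < e * w by exact: mulr_gt0.
have M0 : 0 < M by rewrite /M ltr_wpDl//; apply: divr_ge0 => //; exact: ltW.
have c0 : 0 < c by rewrite /c divr_gt0// mulr_gt0.
exists M, c; split=> // h hh; apply: contrapT => nK.
have Kc y : `|y| <= M -> `|Kern h y| <= c * hal h.
 by move=> yM; rewrite leNgt; apply/negP => k; apply: nK; exists y => //; exact: ltW.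
have H0 := hal_gt0 h.
have C1M : 0 <= 4 * C1 / M by apply: divr_ge0; [exact: mulr_ge0|exact: ltW].
have KM y : `|Kern h y| <= (c + 4 * C1 / M) * hal h.
 have [yM|yM] := leP `|y| M.
  by apply: le_trans (Kc y yM) _; rewrite ler_pM2r// lerDl.
 have [_ yK _] := Kern_bounds y 0 hh.
 apply: le_trans (_ : 4 * C1 / M * hal h <= _); last by rewrite ler_pM2r// lerDr; exact: ltW.
 rewrite mulrAC ler_pdivlMr// (le_trans _ yK)// normrM mulrC ler_wpM2r// ltW//.
set B := 2 * ((c + 4 * C1 / M) * hal h).
have rL (r r' : R -> R) : (forall t, dd r t (r' t)) -> (forall t, `|t| <= 1 -> `|r' t| <= C1 * hal h) ->
  forall t s, `|t| <= 1 -> `|s| <= 1 -> `|r t - r s| <= C1 * hal h * `|t - s|.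
 move=> dr br t s; wlog ts : t s / s <= t => [hw t1 s1|].
  have [ts|/ltW ts] := leP s t; first exact: hw.
  by rewrite (distrC (r t)) (distrC t); exact: hw.
 move=> t1 s1; move: (t1) (s1); rewrite (ger0_norm (_ : 0 <= t - s)) ?subr_ge0// => /ler_normlP[t2 t3] /ler_normlP[s2 s3].
 apply: (dd_lip ts (fun x _ => dr x)) => x /andP[x1 x2].
 by apply: br; apply/ler_normlP; split; lra.
have cK2 y : `|cos (y * t0) * (Kern h y + Kern h (- y))| <= B /\ `|sin (y * t0) * (Kern h y - Kern h (- y))| <= B.
 have [k1 k2] := (KM y, KM (- y)).
 split; rewrite normrM; apply: le_trans (_ : 1 * (`|Kern h y| + `|Kern h (- y)|) <= _); try (by rewrite mul1r /B; lra).
  by rewrite ler_pM ?ler_normD// ler_norml cos_geN1 cos_le1.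
 by rewrite ler_pM ?ler_normB// ler_norml sin_geN1 sin_le1.
have KpE y : J leb (fun t : R => I1 t * ((cos (y * (t - t0)) + 1 * cos (y * (t + t0))) * pk h t)) = cos (y * t0) * (Kern h y + Kern h (- y)).
 rewrite /Kern -J_D; [|exact: itgI..]; rewrite -J_Z; last by apply: itgD; exact: itgI.
 congr J; apply/funext => t; rewrite mul1r mulrBr mulrDr cosB cosD mulrN cosN sinN (mulrC t y) /I1; ring.
have KqE y : J leb (fun t : R => I1 t * ((cos (y * (t - t0)) + -1 * cos (y * (t + t0))) * qk h t)) = sin (y * t0) * (Kern h y - Kern h (- y)).
 rewrite /Kern -J_B; [|exact: itgI..]; rewrite -J_Z; last by apply: itgB; exact: itgI.
 congr J; apply/funext => t; rewrite mulrBr mulrDr cosB cosD mulrN cosN sinN (mulrC t y) /I1; ring.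
have lp : `|pk h t0| <= 3 * (C1 * hal h) * Num.sqrt e + B / e.
 apply: (@lower1 e 1 (pk h)) => //; [by rewrite expr1n|exact: pk_meas| | |by move=> y; rewrite KpE; case: (cK2 y)].
  by rewrite /pk mulNr Ae Bo ae bo cosN sinN; ring.
 by apply: (rL _ (pk' h)); [exact: dd_pk|move=> t t1; case: (pk_bound hh t1)].
have lq : `|qk h t0| <= 3 * (C1 * hal h) * Num.sqrt e + B / e.
 apply: (@lower1 e (-1) (qk h)) => //; [by rewrite sqrrN expr1n|exact: qk_meas| | |by move=> y; rewrite KqE; case: (cK2 y)].
  by rewrite /qk mulNr Ae Bo ae bo cosN sinN; ring.
 by apply: (rL _ (qk' h)); [exact: dd_qk|move=> t t1; case: (pk_bound hh t1)].
have sq : pk h t0 ^+ 2 + qk h t0 ^+ 2 = (expR (- pA (t0 / h)) * v) ^+ 2.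
 rewrite [RHS]exprMn [v ^+ 2]sqr_sqrtr ?(ltW ab)// /pk /qk.
 rewrite -[X in _ = _ * X]mul1r -(cos2Dsin2 (pB (t0 / h))); ring.
have low : w * hal h <= `|pk h t0| + `|qk h t0|.
 apply: le_trans (_ : expR (- pA (t0 / h)) * v <= _).
  by rewrite /w mulrAC ler_pM2r// expA_lower.
 rewrite -(@ler_pXn2r _ 2)// ?nnegrE ?addr_ge0 ?mulr_ge0 ?expR_ge0 ?(ltW v0)//.
 rewrite -sq sqrrD !real_normK ?num_real// [leRHS]addrAC lerDl mulrn_wge0// mulr_ge0.
suff : w * hal h <= 3 / 4 * w * hal h by rewrite ler_pM2r// => ?; lra.
apply: le_trans low _; apply: le_trans (lerD lp lq) _.
have e3 : 6 * C1 * Num.sqrt e * hal h <= w / 4 * hal h by rewrite ler_pM2r.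
have : B / e <= w / 4 * hal h.
 rewrite ler_pdivrMr// /B /c.
 have : 4 * C1 / M <= w * e / 16.
  rewrite ler_pdivrMr// /M mulrDr mulr1.
  have -> : w * e / 16 * (8 * (8 * C1) / (e * w)) = 4 * C1 by field; rewrite !gt_eqF.
  by rewrite lerDl; apply: mulr_ge0; [apply: mulr_ge0; exact: ltW|].
 move=> l; have : (w * e / 32 + 4 * C1 / M) * hal h <= (w * e / 32 + w * e / 16) * hal h by rewrite ler_pM2r// lerD2l.
 have : 0 < w * e * hal h by rewrite mulr_gt0// mulr_gt0.
 lra.
lra.
Qed.

End lower.

End kernel.

(** * Probabilities of boolean events *)

Definition pr {R : realType} {d} {T : measurableType d} (P : probability T R) (b : T -> bool) : R :=
 J P (fun w => if b w then 1 else 0).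

Section pr_theory.
Context {R : realType} {d} {T : measurableType d} (P : probability T R).
Implicit Types b c : T -> bool.

Lemma bmf_pr b : measurable_fun setT b -> bmf (fun w => if b w then 1 else 0 : R).
Proof. by move=> mb; bm. Qed.

Lemma pr_ge0 b : 0 <= pr P b.
Proof. by apply: J_ge0 => w; case: ifP. Qed.

Lemma pr_le b c : measurable_fun setT b -> measurable_fun setT c -> (forall w, b w -> c w) -> pr P b <= pr P c.
Proof.
move=> mb mc bc; apply: J_le; [exact/bmf_itg/bmf_pr|exact/bmf_itg/bmf_pr|].
by move=> w; case: ifP => [/bc ->//|_]; case: ifP.
Qed.

Lemma pr_set b : measurable_fun setT b -> measurable [set w | b w] /\ pr P b = fine (P [set w | b w]).
Proof.
move=> mb; have mS : measurable [set w | b w].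
 rewrite (_ : [set w | b w] = setT `&` b @^-1` [set true]); first exact: mb.
 by rewrite setTI; apply/seteqP; split => w /=.
split=> //; rewrite -Ex_indic//; congr J; apply/funext => w; rewrite indicE.
by case: ifP => h; [rewrite mem_set|rewrite memNset//= h].
Qed.

Lemma pr_or b c : measurable_fun setT b -> measurable_fun setT c -> pr P (fun w => b w || c w) <= pr P b + pr P c.
Proof.
move=> mb mc; have [b1 b2] := (bmf_itg P (bmf_pr mb), bmf_itg P (bmf_pr mc)).
rewrite -J_D//; apply: J_le; [apply/bmf_itg/bmf_pr|exact: itgD|].
 by apply: measurable_or.
by move=> w; case: (b w); case: (c w) => /=; lra.
Qed.

Lemma pr_piece b (c : nat -> T -> bool) : measurable_fun setT b -> (forall k, measurable_fun setT (c k)) ->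
 (forall w, b w -> exists k, c k w) -> 0 < pr P b -> exists k, 0 < pr P (c k).
Proof.
move=> mb mc bc; have [mB ->] := pr_set mb; move=> b0; apply: contrapT => nk.
have ck k : P.-negligible [set w | c k w].
 have [mS e] := pr_set (mc k); apply/negligibleP => //.
 have : pr P (c k) <= 0 by rewrite leNgt; apply/negP => h; apply: nk; exists k.
 rewrite e => h; apply/eqP; rewrite eq_le measure_ge0 andbT -(fineK (fin_num_measure P _ mS)) lee_fin//.
have : P.-negligible [set w | b w].
 apply: negligibleS (negligible_bigcup ck) => w /bc[k]; by exists k.
by move/(negligibleP _ mB) => e; rewrite e ltxx in b0.
Qed.
End pr_theory.

Ltac mf1 ::= lazymatch goal with
 | |- measurable _ => by []
 | |- measurable_fun _ (fun x => x) => exact: measurable_id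
 | |- measurable_fun _ (fun x => x.1) => exact: measurable_fst
 | |- measurable_fun _ (fun x => x.2) => exact: measurable_snd
 | |- measurable_fun _ (fun x => @?f x + @?g x) => apply: (@meas_D _ _ _ f g)
 | |- measurable_fun _ (fun x => @?f x * @?g x) => apply: (@meas_M _ _ _ f g)
 | |- measurable_fun _ (fun x => - @?f x) => apply: (@meas_N _ _ _ f)
 | |- measurable_fun _ (fun x => @?f x ^+ ?n) => apply: (@meas_X _ _ _ n f)
 | |- measurable_fun _ (fun x => (@?f x)^-1) => apply: (@meas_inv _ _ _ f)
 | |- measurable_fun _ (fun x => expR (@?f x)) => apply: (@meas_exp _ _ _ f)
 | |- measurable_fun _ (fun x => cos (@?f x)) => apply: (@meas_cos _ _ _ f)
 | |- measurable_fun _ (fun x => sin (@?f x)) => apply: (@meas_sin _ _ _ f)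
 | |- measurable_fun _ (fun x => `|@?f x|) => apply: (@meas_norm _ _ _ f)
 | |- measurable_fun _ (fun x => Num.max (@?f x) (@?g x)) => apply: (@meas_max _ _ _ f g)
 | |- measurable_fun _ (fun x => if _ then _ else _) => apply: meas_if
 | |- measurable_fun _ (fun x => @?f x && @?g x) => apply: (@measurable_and _ _ setT f g)
 | |- measurable_fun _ (fun x => @?f x || @?g x) => apply: (@measurable_or _ _ setT f g)
 | |- measurable_fun _ (fun x => @?f x <= @?g x) => apply: (@meas_le _ _ _ f g)
 | |- measurable_fun _ (fun x => @?f x < @?g x) => apply: (@meas_lt _ _ _ f g)
 | |- measurable_fun _ (@Order.lt _ _ ?a) => apply: (@meas_lt _ _ _ (fun=> a) (fun x => x))
 | |- measurable_fun _ (@Order.le _ _ ?a) => apply: (@meas_le _ _ _ (fun=> a) (fun x => x))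
 | |- measurable_fun _ (bigop.body _ _) => first [apply: meas_sum => ? | apply: meas_prod => ?]
 | |- measurable_fun _ (fun x => bigop.body _ _ _) => first [apply: meas_sum => ? | apply: meas_prod => ?]
 | |- measurable_fun _ (fun x => \1_(?A) (@?f x)) => apply: (@meas_indic_comp _ _ _ _ _ A f)
 | H : measurable_fun _ ?h |- measurable_fun _ (fun x => ?h (@?f x)) => first [exact: H | apply: (measurableT_comp H)]
 | H : forall k, measurable_fun _ (?h k) |- measurable_fun _ (?h ?k) => exact: (H k)
 | H : forall k, measurable_fun _ (?h k) |- measurable_fun _ (fun x => ?h ?k (@?f x)) => first [exact: (H k) | apply: (measurableT_comp (H k))]
 end.

(** * Small balls and tails of the stationary law *)

Section smallball.
Context {R : realType} {d} {Omega : measurableType d} (P : probability Omega R).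
Variables (alpha CA D : R) (A B : R -> R) (X : Omega -> R).
Hypotheses (al2 : 2 <= alpha) (mX : measurable_fun setT X).
Hypothesis cf : forall t, J P (fun w => cos (t * X w)) = expR (A t) * cos (B t) /\
 J P (fun w => sin (t * X w)) = expR (A t) * sin (B t).
Hypothesis asy : forall t, `|A t + alpha * ln (1 + `|t|)| <= CA.
Hypotheses (A0 : forall t, A t <= 0) (AD : forall t, `|A t| <= D * `|t|) (BD : forall t, `|B t| <= D * `|t|).
Local Notation leb := (@lebesgue_measure R).
Let I0 := \1_(`[0, +oo[%classic) : R -> R.
Let mI0 : measurable_fun setT I0. Proof. exact: measurable_indic. Qed.
Let I00 s : 0 <= I0 s. Proof. by rewrite /I0 indicE. Qed.

Let cauchy_itg : itg leb (fun s => I0 s * (1 + s ^+ 2)^-1) /\ J leb (fun s => I0 s * (1 + s ^+ 2)^-1) = pi / 2.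
Proof.
have e : (\int[leb]_s (I0 s * (1 + s ^+ 2)^-1)%:E = (pi / 2)%:E)%E.
 rewrite -integral0y_oneDsqr [RHS]integral_mkcond; apply: eq_integral => s _.
 by rewrite /I0 patchE indicE; case: (s \in _); rewrite ?mul1r ?mul0r.
have nn (s : R) : 0 <= I0 s * (1 + s ^+ 2)^-1 by rewrite mulr_ge0// invr_ge0 addr_ge0// sqr_ge0.
split; last by rewrite /J e.
split; first by mf.
rewrite (_ : (\int[leb]_x _)%E = (pi / 2)%:E) ?ltry// -e; apply: eq_integral => s _.
by rewrite /= ger0_norm.
Qed.

Let cfx s x : J P (fun w => cos (s * (X w - x))) = cos (s * x) * (expR (A s) * cos (B s)) + sin (s * x) * (expR (A s) * sin (B s)).
Proof.
have [<- <-] := cf s.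
rewrite -J_Z; last by apply: bmf_itg; bm.
rewrite -[X in _ + X]J_Z; last by apply: bmf_itg; bm.
rewrite -J_D; [|by apply: itgZ; apply: bmf_itg; bm..].
by congr J; apply/funext => w; rewrite mulrBr cosB; ring.
Qed.

Let pois u x : 0 < u -> 
 J P (fun w => u / (u ^+ 2 + (X w - x) ^+ 2)) = J leb (fun s => I0 s * expR (- (u * s)) * J P (fun w => cos (s * (X w - x)))) /\
 itg leb (fun s => I0 s * expR (- (u * s)) * J P (fun w => cos (s * (X w - x)))).
Proof.
move=> u0; have [iE _] := itg_exp u0.
have [||i1 i2 j1 _] := @J_swap _ _ _ _ _ P leb (fun w (s : R) => I0 s * (expR (- (u * s)) * cos (s * (X w - x)))) (fun=> 1)
  (fun s => I0 s * expR (- (u * s))) _ (itg_cst P 1) iE.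
- by mf.
- move=> w s; rewrite mul1r mulrA normrM ger0_norm ?mulr_ge0 ?expR_ge0//.
 by rewrite ler_piMr ?mulr_ge0 ?expR_ge0// ler_norml cos_geN1 cos_le1.
have e : (fun s : R => J P (fun w => I0 s * (expR (- (u * s)) * cos (s * (X w - x))))) =
  (fun s => I0 s * expR (- (u * s)) * J P (fun w => cos (s * (X w - x)))).
 apply/funext => s; rewrite -J_Z; first by congr J; apply/funext => w; rewrite mulrA.
 by apply: bmf_itg; bm.
rewrite e in i2 j1; split => //; rewrite -j1; congr J; apply/funext => w.
by rewrite -[LHS]poisson_int.
Qed.

(** The Poisson kernel of width [u] is at least [1 / (2 * u)] on the ball, and its mean is a damped
    integral of the characteristic function. Here [alpha >= 2] enters: it bounds [|phi|] by a
    multiple of [1 / (1 + s ^+ 2)], whose integral over the half-line is [pi / 2]. *)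
Lemma small_ball : exists2 C, 0 < C & forall x u, 0 < u -> pr P (fun w => `|X w - x| <= u) <= C * u.
Proof.
have p0 : 0 < pi :> R := pi_gt0 R.
exists (2 * (2 * expR CA) * (pi / 2)); first by rewrite !mulr_gt0 ?expR_gt0// divr_gt0.
move=> x u u0; have [e i] := pois x u0.
have D0 (y : R) : 0 < u ^+ 2 + y ^+ 2 by rewrite ltr_pwDl ?exprn_gt0 ?sqr_ge0.
have ub (y : R) : 0 <= u / (u ^+ 2 + y ^+ 2) <= u^-1.
 rewrite divr_ge0 ?(ltW u0) ?(ltW (D0 _))//= ler_pdivrMr// mulrDr expr2 mulKf ?gt_eqF// lerDl mulr_ge0 ?sqr_ge0 ?invr_ge0// ltW//.
have bP : bmf (fun w => u / (u ^+ 2 + (X w - x) ^+ 2)).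
 by apply: (@bmf_intro _ _ _ u^-1); [mf|move=> w; case/andP: (ub (X w - x)) => h1 h2; rewrite ger0_norm].
apply: le_trans (_ : J P (fun w => (2 * u) * (u / (u ^+ 2 + (X w - x) ^+ 2))) <= _).
 apply: J_le; [by apply/bmf_itg/bmf_pr; mf|by apply: itgZ; exact: bmf_itg|move=> w].
 case: ifP => h; last by have /andP[h1 _] := ub (X w - x); rewrite mulr_ge0// mulr_ge0// ltW.
 rewrite mulrA ler_pdivlMr// mul1r.
 have : (X w - x) ^+ 2 <= u ^+ 2 by rewrite -[leLHS]real_normK ?num_real// lerXn2r ?nnegrE ?(ltW u0).
 by rewrite -mulrA -expr2; lra.
rewrite J_Z ?e; last exact: bmf_itg.
rewrite [leRHS](_ : _ = (2 * u) * ((2 * expR CA) * (pi / 2))); last by ring.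
rewrite ler_pM2l ?mulr_gt0//.
have [ci cj] := cauchy_itg; rewrite -cj -J_Z//; apply: J_le => //; first exact: itgZ.
move=> s; rewrite -mulrA [leRHS]mulrCA /I0 indic_cy; case: (leP 0 s) => s0; rewrite ?mul0r// !mul1r.
have es : expR (A s) <= expR CA * (1 + s ^+ 2)^-1.
 have s1 : 0 < 1 + s by lra.
 have ss : 0 < 1 + s ^+ 2 by rewrite ltr_pwDl ?sqr_ge0.
 apply: le_trans (_ : expR (CA - ln (1 + s ^+ 2)) <= _); last by rewrite expRD expRN lnK.
 rewrite ler_expR; have := asy s; rewrite ler_norml (ger0_norm s0) => /andP[_ l].
 have : ln (1 + s ^+ 2) <= ln ((1 + s) ^+ 2) by rewrite ler_ln ?posrE ?exprn_gt0// sqrrD; nra.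
 rewrite lnXn// mulr2n; have : 0 <= ln (1 + s) by rewrite ln_ge0// lerDl.
 move=> l0; have : 2 * ln (1 + s) <= alpha * ln (1 + s) by rewrite ler_wpM2r.
 lra.
apply: le_trans (_ : 1 * (2 * expR (A s)) <= _); last by rewrite mul1r -mulrA ler_pM2l.
apply: le_trans (ler_norm _) _; rewrite normrM ler_pM//.
 by rewrite ger0_norm ?expR_ge0// -expR0 ler_expR oppr_le0 mulr_ge0// ltW.
rewrite cfx mulr2n mulrDl mul1r (le_trans (ler_normD _ _))//.
have b1 (p q r : R) : `|p| <= 1 -> `|q| <= 1 -> 0 <= r -> `|p * (r * q)| <= r.
 move=> p1 q1 r0; rewrite !normrM (ger0_norm r0) -[leRHS]mul1r ler_pM ?mulr_ge0// -[leRHS]mulr1 ler_wpM2l//.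
by rewrite lerD// b1 ?expR_ge0// ler_norml ?cos_geN1 ?cos_le1 ?sin_geN1 ?sin_le1.
Qed.

(** Where [|X| > c], [c ^+ 2 / (c ^+ 2 + X ^+ 2)] is at most 1/2. The mean of its defect from 1 is
    [c] times the integral of [expR (- (c * s)) * (1 - Re phi s)]; since the exponent is Lipschitz
    at 0 the bracket is at most [2 * D * s], and half of the damping absorbs the factor [s]. *)
Lemma tail_bound c : 0 < c -> pr P (fun w => c < `|X w|) <= 16 * D / c.
Proof.
move=> c0; have [e i] := pois 0 c0.
have c20 : 0 < c / 2 by rewrite divr_gt0.
have [iE jE] := itg_exp c0; have [iE2 jE2] := itg_exp c20.
have D0 (y : R) : 0 < c ^+ 2 + y ^+ 2 by rewrite ltr_pwDl ?exprn_gt0 ?sqr_ge0.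
have ub (y : R) : 0 <= c / (c ^+ 2 + y ^+ 2) <= c^-1.
 rewrite divr_ge0 ?(ltW c0) ?(ltW (D0 _))//= ler_pdivrMr// mulrDr expr2 mulKf ?gt_eqF// lerDl mulr_ge0 ?sqr_ge0 ?invr_ge0// ltW//.
have bP : bmf (fun w => c / (c ^+ 2 + (X w - 0) ^+ 2)).
 by apply: (@bmf_intro _ _ _ c^-1); [mf|move=> w; case/andP: (ub (X w - 0)) => h1 h2; rewrite ger0_norm].
apply: le_trans (_ : J P (fun w => 2 * (1 - c * (c / (c ^+ 2 + (X w - 0) ^+ 2)))) <= _).
 apply: J_le; [by apply/bmf_itg/bmf_pr; mf|by apply: bmf_itg; bm|move=> w]; rewrite subr0.
 have cc : c * (c / (c ^+ 2 + X w ^+ 2)) <= 1.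
  by rewrite mulrA ler_pdivrMr// mul1r -expr2 lerDl sqr_ge0.
 case: ifP => h; last by rewrite mulr_ge0// subr_ge0.
 suff : c * (c / (c ^+ 2 + X w ^+ 2)) <= 1 / 2 by lra.
 rewrite mulrA ler_pdivrMr//.
 have : c ^+ 2 <= X w ^+ 2 by rewrite -[leRHS]real_normK ?num_real// lerXn2r ?nnegrE ?(ltW c0)// ltW.
 by rewrite -expr2; lra.
have bq : bmf (fun w => 1 - c * (c / (c ^+ 2 + (X w - 0) ^+ 2))) by bm.
rewrite J_Z; last exact: bmf_itg.
rewrite J_B; [|exact: itg_cst|by apply: itgZ; exact: bmf_itg].
rewrite Ex_cst J_Z ?e; last exact: bmf_itg.
rewrite [X in 2 * (X - _)](_ : _ = c * J leb (fun s => I0 s * expR (- (c * s)))); last by rewrite jE mulfV// gt_eqF.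
rewrite -mulrBr -J_B//.
apply: le_trans (_ : 2 * (c * J leb (fun s => (4 * D / c) * (I0 s * expR (- (c / 2 * s))))) <= _); last first.
 rewrite J_Z// jE2 le_eqVlt; apply/orP; left; apply/eqP; field; by rewrite gt_eqF.
rewrite ler_pM2l// ler_pM2l//; apply: J_le; [exact: itgB|exact: itgZ|move=> s].
set Jc := J P _; rewrite (_ : _ - _ = I0 s * (expR (- (c * s)) * (1 - Jc))); last by ring.
rewrite [leRHS](_ : _ = I0 s * (4 * D / c * expR (- (c / 2 * s)))); last by ring.
rewrite /Jc /I0 indic_cy; case: (leP 0 s) => s0; rewrite ?mul0r// !mul1r.
rewrite (_ : (fun w => _) = (fun w => cos (s * X w))); last by apply/funext => w; rewrite subr0.
have -> : expR (- (c * s)) = expR (- (c / 2 * s)) * expR (- (c / 2 * s)) by rewrite -expRD; congr expR; field.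
have [-> _] := cf s.
have a1 : expR (A s) <= 1 by rewrite -expR0 ler_expR.
have Ds : 0 <= D * s by have := le_trans (normr_ge0 _) (AD s); rewrite ger0_norm.
have h1 : 1 - expR (A s) * cos (B s) <= 2 * (D * s).
 have : 1 + A s <= expR (A s) by exact: expR_ge1Dx.
 have := AD s; rewrite (ger0_norm s0) ler_norml => /andP[h2 _].
 have : `|cos 0 - cos (B s)| <= D * s.
  by apply: le_trans (cos_lip _ _) _; rewrite sub0r normrN; have := BD s; rewrite (ger0_norm s0).
 rewrite cos0 => h3; have h4 : 1 - cos (B s) <= D * s by exact: le_trans (ler_norm _) h3.
 have h5 := cos_le1 (B s).
 have h6 : expR (A s) * (1 - cos (B s)) <= 1 * (1 - cos (B s)) by rewrite ler_wpM2r// subr_ge0.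
 by move: h6; rewrite mulrBr mulr1 mul1r; lra.
have h2 : c / 2 * s * expR (- (c / 2 * s)) <= 1.
 rewrite expRN ler_pdivrMr ?expR_gt0// mul1r (le_trans _ (expR_ge1Dx _))// lerDr//.
have E0 := expR_gt0 (- (c / 2 * s)); set E := expR _ in h2 E0 *.
rewrite -mulrA [leRHS]mulrC ler_pM2l//.
apply: le_trans (_ : E * (2 * (D * s)) <= _); first by rewrite ler_pM2l.
have D00 : 0 <= D by have := le_trans (normr_ge0 _) (AD 1); rewrite normr1 mulr1.
rewrite (_ : E * (2 * (D * s)) = 4 * D / c * (c / 2 * s * E)); last by field; rewrite gt_eqF.
by rewrite ler_piMr// divr_ge0 ?(ltW c0)// mulr_ge0.
Qed.

End smallball.

(** * Lower bound for small balls *)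

Section smallball_lower.
Context {R : realType} {d : measure_display} {Omega : measurableType d} (P : probability Omega R).
Variables (alpha eps lam : R) (F : probability R R) (X0 : Omega -> R) (E U : nat -> Omega -> R).
Hypotheses (al0 : 0 < alpha) (F1 : F (`]0%R, +oo[%classic) = 1%E) (eps0 : 0 < eps).
Hypothesis mom : (\int[lebesgue_measure]_(x in `]0%R, +oo[%classic)
    (Num.max 1 (`|x| `^ (2 + eps)) * kf alpha F x)%:E < +oo)%E.
Hypotheses (cre : continuous (phik_re alpha F)) (cim : continuous (phik_im alpha F)).
Hypotheses (mX0 : measurable_fun setT X0) (mE : forall j, measurable_fun setT (E j))
 (mU : forall j, measurable_fun setT (U j)).
Hypothesis ind : mutually_independent P (driver X0 E U).
Hypothesis lawE : forall j (A : set R), measurable A -> P (E j @^-1` A) = exponential_prob alpha A.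
Hypothesis lawU : forall j (A : set R), measurable A -> P (U j @^-1` A) = F A.
Hypothesis cfX0 : forall t, J P (fun w => cos (t * X0 w)) = phi_re alpha F t /\
 J P (fun w => sin (t * X0 w)) = phi_im alpha F t.
Hypotheses (lam0 : 0 < lam) (Ct : R) (tail : forall c, 0 < c -> pr P (fun w => c < `|X0 w|) <= Ct / c).

(** With [L / lam] as sampling step the jump clock runs over [[0, L]], so stationarity on the grid
    applies at an arbitrary time. *)
Let X L := OUproc lam X0 E U (1%:R * (L / lam)).

Let X_meas L : measurable_fun setT (X L).
Proof. exact: (@ouX_meas _ _ _ lam (L / lam) X0 E U mX0 mE mU 1%N). Qed.

Let X_law L (b : R -> bool) : 0 < L -> measurable_fun setT b -> pr P (fun w => b (X L w)) = pr P (fun w => b (X0 w)).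
Proof.
move=> L0 mb.
have l0 : 0 < lam * (L / lam) by rewrite mulr_gt0// divr_gt0.
have law := @ouX_law _ _ _ P alpha eps lam (L / lam) F X0 E U al0 F1 eps0 mom cre cim mX0 mE mU ind lawE lawU cfX0 l0 1%N.
exact: (J_law (X_meas L) mX0 law (bmf_pr mb)).
Qed.

(** On [E 0 <= L < E 1] exactly one jump occurs before [L]: the single waiting time [E 1] already
    places the second arrival beyond [L], once waiting times are nonnegative. *)
Let jump1 L : 0 < L -> exists2 N : set Omega, measurable N /\ P N = 0%E &
 forall w, ~ N w -> 0 <= E 0 w /\ (E 0 w <= L -> L < E 1 w -> X L w = expR (- L) * (X0 w + expR (E 0 w) * U 0 w)).
Proof.
move=> L0; pose N1 := \bigcup_k (E k @^-1` `]-oo, 0%R[%classic).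
have nN1 : P.-negligible N1.
 apply: negligible_bigcup => k; apply/negligibleP; last exact: (E_neg lawE).
 by rewrite -[X in measurable X]setTI; exact: mE.
have [A [mA PA NA]] := nN1; exists A => // w nA.
have w0 k : 0 <= E k w.
 rewrite leNgt; apply/negP => h; apply: nA; apply: NA; exists k => //.
split=> // e0 e1; rewrite /X /OUproc (_ : lam * (1%:R * (L / lam)) = L); last by field; rewrite gt_eqF.
have arr0 : arrival E 0 w = E 0 w by rewrite /arrival big_ord1.
set u := fun m : nat => \sum_(j < m) _.
have cv : u @ \oo --> expR (- L) * (expR (E 0 w) * U 0 w).
 apply: cvg_near_cst; exists 1%N => // -[//|m] _; rewrite /u big_ord_recl big1 ?addr0.
  by rewrite arr0 e0 mul1r expRD mulrA.
 move=> j _; rewrite leNgt (_ : _ < _) ?mul0r//; apply: lt_le_trans e1 _.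
 rewrite /arrival !big_ord_recl/= addrCA lerDl addr_ge0 ?sumr_ge0//.
by rewrite (cvg_lim _ cv)// mulrDr.
Qed.

Let ind4 (A B C D : R -> bool) : measurable_fun setT A -> measurable_fun setT B -> measurable_fun setT C -> measurable_fun setT D ->
 pr P (fun w => [&& A (X0 w), B (U 0 w), C (E 0 w) & D (E 1 w)]) =
 pr P (fun w => A (X0 w)) * (pr P (fun w => B (U 0 w)) * (pr P (fun w => C (E 0 w)) * pr P (fun w => D (E 1 w)))).
Proof.
move=> mA mB mC mD; have mE0 := mE 0%N; have mE1 := mE 1%N; have mU0 := mU 0%N.
have [_ ->] := pr_set P (measurableT_comp mA mX0).
have [_ ->] := pr_set P (measurableT_comp mB mU0).
have [_ ->] := pr_set P (measurableT_comp mC mE0).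
have [_ ->] := pr_set P (measurableT_comp mD mE1).
have mm : measurable_fun setT (fun w => [&& A (X0 w), B (U 0 w), C (E 0 w) & D (E 1 w)]) by mf.
have [_ ->] := pr_set P mm.
pose S (b : R -> bool) := [set x | b x].
have mS b : measurable_fun setT b -> measurable (S b).
 by move=> mb; case: (pr_set F mb).
pose BB (i : option (nat + nat)) : set R := match i with None => S A | Some (inr _) => S B | Some (inl 0) => S C | _ => S D end.
have := @ind [:: None; Some (inr 0%N); Some (inl 0%N); Some (inl 1%N)] BB erefl.
rewrite !big_cons big_nil mulr1 /=.
move=> <-; last by move=> [[[|?]|?]|]; exact: mS.
congr (fine (P _)); apply/seteqP; split => w /=.
 by move=> /and4P[a b c e] i /=; rewrite !inE => /or4P[] /eqP ->.
move=> h; apply/and4P; split.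
- exact: (h None isT).
- exact: (h (Some (inr 0%N)) isT).
- exact: (h (Some (inl 0%N)) isT).
- exact: (h (Some (inl 1%N)) isT).
Qed.

Let prE j s1 s2 : 0 <= s1 <= s2 -> alpha * expR (- (alpha * s2)) * (s2 - s1) <= pr P (fun w => (s1 <= E j w) && (E j w <= s2)).
Proof.
move=> /andP[s0 s12].
have bg : bmf (fun s : R => if (s1 <= s) && (s <= s2) then 1 else 0 : R) by apply: bmf_pr; mf.
rewrite /pr (J_E al0 mE lawE j bg).
pose c := alpha * expR (- (alpha * s2)).
have cc : continuous (fun _ : R => c) by move=> x; exact: cvg_cst.
have dc (x : R) : dd (fun y : R => c * y) x c by dauto; ring.
rewrite -/c mulrBr -(@FTC2 R (fun y => c * y) (fun=> c) s1 s2 s12 dc cc).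
have mi : measurable_fun setT (\1_(`[0, +oo[%classic) : R -> R) by exact: measurable_indic.
apply: J_le; first exact: itg_itv.
 have [iE _] := itg_exp al0; apply: itg_dom (itgZ alpha iE); first by mf; exact: bmf_meas bg.
 move=> s; rewrite indic_cy; case: (0 <= s); rewrite ?(mul0r, normr0)// ?mulr0// !mul1r.
 rewrite normrM ger0_norm ?mulr_ge0 ?expR_ge0 ?(ltW al0)// ler_piMr ?mulr_ge0 ?expR_ge0 ?(ltW al0)//.
 by case: ifP; rewrite ?normr1 ?normr0.
move=> s; rewrite indic_cc indic_cy; case: (boolP (_ <= _ <= _)) => [/andP[h1 h2]|_]; rewrite ?mul0r.
 rewrite (le_trans s0 h1) !mul1r mulr1 /c ler_pM2l// ler_expR lerN2 ler_pM2l//.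
by rewrite !mulr_ge0 ?expR_ge0 ?(ltW al0).
Qed.

Let prE_pos s1 s2 j : 0 <= s1 -> s1 < s2 -> 0 < pr P (fun w => (s1 <= E j w) && (E j w <= s2)).
Proof.
move=> s0 s12; apply: lt_le_trans (prE j (s1 := s1) (s2 := s2) _); last by rewrite s0 ltW.
by rewrite !mulr_gt0 ?expR_gt0 ?subr_gt0.
Qed.

Let prE_gt L j : 0 <= L -> 0 < pr P (fun w => L < E j w).
Proof.
move=> L0; have mEj := mE j; apply: lt_le_trans (@prE_pos (L + 1) (L + 2) j _ _) _; [lra|lra|].
by apply: pr_le; [mf|mf|move=> w /andP[h _]; apply: lt_le_trans h; rewrite ltrDl].
Qed.

Let grid (M eta y : R) : 0 < eta -> M <= y -> exists k : nat, M + k%:R * eta <= y /\ y < M + k%:R * eta + eta.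
Proof.
move=> e0 My; have q0 : 0 <= (y - M) / eta by rewrite divr_ge0 ?subr_ge0// ltW.
exists (Num.trunc ((y - M) / eta)); have /andP[h1 h2] := truncn_itv q0.
move: h1 h2; set q := Num.trunc _; rewrite ler_pdivlMr// ltr_pdivrMr// -natr1 mulrDl mul1r; lra.
Qed.

(** The ratio 3/2 between the two bounds is what later gives [1 <= r1], that is, a nonnegative jump
    time. *)
Let jump_size : exists2 u, 0 < u & 0 < pr P (fun w => (u <= U 0 w) && (U 0 w < 3 / 2 * u)).
Proof.
have mU0 := mU 0%N.
have p1 : pr P (fun w => 0 < U 0 w) = 1.
 have mb : measurable_fun setT (fun w => 0 < U 0 w) by mf.
 have [_ ->] := pr_set P mb.
 rewrite (_ : [set w | _] = U 0 @^-1` `]0%R, +oo[%classic); first by rewrite lawU// F1.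
 by apply/seteqP; split => w /=; rewrite in_itv/= andbT.
have [k k0] : exists k : nat, 0 < pr P (fun w => k.+1%:R^-1 <= U 0 w).
 apply: (@pr_piece _ _ _ P (fun w => 0 < U 0 w)); [mf|by move=> k; mf| |by rewrite p1].
 move=> w w0; exists (Num.trunc (U 0 w)^-1).
 rewrite -[leRHS]invrK lef_pV2 ?posrE ?invr_gt0//; exact/ltW/truncnS_gt.
set v := k.+1%:R^-1 in k0; have v0 : 0 < v :> R by rewrite invr_gt0.
have [j j0] : exists j : nat, 0 < pr P (fun w => (v + j%:R * (v / 2) <= U 0 w) && (U 0 w < v + j%:R * (v / 2) + v / 2)).
 apply: (pr_piece _ _ _ k0); [mf|by move=> j; mf|move=> w h].
 by have [j [h1 h2]] := @grid v (v / 2) (U 0 w) ltac:(lra) h; exists j; rewrite h1 h2.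
have jv : 0 <= j%:R * (v / 2) by rewrite mulr_ge0// ltW// divr_gt0.
exists (v + j%:R * (v / 2)); first lra.
apply: lt_le_trans j0 _; apply: pr_le; [mf|mf|move=> w /andP[-> h] /=]; lra.
Qed.

(** Stationarity lets a positive probability above a level propagate upwards: running for a short
    time with one jump of size at least [us] raises the level by [us / 2], and this is iterated. *)
Let unbounded m : 0 < pr P (fun w => m < X0 w).
Proof.
have [us u0 pU] := jump_size; have mU0 := mU 0%N; have mE0 := mE 0%N; have mE1 := mE 1%N.
have step m' : 0 < pr P (fun w => m' < X0 w) -> 0 < pr P (fun w => m' + us / 2 < X0 w).
 (* The horizon [L] is so short that the damping costs [y] at most [us / 4], while the jump has
    added [us]. *)
 move=> pm; pose y := m' + us; pose L := us / (4 * (`|y| + 1)).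
 have y1 : 0 < 4 * (`|y| + 1) by rewrite mulr_gt0// ltr_wpDl.
 have L0 : 0 < L by rewrite divr_gt0.
 have Ly : m' + us / 2 < expR (- L) * y.
  have h1 : `|(1 - expR (- L)) * y| <= us / 4.
   have e1 : 0 <= 1 - expR (- L) <= L.
    have := expR_ge1Dx (- L); have : expR (- L) <= 1 by rewrite -expR0 ler_expR oppr_le0 ltW.
    lra.
   case/andP: e1 => e1 e2; rewrite normrM (ger0_norm e1).
   apply: le_trans (_ : L * (`|y| + 1) <= _); first by rewrite ler_pM// lerDl.
   rewrite /L invfM mulrA -mulrA mulVf ?mulr1//; rewrite gt_eqF// ltr_wpDl//.
  have := le_trans (ler_norm _) h1; rewrite mulrBl mul1r /y; lra.
 have [N [mN PN] hN] := jump1 L0.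
 rewrite -(X_law L0 (b := fun x => m' + us / 2 < x)); last by mf.
 pose ev w := [&& m' < X0 w, us <= U 0 w, E 0 w <= L & L < E 1 w].
 have pev : 0 < pr P ev.
  rewrite (ind4 (A := fun x => m' < x) (B := fun x => us <= x) (C := fun x => x <= L) (D := fun x => L < x)); [|mf..].
  rewrite !mulr_gt0//; last exact: (prE_gt 1 (ltW L0)).
   apply: lt_le_trans pU _; apply: pr_le; [mf|mf|by move=> w /andP[]].
  apply: lt_le_trans (prE_pos 0 (lexx 0) L0) _; apply: pr_le; [mf|mf|by move=> w /andP[]].
 have mev : measurable_fun setT ev by rewrite /ev; mf.
 have mev1 : measurable_fun setT (fun w => if ev w then 1 else 0 : R) by exact: bmf_meas (bmf_pr mev).
 apply: lt_le_trans pev _; have mX := X_meas L.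
 have mNb : measurable_fun setT (\1_N : Omega -> R) by exact: measurable_indic.
 rewrite /pr -(J_ae (mu := P) (A := N) (f := fun w => (1 - \1_N w) * (if ev w then 1 else 0))) //; last 2 first.
 - by mf.
 - by move=> w nw; rewrite indicE memNset// subr0 mul1r.
 apply: J_le.
 - apply: bmf_itg; apply: bmfM; last by apply: bmf_pr; rewrite /ev; mf.
  by apply: bmfD; [exact: bmf_cst|apply: bmfN; exact: bmf_indic].
 - by apply/bmf_itg/bmf_pr; mf.
 - move=> w; rewrite indicE; case: (boolP (w \in N)) => wN; first by rewrite subrr mul0r; case: ifP.
  rewrite subr0 mul1r; case: (boolP (ev w)) => [/and4P[h1 h2 h3 h4]|_]; last by case: ifP.
  have [e0 /(_ h3 h4) ->] : 0 <= E 0 w /\ _ := hN w (fun h => ltac:(by move/negP: wN; apply; rewrite inE)).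
  rewrite (lt_le_trans Ly)// ler_pM2l ?expR_gt0// /y lerD ?(ltW h1)// (le_trans h2)// ler_peMl ?(le_trans (ltW u0))//.
  by rewrite -expR0 ler_expR.
have [m0 pm0] : exists m0, 0 < pr P (fun w => m0 < X0 w).
 pose c := 2 * `|Ct| + 1; have c0 : 0 < c by rewrite ltr_wpDl// mulr_ge0.
 exists (- c - 1).
 have h : 1 <= pr P (fun w => c < `|X0 w|) + pr P (fun w => - c - 1 < X0 w).
  apply: le_trans (pr_or _ _ _); [|by mf..].
  rewrite -[leLHS](Ex_cst P); apply: J_le; [exact: itg_cst|by apply/bmf_itg/bmf_pr; mf|move=> w].
  case: ifP => // /negbT; rewrite negb_or -!leNgt ler_norml; lra.
 have h2 : Ct / c <= 1 / 2.
  by rewrite ler_pdivrMr// /c; have := ler_norm Ct; lra.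
 by have := tail c0; lra.
have ih n : 0 < pr P (fun w => m0 + n%:R * (us / 2) < X0 w).
 elim: n => [|n /step]; first by rewrite mul0r addr0.
 by rewrite -(natr1 n) mulrDl mul1r addrA.
have [n mn] : exists n : nat, m <= m0 + n%:R * (us / 2).
 exists (Num.trunc (`|m - m0| / (us / 2))).+1.
 have : `|m - m0| / (us / 2) <= (Num.trunc (`|m - m0| / (us / 2))).+1%:R by exact/ltW/truncnS_gt.
 rewrite ler_pdivrMr ?divr_gt0// => h; have := ler_norm (m - m0); lra.
apply: lt_le_trans (ih n) _; apply: pr_le; [mf|mf|move=> w]; exact: le_lt_trans.
Qed.

(** By stationarity [X0] is replaced by the process at a time with exactly one jump. Starting point
    and jump size are frozen in fixed windows; landing in [[z, z + u]] then constrains only the jump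
    time, which has an exponential density bounded below. *)
Lemma small_ball_lower a b : 0 < a -> a <= b -> exists c u0, [/\ 0 < c, 0 < u0 &
 forall z u, a <= z <= b -> 0 < u <= u0 -> c * u <= pr P (fun w => (z <= X0 w) && (X0 w <= z + u))].
Proof.
move=> a0 ab; have [us u0 pU] := jump_size; have mU0 := mU 0%N; have mE0 := mE 0%N; have mE1 := mE 1%N.
have [k pX] : exists k : nat, 0 < pr P (fun w => (4 * b + k%:R * (us / 4) <= X0 w) && (X0 w < 4 * b + k%:R * (us / 4) + us / 4)).
 apply: (pr_piece _ _ _ (unbounded (4 * b))); [mf|by move=> j; mf|move=> w /ltW h].
 by have [j [h1 h2]] := @grid (4 * b) (us / 4) (X0 w) ltac:(lra) h; exists j; rewrite h1 h2.
set m := 4 * b + _ in pX.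
have mb : 4 * b <= m by rewrite /m lerDl mulr_ge0// ltW// divr_gt0.
(* Upper bound of the horizon [L] over all [z >= a], so that the event on [E 1] does not depend on
   [z]. *)
pose Lm := ln ((m + 2 * us) / a).
have b0 : 0 < b by exact: lt_le_trans ab.
have m0 : 0 < m + 2 * us by lra.
have Lm0 : 0 <= Lm by apply: ln_ge0; rewrite ler_pdivlMr// mul1r; lra.
pose pE := pr P (fun w => Lm < E 1 w).
have pE0 : 0 < pE by exact: prE_gt.
pose g w := [&& (m <= X0 w) && (X0 w < m + us / 4), (us <= U 0 w) && (U 0 w < 3 / 2 * us), true & Lm < E 1 w].
have pg : 0 < pr P g.
 rewrite (ind4 (A := fun x => (m <= x) && (x < m + us / 4)) (B := fun x => (us <= x) && (x < 3 / 2 * us)) (C := fun x => true) (D := fun x => Lm < x)); [|mf..].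
 by rewrite !mulr_gt0//; rewrite /pr /= Ex_cst.
(* The factor [8 / (9 * us)] combines [expR L >= 4], a jump below [3 / 2 * us] and the 1/3 from the
   logarithm. *)
pose c1 := alpha * expR (- (alpha * ln 3)) * (8 / (9 * us)).
have c10 : 0 < c1 by apply: mulr_gt0; [apply: mulr_gt0 => //; exact: expR_gt0|apply: divr_gt0 => //; exact: mulr_gt0].
exists (c1 * pr P g), (us * a / (m + 2 * us)); split; [exact: mulr_gt0|by rewrite divr_gt0// mulr_gt0|].
move=> z u /andP[az zb] /andP[up uu].
have z0 : 0 < z by exact: lt_le_trans az.
(* The horizon is fitted to [z]: [expR L * z = m + 2 * us] is out of reach for the start [x], close
   to [m], and reached with one jump. *)
pose EL := (m + 2 * us) / z; pose L := ln EL.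
have EL4 : 4 <= EL by rewrite /EL ler_pdivlMr//; lra.
have EL0 : 0 < EL by lra.
have ELe : expR L = EL by rewrite lnK ?posrE.
have L0 : 0 < L by apply: ln_gt0; lra.
have LLm : L <= Lm.
 by rewrite /L /Lm ler_ln ?posrE ?divr_gt0// /EL ler_pM2l// lef_pV2 ?posrE.
have uEL : u * EL <= us.
 apply: le_trans (_ : us * a / (m + 2 * us) * ((m + 2 * us) / a) <= _).
  by rewrite ler_pM ?(ltW up) ?(ltW EL0)// /EL ler_pM2l// lef_pV2 ?posrE.
 by rewrite le_eqVlt; apply/orP; left; apply/eqP; field; rewrite !gt_eqF.
have [N [mN PN] hN] := jump1 L0.
have mX := X_meas L.
rewrite -(X_law L0 (b := fun x => (z <= x) && (x <= z + u))); last by mf.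
pose Phi w w' : R := if g w && [&& E 0 w' <= L, 0 <= E 0 w', z <= expR (- L) * (X0 w + expR (E 0 w') * U 0 w) &
  expR (- L) * (X0 w + expR (E 0 w') * U 0 w) <= z + u] then 1 else 0.
pose A : pred (option (nat + nat)) := fun i => i != Some (inl 0%N).
pose B : pred (option (nat + nat)) := fun i => i == Some (inl 0%N).
have dj i : i \in A -> i \in B -> false by rewrite /A /B !unfold_in => /negbTE ->.
have [bb jj] : bmf (fun w => J P (Phi w)) /\ J P (fun w => Phi w w) = J P (fun w => J P (Phi w)).
 apply: (@Ex_copy R _ _ P _ (driver X0 E U) (driver_meas mX0 mE mU) ind A B dj Phi 1).
 - pose Xa : sigT (driver X0 E U) A -> R := X0.
  have mXA : measurable_fun setT Xa by apply: (@sig_X _ _ _ _ (driver X0 E U) A None).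
  pose Ua : sigT (driver X0 E U) A -> R := U 0%N.
  have mUA : measurable_fun setT Ua by apply: (@sig_X _ _ _ _ (driver X0 E U) A (Some (inr 0%N))).
  pose Ea : sigT (driver X0 E U) A -> R := E 1%N.
  have mEA : measurable_fun setT Ea by apply: (@sig_X _ _ _ _ (driver X0 E U) A (Some (inl 1%N))).
  pose Eb : sigT (driver X0 E U) B -> R := E 0%N.
  have mEB : measurable_fun setT Eb by apply: (@sig_X _ _ _ _ (driver X0 E U) B (Some (inl 0%N))).
  rewrite (_ : (fun z => _) = (fun q : sigT (driver X0 E U) A * sigT (driver X0 E U) B =>
   if [&& (m <= Xa q.1) && (Xa q.1 < m + us / 4), (us <= Ua q.1) && (Ua q.1 < 3 / 2 * us), true & Lm < Ea q.1] &&
   [&& Eb q.2 <= L, 0 <= Eb q.2, z <= expR (- L) * (Xa q.1 + expR (Eb q.2) * Ua q.1) &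
    expR (- L) * (Xa q.1 + expR (Eb q.2) * Ua q.1) <= z + u] then 1 else 0 : R))//.
  by mf.
 - by move=> w w'; rewrite /Phi; case: ifP; rewrite ?normr1 ?normr0.
have mg : measurable_fun setT g by rewrite /g; mf.
apply: le_trans (_ : J P (fun w => Phi w w) <= _); last first.
 have mNb : measurable_fun setT (\1_N : Omega -> R) by exact: measurable_indic.
 have mPhi : measurable_fun setT (fun w => Phi w w) by rewrite /Phi; mf.
 rewrite -(J_ae (mu := P) (A := N) (f := fun w => (1 - \1_N w) * Phi w w)) //; last 2 first.
 - by mf.
 - by move=> w nw; rewrite indicE memNset// subr0 mul1r.
 apply: J_le.
 - apply: bmf_itg; apply: bmfM; last by rewrite /Phi; apply: bmf_pr; mf.
  by apply: bmfD; [exact: bmf_cst|apply: bmfN; exact: bmf_indic].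
 - by apply/bmf_itg/bmf_pr; mf.
 - move=> w; rewrite indicE; case: (boolP (w \in N)) => wN; first by rewrite subrr mul0r; case: ifP.
  rewrite subr0 mul1r /Phi; case: ifP => [|_]; last by case: ifP.
  move=> /andP[/and4P[_ _ _ h1]] /and4P[h2 _ h3 h4].
  have [e0 ->] : 0 <= E 0 w /\ X L w = expR (- L) * (X0 w + expR (E 0 w) * U 0 w).
   have [q1 q2] := hN w (fun h => ltac:(by move/negP: wN; apply; rewrite inE)).
   by split=> //; apply: q2 => //; exact: le_lt_trans h1.
  by rewrite h3 h4.
rewrite jj -mulrAC -J_Z; last exact/bmf_itg/bmf_pr.
apply: J_le; [by apply: itgZ; exact/bmf_itg/bmf_pr|exact: bmf_itg|move=> w].
case: (boolP (g w)) => gw; last by rewrite mulr0; apply: J_ge0 => w'; rewrite /Phi; case: ifP.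
rewrite mulr1.
have := gw; rewrite /g => /and4P[/andP[x1 x2] /andP[v1 v2] _ _].
set x := X0 w in x1 x2 *; set v := U 0 w in v1 v2 *.
have v0 : 0 < v by lra.
(* The process lands in [[z, z + u]] exactly when [expR (E 0)] lies in [[r1, r2]]. As this interval
   is contained in [[1, 3]], the admissible jump times have length at least [(r2 - r1) / 3]. *)
pose r1 := (m + 2 * us - x) / v; pose r2 := (m + 2 * us - x + u * EL) / v.
have uE0 : 0 < u * EL by exact: mulr_gt0.
have r11 : 1 <= r1 by rewrite /r1 ler_pdivlMr//; lra.
have r23 : r2 <= 3 by rewrite /r2 ler_pdivrMr//; lra.
have r12 : r2 - r1 = u * EL / v by rewrite /r1 /r2; field; rewrite gt_eqF.
have r12p : r1 <= r2 by rewrite -subr_ge0 r12 divr_ge0 // ltW.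
have s12 : (r2 - r1) / 3 <= ln r2 - ln r1.
 have q : ln (1 + (r1 / r2 - 1)) <= r1 / r2 - 1 by apply: le_ln1Dx; rewrite ltrBrDl subrr divr_gt0; lra.
 move: q; rewrite addrC subrK ln_div ?posrE; [|lra|lra].
 have : (r2 - r1) / 3 <= (r2 - r1) / r2 by rewrite ler_wpM2l ?subr_ge0// lef_pV2 ?posrE; lra.
 by rewrite [X in _ <= X -> _](_ : _ = 1 - r1 / r2); [lra|rewrite mulrBl divff// gt_eqF//; lra].
apply: le_trans (_ : alpha * expR (- (alpha * ln r2)) * (ln r2 - ln r1) <= _).
 rewrite /c1 -[leLHS]mulrA; apply: ler_pM.
 - by apply: mulr_ge0; [exact: ltW|exact: expR_ge0].
 - by apply: mulr_ge0; [apply: divr_ge0 => //; apply: mulr_ge0 => //; exact: ltW|exact: ltW].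
 - by rewrite ler_pM2l// ler_expR lerN2 ler_pM2l// ler_ln ?posrE//; lra.
 - apply: le_trans s12; rewrite r12 ler_pdivlMr// ler_pdivlMr//.
  rewrite (_ : 8 / (9 * us) * u * 3 * v = u * (8 / 3 * (v / us))); last by field; rewrite gt_eqF.
  rewrite ler_pM2l// (le_trans _ EL4)//.
  have : v / us <= 3 / 2 by rewrite ler_pdivrMr//; lra.
  by lra.
have l1 : 0 <= ln r1 <= ln r2 by rewrite ln_ge0//= ler_ln ?posrE//; lra.
apply: le_trans (prE 0 l1) _; rewrite /pr; apply: J_le; [by apply/bmf_itg/bmf_pr; mf|by rewrite /Phi; apply/bmf_itg/bmf_pr; mf|].
move=> w'; case: ifP => [/andP[h1 h2]|_]; last by rewrite /Phi; case: ifP.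
rewrite /Phi gw /= -/x -/v.
have e1 : r1 <= expR (E 0 w') by rewrite -[leLHS]lnK ?posrE ?ler_expR//; lra.
have e2 : expR (E 0 w') <= r2 by rewrite -[leRHS]lnK ?posrE ?ler_expR//; lra.
have zE : z * EL = m + 2 * us by rewrite /EL mulrC divfK// gt_eqF.
have -> : E 0 w' <= L.
 by apply: le_trans h2 _; rewrite /L ler_ln ?posrE//; lra.
have -> : 0 <= E 0 w' by apply: le_trans h1; case/andP: l1.
have -> : z <= expR (- L) * (x + expR (E 0 w') * v).
 rewrite expRN ELe ler_pdivlMl// mulrC zE.
 by move: e1; rewrite /r1 ler_pdivrMr//; lra.
have -> // : expR (- L) * (x + expR (E 0 w') * v) <= z + u.
rewrite expRN ELe ler_pdivrMl// mulrDr (mulrC EL z) zE (mulrC EL u).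
by move: e2; rewrite /r2 ler_pdivlMr//; lra.
Qed.

End smallball_lower.

(** * Soft indicator of the maximum and its derivatives *)

Lemma dd_sum {R : realType} (I : Type) (s : seq I) (G : I -> R -> R) (g : I -> R) (x : R) :
 (forall i, dd (G i) x (g i)) -> dd (fun y => \sum_(i <- s) G i y) x (\sum_(i <- s) g i).
Proof.
move=> dG; elim: s => [|i s ih].
 by rewrite big_nil (_ : (fun y => _) = fun=> 0); [exact: dd_cst|apply/funext => y; rewrite big_nil].
rewrite big_cons (_ : (fun y => _) = fun y => G i y + \sum_(j <- s) G j y); last by apply/funext => y; rewrite big_cons.
exact: dd_D.
Qed.

Section vectors.
Context {R : realType} (N : nat).
Implicit Types x z u v : 'I_N -> R.

Definition vadd x z : 'I_N -> R := fun l => x l + z l.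
(** Measurability tested along measurable families: this avoids a sigma-algebra on ['I_N -> R] and
    also applies over restricted sigma-algebras such as [sigT]. *)
Definition cmeas (G : ('I_N -> R) -> R) : Prop :=
 forall d (T : measurableType d) (v : T -> 'I_N -> R),
 (forall l, measurable_fun setT (fun t => v t l)) -> measurable_fun setT (fun t => G (v t)).
Definition pair1 (h : 'I_N -> R) v : R := \sum_l v l * h l.
Definition pair2 (h : 'I_N -> 'I_N -> R) u v : R := \sum_l \sum_m u l * v m * h l m.

(* [H1] and [H2] play the role of the gradient and the Hessian of [H]; the Taylor
  estimates are the only properties of the derivatives that survive averaging. *)
Record smooth (K B1 B2 : R) (H : ('I_N -> R) -> R) (H1 : ('I_N -> R) -> 'I_N -> R)
 (H2 : ('I_N -> R) -> 'I_N -> 'I_N -> R) : Prop := Smooth {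
 sm0 : cmeas H; sm1 : forall l, cmeas (H1 ^~ l); sm2 : forall l m, cmeas (fun x => H2 x l m);
 sb0 : forall x, `|H x| <= 1;
 sb1 : forall x, \sum_l `|H1 x l| <= B1;
 sb2 : forall x, \sum_l \sum_m `|H2 x l m| <= B2;
 st2 : forall x z u v cz cu cv, 0 <= cz -> 0 <= cu -> 0 <= cv -> (forall l, `|z l| <= cz) -> (forall l, `|u l| <= cu) -> (forall l, `|v l| <= cv) ->
  `|pair2 (H2 (vadd x z)) u v - pair2 (H2 x) u v| <= K * cz * cu * cv;
 st1 : forall x z v cz cv, 0 <= cz -> 0 <= cv -> (forall l, `|z l| <= cz) -> (forall l, `|v l| <= cv) ->
  `|pair1 (H1 (vadd x z)) v - pair1 (H1 x) v - pair2 (H2 x) z v| <= K * cz * cz * cv;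
 st0 : forall x v cv, 0 <= cv -> (forall l, `|v l| <= cv) ->
  `|H (vadd x v) - H x - pair1 (H1 x) v - 2^-1 * pair2 (H2 x) v v| <= K * cv * cv * cv }.

Section softmax.
Variables (c b : R).
Hypotheses (c0 : 0 < c) (b0 : 0 < b).
Let p0 (y : R) := c * (expR (b * y) + expR (- (b * y))).
Let p1 (y : R) := c * (b * (expR (b * y) - expR (- (b * y)))).
Definition softind x := expR (- \sum_l p0 (x l)).
Definition softind1 x l := - p1 (x l) * softind x.
Definition softind2 x l m := (p1 (x l) * p1 (x m) - (if l == m then b ^+ 2 * p0 (x l) else 0)) * softind x.

Let p0_gt0 y : 0 < p0 y. Proof. by rewrite mulr_gt0// addr_gt0 ?expR_gt0. Qed.
Let p1_abs y : `|p1 y| <= b * p0 y.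
Proof.
rewrite /p1 /p0 normrM (gtr0_norm c0) normrM (gtr0_norm b0) mulrCA ler_pM2l// ler_pM2l//.
by rewrite (le_trans (ler_normB _ _))// !ger0_norm ?expR_ge0.
Qed.

Let Phi x := \sum_l p0 (x l).
Let Phi0 x : 0 <= Phi x. Proof. by apply: sumr_ge0 => l _; exact: ltW. Qed.

(** From [y * expR (- y) <= 1] at [y = Phi / k], raised to the power [k]. Derivatives of [softind]
    are bounded by polynomials of degree at most three in [Phi] times [softind], so these three
    bounds are what makes them independent of [N]. *)
Let Phi_exp x : [/\ Phi x * softind x <= 1, Phi x ^+ 2 * softind x <= 4 & Phi x ^+ 3 * softind x <= 27].
Proof.
have e (k : nat) : Phi x ^+ k.+1 * softind x <= k.+1%:R ^+ k.+1.
 have k0 : 0 < k.+1%:R :> R by [].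
 have h : Phi x / k.+1%:R * expR (- (Phi x / k.+1%:R)) <= 1.
  by rewrite expRN ler_pdivrMr ?expR_gt0// mul1r (le_trans _ (expR_ge1Dx _))// lerDr.
 have : (Phi x / k.+1%:R * expR (- (Phi x / k.+1%:R))) ^+ k.+1 <= 1.
  by rewrite exprn_ile1// mulr_ge0 ?expR_ge0// divr_ge0.
 rewrite exprMn expr_div_n -expRM_natl mulrN mulrCA mulfV ?gt_eqF// mulr1.
 by rewrite mulrAC ler_pdivrMr ?exprn_gt0// mul1r.
have := (e 0%N, e 1%N, e 2%N) => -[[]]; rewrite !expr1 expr2 => h1 h2 h3.
by split=> //; [apply: le_trans h2 _|apply: le_trans h3 _]; lra.
Qed.

Let a x v := \sum_l p1 (x l) * v l.
Let A2 x u v := \sum_l b ^+ 2 * p0 (x l) * u l * v l.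
Let A3 x z u v := \sum_l b ^+ 2 * p1 (x l) * z l * u l * v l.

Let sum_bd (g h : 'I_N -> R) (k : R) x : (forall l, `|g l| <= k * p0 (x l)) -> `|\sum_l g l| <= k * Phi x.
Proof. by move=> gk; rewrite /Phi mulr_sumr; apply: le_trans (ler_norm_sum _ _ _) _; apply: ler_sum. Qed.

Let nn (r s t w : R) : `|r| <= s -> `|t| <= w -> `|r * t| <= s * w.
Proof. by move=> ? ?; rewrite normrM ler_pM. Qed.

Let a_bd x v cv : (forall l, `|v l| <= cv) -> `|a x v| <= b * cv * Phi x.
Proof. by move=> vc; apply: sum_bd => // l; rewrite [leRHS]mulrAC; apply: nn. Qed.

Let A2_bd x u v cu cv : (forall l, `|u l| <= cu) -> (forall l, `|v l| <= cv) -> `|A2 x u v| <= b ^+ 2 * cu * cv * Phi x.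
Proof.
move=> uc vc; apply: sum_bd => // l; rewrite (_ : b ^+ 2 * cu * cv * _ = b ^+ 2 * p0 (x l) * cu * cv); last by ring.
by apply: nn => //; apply: nn => //; rewrite ger0_norm// mulr_ge0 ?sqr_ge0// ltW.
Qed.

Let A3_bd x z u v cz cu cv : (forall l, `|z l| <= cz) -> (forall l, `|u l| <= cu) -> (forall l, `|v l| <= cv) ->
 `|A3 x z u v| <= b ^+ 3 * cz * cu * cv * Phi x.
Proof.
move=> zc uc vc; apply: sum_bd => // l; rewrite (_ : b ^+ 3 * cz * cu * cv * _ = b ^+ 2 * (b * p0 (x l)) * cz * cu * cv); last by ring.
by do 3 (apply: nn => //); apply: nn => //; rewrite ger0_norm// sqr_ge0.
Qed.

Let pair1E x v : pair1 (softind1 x) v = - a x v * softind x.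
Proof. by rewrite /pair1 /a mulNr mulr_suml -sumrN; apply: eq_bigr => l _; rewrite /softind1; ring. Qed.

Let pair2E x u v : pair2 (softind2 x) u v = (a x u * a x v - A2 x u v) * softind x.
Proof.
rewrite /pair2 /a /A2 mulrBl mulr_suml !mulr_suml -sumrB; apply: eq_bigr => l _.
rewrite (bigD1 l)//= [X in _ = _ * X * _ - _](bigD1 l)//= {1}/softind2 eqxx.
rewrite (eq_bigr (fun i => p1 (x l) * u l * softind x * (p1 (x i) * v i))); last first.
 by move=> m ml; rewrite /softind2 eq_sym (negbTE ml); ring.
by rewrite -mulr_sumr; ring.
Qed.

Let line x z (t : R) : 'I_N -> R := fun l => x l + t * z l.

Let dp0 x z l t : dd (fun t => p0 (line x z t l)) t (p1 (line x z t l) * z l).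
Proof. by rewrite /p0 /p1 /line; dauto; ring. Qed.
Let dp1 x z l t : dd (fun t => p1 (line x z t l)) t (b ^+ 2 * p0 (line x z t l) * z l).
Proof. by rewrite /p0 /p1 /line; dauto; ring. Qed.

Let dsoft x z t : dd (fun t => softind (line x z t)) t (pair1 (softind1 (line x z t)) z).
Proof.
rewrite pair1E /softind; dauto; last first.
 by rewrite mulrC /a; congr (_ * _).
by apply: dd_sum => l; exact: dp0.
Qed.

Let da x z v t : dd (fun t => a (line x z t) v) t (A2 (line x z t) z v).
Proof.
rewrite /a /A2; apply: dd_sum => l; apply: dd_eq.
 by apply: dd_M; [exact: dp1|exact: dd_cst].
by cbv beta; ring.
Qed.

Let dA2 x z u v t : dd (fun t => A2 (line x z t) u v) t (A3 (line x z t) z u v).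
Proof.
rewrite /A2 /A3; apply: dd_sum => l; apply: dd_eq.
 by apply: dd_M; [apply: dd_M; [apply: dd_M; [exact: dd_cst|exact: dp0]|exact: dd_cst]|exact: dd_cst].
by cbv beta; ring.
Qed.

Let dpair1 x z v t : dd (fun t => pair1 (softind1 (line x z t)) v) t (pair2 (softind2 (line x z t)) z v).
Proof.
rewrite (_ : (fun t => _) = fun t => - a (line x z t) v * softind (line x z t)); last by apply/funext => ?; rewrite pair1E.
apply: dd_eq.
 by apply: dd_M; [apply: dd_N; exact: da|exact: dsoft].
rewrite pair1E pair2E; ring.
Qed.

Let D3 x z u v := (A2 x z u * a x v + a x u * A2 x z v - A3 x z u v - (a x u * a x v - A2 x u v) * a x z) * softind x.

Let dpair2 x z u v t : dd (fun t => pair2 (softind2 (line x z t)) u v) t (D3 (line x z t) z u v).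
Proof.
rewrite (_ : (fun t => _) = fun t => (a (line x z t) u * a (line x z t) v - A2 (line x z t) u v) * softind (line x z t)); last first.
 by apply/funext => ?; rewrite pair2E.
apply: dd_eq.
 apply: dd_M; last exact: dsoft.
 by apply: dd_D; [apply: dd_M; exact: da|apply: dd_N; exact: dA2].
rewrite pair1E /D3; ring.
Qed.

(** [40 = 27 + 3 * 4 + 1]: the third derivative has one term cubic in [Phi], three quadratic and one
    linear. *)
Let K := 40 * b ^+ 3.

Let D3_bd x z u v cz cu cv : 0 <= cz -> 0 <= cu -> 0 <= cv ->
 (forall l, `|z l| <= cz) -> (forall l, `|u l| <= cu) -> (forall l, `|v l| <= cv) ->
 `|D3 x z u v| <= K * cz * cu * cv.
Proof.
move=> cz0 cu0 cv0 zc uc vc; have [e1 e2 e3] := Phi_exp x; have s0 := expR_ge0 (- Phi x : R).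
rewrite /D3 normrM (ger0_norm s0); set p := Phi x in e1 e2 e3 s0 *.
pose q := b ^+ 3 * cz * cu * cv; have q0 : 0 <= q by rewrite /q; do 3 (apply: mulr_ge0 => //); apply: exprn_ge0; exact: ltW.
apply: le_trans (_ : (q * p ^+ 3 + 3 * q * p ^+ 2 + q * p) * softind x <= _).
 rewrite ler_wpM2r//.
 have h1 : `|A2 x z u * a x v| <= q * p ^+ 2.
  by rewrite (_ : q * p ^+ 2 = (b ^+ 2 * cz * cu * p) * (b * cv * p)); [apply: nn; [exact: A2_bd|exact: a_bd]|rewrite /q; ring].
 have h2 : `|a x u * A2 x z v| <= q * p ^+ 2.
  by rewrite (_ : q * p ^+ 2 = (b * cu * p) * (b ^+ 2 * cz * cv * p)); [apply: nn; [exact: a_bd|exact: A2_bd]|rewrite /q; ring].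
 have h3 : `|A3 x z u v| <= q * p by exact: A3_bd.
 have h4 : `|a x u * a x v * a x z| <= q * p ^+ 3.
  by rewrite (_ : q * p ^+ 3 = (b * cu * p) * (b * cv * p) * (b * cz * p)); [apply: nn; [apply: nn; exact: a_bd|exact: a_bd]|rewrite /q; ring].
 have h5 : `|A2 x u v * a x z| <= q * p ^+ 2.
  by rewrite (_ : q * p ^+ 2 = (b ^+ 2 * cu * cv * p) * (b * cz * p)); [apply: nn; [exact: A2_bd|exact: a_bd]|rewrite /q; ring].
 rewrite (_ : _ - _ = A2 x z u * a x v + a x u * A2 x z v + A2 x u v * a x z - (A3 x z u v + a x u * a x v * a x z)); last by ring.
 apply: le_trans (ler_normB _ _) _; apply: le_trans (lerD (le_trans (ler_normD _ _) (lerD (le_trans (ler_normD _ _) (lerD h1 h2)) h5)) (le_trans (ler_normD _ _) (lerD h3 h4))) _.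
 by lra.
rewrite (_ : K * cz * cu * cv = q * 40); last by rewrite /K /q; ring.
rewrite (_ : _ * softind x = q * (p ^+ 3 * softind x + 3 * (p ^+ 2 * softind x) + p * softind x)); last by ring.
by rewrite ler_wpM2l//; lra.
Qed.

Let line1 x z : line x z 1 = vadd x z.
Proof. by apply/funext => l; rewrite /line mul1r. Qed.
Let line0 x z : line x z 0 = x.
Proof. by apply/funext => l; rewrite /line mul0r addr0. Qed.

Let lip01 (g g' : R -> R) C : (forall t, dd g t (g' t)) -> (forall t, 0 <= t <= 1 -> `|g' t| <= C) -> `|g 1 - g 0| <= C.
Proof.
move=> dg gC; rewrite -[leRHS]mulr1 -[X in _ * X]subr0.
by apply: (dd_lip ler01 (fun t _ => dg t)).
Qed.

(** Each Taylor estimate is the mean value inequality along a segment, with the next higher estimate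
    bounding the derivative; this yields the same [K] at every order, without factorials. The 5 is
    [4 + 1] from [Phi_exp]. *)
Lemma smooth_softind : smooth K b (5 * b ^+ 2) softind softind1 softind2.
Proof.
have cm0 : cmeas softind by move=> d T v mv; rewrite /softind /p0; mf; exact: mv.
have t2 x z u v cz cu cv : 0 <= cz -> 0 <= cu -> 0 <= cv -> (forall l, `|z l| <= cz) -> (forall l, `|u l| <= cu) -> (forall l, `|v l| <= cv) ->
  `|pair2 (softind2 (vadd x z)) u v - pair2 (softind2 x) u v| <= K * cz * cu * cv.
 move=> cz0 cu0 cv0 zc uc vc; rewrite -line1 -[in X in _ - X](line0 x z).
 by apply: (lip01 (fun t => dpair2 x z u v t)) => t _; exact: D3_bd.
have pZ (h : 'I_N -> 'I_N -> R) t z v : pair2 h (fun l => t * z l) v = t * pair2 h z v.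
 by rewrite /pair2 mulr_sumr; apply: eq_bigr => l _; rewrite mulr_sumr; apply: eq_bigr => m _; ring.
have tz (z : 'I_N -> R) (cz t : R) : 0 <= t <= 1 -> (forall l, `|z l| <= cz) -> forall l, `|t * z l| <= cz.
 by move=> /andP[t0 t1] zc l; rewrite normrM (ger0_norm t0) -[leRHS]mul1r ler_pM.
have t1 x z v cz cv : 0 <= cz -> 0 <= cv -> (forall l, `|z l| <= cz) -> (forall l, `|v l| <= cv) ->
  `|pair1 (softind1 (vadd x z)) v - pair1 (softind1 x) v - pair2 (softind2 x) z v| <= K * cz * cz * cv.
 move=> cz0 cv0 zc vc.
 have dg t : dd (fun t => pair1 (softind1 (line x z t)) v - t * pair2 (softind2 x) z v) t
   (pair2 (softind2 (line x z t)) z v - pair2 (softind2 x) z v).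
  by apply: dd_D; [exact: dpair1|dauto; ring].
 have := lip01 (C := K * cz * cz * cv) dg; rewrite line1 line0 mul0r subr0 mul1r addrAC; apply => t t01.
 by apply: (t2 x (fun l => t * z l)) => //; exact: tz.
split.
- exact: cm0.
- by move=> l d T v mv; have m0 := cm0 d T v mv; rewrite /softind1 /p1; mf; exact: mv.
- move=> l m d T v mv; have m0 := cm0 d T v mv; rewrite /softind2 /p1 /p0; case: (l == m); mf; exact: mv.
- by move=> x; rewrite ger0_norm ?expR_ge0// -expR0 ler_expR oppr_le0; exact: Phi0.
- move=> x; have [e1 _ _] := Phi_exp x.
 apply: le_trans (_ : b * (Phi x * softind x) <= _); last by rewrite -[leRHS]mulr1 ler_pM2l.
 rewrite /Phi mulr_suml mulr_sumr; apply: ler_sum => l _.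
 rewrite /softind1 normrM normrN (ger0_norm (expR_ge0 _)) mulrA ler_wpM2r ?expR_ge0//.
- move=> x; have [e1 e2 _] := Phi_exp x; have s0 := expR_ge0 (- Phi x : R).
 apply: le_trans (_ : b ^+ 2 * (Phi x ^+ 2 * softind x + Phi x * softind x) <= _); last first.
  by rewrite mulrC ler_wpM2r ?sqr_ge0//; lra.
 rewrite (_ : b ^+ 2 * _ = \sum_l b ^+ 2 * (p0 (x l) * Phi x * softind x + p0 (x l) * softind x)); last first.
  by rewrite -mulr_sumr big_split/= -!mulr_suml -/(Phi x) expr2.
 apply: ler_sum => l _.
 apply: le_trans (_ : \sum_m (b ^+ 2 * (p0 (x l) * p0 (x m)) * softind x + (if l == m then b ^+ 2 * p0 (x l) * softind x else 0)) <= _).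
  apply: ler_sum => m _; rewrite /softind2 normrM (ger0_norm s0); case: (l == m) => /=.
   rewrite -mulrDl ler_wpM2r// (le_trans (ler_normB _ _))// lerD//.
    rewrite (_ : b ^+ 2 * _ = (b * p0 (x l)) * (b * p0 (x m))); [exact: nn|ring].
   by rewrite ger0_norm// mulr_ge0 ?sqr_ge0// ltW.
  rewrite addr0 subr0 ler_wpM2r// (_ : b ^+ 2 * _ = (b * p0 (x l)) * (b * p0 (x m))); [exact: nn|ring].
 rewrite big_split/= (_ : \sum_m (if l == m then _ else 0) = b ^+ 2 * p0 (x l) * softind x); last first.
  by rewrite (bigD1 l)//= eqxx big1 ?addr0// => m ml; rewrite eq_sym (negbTE ml).
 rewrite -mulr_suml -mulr_sumr -mulr_sumr -/(Phi x) le_eqVlt; apply/orP; left; apply/eqP; ring.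
- exact: t2.
- exact: t1.
- move=> x v cv cv0 vc.
 have dg t : dd (fun t => softind (line x v t) - t * pair1 (softind1 x) v - 2^-1 * t ^+ 2 * pair2 (softind2 x) v v) t
   (pair1 (softind1 (line x v t)) v - pair1 (softind1 x) v - t * pair2 (softind2 x) v v).
  apply: dd_D; first by apply: dd_D; [exact: dsoft|dauto; ring].
  by dauto; field.
 have := lip01 (C := K * cv * cv * cv) dg.
 rewrite line1 line0 !mul0r expr0n/= mulr0 mul0r !subr0 mul1r expr1n mulr1.
 rewrite (_ : _ - _ - _ - softind x = softind (vadd x v) - softind x - pair1 (softind1 x) v - 2^-1 * pair2 (softind2 x) v v); last by ring.
 apply => t t01; rewrite -pZ.
 by apply: (t1 x (fun l => t * v l)) => //; exact: tz.
Qed.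

End softmax.

(** * Averages over Rademacher signs *)

Section signs.
Definition avg (F : {ffun 'I_N -> bool} -> R) : R := (2^-1) ^+ N * \sum_sg F sg.
Definition sgv (s : R) (sg : {ffun 'I_N -> bool}) : 'I_N -> R := fun l => if sg l then s else - s.
Definition radem (s : R) (H : ('I_N -> R) -> R) x := avg (fun sg => H (vadd x (sgv s sg))).

Lemma avg_cst k : avg (fun=> k) = k.
Proof.
rewrite /avg sumr_const card_ffun card_bool card_ord -(mulr_natr k) natrX mulrCA -exprMn mulVf ?expr1n ?mulr1//.
Qed.

Lemma avgZ k F : avg (fun sg => k * F sg) = k * avg F.
Proof. by rewrite /avg -mulr_sumr mulrCA. Qed.
Lemma avgB F G : avg (fun sg => F sg - G sg) = avg F - avg G.
Proof. by rewrite /avg sumrB mulrBr. Qed.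
Lemma avg_sum (I : Type) (s : seq I) (F : I -> {ffun 'I_N -> bool} -> R) :
 avg (fun sg => \sum_(i <- s) F i sg) = \sum_(i <- s) avg (F i).
Proof. by rewrite /avg exchange_big mulr_sumr. Qed.
Lemma avg_le F G : (forall sg, F sg <= G sg) -> avg F <= avg G.
Proof. by move=> FG; rewrite /avg ler_wpM2l ?exprn_ge0 ?invr_ge0//; apply: ler_sum. Qed.
Lemma avg_norm F : `|avg F| <= avg (fun sg => `|F sg|).
Proof. by rewrite /avg normrM ger0_norm ?exprn_ge0 ?invr_ge0// ler_wpM2l ?exprn_ge0 ?invr_ge0// ler_norm_sum. Qed.
Lemma avg_abs F k : (forall sg, `|F sg| <= k) -> `|avg F| <= k.
Proof. by move=> Fk; apply: le_trans (avg_norm F) _; rewrite -[leRHS](avg_cst k); exact: avg_le. Qed.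

Let flip (l : 'I_N) (sg : {ffun 'I_N -> bool}) : {ffun 'I_N -> bool} := [ffun i => if i == l then ~~ sg i else sg i].
Let avg_flip l F : (forall sg, F (flip l sg) = - F sg) -> avg F = 0.
Proof.
move=> FN; have fK : involutive (flip l).
 by move=> sg; apply/ffunP => i; rewrite !ffunE; case: eqP => // _; rewrite negbK.
have : \sum_sg F sg = - \sum_sg F sg.
 by rewrite {1}(reindex_inj (inv_inj fK))/= -sumrN; apply: eq_bigr => sg _; rewrite FN.
by rewrite /avg => h; rewrite (_ : \sum_sg F sg = 0) ?mulr0//; lra.
Qed.

Lemma avg_sgv1 s l : avg (fun sg => sgv s sg l) = 0.
Proof. by apply: (@avg_flip l) => sg; rewrite /sgv ffunE eqxx; case: (sg l); rewrite ?opprK. Qed.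

Lemma avg_sgv2 s l m : avg (fun sg => sgv s sg l * sgv s sg m) = if l == m then s ^+ 2 else 0.
Proof.
case: eqP => [->|/eqP lm].
 rewrite -[RHS]avg_cst; congr avg; apply/funext => sg; rewrite /sgv; case: (sg m); ring.
apply: (@avg_flip l) => sg; rewrite /sgv !ffunE eqxx (eq_sym m) (negbTE lm).
by case: (sg l); case: (sg m); rewrite /= ?mulNr ?mulrN ?opprK.
Qed.

Lemma avg_pair1 s h : avg (fun sg => pair1 h (sgv s sg)) = 0.
Proof.
rewrite /pair1 avg_sum big1// => l _; rewrite (_ : (fun sg => _) = fun sg => h l * sgv s sg l).
 by rewrite avgZ avg_sgv1 mulr0.
by apply/funext => sg; rewrite mulrC.
Qed.

Lemma avg_pair2 s h : avg (fun sg => pair2 h (sgv s sg) (sgv s sg)) = s ^+ 2 * \sum_l h l l.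
Proof.
rewrite /pair2 avg_sum mulr_sumr; apply: eq_bigr => l _; rewrite avg_sum (bigD1 l)//= big1 ?addr0.
 rewrite (_ : (fun sg => _) = fun sg => h l l * (sgv s sg l * sgv s sg l)); last by apply/funext => sg; rewrite mulrC.
 by rewrite avgZ avg_sgv2 eqxx mulrC.
move=> m ml; rewrite (_ : (fun sg => _) = fun sg => h l m * (sgv s sg l * sgv s sg m)); last by apply/funext => sg; rewrite mulrC.
by rewrite avgZ avg_sgv2 eq_sym (negbTE ml) mulr0.
Qed.

Lemma sgv_abs s sg l : 0 <= s -> `|sgv s sg l| <= s.
Proof. by move=> s0; rewrite /sgv; case: (sg l); rewrite ?normrN ger0_norm. Qed.

Let avgm (F : {ffun 'I_N -> bool} -> ('I_N -> R) -> R) : (forall sg, cmeas (F sg)) -> cmeas (fun x => avg (F ^~ x)).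
Proof. by move=> mF d T v mv; rewrite /avg; mf; apply: mF. Qed.

Let vaddm s sg G : cmeas G -> cmeas (fun x => G (vadd x (sgv s sg))).
Proof. by move=> mG d T v mv; apply: mG => l; rewrite /vadd; mf; exact: mv. Qed.

Let p1avg h v : pair1 (fun l => avg (fun sg => h sg l)) v = avg (fun sg => pair1 (h sg) v).
Proof. by rewrite /pair1 avg_sum; apply: eq_bigr => l _; rewrite -avgZ. Qed.
Let p2avg h u v : pair2 (fun l m => avg (fun sg => h sg l m)) u v = avg (fun sg => pair2 (h sg) u v).
Proof.
by rewrite /pair2 avg_sum; apply: eq_bigr => l _; rewrite avg_sum; apply: eq_bigr => m _; rewrite -avgZ.
Qed.

Let vaddC x z y : vadd (vadd x z) y = vadd (vadd x y) z.
Proof. by apply/funext => l; rewrite /vadd addrAC. Qed.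

(** Every clause of [smooth] is convex in the function and its two derivatives, so it passes to
    averages of translates with the same constants; iteration loses nothing. *)
Lemma smooth_radem K B1 B2 s H H1 H2 : smooth K B1 B2 H H1 H2 ->
 smooth K B1 B2 (radem s H) (fun x l => avg (fun sg => H1 (vadd x (sgv s sg)) l))
  (fun x l m => avg (fun sg => H2 (vadd x (sgv s sg)) l m)).
Proof.
case=> m0 m1 m2 b0 b1 b2 t2 t1 t0; split.
- by apply: avgm => sg; exact: vaddm.
- by move=> l; apply: avgm => sg; apply: (vaddm s sg (m1 l)).
- by move=> l m; apply: avgm => sg; apply: (vaddm s sg (m2 l m)).
- by move=> x; apply: avg_abs.
- move=> x; rewrite -[leRHS](avg_cst B1).
 apply: le_trans (_ : avg (fun sg => \sum_l `|H1 (vadd x (sgv s sg)) l|) <= _); last by apply: avg_le.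
 by rewrite avg_sum; apply: ler_sum => l _; exact: avg_norm.
- move=> x; rewrite -[leRHS](avg_cst B2).
 apply: le_trans (_ : avg (fun sg => \sum_l \sum_m `|H2 (vadd x (sgv s sg)) l m|) <= _); last by apply: avg_le.
 by rewrite avg_sum; apply: ler_sum => l _; rewrite avg_sum; apply: ler_sum => m _; exact: avg_norm.
- move=> x z u v cz cu cv cz0 cu0 cv0 zc uc vc; rewrite !p2avg -avgB; apply: avg_abs => sg.
 by rewrite vaddC; exact: t2.
- move=> x z v cz cv cz0 cv0 zc vc; rewrite !p1avg p2avg -!avgB; apply: avg_abs => sg.
 by rewrite vaddC; exact: t1.
- move=> x v cv cv0 vc; rewrite p1avg p2avg /radem -avgZ -!avgB; apply: avg_abs => sg.
 by rewrite vaddC; exact: t0.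
Qed.

(** The signs have mean zero and covariance [s ^+ 2] times the identity, so the linear term
    disappears and the quadratic one reduces to the trace. *)
Lemma radem_expand K B1 B2 s H H1 H2 x : 0 <= s -> smooth K B1 B2 H H1 H2 ->
 `|radem s H x - H x - 2^-1 * s ^+ 2 * \sum_l H2 x l l| <= K * s ^+ 3.
Proof.
move=> s0 sm.
rewrite (_ : _ - _ - _ = avg (fun sg => H (vadd x (sgv s sg)) - H x - pair1 (H1 x) (sgv s sg) - 2^-1 * pair2 (H2 x) (sgv s sg) (sgv s sg))).
 apply: avg_abs => sg; rewrite (_ : K * s ^+ 3 = K * s * s * s); last by ring.
 by apply: (st0 sm) => // l; exact: sgv_abs.
by rewrite !avgB avgZ avg_cst avg_pair1 avg_pair2 subr0 mulrA.
Qed.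

(** The trace is the average of the quadratic form over unit sign vectors; this avoids a factor
    [N]. *)
Lemma smooth_diag K B1 B2 H H1 H2 x z cz : 0 <= cz -> (forall l, `|z l| <= cz) -> smooth K B1 B2 H H1 H2 ->
 `|\sum_l H2 (vadd x z) l l - \sum_l H2 x l l| <= K * cz.
Proof.
move=> cz0 zc sm.
rewrite (_ : _ - _ = avg (fun sg => pair2 (H2 (vadd x z)) (sgv 1 sg) (sgv 1 sg) - pair2 (H2 x) (sgv 1 sg) (sgv 1 sg))).
 apply: avg_abs => sg; rewrite -[K * cz]mulr1 -[_ * 1]mulr1.
 by apply: (st2 sm) => // l; exact: sgv_abs.
by rewrite avgB !avg_pair2 expr1n !mul1r.
Qed.

End signs.
End vectors.

(** * Lindeberg replacement for weakly dependent increments *)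

Section lindeberg.
Context {R : realType} {d} {Omega : measurableType d} (P : probability Omega R) (N n q : nat).
Variables (w : nat -> Omega -> 'I_N -> R) (K B1 B2 e0 eta eta0 : R).
Hypotheses (K0 : 0 <= K) (B10 : 0 <= B1) (B20 : 0 <= B2) (e00 : 0 <= e0) (eta_ge0 : 0 <= eta) (eta00 : 0 <= eta0) (n0 : (0 < n)%N).
Hypothesis mw : forall k l, measurable_fun setT (fun om => w k om l).
Hypothesis wb : forall k om l, `|w k om l| <= e0.
Definition psum j om : 'I_N -> R := fun l => \sum_(i < j) w i om l.
Hypothesis dec1 : forall j k l (G : ('I_N -> R) -> R) M, cmeas G -> (forall x, `|G x| <= M) -> (k < n)%N ->
 (j == 0%N) || (j + q <= k)%N -> `|J P (fun om => G (psum j om) * w k om l)| <= eta0 * M.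
Hypothesis dec2 : forall j k' k l m (G : ('I_N -> R) -> R) M, cmeas G -> (forall x, `|G x| <= M) -> (k' <= k < n)%N ->
 (j == 0%N) || (j + q <= k')%N ->
 `|J P (fun om => G (psum j om) * (w k' om l * w k om m)) -
  J P (fun om => G (psum j om)) * J P (fun om => w k' om l * w k om m)| <= eta0 * M.
Hypothesis cov : forall k' k l m, (k' < k < n)%N -> `|J P (fun om => w k' om l * w k om m)| <= eta.
Hypothesis var : forall k l m, (k < n)%N ->
 `|J P (fun om => w k om l * w k om m) - (if l == m then n%:R^-1 else 0)| <= eta.

Let mS j l : measurable_fun setT (fun om => psum j om l).
Proof. by rewrite /psum; mf. Qed.

Let bG G M j : cmeas G -> (forall x, `|G x| <= M) -> bmf (fun om => G (psum j om)).
Proof. by move=> mG GM; apply: (@bmf_intro _ _ _ M) => //; apply: mG => l; exact: mS. Qed.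

Let bw k l : bmf (fun om => w k om l).
Proof. by apply: (@bmf_intro _ _ _ e0). Qed.

Let bmf_cmp (f g : Omega -> R) M : bmf f -> measurable_fun setT g -> (forall om, `|g om - f om| <= M) -> bmf g.
Proof.
move=> [mf0 [M' fM]] mg h; apply: (@bmf_intro _ _ _ (M + M')) => // om.
by rewrite -(subrK (f om) (g om)) (le_trans (ler_normD _ _))// lerD.
Qed.

Let J_close (f g : Omega -> R) M : bmf f -> bmf g -> (forall om, `|f om - g om| <= M) -> `|J P f - J P g| <= M.
Proof.
move=> bf bg h; rewrite -J_B; [|exact: bmf_itg..].
by apply: Ex_bound => //; apply: bmf_meas; apply: bmfD => //; exact: bmfN.
Qed.

Section step.
Variables (H : ('I_N -> R) -> R) (H1 : ('I_N -> R) -> 'I_N -> R) (H2 : ('I_N -> R) -> 'I_N -> 'I_N -> R).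
Hypothesis sm : smooth K B1 B2 H H1 H2.

Let H2b x l m : `|H2 x l m| <= B2.
Proof.
apply: le_trans (sb2 sm x); rewrite (bigD1 l)//= (bigD1 m)//= -addrA lerDl.
by rewrite addr_ge0 ?sumr_ge0// => i _; rewrite sumr_ge0.
Qed.
Let H1b x l : `|H1 x l| <= B1.
Proof. by apply: le_trans (sb1 sm x); rewrite (bigD1 l)//= lerDl sumr_ge0. Qed.

Let bH2 j l m : bmf (fun om => H2 (psum j om) l m).
Proof. exact: (bG j (sm2 sm l m) (fun x => H2b x l m)). Qed.
Let bH1 j l : bmf (fun om => H1 (psum j om) l).
Proof. exact: (bG j (sm1 sm l) (fun x => H1b x l)). Qed.
Let bH j : bmf (fun om => H (psum j om)).
Proof. exact: (bG j (sm0 sm) (sb0 sm)). Qed.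
Let bp1 j k : bmf (fun om => pair1 (H1 (psum j om)) (w k om)).
Proof. by rewrite /pair1; apply: bmf_sum => l; apply: bmfM. Qed.
Let bp2 j k' k : bmf (fun om => pair2 (H2 (psum j om)) (w k' om) (w k om)).
Proof. by rewrite /pair2; apply: bmf_sum => l; apply: bmf_sum => m; apply: bmfM => //; apply: bmfM. Qed.

Let far j : exists z : Omega -> 'I_N -> R, (forall om, psum j om = vadd (psum (j - q) om) (z om)) /\
 (forall om l, `|z om l| <= q%:R * e0).
Proof.
exists (fun om l => \sum_(j - q <= i < j) w i om l); split.
 move=> om; apply/funext => l; rewrite /vadd /psum -!(big_mkord xpredT (fun i => w i om l)).
 by rewrite (big_cat_nat (leq0n _) (leq_subr q j)).
move=> om l; apply: le_trans (ler_norm_sum _ _ _) _.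
apply: le_trans (_ : \sum_(j - q <= i < j) e0 <= _); first by apply: ler_sum => i _.
by rewrite sumr_const_nat -(mulr_natl e0) ler_wpM2r// ler_nat; lia.
Qed.

(** Truncated subtraction gives [j - q = 0] when fewer than [q] increments precede; this is the
    reason for the alternative [j == 0] in [dec1] and [dec2]. *)
Let farE j k' : (j <= k')%N -> (j - q == 0)%N || (j - q + q <= k')%N.
Proof. by move=> jk; case: (leqP q j) => h; apply/orP; [right|left]; lia. Qed.

Let NN := N%:R * (N%:R * (eta0 * B2)).
Let X := K * (q%:R * e0) * e0 * e0 + NN.

Let X2 j k' k : (j <= k')%N -> (k' <= k < n)%N ->
 `|J P (fun om => pair2 (H2 (psum j om)) (w k' om) (w k om)) -
  \sum_l \sum_m J P (fun om => H2 (psum (j - q) om) l m) * J P (fun om => w k' om l * w k om m)| <= X.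
Proof.
move=> jk kk; have [z [zE zb]] := far j.
set A := J P _; pose B := J P (fun om => pair2 (H2 (psum (j - q) om)) (w k' om) (w k om)).
set C := \sum_l _.
rewrite (_ : A - C = (A - B) + (B - C)); last by ring.
apply: le_trans (ler_normD _ _) _; apply: lerD.
 apply: J_close => // om; rewrite zE.
 by apply: (st2 sm) => //; rewrite mulr_ge0.
rewrite /B /C /pair2 J_sum; last first.
 by move=> l _; apply: bmf_itg; apply: bmf_sum => m; apply: bmfM => //; apply: bmfM.
rewrite -sumrB; apply: le_trans (ler_norm_sum _ _ _) _.
apply: le_trans (_ : \sum_(l < N) N%:R * (eta0 * B2) <= _); last by rewrite sumr_const card_ord -(mulr_natl (N%:R * _)).
apply: ler_sum => l _; rewrite J_sum; last by move=> m _; apply: bmf_itg; apply: bmfM => //; apply: bmfM.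
rewrite -sumrB; apply: le_trans (ler_norm_sum _ _ _) _.
apply: le_trans (_ : \sum_(m < N) (eta0 * B2) <= _); last by rewrite sumr_const card_ord -(mulr_natl (eta0 * _)).
apply: ler_sum => m _.
rewrite (_ : (fun om => _ * _ * _) = (fun om => H2 (psum (j - q) om) l m * (w k' om l * w k om m))); last first.
 by apply/funext => om; rewrite mulrC.
exact: (dec2 l m (sm2 sm l m) (fun x => H2b x l m) kk (farE jk)).
Qed.

(** The bound [B2] on the sum of all absolute entries of the Hessian is used before taking
    expectations, so that the entrywise error [eta] costs no factor depending on [N]. *)
Let absJ2 j (cc : 'I_N -> 'I_N -> R) : (forall l m, `|cc l m| <= eta) ->
 `|\sum_l \sum_m J P (fun om => H2 (psum j om) l m) * cc l m| <= B2 * eta.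
Proof.
move=> ce.
rewrite (_ : \sum_l _ = J P (fun om => \sum_l \sum_m H2 (psum j om) l m * cc l m)); last first.
 rewrite J_sum; last by move=> l _; apply: bmf_itg; apply: bmf_sum => m; apply: bmfM => //; exact: bmf_cst.
 apply: eq_bigr => l _; rewrite J_sum; last by move=> m _; apply: bmf_itg; apply: bmfM => //; exact: bmf_cst.
 by apply: eq_bigr => m _; rewrite J_Zr//; exact: bmf_itg.
apply: Ex_bound.
 by apply: bmf_meas; apply: bmf_sum => l; apply: bmf_sum => m; apply: bmfM => //; exact: bmf_cst.
move=> om; apply: le_trans (_ : (\sum_l \sum_m `|H2 (psum j om) l m|) * eta <= _); last by rewrite ler_wpM2r// (sb2 sm).
apply: le_trans (ler_norm_sum _ _ _) _; rewrite mulr_suml; apply: ler_sum => l _.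
apply: le_trans (ler_norm_sum _ _ _) _; rewrite mulr_suml; apply: ler_sum => m _.
by rewrite normrM ler_wpM2l.
Qed.

Let Y := K * e0 * e0 * e0 + X + B2 * eta.

(** The [i] most recent increments are removed one by one from the argument of the gradient. Each
    removal creates a second-order term in two distinct increments, small by decorrelation and the
    covariance bound [eta]. *)
Let back k i : (i <= k)%N -> (k < n)%N ->
 `|J P (fun om => pair1 (H1 (psum k om)) (w k om)) - J P (fun om => pair1 (H1 (psum (k - i) om)) (w k om))| <= i%:R * Y.
Proof.
move=> + kn; elim: i => [|i ih] ik; first by rewrite subn0 subrr normr0 mul0r.
set A := J P _; pose B := J P (fun om => pair1 (H1 (psum (k - i) om)) (w k om)).
set j := (k - i.+1)%N; have ji : (k - i)%N = j.+1 by rewrite /j; lia.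
have jk : (j < k)%N by rewrite /j; lia.
set C := J P _; rewrite (_ : A - C = (A - B) + (B - C)); last by ring.
apply: le_trans (ler_normD _ _) _; rewrite -natr1 mulrDl mul1r; apply: lerD; first by apply: ih; exact: ltnW.
pose D := J P (fun om => pair2 (H2 (psum j om)) (w j om) (w k om)).
rewrite (_ : B - C = (B - (C + D)) + D); last by ring.
apply: le_trans (ler_normD _ _) _; rewrite /Y -addrA; apply: lerD.
 rewrite /C /D -J_D; [|exact: bmf_itg..]; rewrite /B ji.
 apply: J_close => //; first exact: bmfD.
 move=> om; rewrite (_ : psum j.+1 om = vadd (psum j om) (w j om)); last first.
  by apply/funext => l; rewrite /vadd /psum big_ord_recr.
 by rewrite opprD addrA; apply: (st1 sm).
rewrite -(subrK (\sum_l \sum_m J P (fun om => H2 (psum (j - q) om) l m) * J P (fun om => w j om l * w k om m)) D).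
apply: le_trans (ler_normD _ _) _; apply: lerD; first by apply: X2 => //; rewrite (ltnW jk).
by apply: absJ2 => l m; apply: cov; rewrite jk.
Qed.

Definition step_err := K * e0 * e0 * e0 + (N%:R * (eta0 * B1) + q%:R * (K * e0 * e0 * e0 + (K * (q%:R * e0) * e0 * e0 + N%:R * (N%:R * (eta0 * B2))) + B2 * eta))
 + (K * (q%:R * e0) * e0 * e0 + N%:R * (N%:R * (eta0 * B2)) + B2 * eta + n%:R^-1 * (K * (q%:R * e0))) + K * (Num.sqrt n%:R^-1) ^+ 3.

(** Both sides are expanded to second order at [psum k]. The linear term is treated by [back], the
    quadratic one by decorrelation and [var]; the resulting trace sits at [psum (k - q)] and is
    moved back to [psum k] by [smooth_diag]. *)
Lemma lindeberg_step k : (k < n)%N ->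
 `|J P (fun om => H (psum k.+1 om)) - J P (fun om => radem (Num.sqrt n%:R^-1) H (psum k om))| <= step_err.
Proof.
move=> kn; have kk : (k <= k < n)%N by rewrite leqnn.
have s2 : Num.sqrt n%:R^-1 ^+ 2 = n%:R^-1 :> R by rewrite sqr_sqrtr.
have bdg j : bmf (fun om => \sum_l H2 (psum j om) l l) by apply: bmf_sum => l.
set A := J P _; set Z := J P (fun om => radem _ _ _).
pose A0 := J P (fun om => H (psum k om)).
pose A1 := J P (fun om => pair1 (H1 (psum k om)) (w k om)).
pose A2 := J P (fun om => pair2 (H2 (psum k om)) (w k om) (w k om)).
pose A3 := J P (fun om => \sum_l H2 (psum k om) l l).
pose A4 := J P (fun om => \sum_l H2 (psum (k - q) om) l l).
have h1 : `|A - (A0 + A1 + 2^-1 * A2)| <= K * e0 * e0 * e0.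
 have b2' : bmf (fun om => 2^-1 * pair2 (H2 (psum k om)) (w k om) (w k om)) by apply: bmfM => //; exact: bmf_cst.
 rewrite /A0 /A1 /A2 -J_Z; last exact: bmf_itg.
 rewrite -J_D; [|exact: bmf_itg..]; rewrite -J_D; [|apply: itgD; exact: bmf_itg|exact: bmf_itg].
 apply: J_close => //; first by apply: bmfD => //; exact: bmfD.
 move=> om; rewrite (_ : psum k.+1 om = vadd (psum k om) (w k om)); last first.
  by apply/funext => l; rewrite /vadd /psum big_ord_recr.
 by rewrite !opprD !addrA; apply: (st0 sm).
have h2 : `|A1| <= N%:R * (eta0 * B1) + q%:R * Y.
 (* If fewer than [q] increments precede, all of them are removed and the case [j == 0] of [dec1]
    applies. *)
 pose i := minn q k; have ik : (i <= k)%N by rewrite /i; lia.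
 have := back ik kn; rewrite -/A1; set A1' := J P _ => hA.
 rewrite -(subrK A1' A1) addrC; apply: le_trans (ler_normD _ _) _; apply: lerD; last first.
  apply: le_trans hA _; rewrite ler_wpM2r//; last by rewrite ler_nat /i; lia.
  by rewrite /Y /X /NN !addr_ge0// ?mulr_ge0// mulr_ge0// mulr_ge0// mulr_ge0.
 rewrite /A1' /pair1 J_sum; last by move=> l _; apply: bmf_itg; apply: bmfM.
 apply: le_trans (ler_norm_sum _ _ _) _.
 apply: le_trans (_ : \sum_(l < N) (eta0 * B1) <= _); last by rewrite sumr_const card_ord -(mulr_natl (eta0 * _)).
 apply: ler_sum => l _.
 rewrite (_ : (fun om => _) = (fun om => H1 (psum (k - i) om) l * w k om l)); last by apply/funext => om; rewrite mulrC.
 apply: (dec1 l (sm1 sm l) (fun x => H1b x l) kn).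
 by rewrite /i; case: (leqP q k) => h; apply/orP; [right|left]; lia.
have h3 : `|A2 - n%:R^-1 * A4| <= X + B2 * eta.
 pose C := \sum_l \sum_m J P (fun om => H2 (psum (k - q) om) l m) * J P (fun om => w k om l * w k om m).
 rewrite (_ : A2 - _ = (A2 - C) + (C - n%:R^-1 * A4)); last by ring.
 apply: le_trans (ler_normD _ _) _; apply: lerD; first exact: X2.
 rewrite (_ : C - _ = \sum_l \sum_m J P (fun om => H2 (psum (k - q) om) l m) * (J P (fun om => w k om l * w k om m) - (if l == m then n%:R^-1 else 0))).
  by apply: absJ2 => l m; exact: var.
 rewrite /A4 J_sum; last by move=> l _; exact: bmf_itg.
 rewrite mulr_sumr /C -sumrB; apply: eq_bigr => l _.
 rewrite [in RHS](eq_bigr _ (fun m _ => mulrBr _ _ _)) sumrB; congr (_ - _).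
 rewrite (bigD1 l)//= eqxx big1 ?addr0 1?mulrC// => m ml; by rewrite eq_sym (negbTE ml) mulr0.
have h4 : `|A4 - A3| <= K * (q%:R * e0).
 have [z [zE zb]] := far k.
 have q0 : 0 <= q%:R * e0 by rewrite mulr_ge0.
 by apply: J_close => // om; rewrite zE distrC; exact: (smooth_diag (psum (k - q) om) q0 (zb om) sm).
have h5 : `|Z - (A0 + 2^-1 * (n%:R^-1 * A3))| <= K * (Num.sqrt n%:R^-1) ^+ 3.
 have b3 : bmf (fun om => 2^-1 * (n%:R^-1 * \sum_l H2 (psum k om) l l)) by do 2 (apply: bmfM; first exact: bmf_cst).
 rewrite /A0 /A3 -J_Z; last exact: bmf_itg.
 rewrite -J_Z; last by apply: itgZ; exact: bmf_itg.
 rewrite -J_D; [|exact: bmf_itg..].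
 have sr := smooth_radem (Num.sqrt n%:R^-1) sm.
 apply: J_close => //; first exact: (bG k (sm0 sr) (sb0 sr)).
  exact: bmfD.
 move=> om; rewrite opprD addrA mulrA -[X in 2^-1 * X * _]s2.
 exact: radem_expand sm.
rewrite (_ : A - Z = (A - (A0 + A1 + 2^-1 * A2)) + A1 + 2^-1 * (A2 - n%:R^-1 * A4) + 2^-1 * (n%:R^-1 * (A4 - A3)) - (Z - (A0 + 2^-1 * (n%:R^-1 * A3)))); last by move: (n%:R^-1) => nv; field.
have h6 : `|2^-1 * (A2 - n%:R^-1 * A4)| <= X + B2 * eta.
 by rewrite normrM ger0_norm ?invr_ge0// -[leRHS]mul1r ler_pM ?invr_ge0// invf_le1// ler1n.
have h7 : `|2^-1 * (n%:R^-1 * (A4 - A3))| <= n%:R^-1 * (K * (q%:R * e0)).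
 rewrite normrM ger0_norm ?invr_ge0// -[leRHS]mul1r ler_pM ?invr_ge0//; first by rewrite invf_le1// ler1n.
 by rewrite normrM ger0_norm ?invr_ge0// ler_wpM2l ?invr_ge0.
apply: le_trans (ler_normB _ _) _; rewrite /step_err; apply: lerD => //.
apply: le_trans (ler_normD _ _) _; rewrite addrA; apply: le_trans (lerD (ler_normD _ _) h7) _.
rewrite lerD2r; apply: lerD => //.
by apply: le_trans (ler_normD _ _) _; apply: lerD.
Qed.

End step.

(** Replacing increments from the last one backwards makes the signs act as an operator on [H], so
    they need no probability space of their own, and the iterates stay smooth with the same
    constants. *)
Lemma lindeberg H H1 H2 : smooth K B1 B2 H H1 H2 ->
 `|J P (fun om => H (psum n om)) - iter n (radem (Num.sqrt n%:R^-1)) H (fun=> 0)| <= n%:R * step_err.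
Proof.
move=> sm.
have smi i : exists H1' H2', smooth K B1 B2 (iter i (radem (Num.sqrt n%:R^-1)) H) H1' H2'.
 elim: i => [|i [H1' [H2' s']]]; first by exists H1, H2.
 by eexists; eexists; rewrite iterS; exact: (smooth_radem _ s').
have h i : (i <= n)%N -> `|J P (fun om => H (psum n om)) - J P (fun om => iter i (radem (Num.sqrt n%:R^-1)) H (psum (n - i) om))| <= i%:R * step_err.
 elim: i => [|i ih] ni; first by rewrite subn0 subrr normr0 mul0r.
 have [H1' [H2' s']] := smi i.
 set A := J P _; set C := J P _; pose B := J P (fun om => iter i (radem (Num.sqrt n%:R^-1)) H (psum (n - i) om)).
 rewrite (_ : A - C = (A - B) + (B - C)); last by ring.
 rewrite -natr1 mulrDl mul1r; apply: le_trans (ler_normD _ _) _; apply: lerD; first by apply: ih; exact: ltnW.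
 rewrite /B /C (_ : (n - i)%N = (n - i.+1).+1); last by lia.
 by apply: (lindeberg_step s'); lia.
have := h n (leqnn n); rewrite subnn.
rewrite (_ : (fun om => iter n _ H (psum 0 om)) = (fun=> iter n (radem (Num.sqrt n%:R^-1)) H (fun=> 0))) ?Ex_cst//.
by apply/funext => om; congr (iter _ _ _ _); apply/funext => l; rewrite /psum big_ord0.
Qed.

End lindeberg.

(** * Gaussian smoothing in one dimension *)

Section gaussian.
Context {R : realType}.
Local Notation leb := (@lebesgue_measure R).
Local Notation npdf := (@normal_pdf R).
Implicit Types (s m x y z : R) (h : R -> R).

Let kp : R := normal_peak 1.

Let kp_gt0 : 0 < kp. Proof. by rewrite normal_peak_gt0// oner_neq0. Qed.

Lemma npdfE m s y : 0 < s -> npdf m s y = s^-1 * kp * expR (- ((y - m) ^+ 2 / (2 * s ^+ 2))).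
Proof.
move=> s0; rewrite /normal_pdf gt_eqF// /normal_fun /kp /normal_peak.
congr (_ * _); last by rewrite mulNr mulr_natl.
by rewrite expr1n mul1r -mulrnAr sqrtrM ?sqr_ge0// sqrtr_sqr gtr0_norm// invfM.
Qed.

Let npdf_ge0 m s y : 0 <= npdf m s y. Proof. exact: normal_pdf_ge0. Qed.
Let npdf_meas m s : measurable_fun setT (npdf m s). Proof. exact: measurable_normal_pdf. Qed.

Let itg_npdf m s : itg leb (npdf m s).
Proof. by apply/itgP; exact: integrable_normal_pdf. Qed.

Let J_npdf m s : J leb (npdf m s) = 1.
Proof. by rewrite /J integral_normal_pdf. Qed.

Let npdf_bmf m s h : bmf h -> itg leb (fun y => npdf m s y * h y).
Proof.
move=> [mh [M hM]]; have mn := npdf_meas m s; apply: itg_dom (itgZr M (itg_npdf m s)); first by mf.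
by move=> y; rewrite normrM ger0_norm// ler_wpM2l.
Qed.

Let dd_npdf s y : 0 < s -> dd (npdf 0 s) y (- (y / s ^+ 2) * npdf 0 s y).
Proof.
move=> s0; rewrite (_ : npdf 0 s = fun y => s^-1 * kp * expR (- ((y - 0) ^+ 2 / (2 * s ^+ 2)))); last first.
 by apply/funext => z; rewrite npdfE.
by dauto; rewrite expr1; field; rewrite gt_eqF.
Qed.

(** A quartic factor is absorbed by half of the Gaussian exponent, leaving the density with doubled
    variance. *)
Let dom4 s y : 0 < s -> y ^+ 4 * npdf 0 s y <= 64 * s ^+ 4 * Num.sqrt 2 * npdf 0 (s * Num.sqrt 2) y.
Proof.
move=> s0; have q0 : 0 < Num.sqrt 2 :> R by rewrite sqrtr_gt0.
have q2 : Num.sqrt 2 ^+ 2 = 2 :> R by rewrite sqr_sqrtr.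
rewrite !npdfE// ?mulr_gt0// subr0 exprMn q2.
pose zz := y ^+ 2 / (4 * s ^+ 2).
have z0 : 0 <= zz by rewrite divr_ge0 ?sqr_ge0// mulr_ge0// sqr_ge0.
have -> : y ^+ 2 / (2 * s ^+ 2) = zz + zz by rewrite /zz; field; rewrite gt_eqF.
have -> : y ^+ 2 / (2 * (s ^+ 2 * 2)) = zz by rewrite /zz; field; rewrite gt_eqF.
have -> : y ^+ 4 = 64 * s ^+ 4 * (zz / 2) ^+ 2 by rewrite /zz; field; rewrite gt_eqF.
have h : (zz / 2) ^+ 2 * expR (- zz) <= 1.
 have -> : expR (- zz) = (expR (zz / 2) ^+ 2)^-1 by rewrite -expRM_natl -expRN; congr expR; field.
 have z2 : 0 <= zz / 2 by rewrite divr_ge0.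
 rewrite ler_pdivrMr ?exprn_gt0 ?expR_gt0// mul1r; apply: lerXn2r; rewrite ?nnegrE ?expR_ge0//.
 by apply: le_trans (expR_ge1Dx _); rewrite lerDr.
rewrite invfM opprD expRD.
have E0 := expR_gt0 (- zz); set E := expR _ in h E0 *.
rewrite (_ : _ * (s^-1 * kp * (E * E)) = (64 * s ^+ 4 * (s^-1 * kp) * E) * ((zz / 2) ^+ 2 * E)); last by ring.
rewrite (_ : _ * (s^-1 / Num.sqrt 2 * kp * E) = (64 * s ^+ 4 * (s^-1 * kp) * E) * 1); last by field; rewrite !gt_eqF.
by rewrite ler_wpM2l// !mulr_ge0 ?exprn_ge0 ?invr_ge0 ?(ltW s0) ?(ltW kp_gt0) ?(ltW E0).
Qed.

Let itg4 s : 0 < s -> itg leb (fun y => npdf 0 s y * y ^+ 4).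
Proof.
move=> s0; have mn := npdf_meas 0 s.
apply: itg_dom (itgZ (64 * s ^+ 4 * Num.sqrt 2) (itg_npdf 0 (s * Num.sqrt 2))); first by mf.
move=> y; rewrite ger0_norm; last by rewrite mulr_ge0// exprn_even_ge0.
by rewrite mulrC; exact: dom4.
Qed.

Let itgk s (k : R -> R) : 0 < s -> measurable_fun setT k -> (forall y, `|k y| <= 2 * (1 + y ^+ 4)) -> itg leb (fun y => npdf 0 s y * k y).
Proof.
move=> s0 mk kb; have mn := npdf_meas 0 s.
apply: itg_dom (itgZ 2 (itgD (itg_npdf 0 s) (itg4 s0))); first by mf.
move=> y; rewrite normrM ger0_norm// -[X in X + _]mulr1 -mulrDr mulrCA ler_wpM2l//; exact: kb.
Qed.

Let y4 y : y ^+ 4 = (y ^+ 2) ^+ 2. Proof. by rewrite -exprM. Qed.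
Let itg1 s : 0 < s -> itg leb (fun y => npdf 0 s y * y).
Proof.
move=> s0; apply: itgk => //.
move=> y; rewrite y4 -(real_normK (num_real y)); move: (`|y|) => b.
have := sqr_ge0 (b - 1); have := sqr_ge0 (b ^+ 2 - 1); have := sqr_ge0 (b ^+ 2); lra.
Qed.
Let itg2 s : 0 < s -> itg leb (fun y => npdf 0 s y * y ^+ 2).
Proof.
move=> s0; apply: itgk => //.
move=> y; rewrite ger0_norm ?sqr_ge0//; have := sqr_ge0 (y ^+ 2 - 1); have := sqr_ge0 (y ^+ 2); rewrite y4 !sqrrB; lra.
Qed.

Let FTC_line (G g : R -> R) : (forall y, dd G y (g y)) -> continuous g -> itg leb g ->
 G n.+1%:R - G (- n.+1%:R) @[n --> \oo] --> (0 : R) -> J leb g = 0.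
Proof.
move=> dG cg ig cv.
have l1 : J leb (fun y => \1_(`[- n.+1%:R, n.+1%:R]%classic) y * g y) @[n --> \oo] --> J leb g.
 apply: (@J_dct _ _ _ leb (fun (n : nat) (y : R) => \1_(`[- n.+1%:R, n.+1%:R]%classic) y * g y) g (fun y : R => `|g y|) _ (itg_norm ig) _ _).2.
 - move=> n; apply: meas_M; [exact: measurable_indic|exact: itg_meas ig].
 - by move=> n y; rewrite normrM indic_cc ler_piMl//; case: (_ <= _ <= _) => /=; rewrite ?normr1 ?normr0.
 - move=> y; apply: cvg_near_cst; exists (Num.trunc `|y|) => // n /= yn.
  rewrite indic_cc -ler_norml (_ : `|y| <= n.+1%:R) ?mul1r// ltW// (lt_le_trans (truncnS_gt _))// ler_nat ltnS//.
have e n : J leb (fun y => \1_(`[- n.+1%:R, n.+1%:R]%classic) y * g y) = G n.+1%:R - G (- n.+1%:R).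
 by apply: FTC2 => //; rewrite (@le_trans _ _ 0)// oppr_le0.
rewrite (_ : (fun n => _) = (fun n => G n.+1%:R - G (- n.+1%:R))) in l1; last by apply/funext.
by rewrite -(cvg_lim _ l1)// (cvg_lim _ cv).
Qed.

Let npdf_even s y : 0 < s -> npdf 0 s (- y) = npdf 0 s y.
Proof. by move=> s0; rewrite !npdfE// !subr0 sqrrN. Qed.

Let npdf_cont s : 0 < s -> continuous (npdf 0 s).
Proof. by move=> s0; apply: continuous_normal_pdf; rewrite gt_eqF. Qed.

Let ycont : continuous (fun y : R => y). Proof. by move=> y; exact: cvg_id. Qed.
Let Xcont n : continuous (fun y : R => y ^+ n). Proof. exact: exprn_continuous. Qed.

Let mom1 s : 0 < s -> J leb (fun y => npdf 0 s y * y) = 0.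
Proof.
move=> s0.
apply: (@FTC_line (fun y => - s ^+ 2 * npdf 0 s y)).
- by move=> y; have dn z := dd_npdf z s0; apply: dd_eq; [apply: dd_M; [exact: dd_cst|exact: dn]|cbv beta; field; rewrite gt_eqF].
- by move=> y; apply: cvgM; [exact: npdf_cont|exact: ycont].
- exact: itg1.
- rewrite (_ : (fun n => _) = (fun=> 0)); first exact: cvg_cst.
 by apply/funext => n; rewrite npdf_even// subrr.
Qed.

Let lim4 s k : 0 < s -> (k <= 3)%N -> n.+1%:R ^+ k * npdf 0 s n.+1%:R @[n --> \oo] --> (0 : R).
Proof.
move=> s0 k3; pose C := 64 * s ^+ 4 * Num.sqrt 2 * normal_peak (s * Num.sqrt 2).
have sq : s * Num.sqrt 2 != 0 by rewrite mulf_neq0 ?gt_eqF// sqrtr_gt0.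
have b (n : nat) : n.+1%:R ^+ k * npdf 0 s n.+1%:R <= C * (n.+1%:R)^-1.
 rewrite ler_pdivlMr// mulrAC -exprSr.
 apply: le_trans (_ : n.+1%:R ^+ 4 * npdf 0 s n.+1%:R <= _).
  by rewrite ler_wpM2r// ler_weXn2l ?ler1n//; lia.
 apply: le_trans (dom4 _ s0) _; rewrite ler_wpM2l ?normal_pdf_ub//.
 by rewrite !mulr_ge0 ?exprn_ge0 ?(ltW s0) ?sqrtr_ge0.
apply: (@squeeze_cvgr _ _ _ _ (fun=> 0) (fun n => C * (n.+1%:R)^-1)).
- by apply: nearW => n; rewrite b mulr_ge0 ?exprn_ge0.
- exact: cvg_cst.
- rewrite -(mulr0 C); apply: cvgM; first exact: cvg_cst.
 exact: (@cvg_harmonic R).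
Qed.

Let cvgZ0 (u : nat -> R) (c : R) : u n @[n --> \oo] --> (0 : R) -> c * u n @[n --> \oo] --> (0 : R).
Proof. by move=> h; rewrite -(mulr0 c); apply: cvgM; [exact: cvg_cst|exact: h]. Qed.

Let ynpdf_cont s k : 0 < s -> continuous (fun y => npdf 0 s y * y ^+ k).
Proof. by move=> s0 y; apply: cvgM; [exact: npdf_cont|exact: Xcont]. Qed.

Let mom2 s : 0 < s -> J leb (fun y => npdf 0 s y * y ^+ 2) = s ^+ 2.
Proof.
move=> s0; suff : J leb (fun y => npdf 0 s y * y ^+ 2 - s ^+ 2 * npdf 0 s y) = 0.
 by rewrite J_B ?J_Z ?J_npdf//; [move=> /eqP; rewrite subr_eq0 mulr1 => /eqP|exact: itg2|exact: itgZ].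
apply: (@FTC_line (fun y => - s ^+ 2 * (y * npdf 0 s y))).
- move=> y; have dn z := dd_npdf z s0; apply: dd_eq.
  by apply: dd_M; [exact: dd_cst|apply: dd_M; [exact: dd_id|exact: dn]].
 by cbv beta; field; rewrite gt_eqF.
- move=> y; apply: cvgB; first exact: ynpdf_cont.
 by apply: cvgM; [exact: cvg_cst|exact: npdf_cont].
- by apply: itgB; [exact: itg2|exact: itgZ].
- rewrite (_ : (fun n => _) = (fun n => (- 2 * s ^+ 2) * (n.+1%:R ^+ 1 * npdf 0 s n.+1%:R))).
  exact: (cvgZ0 _ (@lim4 s 1 s0 isT)).
 by apply/funext => n; rewrite npdf_even// expr1; ring.
Qed.

Let mom4 s : 0 < s -> J leb (fun y => npdf 0 s y * y ^+ 4) = 3 * s ^+ 4.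
Proof.
move=> s0; suff : J leb (fun y => npdf 0 s y * y ^+ 4 - (3 * s ^+ 2) * (npdf 0 s y * y ^+ 2)) = 0.
 rewrite J_B ?J_Z ?mom2//; [|exact: itg2|exact: itg4|by apply: itgZ; exact: itg2].
 by move=> /eqP; rewrite subr_eq0 => /eqP ->; ring.
apply: (@FTC_line (fun y => - s ^+ 2 * (y ^+ 3 * npdf 0 s y))).
- move=> y; have dn z := dd_npdf z s0; apply: dd_eq.
  by apply: dd_M; [exact: dd_cst|apply: dd_M; [apply: dd_X; exact: dd_id|exact: dn]].
 by rewrite /=; field; rewrite gt_eqF.
- move=> y; apply: cvgB; first exact: ynpdf_cont.
 by apply: cvgM; [exact: cvg_cst|exact: ynpdf_cont].
- by apply: itgB; [exact: itg4|apply: itgZ; exact: itg2].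
- rewrite (_ : (fun n => _) = (fun n => (- 2 * s ^+ 2) * (n.+1%:R ^+ 3 * npdf 0 s n.+1%:R))).
  exact: (cvgZ0 _ (@lim4 s 3 s0 isT)).
 by apply/funext => n; rewrite npdf_even//; ring.
Qed.

Definition Ns s h x := J leb (fun y => npdf 0 s y * h (x + y)).
Definition Rs s h x : R := 2^-1 * (h (x + s) + h (x - s)).
Definition taylor3 (K : R) h := exists h1 h2, [/\ bmf h, bmf h1, bmf h2 &
 forall x v, `|h (x + v) - h x - v * h1 x - 2^-1 * v ^+ 2 * h2 x| <= K * `|v| ^+ 3].

Let bmf_shift h x : bmf h -> bmf (fun y => h (x + y)).
Proof. by move=> bh; bm. Qed.

Let Ns_itg s h x : bmf h -> itg leb (fun y => npdf 0 s y * h (x + y)).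
Proof. by move=> bh; apply: npdf_bmf; exact: bmf_shift. Qed.

Lemma Ns_bound s h M x : measurable_fun setT h -> (forall y, `|h y| <= M) -> `|Ns s h x| <= M.
Proof.
move=> mh hM; have mn := npdf_meas 0 s.
have -> : M = J leb (fun y => npdf 0 s y * M) by rewrite J_Zr// J_npdf mul1r.
have mx : measurable_fun setT (fun y : R => x + y) by apply: meas_D; [exact: measurable_cst|exact: measurable_id].
have m1 : measurable_fun setT (fun y : R => npdf 0 s y * h (x + y)).
 by apply: meas_M; [exact: mn|exact: (measurableT_comp mh mx)].
apply: J_abs.
- exact: m1.
- exact: (itgZr M (itg_npdf 0 s)).
- by move=> y; rewrite normrM (ger0_norm (npdf_ge0 _ _ _)); apply: ler_wpM2l.
Qed.

Lemma Ns_bmf s h : bmf h -> bmf (Ns s h).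
Proof.
move=> bh; have [mh [M hM]] := bh; apply: (@bmf_intro _ _ _ M); last by move=> x; exact: Ns_bound.
have mn := npdf_meas 0 s.
have [||i _ _ _] := @J_swap _ _ _ _ _ (\d_(0 : R)) leb (fun x y : R => npdf 0 s y * h (x + y)) (fun=> 1) (fun y => npdf 0 s y * M) _ (itg_cst _ 1) (itgZr M (itg_npdf 0 s)).
- by mf.
- by move=> x y; rewrite mul1r normrM ger0_norm// ler_wpM2l.
- exact: itg_meas i.
Qed.

Lemma Ns_taylor3 s K h : taylor3 K h -> taylor3 K (Ns s h).
Proof.
move=> [h1 [h2 [b0 b1 b2 T]]]; exists (Ns s h1), (Ns s h2); split; try exact: Ns_bmf.
move=> x v.
have i0 := Ns_itg s x b0; have i1 := Ns_itg s x b1; have i2 := Ns_itg s x b2; have i3 := Ns_itg s (x + v) b0.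
have ia := itgB (itgB i3 i0) (itgZ v i1); have ib := itgZ (2^-1 * v ^+ 2) i2.
rewrite /Ns -(J_Z v i1) -(J_Z _ i2) -(J_B i3 i0) -(J_B (itgB i3 i0) (itgZ v i1)) -(J_B ia ib).
have eK : K * `|v| ^+ 3 = J leb (fun y => npdf 0 s y * (K * `|v| ^+ 3)) by rewrite J_Zr// J_npdf mul1r.
rewrite [leRHS]eK; apply: J_abs; [exact: itg_meas (itgB ia ib)|exact: (itgZr _ (itg_npdf 0 s))|move=> y].
rewrite (_ : _ - _ = npdf 0 s y * (h (x + y + v) - h (x + y) - v * h1 (x + y) - 2^-1 * v ^+ 2 * h2 (x + y))); last first.
 by rewrite (addrAC x v y); ring.
by rewrite normrM (ger0_norm (npdf_ge0 _ _ _)) ler_wpM2l.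
Qed.

(** The two-point law and the normal law share mean and variance, so only third-order remainders are
    left. On the normal side [|y| ^+ 3 <= y ^+ 4 / (2 * s) + y ^+ 2 * s / 2] avoids an odd absolute
    moment and gives [2 * K * s ^+ 3]. *)
Lemma Rs_Ns s K h x : 0 < s -> taylor3 K h -> `|Rs s h x - Ns s h x| <= 3 * K * s ^+ 3.
Proof.
move=> s0 [h1 [h2 [b0 b1 b2 T]]].
have h3 : `|Rs s h x - (h x + 2^-1 * s ^+ 2 * h2 x)| <= K * s ^+ 3.
 have := T x s; have := T x (- s); rewrite normrN (gtr0_norm s0) sqrrN.
 set u := h (x - s); set v := h (x + s) => t1 t2.
 rewrite /Rs -/u -/v (_ : _ - _ = 2^-1 * (u - h x - - s * h1 x - 2^-1 * s ^+ 2 * h2 x + (v - h x - s * h1 x - 2^-1 * s ^+ 2 * h2 x))); last by field.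
 rewrite normrM ger0_norm ?invr_ge0// ler_pdivrMl//; apply: le_trans (ler_normD _ _) _; lra.
have K0 : 0 <= K.
 by have := le_trans (normr_ge0 _) (T 0 1); rewrite normr1 expr1n mulr1.
have i0 := Ns_itg s x b0.
have e : h x + 2^-1 * s ^+ 2 * h2 x = J leb (fun y => npdf 0 s y * h x + (npdf 0 s y * y) * h1 x + (npdf 0 s y * y ^+ 2) * (2^-1 * h2 x)).
 rewrite J_D; [|by apply: itgD; [exact: itgZr|apply: itgZr; exact: itg1]|by apply: itgZr; exact: itg2].
 rewrite J_D; [|exact: itgZr|by apply: itgZr; exact: itg1].
 rewrite !J_Zr//; [|exact: itg2|exact: itg1].
 by rewrite J_npdf mom1// mom2//; ring.
have h4 : `|Ns s h x - (h x + 2^-1 * s ^+ 2 * h2 x)| <= 2 * K * s ^+ 3.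
 have ie : itg leb (fun y => npdf 0 s y * h x + (npdf 0 s y * y) * h1 x + (npdf 0 s y * y ^+ 2) * (2^-1 * h2 x)).
  by apply: itgD; [apply: itgD; [exact: itgZr|apply: itgZr; exact: itg1]|apply: itgZr; exact: itg2].
 rewrite e /Ns -J_B//.
 have -> : 2 * K * s ^+ 3 = J leb (fun y => (npdf 0 s y * y ^+ 4) * (K / (2 * s)) + (npdf 0 s y * y ^+ 2) * (K * s / 2)).
  rewrite J_D; [|by apply: itgZr; exact: itg4|by apply: itgZr; exact: itg2].
  by rewrite !J_Zr ?mom4 ?mom2//; [field; rewrite gt_eqF|exact: itg2|exact: itg4].
 apply: J_abs; [exact: itg_meas (itgB i0 ie)|by apply: itgD; apply: itgZr; [exact: itg4|exact: itg2]|move=> y].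
 rewrite (_ : _ - _ = npdf 0 s y * (h (x + y) - h x - y * h1 x - 2^-1 * y ^+ 2 * h2 x)); last by ring.
 rewrite [leRHS](_ : _ = npdf 0 s y * (K * (y ^+ 4 / (2 * s) + y ^+ 2 * (s / 2)))); last by field; rewrite gt_eqF.
 rewrite normrM (ger0_norm (npdf_ge0 _ _ _)) ler_wpM2l//; apply: le_trans (T x y) _.
 rewrite ler_wpM2l//.
 have n2 : `|y| ^+ 2 = y ^+ 2 by rewrite real_normK ?num_real.
 have n4 : `|y| ^+ 4 = y ^+ 4 by rewrite y4 -n2 -exprM.
 rewrite -n4 -n2 -subr_ge0.
 rewrite (_ : _ - _ = `|y| ^+ 2 * (`|y| - s) ^+ 2 / (2 * s)); last by field; rewrite gt_eqF.
 by apply: divr_ge0; [rewrite mulr_ge0 ?sqr_ge0|rewrite mulr_ge0// ltW].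
rewrite (_ : _ - _ = (Rs s h x - (h x + 2^-1 * s ^+ 2 * h2 x)) - (Ns s h x - (h x + 2^-1 * s ^+ 2 * h2 x))); last by ring.
by apply: le_trans (ler_normB _ _) _; lra.
Qed.

Let NsE s h x : 0 < s -> bmf h -> Ns s h x = J leb (fun z => npdf x s z * h z).
Proof.
move=> s0 bh; rewrite -(J_shift x (npdf_bmf x s bh)).2; congr J; apply/funext => y.
by rewrite !npdfE// subr0 addrK addrC.
Qed.

(** Completing the square turns the product of the two densities into the density of the sum times a
    density of mass 1 in the intermediate variable. *)
Lemma Ns_comp s t h x : 0 < s -> 0 < t -> bmf h -> Ns s (Ns t h) x = Ns (Num.sqrt (s ^+ 2 + t ^+ 2)) h x.
Proof.
move=> s0 t0 bh; have [mh [M hM]] := bh; set c := Num.sqrt _.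
have st0 : 0 < s ^+ 2 + t ^+ 2 by rewrite ltr_pwDl ?exprn_gt0// sqr_ge0.
have c0 : 0 < c by rewrite sqrtr_gt0.
have c2 : c ^+ 2 = s ^+ 2 + t ^+ 2 by rewrite sqr_sqrtr// ltW.
have st : 0 < s * t / c by rewrite divr_gt0// mulr_gt0.
have prodE y z : npdf x s y * npdf y t z = npdf x c z * npdf ((x * t ^+ 2 + z * s ^+ 2) / c ^+ 2) (s * t / c) y.
 rewrite !npdfE//.
 rewrite (_ : s^-1 * kp * _ * (t^-1 * kp * _) = (s^-1 * t^-1 * kp * kp) * expR (- ((y - x) ^+ 2 / (2 * s ^+ 2)) - (z - y) ^+ 2 / (2 * t ^+ 2))); last by rewrite expRD; ring.
 rewrite (_ : c^-1 * kp * _ * _ = (c^-1 * (s * t / c)^-1 * kp * kp) * expR (- ((z - x) ^+ 2 / (2 * c ^+ 2)) - (y - (x * t ^+ 2 + z * s ^+ 2) / c ^+ 2) ^+ 2 / (2 * (s * t / c) ^+ 2))); last by rewrite expRD; ring.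
 congr (_ * expR _); first by field; rewrite !gt_eqF.
 rewrite (_ : (s * t / c) ^+ 2 = s ^+ 2 * t ^+ 2 / c ^+ 2); last by rewrite expr_div_n exprMn.
 by rewrite c2; field; rewrite ?gt_eqF// ?addr_gt0 ?exprn_gt0.
have mn a b := npdf_meas a b.
have mm : measurable_fun setT (fun p : R * R => npdf x s p.1 * npdf p.1 t p.2 * h p.2).
 rewrite (_ : (fun p => _) = (fun p : R * R => npdf x s p.1 * (t^-1 * kp * expR (- ((p.2 - p.1) ^+ 2 / (2 * t ^+ 2)))) * h p.2)); last first.
  by apply/funext => p; rewrite (npdfE p.1).
 by have m1 := mn x s; mf.
have [|||_ _ e _] := @J_fubini _ _ _ _ _ leb leb (fun y z => npdf x s y * npdf y t z * h z) mm.
- by move=> y; rewrite (_ : (fun z => _) = fun z => npdf x s y * (npdf y t z * h z)); [apply: itgZ; exact: npdf_bmf|apply/funext => z; rewrite mulrA].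
- move=> z; rewrite (_ : (fun y => _) = fun y => (npdf x c z * h z) * npdf ((x * t ^+ 2 + z * s ^+ 2) / c ^+ 2) (s * t / c) y).
  exact: itgZ.
 by apply/funext => y; rewrite prodE; ring.
- exists (fun y => npdf x s y * M); first exact: itgZr.
 move=> y; rewrite (_ : (fun z => _) = (fun z => npdf x s y * (npdf y t z * `|h z|))).
  rewrite J_Z; last by apply: npdf_bmf; exact: bmf_norm.
  rewrite ler_wpM2l// -[leRHS]mul1r -(J_npdf y t) -J_Zr//; apply: J_le; [by apply: npdf_bmf; exact: bmf_norm|exact: itgZr|].
  by move=> z; rewrite ler_wpM2l.
 by apply/funext => z; rewrite !normrM !(ger0_norm (npdf_ge0 _ _ _)) mulrA.
rewrite NsE//; last exact: Ns_bmf.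
rewrite NsE// (_ : (fun z => _) = (fun y => J leb (fun z => npdf x s y * npdf y t z * h z))); last first.
 apply/funext => y; rewrite NsE// -J_Z; last exact: npdf_bmf.
 by congr J; apply/funext => z; rewrite mulrA.
rewrite e; congr J; apply/funext => z.
rewrite (_ : (fun y => _) = fun y => (npdf x c z * h z) * npdf ((x * t ^+ 2 + z * s ^+ 2) / c ^+ 2) (s * t / c) y).
 by rewrite J_Z// J_npdf mulr1.
by apply/funext => y; rewrite prodE; ring.
Qed.

Let Ns_iter s h n x : 0 < s -> bmf h -> iter n.+1 (Ns s) h x = Ns (Num.sqrt n.+1%:R * s) h x.
Proof.
move=> s0 bh; elim: n x => [|n ih] x; first by rewrite sqrtr1 mul1r.
rewrite iterS (_ : iter n.+1 (Ns s) h = Ns (Num.sqrt n.+1%:R * s) h); last by apply/funext.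
have q0 : 0 < Num.sqrt n.+1%:R :> R by rewrite sqrtr_gt0.
transitivity (Ns (Num.sqrt (s ^+ 2 + (Num.sqrt n.+1%:R * s) ^+ 2)) h x); first exact: (Ns_comp x s0 (mulr_gt0 q0 s0) bh).
congr (Ns _ h x).
rewrite exprMn sqr_sqrtr// -[X in X + _]mul1r -mulrDl -(natr1 n.+1) addrC sqrtrM ?sqrtr_sqr ?gtr0_norm//.
Qed.

Let Rs_contr s h g n M x : (forall y, `|h y - g y| <= M) -> `|iter n (Rs s) h x - iter n (Rs s) g x| <= M.
Proof.
elim: n x => [|n ih] x hg; first exact: hg.
rewrite !iterS /Rs -mulrBr normrM ger0_norm ?invr_ge0// ler_pdivrMl//.
rewrite opprD addrACA (le_trans (ler_normD _ _))//.
by have := ih (x + s) hg; have := ih (x - s) hg; lra.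
Qed.

Lemma Rs_01 s h n x : (forall y, 0 <= h y <= 1) -> 0 <= iter n (Rs s) h x <= 1.
Proof.
move=> h01; elim: n x => [|n ih] x; first exact: h01.
rewrite iterS /Rs; have /andP[u1 u2] := ih (x + s); have /andP[v1 v2] := ih (x - s).
by apply/andP; split; lra.
Qed.

(** [Rs] is a contraction in sup norm and [Ns] preserves [taylor3], so the errors of the [n] steps
    of variance [1 / n] simply add. *)
Lemma Rs_iter K h n x : (0 < n)%N -> taylor3 K h ->
 `|iter n (Rs (Num.sqrt n%:R^-1)) h x - Ns 1 h x| <= n%:R * (3 * K * (Num.sqrt n%:R^-1) ^+ 3).
Proof.
move=> n0 T; set s := Num.sqrt _; have s0 : 0 < s by rewrite sqrtr_gt0 invr_gt0 ltr0n.
have bh : bmf h by case: T => ? [? []].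
have -> : Ns 1 h x = iter n (Ns s) h x.
 rewrite -(prednK n0) (Ns_iter n.-1 x s0 bh) prednK//; congr (Ns _ h x); rewrite /s -sqrtrM//.
 by rewrite mulfV ?sqrtr1// pnatr_eq0 -lt0n.
elim: (n) h T {bh} x => [|m ih] h T x; first by rewrite subrr normr0 mul0r.
rewrite !iterSr (_ : _ - _ = (iter m (Rs s) (Rs s h) x - iter m (Rs s) (Ns s h) x) + (iter m (Rs s) (Ns s h) x - iter m (Ns s) (Ns s h) x)); last by ring.
rewrite (le_trans (ler_normD _ _))// -(natr1 m) mulrDl mul1r addrC lerD//; first by apply: ih; exact: Ns_taylor3.
by apply: Rs_contr => y; exact: Rs_Ns.
Qed.

End gaussian.

(** * Reduction of sign averages to one dimension *)

Section product.
Context {R : realType} (N : nat).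

(** Summing a product of one-coordinate functions over all sign vectors is the expansion of a
    product of two-term sums. *)
Lemma radem_prod (s : R) (g : 'I_N -> R -> R) (x : 'I_N -> R) :
 radem s (fun y => \prod_l g l (y l)) x = \prod_l Rs s (g l) (x l).
Proof.
rewrite /radem /avg /Rs.
rewrite (eq_bigr (fun l => \sum_(b : bool) 2^-1 * g l (x l + (if b then s else - s)))); last first.
 by move=> l _; rewrite big_bool /= mulrDr.
rewrite bigA_distr_bigA /= mulr_sumr; apply: eq_bigr => f _.
by rewrite big_split/= prodr_const card_ord; congr (_ * _).
Qed.

Lemma radem_iter_prod (s : R) (g : R -> R) n (x : 'I_N -> R) :
 iter n (radem s) (fun y => \prod_l g (y l)) x = \prod_l iter n (Rs s) g (x l).
Proof.
elim: n x => [//|n ih] x; rewrite iterS (_ : iter n _ _ = (fun y => \prod_l iter n (Rs s) g (y l))); last by apply/funext.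
exact: (radem_prod s (fun=> iter n (Rs s) g)).
Qed.

Definition softind_1 (c b y : R) := expR (- (c * (expR (b * y) + expR (- (b * y))))).

Lemma softind_prod (c b : R) : softind (N := N) c b = fun y => \prod_l softind_1 c b (y l).
Proof.
apply/funext => y; rewrite /softind /softind_1.
elim/big_ind2: _ => [|u v u' v' e1 e2|l _]//; first by rewrite oppr0 expR0.
by rewrite opprD expRD e1 e2.
Qed.
End product.

Lemma softind_taylor3 {R : realType} (c b : R) : 0 < c -> 0 < b -> taylor3 (40 * b ^+ 3) (softind_1 c b).
Proof.
move=> c0 b0; have sm := @smooth_softind R 1 c b c0 b0.
have e (y : R) : softind c b (fun _ : 'I_1 => y) = softind_1 c b y by rewrite softind_prod big_ord1.
exists (fun y => softind1 c b (fun _ : 'I_1 => y) ord0), (fun y => softind2 c b (fun _ : 'I_1 => y) ord0 ord0); split.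
- rewrite (_ : softind_1 c b = fun y => softind c b (fun _ : 'I_1 => y)); last by apply/funext => y; rewrite e.
 apply: (@bmf_intro _ _ _ 1); last by move=> x; exact: (sb0 sm).
 by apply: (sm0 sm) => l; exact: measurable_id.
- apply: (@bmf_intro _ _ _ b); last by move=> x; have := sb1 sm (fun=> x); rewrite big_ord1.
 by apply: (sm1 sm) => l; exact: measurable_id.
- apply: (@bmf_intro _ _ _ (5 * b ^+ 2)); last by move=> x; have := sb2 sm (fun=> x); rewrite !big_ord1.
 by apply: (sm2 sm) => l; exact: measurable_id.
- move=> x v; have := @st0 _ _ _ _ _ _ _ _ sm (fun=> x) (fun=> v) `|v| (normr_ge0 v) (fun=> lexx _).
 rewrite /pair1 /pair2 !big_ord1 -!e /vadd (_ : _ * `|v| * `|v| * `|v| = 40 * b ^+ 3 * `|v| ^+ 3); last by ring.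
 by rewrite -expr2 -(mulrA 2^-1).
Qed.

Lemma expn_lip {R : realType} (a b : R) n : 0 <= a <= 1 -> 0 <= b <= 1 -> `|a ^+ n - b ^+ n| <= n%:R * `|a - b|.
Proof.
move=> /andP[a0 a1] /andP[b0 b1]; elim: n => [|n ih]; first by rewrite !expr0 subrr normr0 mul0r.
rewrite !exprS (_ : _ - _ = a * (a ^+ n - b ^+ n) + (a - b) * b ^+ n); last by ring.
rewrite (le_trans (ler_normD _ _))// -(natr1 n) [leRHS]mulrDl mul1r !normrM (ger0_norm a0) lerD//.
 by apply: le_trans ih; rewrite ler_piMl.
by rewrite ler_piMr// ger0_norm ?exprn_ge0// exprn_ile1.
Qed.

(** The soft indicator is a product over coordinates, so one factor is compared with its Gaussian
    mean and [expn_lip] accounts for the power [N]. *)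
Lemma radem_gauss {R : realType} (N n : nat) (c b : R) : (0 < n)%N -> 0 < c -> 0 < b ->
 `|iter n (radem (Num.sqrt n%:R^-1)) (softind (N := N) c b) (fun=> 0) - Ns 1 (softind_1 c b) 0 ^+ N|
 <= N%:R * (n%:R * (3 * (40 * b ^+ 3) * (Num.sqrt n%:R^-1) ^+ 3)).
Proof.
move=> n0 c0 b0; rewrite softind_prod radem_iter_prod prodr_const card_ord.
have T := softind_taylor3 c0 b0.
have s01 y : 0 <= softind_1 c b y <= 1.
 by rewrite expR_ge0/= -expR0 ler_expR oppr_le0 mulr_ge0 ?addr_ge0 ?expR_ge0 ?(ltW c0).
apply: le_trans (expn_lip _ _ _) _; last by rewrite ler_wpM2l//; exact: Rs_iter.
- exact: Rs_01.
- have [mh _] : bmf (softind_1 c b) by case: T => ? [? []].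
 have := @Ns_bound R 1 (softind_1 c b) 1 0 mh; rewrite ler_norml => h.
 apply/andP; split.
  by apply: J_ge0 => y; rewrite mulr_ge0 ?normal_pdf_ge0//; case/andP: (s01 (0 + y)).
 by case/andP: (h (fun y => ltac:(by case/andP: (s01 y) => *; rewrite ger0_norm))).
Qed.

(** * Anticoncentration of the Gaussian maximum *)

Section gaussian_cdf.
Context {R : realType}.
Local Notation leb := (@lebesgue_measure R).
Implicit Types (x y z u : R).

(** Distribution function of the absolute value of a standard normal variable. *)
Definition gcdf x : R := J leb (fun y => normal_pdf 0 1 y * (if `|y| <= x then 1 else 0)).

Let np := (@normal_pdf R 0 1).
Let np_ge0 y : 0 <= np y. Proof. exact: normal_pdf_ge0. Qed.
Let mnp : measurable_fun setT np. Proof. exact: measurable_normal_pdf. Qed.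
Let inp m : itg leb (@normal_pdf R m 1). Proof. by apply/itgP; exact: integrable_normal_pdf. Qed.
Let Jnp m : J leb (@normal_pdf R m 1) = 1. Proof. by rewrite /J integral_normal_pdf. Qed.
Let ib (b : R -> bool) : measurable_fun setT b -> itg leb (fun y => np y * (if b y then 1 else 0)).
Proof.
move=> mb; apply: itg_dom (inp 0); first by mf.
by move=> y; rewrite normrM (ger0_norm (np_ge0 _)) ler_piMr//; case: ifP; rewrite ?normr1 ?normr0.
Qed.

Let mle (x : R) : measurable_fun setT (fun y : R => `|y| <= x). Proof. by mf. Qed.

Lemma gcdf_01 x : 0 <= gcdf x <= 1.
Proof.
apply/andP; split; first by apply: J_ge0 => y; rewrite mulr_ge0//; case: ifP.
by rewrite -(Jnp 0); apply: J_le => // [|y]; [exact: (ib (mle x))|rewrite ler_piMr//; case: ifP].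
Qed.

Lemma gcdf_mono x z : x <= z -> gcdf x <= gcdf z.
Proof.
move=> xz; apply: J_le => [||y]; [exact: (ib (mle x))|exact: (ib (mle z))|].
by rewrite ler_wpM2l//; case: ifP => [h|_]; [rewrite (le_trans h xz)|case: ifP].
Qed.

Lemma gcdf_neg x : x < 0 -> gcdf x = 0.
Proof.
move=> x0; rewrite /gcdf (_ : (fun y => _) = fun=> 0) ?J0//; apply/funext => y.
by rewrite leNgt (lt_le_trans x0)//= mulr0.
Qed.

Let k0 : R := normal_peak 1.
Let k00 : 0 < k0. Proof. by rewrite normal_peak_gt0// oner_neq0. Qed.
Let npE y : np y = k0 * expR (- (y ^+ 2 / 2)).
Proof. by rewrite /np npdfE// invr1 mul1r subr0 expr1n mulr1. Qed.

Let compl z : 1 - gcdf z = J leb (fun y => np y - np y * (if `|y| <= z then 1 else 0)).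
Proof. by rewrite J_B; [rewrite Jnp|exact: inp|exact: (ib (mle z))]. Qed.

(** Exponential Markov inequality with parameters 1 and -1; tilting shifts the mean of the density
    and produces the factor [expR (1 / 2)]. *)
Lemma gcdf_tail z : 1 - gcdf z <= 2 * expR (1 / 2) * expR (- z).
Proof.
rewrite compl.
have e m : m ^+ 2 = 1 -> (fun y => expR (1 / 2) * expR (- z) * normal_pdf m 1 y) = (fun y => np y * expR (m * y - z)).
 move=> m2; apply/funext => y; rewrite npE npdfE// invr1 expr1n mulr1.
 transitivity (k0 * (expR (1 / 2) * expR (- z) * expR (- ((y - m) ^+ 2 / 2)))); first by rewrite /k0; ring.
 rewrite (_ : expR (1 / 2) * expR (- z) * _ = expR (1 / 2 - z - (y - m) ^+ 2 / 2)); last by rewrite !expRD.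
 by rewrite -[RHS]mulrA -expRD; congr (_ * expR _); rewrite sqrrB m2; field.
have i1 := itgZ (expR (1 / 2) * expR (- z)) (inp 1).
have i2 := itgZ (expR (1 / 2) * expR (- z)) (inp (-1)).
rewrite (_ : 2 * _ * _ = J leb (fun y => expR (1 / 2) * expR (- z) * normal_pdf 1 1 y + expR (1 / 2) * expR (- z) * normal_pdf (-1) 1 y)); last first.
 by rewrite J_D// !J_Z// !Jnp; ring.
apply: J_le; [by apply: itgB; [exact: inp|exact: (ib (mle z))]|exact: itgD|move=> y].
have := congr1 (fun f => f y) (e 1 (expr1n _ 2)); have := congr1 (fun f => f y) (e (-1) ltac:(by rewrite sqrrN expr1n)) => /= -> ->.
rewrite mul1r mulN1r -mulrDr -[X in X - _]mulr1 -mulrBr ler_wpM2l//.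
case: ifP => [_|/negbT]; first by rewrite subrr addr_ge0 ?expR_ge0.
rewrite -ltNge subr0 => zy.
have [y0|y0] := leP 0 y; move: zy; rewrite ?(ger0_norm y0) ?(ltr0_norm y0) => zy.
 by apply: ler_wpDr; rewrite ?expR_ge0// -expR0 ler_expR; lra.
by apply: ler_wpDl; rewrite ?expR_ge0// -expR0 ler_expR; lra.
Qed.

Let sub_le (a b : R) : a <= b -> J leb (fun y => \1_(`[a, b]%classic) y * 1) = b - a.
Proof.
move=> ab; have c1 : continuous (fun _ : R => 1 : R) by move=> x; exact: cvg_cst.
by rewrite (@FTC2 R (fun y => y) (fun=> 1) _ _ ab (fun x => dd_id x) c1).
Qed.

(** Only the mass of an interval of length [1 / (1 + z)] to the right of [z] is kept. Over it the
    square of the argument grows by at most 3, because [2 * z / (1 + z) <= 2] and the squared length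
    is at most 1. *)
Let mills z : 0 <= z -> k0 * expR (- ((z ^+ 2 + 3) / 2)) / (1 + z) <= 1 - gcdf z.
Proof.
move=> z0; have z1 : 0 < 1 + z by lra.
pose t := z + (1 + z)^-1; have zt : z <= t by rewrite lerDl invr_ge0 ltW.
rewrite compl.
have c1 : continuous (fun _ : R => 1 : R) by move=> x; exact: cvg_cst.
have it := itg_itv z t c1.
rewrite (_ : _ / (1 + z) = J leb (fun y => k0 * expR (- ((z ^+ 2 + 3) / 2)) * (\1_(`[z, t]%classic) y * 1))); last first.
 by rewrite J_Z// sub_le// /t addrAC subrr add0r.
(* the endpoint [z] itself is not in the tail, hence the comparison almost everywhere *)
have mN : measurable ([set z] : set R) by exact: measurable_set1.
pose f y := k0 * expR (- ((z ^+ 2 + 3) / 2)) * (\1_(`[z, t]%classic) y * 1).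
have mi : measurable_fun setT (\1_(`[z, t]%classic) : R -> R) by exact: measurable_indic.
have mf1 : measurable_fun setT f by rewrite /f; mf.
have mf2 : measurable_fun setT (fun y => if y == z then 0 else f y).
 rewrite (_ : (fun y => _) = fun y => if (y <= z) && (z <= y) then 0 else f y); first by mf.
 by apply/funext => y; rewrite -eq_le.
have nz : leb [set z] = 0%E by exact: leb1.
rewrite -/f (@J_ae _ _ _ leb [set z] _ _ mf1 mf2 mN nz); last by move=> y /eqP/negbTE ->.
apply: J_le; [|by apply: itgB; [exact: inp|exact: (ib (mle z))]|].
 apply: itg_dom (itgZ (k0 * expR (- ((z ^+ 2 + 3) / 2))) it) => // y.
 have h : 0 <= f y by rewrite /f indic_cc !mulr_ge0 ?expR_ge0 ?(ltW k00).
 by case: ifP => _; rewrite ?normr0 ?ger0_norm.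
move=> y; case: eqP => [_|/eqP yz]; first by rewrite subr_ge0 ler_piMr//; case: ifP.
rewrite /f indic_cc; case: (boolP (_ <= _ <= _)) => [/andP[h1 h2]|_]; last first.
 by rewrite mul0r mulr0 subr_ge0 ler_piMr//; case: ifP.
have zy : z < y by rewrite lt_neqAle eq_sym yz.
rewrite (ger0_norm (le_trans z0 h1)) [y <= z]leNgt zy /= mulr0 subr0 !mulr1 -/np npE ler_pM2l// ler_expR lerN2 ler_pM2r ?invr_gt0//.
have v1 : (1 + z)^-1 <= 1 by rewrite invf_le1// lerDl.
have v2 : z * (1 + z)^-1 <= 1 by rewrite ler_pdivrMr// mul1r lerDr.
have v0 : 0 <= (1 + z)^-1 by rewrite invr_ge0 ltW.
apply: le_trans (_ : t ^+ 2 <= _); first by rewrite lerXn2r ?nnegrE// (le_trans z0).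
rewrite /t sqrrD; move: v0 v1 v2; set v := (1 + z)^-1 => v0 v1 v2.
have : v ^+ 2 <= 1 by rewrite exprn_ile1.
by rewrite mulr2n; lra.
Qed.

(** If [z - 2 * u < |y| <= z] then [y ^+ 2 >= z ^+ 2 - 4 * u * z], so the density exceeds its value
    at [z] by a factor of at most [expR (2 * u * z)]; two intervals of length [2 * u] are
    involved. *)
Let incr z u : 0 <= z -> 0 <= u -> gcdf z - gcdf (z - 2 * u) <= 4 * u * (k0 * expR (- (z ^+ 2 / 2)) * expR (2 * u * z)).
Proof.
move=> z0 u0; pose m := k0 * expR (- (z ^+ 2 / 2)) * expR (2 * u * z).
have m0 : 0 <= m by rewrite !mulr_ge0 ?expR_ge0 ?(ltW k00).
rewrite -J_B; [|exact: (ib (mle z))|exact: (ib (mle _))].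
have c1 : continuous (fun _ : R => 1 : R) by move=> x; exact: cvg_cst.
have ab1 : z - 2 * u <= z by lra.
have ab2 : - z <= - (z - 2 * u) by lra.
have i1 := itgZ m (itg_itv (z - 2 * u) z c1); have i2 := itgZ m (itg_itv (- z) (- (z - 2 * u)) c1).
rewrite (_ : 4 * u * _ = J leb (fun y => m * (\1_(`[z - 2 * u, z]%classic) y * 1) + m * (\1_(`[- z, - (z - 2 * u)]%classic) y * 1))); last first.
 by rewrite J_D// !J_Z ?sub_le//; [rewrite -/m; ring|exact: itg_itv..].
apply: J_le; [by apply: itgB; [exact: (ib (mle z))|exact: (ib (mle _))]|exact: itgD|move=> y].
rewrite -mulrBr !indic_cc !mulr1.
have r0 (b1 b2 : bool) : 0 <= m * (b1 : nat)%:R + m * (b2 : nat)%:R by apply: addr_ge0; apply: mulr_ge0.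
have [h1|h1] := boolP (`|y| <= z); last first.
 rewrite ifF ?subrr ?mulr0//; apply/negbTE; apply: contra h1 => h; apply: le_trans h _; lra.
have [h2|h2] := boolP (`|y| <= z - 2 * u); first by rewrite subrr mulr0.
rewrite subr0 mulr1 -ltNge in h2 *.
have npm : np y <= m.
 rewrite npE /m -mulrA ler_pM2l// -expRD ler_expR.
 have : z ^+ 2 - 4 * u * z <= y ^+ 2.
  rewrite -(real_normK (num_real y)); have [h|h] := leP 0 (z - 2 * u).
   have : (z - 2 * u) ^+ 2 <= `|y| ^+ 2 by rewrite lerXn2r ?nnegrE// ltW.
   by have := sqr_ge0 u; rewrite sqrrB exprMn; nra.
  have := sqr_ge0 `|y|; nra.
 by lra.
have [y0|y0] := leP 0 y; move: h1 h2; rewrite ?(ger0_norm y0) ?(ltr0_norm y0) => h1 h2.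
 rewrite (_ : z - 2 * u <= y <= z); last by rewrite h1 ltW.
 by rewrite mulr1 (le_trans npm)// lerDl mulr_ge0.
rewrite (_ : - z <= y <= - (z - 2 * u)); last by apply/andP; split; lra.
by rewrite mulr1 (le_trans npm)// lerDr mulr_ge0.
Qed.

Lemma pow_diff (a b : R) n : 0 <= b -> b <= a -> a ^+ n - b ^+ n <= n%:R * a ^+ n.-1 * (a - b).
Proof.
move=> b0 ba; have a0 := le_trans b0 ba; elim: n => [|n ih]; first by rewrite !expr0 subrr !mul0r.
rewrite !exprS (_ : _ - _ = a * (a ^+ n - b ^+ n) + b ^+ n * (a - b)); last by ring.
have h1 : a * (a ^+ n - b ^+ n) <= n%:R * a ^+ n * (a - b).
 case: n ih => [|n] ih; first by rewrite !expr0 subrr mulr0 !mul0r.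
 by apply: le_trans (ler_wpM2l a0 ih) _; rewrite /= exprS le_eqVlt; apply/orP; left; apply/eqP; ring.
have h2 : b ^+ n * (a - b) <= a ^+ n * (a - b) by rewrite ler_wpM2r ?subr_ge0// lerXn2r.
by rewrite /= -(natr1 n); lra.
Qed.

(** This is the probability of exactly one failure in [n] trials, hence at most [1 - p ^+ n]. *)
Lemma bernoulli_le1 (p : R) n : 0 <= p <= 1 -> n%:R * p ^+ n.-1 * (1 - p) <= 1.
Proof.
move=> /andP[p0 p1]; case: n => [|n]; first by rewrite !mul0r.
apply: le_trans (_ : 1 - p ^+ n.+1 <= _); last by rewrite gerBl exprn_ge0.
elim: n => [|n ih]; first by rewrite /= expr0 expr1 !mul1r.
have q0 : 0 <= p ^+ n.+1 by exact: exprn_ge0.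
have q1 : p ^+ n.+1 <= 1 by rewrite exprn_ile1.
have h1 := ler_wpM2l p0 ih.
have h2 : p ^+ n.+1 * (1 - p) <= 1 * (1 - p) by rewrite ler_wpM2r ?subr_ge0.
rewrite /= -(natr1 n.+1).
rewrite (_ : (n.+1%:R + 1) * p ^+ n.+1 * (1 - p) = p * (n.+1%:R * p ^+ n.+1.-1 * (1 - p)) + p ^+ n.+1 * (1 - p)); last by rewrite /= exprS; ring.
by rewrite (exprS p n.+1); lra.
Qed.

(** Up to [T], the increment of [gcdf] is a small multiple of the tail [1 - p], by comparing the
    density with the Mills-type bound; [N * p ^+ N.-1 * (1 - p) <= 1] then removes [N]. Beyond [T]
    the tail itself pays for the factor [N]. *)
Lemma anticoncentration (N : nat) x u T : 0 <= u -> 0 <= T ->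
 gcdf (x + 2 * u) ^+ N - gcdf x ^+ N <=
 4 * u * expR (2 * u * T + 3 / 2) * (1 + T) + N%:R * (2 * expR (1 / 2) * expR (- (T - 2 * u))).
Proof.
move=> u0 T0.
have r1 : 0 <= 4 * u * expR (2 * u * T + 3 / 2) * (1 + T) by rewrite !mulr_ge0 ?expR_ge0//; lra.
have r2 : 0 <= N%:R * (2 * expR (1 / 2) * expR (- (T - 2 * u))) by rewrite !mulr_ge0 ?expR_ge0.
have [/andP[p0 p1] /andP[q0 q1]] := (gcdf_01 (x + 2 * u), gcdf_01 x).
have pq : gcdf x <= gcdf (x + 2 * u) by apply: gcdf_mono; lra.
apply: le_trans (pow_diff N q0 pq) _.
set p := gcdf (x + 2 * u) in p0 p1 pq *; pose z := x + 2 * u.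
have Np0 : 0 <= N%:R * p ^+ N.-1 by rewrite mulr_ge0 ?exprn_ge0.
have [z0|z0] := ltP z 0.
 rewrite /p gcdf_neg// gcdf_neg ?subrr ?mulr0 ?addr_ge0//; apply: le_lt_trans z0; rewrite /z; lra.
have xE : x = z - 2 * u by rewrite /z; lra.
have [zT|zT] := leP z T.
 apply: ler_wpDr => //.
 have h1 := incr z0 u0; have h2 := mills z0.
 have e : k0 * expR (- (z ^+ 2 / 2)) = k0 * expR (- ((z ^+ 2 + 3) / 2)) / (1 + z) * (expR (3 / 2) * (1 + z)).
  have -> : - (z ^+ 2 / 2) = - ((z ^+ 2 + 3) / 2) + 3 / 2 by field.
  rewrite expRD; field; rewrite gt_eqF//; lra.
 have h3 : p - gcdf x <= (1 - p) * (4 * u * expR (2 * u * T + 3 / 2) * (1 + T)).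
  rewrite {1}xE; apply: le_trans h1 _; rewrite e.
  rewrite (_ : 4 * u * _ = (k0 * expR (- ((z ^+ 2 + 3) / 2)) / (1 + z)) * (4 * u * (expR (2 * u * z) * expR (3 / 2)) * (1 + z))); last by ring.
  apply: ler_pM => //.
  - by rewrite !mulr_ge0 ?expR_ge0 ?(ltW k00)// invr_ge0; lra.
  - by rewrite !mulr_ge0 ?expR_ge0//; lra.
  - rewrite -expRD; apply: ler_pM; [by rewrite !mulr_ge0 ?expR_ge0|lra| |lra].
   by apply: ler_wpM2l; [rewrite mulr_ge0|rewrite ler_expR lerD2r ler_wpM2l// mulr_ge0].
 apply: le_trans (ler_wpM2l Np0 h3) _; rewrite mulrA ler_piMl//.
 by apply: bernoulli_le1; rewrite p0.
apply: ler_wpDl => //; rewrite -mulrA ler_wpM2l//.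
apply: le_trans (_ : 1 * (1 - gcdf x) <= _).
 by apply: ler_pM; rewrite ?exprn_ge0 ?subr_ge0// ?exprn_ile1// lerB.
rewrite mul1r (le_trans (gcdf_tail x))// ler_pM2l ?mulr_gt0 ?expR_gt0// ler_expR lerN2 xE lerB//; exact: ltW.
Qed.

End gaussian_cdf.

(** * From soft indicators to the law of the maximum *)

Lemma meas_bigmax {R : realType} {d} {T : measurableType d} (I : Type) (s : seq I) (F : I -> T -> R) :
 (forall i, measurable_fun setT (F i)) -> measurable_fun setT (fun x => \big[Num.max/0]_(i <- s) F i x).
Proof.
move=> mF; elim: s => [|i s ih].
 rewrite (_ : (fun x => _) = fun=> 0); first exact: measurable_cst.
 by apply/funext => x; rewrite big_nil.
rewrite (_ : (fun x => _) = fun x => Num.max (F i x) (\big[Num.max/0]_(i <- s) F i x)); first exact: meas_max.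
by apply/funext => x; rewrite big_cons.
Qed.

Section max_normal.
Context {R : realType} {d} {T : measurableType d} (Q : probability T R) (N : nat) (Y : 'I_N -> T -> R).
Hypothesis nY : std_normal_vector Q Y.

Lemma max_normal t : 0 <= t -> fine (Q [set w | \big[Num.max/0]_(l < N) `|Y l w| <= t]) = gcdf t ^+ N.
Proof.
move=> t0; have [mY [iY lY]] := nY.
pose B : set R := [set y | `|y| <= t].
have mB : measurable B.
 have mb : measurable_fun setT (fun y : R => `|y| <= t) by mf.
 by rewrite (_ : B = setT `&` (fun y => `|y| <= t) @^-1` [set true]); [exact: mb|rewrite setTI].
have := iY (index_enum 'I_N) (fun=> B) (index_enum_uniq _) (fun=> mB).
rewrite (eq_bigr (fun=> gcdf t)); last first.
 move=> l _; rewrite lY// /normal_prob /gcdf /J [in LHS]integral_mkcond; congr fine.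
 apply: eq_integral => y _; rewrite patchE.
 by case: ifP => h; [move: h; rewrite inE /B /= => ->; rewrite mulr1|
  rewrite (_ : `|y| <= t = false) ?mulr0//; apply/negbTE/negP => h'; move/negP: h; apply; rewrite inE].
rewrite prodr_const card_ord => <-; congr (fine (Q _)); apply/seteqP; split => w /=.
 by move=> /bigmax_leP[_ h] l _; exact: h.
by move=> h; apply/bigmax_leP; split=> // l _; apply: h; rewrite /= mem_index_enum.
Qed.
End max_normal.

Lemma sandwich {R : realType} (v p p1 p2 g1 g2 j1 j2 ne f k ac : R) : v <= j1 + 2 * ne -> j2 <= v + f ->
 j1 - g1 <= k -> - (j2 - g2) <= k -> g1 <= p1 + ne -> p2 <= g2 + 2 * ne -> p1 - p <= ac -> p - p2 <= ac ->
 0 <= ne -> 0 <= f -> `|v - p| <= k + 3 * ne + f + ac.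
Proof. by move=> *; apply/ler_normlP; split; lra. Qed.

Section max_compare.
Context {R : realType} {d} {T : measurableType d} (P : probability T R) (N : nat) (S : T -> 'I_N -> R).
Hypothesis mS : forall l, measurable_fun setT (fun w => S w l).
Variables (b u err : R).
Hypotheses (b0 : 0 < b) (u0 : 0 <= u).
Hypothesis close : forall c, 0 < c -> `|J P (fun w => softind c b (S w)) - Ns 1 (softind_1 c b) 0 ^+ N| <= err.

Let e := expR (- (b * u)).
Let G c := Ns 1 (softind_1 c b) (0 : R).
Let p0 c (y : R) := c * (expR (b * y) + expR (- (b * y))).
(** With this [c] the penalty of a coordinate is of order [expR (b * (|y| - t))]: the soft indicator
    switches at [|y| = t] over a width of order [1 / b]. *)
Let cc (t : R) := expR (- (b * t)).

Let p0_le t y s : `|y| <= s -> p0 (cc t) y <= 2 * expR (b * (s - t)).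
Proof.
rewrite ler_norml => /andP[h1 h2].
have -> : 2 * expR (b * (s - t)) = cc t * (expR (b * s) + expR (b * s)).
 by rewrite (_ : b * (s - t) = - (b * t) + b * s); [rewrite expRD /cc; ring|ring].
rewrite /p0 ler_pM2l ?expR_gt0// lerD// ler_expR; last rewrite -mulrN; rewrite ler_pM2l//; lra.
Qed.

Let p0_ge t y s : s <= `|y| -> expR (b * (s - t)) <= p0 (cc t) y.
Proof.
move=> h; rewrite (_ : b * (s - t) = - (b * t) + b * s); last by ring.
rewrite expRD /p0 ler_pM2l ?expR_gt0//.
have [y0|y0] := leP 0 y; move: h; rewrite ?(ger0_norm y0) ?(ltr0_norm y0) => h.
 by apply: ler_wpDr; rewrite ?expR_ge0// ler_expR ler_pM2l.
by apply: ler_wpDl; rewrite ?expR_ge0// ler_expR -mulrN ler_pM2l.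
Qed.

Let expexp : expR (- expR (b * u)) <= e.
Proof. by rewrite ler_expR lerN2 (le_trans _ (expR_ge1Dx _))// lerDr. Qed.

Let G01 c : 0 < c -> 0 <= G c <= 1.
Proof.
move=> c0; have [h1 [h2 [[mh _] _ _ _]]] := softind_taylor3 c0 b0.
have s01 y : 0 <= softind_1 c b y <= 1.
 by rewrite expR_ge0/= -expR0 ler_expR oppr_le0 mulr_ge0 ?addr_ge0 ?expR_ge0 ?(ltW c0).
apply/andP; split.
 by apply: J_ge0 => y; rewrite mulr_ge0 ?normal_pdf_ge0//; case/andP: (s01 (0 + y)).
have := @Ns_bound R 1 (softind_1 c b) 1 0 mh; rewrite ler_norml => h.
by case/andP: (h (fun y => ltac:(by case/andP: (s01 y) => *; rewrite ger0_norm))).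
Qed.

Let np_itg (f : R -> R) : bmf f -> itg leb (fun y => @normal_pdf R 0 1 y * f y).
Proof.
move=> [mf0 [M fM]]; have i : itg leb (@normal_pdf R 0 1) by apply/itgP; exact: integrable_normal_pdf.
apply: itg_dom (itgZr M i); first by apply: meas_M => //; exact: measurable_normal_pdf.
by move=> y; rewrite normrM ger0_norm ?normal_pdf_ge0// ler_wpM2l ?normal_pdf_ge0.
Qed.

Let np_le (f g : R -> R) k : bmf f -> bmf g -> (forall y, f y <= g y + k) ->
 J leb (fun y => @normal_pdf R 0 1 y * f y) <= J leb (fun y => @normal_pdf R 0 1 y * g y) + k.
Proof.
move=> bf bg h; have i : itg leb (@normal_pdf R 0 1) by apply/itgP; exact: integrable_normal_pdf.
have -> : k = J leb (fun y => @normal_pdf R 0 1 y * k) by rewrite J_Zr// /J integral_normal_pdf /= mul1r.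
rewrite -J_D; [|exact: np_itg|exact: itgZr].
apply: J_le; [exact: np_itg|by apply: itgD; [exact: np_itg|exact: itgZr]|move=> y].
by rewrite -mulrDr ler_wpM2l ?normal_pdf_ge0.
Qed.

Let bsoft c : 0 < c -> bmf (softind_1 c b).
Proof. by move=> c0; case: (softind_taylor3 c0 b0) => ? [? []]. Qed.
Let bind t : bmf (fun y : R => if `|y| <= t then 1 else 0 : R).
Proof. by apply: bmf_pr; mf. Qed.
Let GE c : G c = J leb (fun y => @normal_pdf R 0 1 y * softind_1 c b y).
Proof. by congr J; apply/funext => y; rewrite add0r. Qed.

Let G_up t : G (cc (t + u)) <= gcdf (t + 2 * u) + e.
Proof.
rewrite GE; apply: np_le; [exact: bsoft (expR_gt0 _)|exact: bind|move=> y].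
case: ifP => [_|/negbT]; last first.
 rewrite -ltNge => /ltW h; rewrite add0r; apply: le_trans expexp.
 by rewrite ler_expR lerN2; have := p0_ge (t + u) h; rewrite (_ : t + 2 * u - (t + u) = u)//; ring.
have /andP[_ h] : 0 <= softind_1 (cc (t + u)) b y <= 1.
 by rewrite expR_ge0/= -expR0 ler_expR oppr_le0 mulr_ge0 ?addr_ge0 ?expR_ge0.
by apply: ler_wpDr => //; exact: expR_ge0.
Qed.

Let G_low t : gcdf (t - 2 * u) <= G (cc (t - u)) + 2 * e.
Proof.
rewrite GE; apply: np_le; [exact: bind|exact: bsoft (expR_gt0 _)|move=> y].
case: ifP => [h|_]; last by rewrite addr_ge0 ?mulr_ge0 ?expR_ge0.
have := p0_le (t - u) h; rewrite (_ : t - 2 * u - (t - u) = - u) ?mulrN; last by ring.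
rewrite -/e => h1; have : 1 - p0 (cc (t - u)) y <= softind_1 (cc (t - u)) b y by exact: expR_ge1Dx.
lra.
Qed.

Let pow_add (x y k : R) : 0 <= x <= 1 -> 0 <= y <= 1 -> 0 <= k -> x <= y + k -> x ^+ N <= y ^+ N + N%:R * k.
Proof.
move=> x01 y01 k0 xy; have [/andP[x0 _] /andP[y0 _]] := (x01, y01).
have [h|h] := leP x y; first by apply: ler_wpDr; [rewrite mulr_ge0|rewrite lerXn2r].
have := expn_lip N x01 y01; rewrite (gtr0_norm (_ : 0 < x - y)) ?subr_gt0// => h1.
have := le_trans (ler_norm _) h1.
have : N%:R * (x - y) <= N%:R * k by rewrite ler_wpM2l//; lra.
lra.
Qed.

(** Soft thresholds at [t + u] and [t - u] trap the indicator of the maximum up to multiples of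
    [e = expR (- (b * u))]. On the Gaussian side they are compared with hard thresholds at
    [t + 2 * u] and [t - 2 * u], whence two uses of [anticoncentration]. *)
Lemma max_compare {d'} {T' : measurableType d'} (Q : probability T' R) (Y : 'I_N -> T' -> R) t Tt :
 std_normal_vector Q Y -> 0 <= Tt -> 
 `|fine (P [set w | \big[Num.max/0]_(l < N) `|S w l| <= t]) - fine (Q [set w | \big[Num.max/0]_(l < N) `|Y l w| <= t])|
 <= err + 3 * N%:R * e + e + (4 * u * expR (2 * u * Tt + 3 / 2) * (1 + Tt) + N%:R * (2 * expR (1 / 2) * expR (- (Tt - 2 * u)))).
Proof.
move=> nY T0; set AC := 4 * u * _ * _ + _; have e0 : 0 <= e by exact: expR_ge0.
have AC0 : 0 <= AC by rewrite addr_ge0// !mulr_ge0 ?expR_ge0// addr_ge0.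
have err0 : 0 <= err by exact: le_trans (normr_ge0 _) (close ltr01).
(* The maxima start from the value 0, so for [t < 0] both events are empty. *)
have [t0|t0] := ltP t 0.
 have z (T1 : Type) (F : 'I_N -> T1 -> R) : [set w | \big[Num.max/0]_(l < N) `|F l w| <= t] = set0.
  by apply/seteqP; split => w //= /bigmax_leP[h _]; move: (le_lt_trans h t0); rewrite ltxx.
 have -> : [set w | \big[Num.max/0]_(l < N) `|S w l| <= t] = set0 := z T (fun l w => S w l).
 rewrite z !measure0 /= subrr normr0; do 3 (apply: addr_ge0 => //); apply: mulr_ge0 => //; exact: mulr_ge0.
rewrite (max_normal nY t0).
pose ev w := \big[Num.max/0]_(l < N) `|S w l| <= t.
have mev : measurable_fun setT ev.
 by apply: meas_le; [apply: meas_bigmax => l; apply: meas_norm|exact: measurable_cst].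
have [_ <-] := pr_set P mev.
have bS c : 0 < c -> bmf (fun w => softind c b (S w)).
 move=> c0; have sm := @smooth_softind R N c b c0 b0.
 by apply: (@bmf_intro _ _ _ 1); [exact: (sm0 sm)|move=> w; exact: (sb0 sm)].
have [gt1 gt2] : 0 < cc (t + u) /\ 0 < cc (t - u) by rewrite !expR_gt0.
have up : pr P ev <= J P (fun w => softind (cc (t + u)) b (S w)) + 2 * N%:R * e.
 rewrite -[X in _ <= _ + X](Ex_cst P) -J_D; [|exact/bmf_itg/bS|exact: itg_cst].
 apply: J_le; [exact/bmf_itg/bmf_pr|by apply: itgD; [exact/bmf_itg/bS|exact: itg_cst]|move=> w].
 case: ifP => [/bigmax_leP[_ h]|_]; last by rewrite addr_ge0 ?expR_ge0 ?mulr_ge0.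
 have : \sum_l p0 (cc (t + u)) (S w l) <= 2 * N%:R * e.
  apply: le_trans (_ : \sum_(l < N) 2 * e <= _); last by rewrite sumr_const card_ord -(mulr_natl (2 * e)) le_eqVlt; apply/orP; left; apply/eqP; ring.
  apply: ler_sum => l _; have := p0_le (t + u) (h l isT).
  by rewrite (_ : t - (t + u) = - u) ?mulrN//; ring.
 have : 1 - \sum_l p0 (cc (t + u)) (S w l) <= softind (cc (t + u)) b (S w) by exact: expR_ge1Dx.
 lra.
have low : J P (fun w => softind (cc (t - u)) b (S w)) <= pr P ev + e.
 rewrite -[X in _ <= _ + X](Ex_cst P) -J_D; [|exact/bmf_itg/bmf_pr|exact: itg_cst].
 apply: J_le; [exact/bmf_itg/bS|by apply: itgD; [exact/bmf_itg/bmf_pr|exact: itg_cst]|move=> w].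
 have q0 l : 0 <= p0 (cc (t - u)) (S w l) by rewrite mulr_ge0 ?addr_ge0 ?expR_ge0.
 case: ifP => [_|/negbT h].
  apply: le_trans (_ : 1 <= _); last by rewrite lerDl.
  by rewrite -expR0 ler_expR oppr_le0 sumr_ge0// => l _; exact: q0.
 rewrite add0r; apply: le_trans expexp; rewrite ler_expR lerN2.
 have [l hl] : exists l, t < `|S w l|.
  apply: contrapT => nl; move/negP: h; apply; apply/bigmax_leP; split=> // l _.
  by rewrite leNgt; apply/negP => hl; apply: nl; exists l.
 have := p0_ge (t - u) (ltW hl); rewrite (_ : t - (t - u) = u); last by ring.
 move/le_trans; apply; rewrite (bigD1 l)//= lerDl sumr_ge0// => i _; exact: q0.
have /ler_normlP[_ c1] := close gt1; have /ler_normlP[c2 _] := close gt2.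
have g1 := pow_add (G01 gt1) (gcdf_01 (t + 2 * u)) e0 (G_up t).
have e20 : 0 <= 2 * e by rewrite mulr_ge0.
have g2 := pow_add (gcdf_01 (t - 2 * u)) (G01 gt2) e20 (G_low t).
have a1 := anticoncentration N t u0 T0; have a2 := anticoncentration N (t - 2 * u) u0 T0.
rewrite subrK in a2; rewrite -/AC in a1 a2.
rewrite -(mulrA 3); apply: (sandwich _ low c1 c2 g1 _ a1 a2); rewrite ?mulr_ge0//.
- by rewrite mulrA.
- by rewrite mulrCA.
Qed.

End max_compare.

Lemma bmfB {R : realType} {d} {T : measurableType d} (f g : T -> R) : bmf f -> bmf g -> bmf (fun x => f x - g x).
Proof. by move=> bf bg; apply: bmfD => //; exact: bmfN. Qed.

Lemma sub_lt_add i q n : (i < n - q -> i.+1 + q <= n.+1)%N. Proof. lia. Qed.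
Lemma subn_sub_le n q : (n - (n - q) <= q)%N. Proof. lia. Qed.

(** * Past and future of the autoregression *)

Section autoregression.
Context {R : realType} {d} {Omega : measurableType d} (P : probability Omega R).
Variables (rho C1 C2 : R) (Z X : nat -> Omega -> R).
Hypotheses (rho0 : 0 <= rho) (rho1 : rho <= 1) (C10 : 0 <= C1) (C20 : 0 <= C2).
Hypotheses (mZ : forall i, measurable_fun setT (Z i)) (indZ : mutually_independent P Z).
Hypothesis XE : forall k w, X k w = \sum_(i < k.+1) rho ^+ (k - i) * Z i w.
Hypothesis lawX : forall k (f : R -> R), bmf f -> J P (fun w => f (X k w)) = J P (fun w => f (X 0 w)).
Hypothesis ball : forall k x u, 0 < u -> pr P (fun w => `|X k w - x| <= u) <= C1 * u.
Hypothesis tail : forall k c, 0 < c -> pr P (fun w => c < `|X k w|) <= C2 / c.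

Definition past j : pred nat := fun i => (i <= j)%N.
Definition future j : pred nat := fun i => (j < i)%N.
Definition zeta j k w : R := \sum_(j.+1 <= i < k.+1) rho ^+ (k - i) * Z i w.

Let dj j i : i \in past j -> i \in future j -> false.
Proof. by rewrite !unfold_in /past /future ltnNge => ->. Qed.

Lemma X_split j k w : (j <= k)%N -> X k w = rho ^+ (k - j) * X j w + zeta j k w.
Proof.
move=> jk; rewrite !XE -!(big_mkord xpredT (fun i => rho ^+ (_ - i) * Z i w)).
rewrite (big_cat_nat (n := j.+1))//= ?ltnS// mulr_sumr; congr (_ + _).
by apply: eq_big_nat => i /andP[_ ij]; rewrite mulrA -exprD; congr (_ ^+ _ * _); lia.
Qed.

Lemma X_past j k : (k <= j)%N -> measurable_fun [set: sigT Z (past j)] (X k : sigT Z (past j) -> R).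
Proof.
move=> kj; rewrite (_ : X k = fun w => \sum_(i < k.+1) rho ^+ (k - i) * Z i w); last by apply/funext => w; exact: XE.
apply: (@meas_sum _ _ (sigT Z (past j))) => i; apply: (@meas_M _ _ (sigT Z (past j))); first exact: measurable_cst.
apply: sig_X; rewrite unfold_in /past; have := ltn_ord i; lia.
Qed.

Lemma zeta_future j k : measurable_fun [set: sigT Z (future j)] (zeta j k : sigT Z (future j) -> R).
Proof.
rewrite (_ : zeta j k = fun w => \sum_(i <- index_iota j.+1 k.+1) (if (j < i)%N then rho ^+ (k - i) * Z i w else 0)); last first.
 by apply/funext => w; apply: eq_big_nat => i /andP[-> _].
apply: (@meas_sum _ _ (sigT Z (future j))) => i; case ji: (j < i)%N; last exact: measurable_cst.
by apply: (@meas_M _ _ (sigT Z (future j))); [exact: measurable_cst|apply: sig_X; rewrite unfold_in].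
Qed.

Lemma X_meas k : measurable_fun setT (X k).
Proof. exact: (@sig_meas_fun _ _ _ _ _ mZ _ _ (X_past (leqnn k))). Qed.

Lemma zeta_meas j k : measurable_fun setT (zeta j k).
Proof. exact: (@sig_meas_fun _ _ _ _ _ mZ _ _ (@zeta_future j k)). Qed.

Definition pastb j (M : R) (f : Omega -> R) : Prop :=
 measurable_fun [set: sigT Z (past j)] (f : sigT Z (past j) -> R) /\ forall w, `|f w| <= M.
Definition futureb j (M : R) (f : Omega -> R) : Prop :=
 measurable_fun [set: sigT Z (future j)] (f : sigT Z (future j) -> R) /\ forall w, `|f w| <= M.

Lemma pastb_bmf j M f : pastb j M f -> bmf f.
Proof. by move=> [m1 m2]; apply: (@bmf_intro _ _ _ M) => //; exact: (@sig_meas_fun _ _ _ _ _ mZ _ _ m1). Qed.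
Lemma futureb_bmf j M f : futureb j M f -> bmf f.
Proof. by move=> [m1 m2]; apply: (@bmf_intro _ _ _ M) => //; exact: (@sig_meas_fun _ _ _ _ _ mZ _ _ m1). Qed.

Lemma indep_mul j M M' f g : pastb j M f -> futureb j M' g -> J P (fun w => f w * g w) = J P f * J P g.
Proof.
move=> pf fg; have [mf0 bf] := pf; have [mg bg] := fg.
have [|_ ->] := @Ex_copy _ _ _ P _ Z mZ indZ (past j) (future j) (@dj j) (fun w w' => f w * g w') (M * M') _ (fun w w' => ltac:(by rewrite normrM ler_pM)).
 apply: (@meas_M _ _ (sigT Z (past j) * sigT Z (future j))%type (fun z => f z.1) (fun z => g z.2)).
  exact: (measurableT_comp mf0 measurable_fst).
 exact: (measurableT_comp mg measurable_snd).
rewrite (_ : (fun w => J P _) = (fun w => f w * J P g)); last first.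
 by apply/funext => w; rewrite J_Z//; exact/bmf_itg/(futureb_bmf fg).
by rewrite J_Zr//; exact/bmf_itg/(pastb_bmf pf).
Qed.

(** Conditioning on the innovations up to [j] by [Ex_copy]: given this past, [X k] is a translate of
    [zeta j k], which is why the bound must hold uniformly in the shift [y]. *)
Lemma cond_bound j k M c f (phi : R -> R) : (j <= k)%N -> pastb j M f -> (forall w, 0 <= f w) -> bmf phi ->
 (forall y, J P (fun w => phi (y + zeta j k w)) <= c) -> J P (fun w => f w * phi (X k w)) <= c * J P f.
Proof.
move=> jk pf f0 [mphi [M' bphi]] hc; have [mf0 bf] := pf.
have mXp := X_past (leqnn j); have mzf := @zeta_future j k.
have mz := zeta_meas j k.
have [|b1 e1] := @Ex_copy _ _ _ P _ Z mZ indZ (past j) (future j) (@dj j)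
 (fun w w' => f w * phi (rho ^+ (k - j) * X j w + zeta j k w')) (M * M') _ (fun w w' => ltac:(by rewrite normrM ler_pM)).
 apply: (@meas_M _ _ (sigT Z (past j) * sigT Z (future j))%type (fun z => f z.1) (fun z => phi (rho ^+ (k - j) * X j z.1 + zeta j k z.2))).
  exact: (measurableT_comp mf0 measurable_fst).
 apply: (measurableT_comp mphi).
 apply: (@meas_D _ _ (sigT Z (past j) * sigT Z (future j))%type (fun z => rho ^+ (k - j) * X j z.1) (fun z => zeta j k z.2)).
  apply: (@meas_M _ _ (sigT Z (past j) * sigT Z (future j))%type (fun=> rho ^+ (k - j)) (fun z => X j z.1)); first exact: measurable_cst.
  exact: (measurableT_comp mXp measurable_fst).
 exact: (measurableT_comp mzf measurable_snd).
rewrite (_ : (fun w => f w * phi (X k w)) = (fun w => f w * phi (rho ^+ (k - j) * X j w + zeta j k w))); last first.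
 by apply/funext => w; rewrite -X_split.
rewrite e1 -J_Z; last exact/bmf_itg/(pastb_bmf pf).
apply: J_le; [exact: bmf_itg|by apply: itgZ; exact/bmf_itg/(pastb_bmf pf)|move=> w].
rewrite J_Z; last first.
 by apply: bmf_itg; apply: (@bmf_intro _ _ _ M') => //; apply: (measurableT_comp mphi); mf.
by rewrite mulrC ler_wpM2r.
Qed.

(** By the tail bound, [|X j| <= c0] has probability at least 1/2. *)
Let c0 := 2 * C2 + 1.
Definition A0 := 2 * C1 * (1 + c0).

Let c00 : 0 < c0. Proof. by rewrite ltr_wpDl// mulr_ge0. Qed.
Lemma A0_ge0 : 0 <= A0.
Proof. by rewrite /A0; apply: mulr_ge0; [exact: mulr_ge0|rewrite addr_ge0// ltW]. Qed.

(** On [|X j| <= c0], an event of probability at least 1/2 independent of [zeta j k], closeness of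
    [zeta j k] to [x] forces [X k] within [u + rho * c0] of [x]. The small-ball bound of the
    stationary law is thus inherited, up to an additive [rho]. *)
Lemma zeta_ball j k x u : (j < k)%N -> 0 < u -> pr P (fun w => `|zeta j k w - x| <= u) <= A0 * (u + rho).
Proof.
move=> jk u0; have mX := X_meas j; have mXk := X_meas k; have mz := zeta_meas j k.
pose e := rho ^+ (k - j).
have e0 : 0 <= e by exact: exprn_ge0.
have er : e <= rho.
 rewrite /e (_ : (k - j)%N = (k - j).-1.+1); last by lia.
 by rewrite exprS ler_piMr// exprn_ile1.
have half : 1 / 2 <= pr P (fun w => `|X j w| <= c0).
 have : 1 <= pr P (fun w => c0 < `|X j w|) + pr P (fun w => `|X j w| <= c0).
  apply: le_trans (pr_or _ _ _); [|by mf..].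
  rewrite -[leLHS](Ex_cst P); apply: J_le; [exact: itg_cst|by apply/bmf_itg/bmf_pr; mf|move=> w].
  by case: ltP.
 have := tail j c00; have : C2 / c0 <= 1 / 2 by rewrite ler_pdivrMr// /c0; lra.
 by lra.
have pa : pastb j 1 (fun w => if `|X j w| <= c0 then 1 else 0).
 split; last by move=> w; case: ifP; rewrite ?normr1 ?normr0.
 have mXp := X_past (leqnn j).
 apply: (@meas_if _ _ (sigT Z (past j)) (fun w => `|X j w| <= c0) (fun=> 1) (fun=> 0)); [|exact: measurable_cst..].
 apply: (@meas_le _ _ (sigT Z (past j)) (fun w => `|X j w|) (fun=> c0)); last exact: measurable_cst.
 exact: (@meas_norm _ _ (sigT Z (past j))).
have fu : futureb j 1 (fun w => if `|zeta j k w - x| <= u then 1 else 0).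
 split; last by move=> w; case: ifP; rewrite ?normr1 ?normr0.
 have mzf := @zeta_future j k.
 apply: (@meas_if _ _ (sigT Z (future j)) (fun w => `|zeta j k w - x| <= u) (fun=> 1) (fun=> 0)); [|exact: measurable_cst..].
 apply: (@meas_le _ _ (sigT Z (future j)) (fun w => `|zeta j k w - x|) (fun=> u)); last exact: measurable_cst.
 apply: (@meas_norm _ _ (sigT Z (future j)) (fun w => zeta j k w - x)).
 by apply: (@meas_D _ _ (sigT Z (future j)) (zeta j k) (fun=> - x)) => //; exact: measurable_cst.
have h : pr P (fun w => `|X j w| <= c0) * pr P (fun w => `|zeta j k w - x| <= u) <= C1 * (u + e * c0).
 have ue : 0 < u + e * c0 by rewrite ltr_wpDr// mulr_ge0// ltW.
 apply: le_trans (ball k x ue); rewrite -(indep_mul pa fu).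
 apply: J_le; [apply: bmf_itg; apply: bmfM; apply: bmf_pr; mf|by apply/bmf_itg/bmf_pr; mf|move=> w].
 case: ifP => h1; last by rewrite mul0r; case: ifP.
 rewrite mul1r; case: ifP => h2; last by case: ifP.
 rewrite (_ : `|X k w - x| <= u + e * c0)// (X_split w (ltnW jk)) -/e -addrA addrC (le_trans (ler_normD _ _))//.
 by rewrite lerD// normrM (ger0_norm e0) ler_wpM2l.
have h2 : 1 / 2 * pr P (fun w => `|zeta j k w - x| <= u) <= C1 * (u + e * c0).
 by apply: le_trans h; rewrite ler_wpM2r// pr_ge0.
have h3 : C1 * (u + e * c0) <= C1 * ((1 + c0) * (u + rho)).
 rewrite ler_wpM2l//; have : e * c0 <= rho * c0 by rewrite ler_wpM2r// ltW.
 have : 0 <= c0 * u by rewrite mulr_ge0// ltW.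
 lra.
rewrite /A0; lra.
Qed.

Lemma X_ball k x u : 0 < u -> pr P (fun w => `|X k w - x| <= u) <= A0 * (u + 0).
Proof.
rewrite addr0 => u0; apply: le_trans (ball k x u0) _; rewrite /A0.
have : 0 <= C1 * u by rewrite mulr_ge0// ltW.
have : 0 <= C1 * c0 * u by rewrite !mulr_ge0// ltW.
lra.
Qed.

(** * Moments of the kernel summands *)

Section kernel_moments.
Variables (h theta B bx a : R) (Kf : R -> R) (Jn q : nat).
Hypotheses (h0 : 0 < h) (h1 : h <= 1) (Jh : (2^-1) ^+ Jn <= h) (theta0 : 0 <= theta) (B0 : 0 <= B) (bx1 : 1 <= bx).
Hypotheses (mK : measurable_fun setT Kf) (K1 : forall v, `|Kf v| <= B) (K2 : forall v, `|v * Kf v| <= B)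
 (K3 : forall v v', `|Kf v - Kf v'| <= B * `|v - v'|).

(** Envelope of the rescaled kernel: 1 within distance [h] and [h / |v|] beyond. *)
Definition mm (v : R) : R := h / Num.max h `|v|.

Let mx0 (v : R) : 0 < Num.max h `|v|. Proof. by rewrite lt_max h0. Qed.
Lemma mm_01 v : 0 <= mm v <= 1.
Proof. by rewrite divr_ge0 ?(ltW h0) ?(ltW (mx0 _))//= ler_pdivrMr// mul1r le_max lexx. Qed.

(** Dyadic decomposition: beyond distance [h * 2 ^+ n] the envelope is at most [(2^-1) ^+ n], and
    the shells below are covered by balls. *)
Let dyad v n : mm v <= \sum_(i < n) 2 * (2^-1) ^+ i * (if `|v| <= h * 2 ^+ i then 1 else 0) + 2 * (2^-1) ^+ n.
Proof.
elim: n => [|n ih]; first by rewrite big_ord0 add0r expr0 mulr1; case/andP: (mm_01 v) => _; lra.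
have p0 (i : nat) : 0 <= 2 * (2^-1 : R) ^+ i by rewrite mulr_ge0// exprn_ge0.
rewrite big_ord_recr/= exprS; case: ifP => hv; first by rewrite mulr1; apply: le_trans ih _; have := p0 n; lra.
rewrite mulr0 addr0; apply: le_trans (_ : (2^-1) ^+ n <= _); last first.
 rewrite mulrA mulfV// mul1r lerDr sumr_ge0// => i _; rewrite mulr_ge0//; by case: ifP.
rewrite /mm ler_pdivrMr// exprVn mulrC ler_pdivlMr ?exprn_gt0//.
by rewrite le_max; move/negbT: hv; rewrite -ltNge => /ltW ->; rewrite orbT.
Qed.

Let mm_meas : measurable_fun setT mm.
Proof. by rewrite /mm; mf. Qed.

(** Each of the [Jn] dyadic scales contributes [2 * A0 * (h + r)] to the mean of the envelope, [r]
    being the additive error of the ball bound. The logarithmic factor [Jn] reflects the slow decay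
    [1 / |v|]. *)
Definition nu (r : R) := (2 * A0 * Jn%:R + 2) * (h + r).
Definition mu := nu 0.

Lemma mu_ge : 0 <= mu /\ h <= mu.
Proof.
have AJ : 0 <= 2 * A0 * Jn%:R by apply: mulr_ge0 => //; apply: mulr_ge0 => //; exact: A0_ge0.
have hh := ltW h0.
have : 0 <= 2 * A0 * Jn%:R * h by rewrite mulr_ge0.
have -> : mu = 2 * A0 * Jn%:R * h + 2 * h by rewrite /mu /nu addr0 mulrDl.
by move: (2 * A0 * Jn%:R * h) => k k0; split; lra.
Qed.

Lemma nu_ge (r : R) : 0 <= r -> mu <= nu r.
Proof.
move=> r0; rewrite /mu /nu ler_wpM2l ?lerD2l//; apply: addr_ge0 => //; apply: mulr_ge0 => //.
by apply: mulr_ge0 => //; exact: A0_ge0.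
Qed.

Lemma E_mm (V : Omega -> R) x r : 0 <= r -> measurable_fun setT V ->
 (forall u, 0 < u -> pr P (fun w => `|V w - x| <= u) <= A0 * (u + r)) -> J P (fun w => mm (x - V w)) <= nu r.
Proof.
move=> r0 mV bV.
have bi (i : nat) : bmf (fun w => if `|x - V w| <= h * 2 ^+ i then 1 else 0 : R) by apply: bmf_pr; mf.
have bs : bmf (fun w => \sum_(i < Jn) 2 * (2^-1) ^+ i * (if `|x - V w| <= h * 2 ^+ i then 1 else 0) : R).
 by apply: bmf_sum => i; apply: bmfM; [exact: bmf_cst|exact: bi].
apply: le_trans (_ : J P (fun w => \sum_(i < Jn) 2 * (2^-1) ^+ i * (if `|x - V w| <= h * 2 ^+ i then 1 else 0) + 2 * (2^-1) ^+ Jn) <= _).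
 apply: J_le; [|by apply: itgD; [exact: bmf_itg|exact: itg_cst]|by move=> w; exact: dyad].
 apply: bmf_itg; apply: (@bmf_intro _ _ _ 1); first by apply: (measurableT_comp mm_meas); mf.
 by move=> w; case/andP: (mm_01 (x - V w)) => *; rewrite ger0_norm.
rewrite J_D; [|exact: bmf_itg|exact: itg_cst].
rewrite Ex_cst J_sum; last by move=> i _; apply: itgZ; exact/bmf_itg/bi.
have -> : nu r = 2 * A0 * Jn%:R * (h + r) + 2 * (h + r) by rewrite /nu mulrDl.
apply: lerD; last first.
 by apply: le_trans (_ : 2 * h <= _); [rewrite ler_pM2l|rewrite ler_pM2l// lerDl].
apply: le_trans (_ : \sum_(i < Jn) 2 * A0 * (h + r) <= _); last first.
 by rewrite sumr_const card_ord -(mulr_natl (2 * A0 * _)) le_eqVlt; apply/orP; left; apply/eqP; ring.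
apply: ler_sum => i _; rewrite J_Z; last exact/bmf_itg/bi.
have i0 : 0 < (2 : R) ^+ i by exact: exprn_gt0.
have hi : 0 < h * 2 ^+ i by exact: mulr_gt0.
have := bV _ hi; rewrite /pr (_ : (fun w => _) = (fun w => if `|x - V w| <= h * 2 ^+ i then 1 else 0)); last first.
 by apply/funext => w; rewrite distrC.
move=> l; apply: le_trans (_ : 2 * (2^-1) ^+ i * (A0 * (h * 2 ^+ i + r)) <= _).
 by rewrite ler_wpM2l// mulr_ge0// exprn_ge0.
rewrite exprVn [leLHS](_ : _ = 2 * A0 * ((h * 2 ^+ i + r) / 2 ^+ i)); last by ring.
rewrite ler_wpM2l//; [by apply: mulr_ge0 => //; exact: A0_ge0|].
rewrite mulrDl mulfK ?gt_eqF// lerD2l ler_piMr// invf_le1// exprn_ege1//.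
by rewrite ler1n.
Qed.

(** The summand of the statistic as a function of the observation [y]. *)
Definition gK x y : R := y * (if `|y| <= theta then 1 else 0) * Kf ((x - y) / h).
Definition B1 := bx * B.

Let B1_ge0 : 0 <= B1. Proof. by rewrite /B1 mulr_ge0// (le_trans ler01). Qed.

Let K_mm x y : `|Kf ((x - y) / h)| <= B * mm (x - y).
Proof.
rewrite /mm /Num.max; case: ifP => hv; last by rewrite mulfV ?gt_eqF// mulr1.
have v0 : 0 < `|x - y| by exact: lt_trans hv.
rewrite mulrA ler_pdivlMr// mulrC -ler_pdivrMr//.
have := K2 ((x - y) / h); rewrite normrM normrM (gtr0_norm (_ : 0 < h^-1)) ?invr_gt0// .
by move=> /(le_trans _) -> //; rewrite mulrAC.
Qed.

(** The factor [y] is bounded only by [theta]. Writing [y = x - h * v] with [v = (x - y) / h] trades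
    it for [|x| <= bx] and for [h] times the bounded quantity [v * Kf v]. *)
Lemma gK_mm x y : `|x| <= bx -> `|gK x y| <= B1 * (mm (x - y) + h).
Proof.
move=> xb; have /andP[m0 _] := mm_01 (x - y).
apply: le_trans (_ : `|y| * `|Kf ((x - y) / h)| <= _).
 by rewrite /gK !normrM; case: ifP; rewrite ?normr1 ?normr0 ?mulr1// mulr0 mul0r mulr_ge0.
have e : y = x - h * ((x - y) / h) by field; rewrite gt_eqF.
apply: le_trans (_ : `|x| * `|Kf ((x - y) / h)| + h * `|(x - y) / h * Kf ((x - y) / h)| <= _).
 have e2 : `|y| <= `|x| + h * `|(x - y) / h|.
  by rewrite {1}e; apply: le_trans (ler_normB _ _) _; rewrite (normrM h) (gtr0_norm h0).
 by apply: le_trans (ler_wpM2r (normr_ge0 _) e2) _; rewrite mulrDl (normrM (_ / _)) mulrA.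
rewrite /B1 mulrDr; apply: lerD.
 by rewrite -mulrA ler_pM// K_mm.
apply: le_trans (_ : h * B <= _); first by rewrite ler_pM2l.
by rewrite mulrC ler_wpM2r ?(ltW h0)// ler_peMl.
Qed.

Lemma gK_abs x y : `|x| <= bx -> `|gK x y| <= 2 * B1.
Proof.
move=> xb; apply: le_trans (gK_mm y xb) _; rewrite mulrC ler_wpM2r//.
by have /andP[_ m1] := mm_01 (x - y); have hh := h1; lra.
Qed.

Lemma gK_bmf x : `|x| <= bx -> bmf (gK x).
Proof.
move=> xb; apply: (@bmf_intro _ _ _ (2 * B1)); last by move=> y; exact: gK_abs.
by rewrite /gK; mf.
Qed.

(** Index 1 matches the centring in the statistic. *)
Definition Eg x := J P (fun w => gK x (X 1 w)).
Definition gc x k w := gK x (X k w) - Eg x.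

Let bgX x k : `|x| <= bx -> bmf (fun w => gK x (X k w)).
Proof. by move=> xb; apply: bmf_comp; [exact: gK_bmf|exact: X_meas]. Qed.

Lemma gc_bmf x k : `|x| <= bx -> bmf (gc x k).
Proof. by move=> xb; apply: bmfD; [exact: bgX|exact: bmf_cst]. Qed.

Lemma gc_mean x k : `|x| <= bx -> J P (gc x k) = 0.
Proof.
move=> xb; rewrite /gc J_B; [|exact/bmf_itg/bgX|exact: itg_cst].
by rewrite Ex_cst /Eg !(lawX _ (gK_bmf xb)) subrr.
Qed.

Let Eg_abs x : `|x| <= bx -> `|Eg x| <= 2 * B1.
Proof. by move=> xb; apply: Ex_bound; [exact: bmf_meas (bgX 1 xb)|move=> w; exact: gK_abs]. Qed.

Lemma gc_abs x k w : `|x| <= bx -> `|gc x k w| <= 4 * B1.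
Proof. by move=> xb; apply: le_trans (ler_normB _ _) _; have := gK_abs (X k w) xb; have := Eg_abs xb; lra. Qed.

Let bmm x k : bmf (fun w => mm (x - X k w)).
Proof.
have mX := X_meas k.
apply: (@bmf_intro _ _ _ 1); first by apply: (measurableT_comp mm_meas); mf.
by move=> w; case/andP: (mm_01 (x - X k w)) => *; rewrite ger0_norm.
Qed.

Let EmmX x k : J P (fun w => mm (x - X k w)) <= mu.
Proof. by apply: E_mm => //; [exact: X_meas|move=> u; exact: X_ball]. Qed.

Lemma Eg_mu x : `|x| <= bx -> `|Eg x| <= 2 * B1 * mu.
Proof.
move=> xb; have [mu0 hmu] := mu_ge.
have i : itg P (fun w => B1 * (mm (x - X 1 w) + h)) by apply: itgZ; apply: itgD; [exact/bmf_itg/bmm|exact: itg_cst].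
apply: le_trans (J_abs (bmf_meas (bgX 1 xb)) i (fun w => gK_mm _ xb)) _.
rewrite J_Z; last by apply: itgD; [exact/bmf_itg/bmm|exact: itg_cst].
rewrite J_D ?Ex_cst; [|exact/bmf_itg/bmm|exact: itg_cst].
rewrite [leRHS](_ : _ = B1 * (2 * mu)); last by ring.
by rewrite ler_wpM2l//; have := EmmX x 1; lra.
Qed.

(** Of the 7 terms [mu ^+ 2], four come from the product of the two means and three from the
    additive [h] in [gK_mm], with [h <= mu]. *)
Let cov_mm x y j k S : `|x| <= bx -> `|y| <= bx -> J P (fun w => mm (x - X j w) * mm (y - X k w)) <= S ->
 `|J P (fun w => gc x j w * gc y k w)| <= B1 ^+ 2 * (S + 7 * mu ^+ 2).
Proof.
move=> xb yb mS; have [mu0 hmu] := mu_ge.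
have b1 := bgX j xb; have b2 := bgX k yb; have b3 := bmm x j; have b4 := bmm y k.
have e : J P (fun w => gc x j w * gc y k w) = J P (fun w => gK x (X j w) * gK y (X k w)) - Eg x * Eg y.
 rewrite (_ : (fun w => gc x j w * _) = (fun w => gK x (X j w) * gK y (X k w) - (Eg y * gc x j w + Eg x * gK y (X k w)))); last first.
  by apply/funext => w; rewrite /gc; ring.
 have bgc := gc_bmf j xb.
 rewrite J_B; [|exact/bmf_itg/bmfM|by apply: itgD; apply: itgZ; exact: bmf_itg].
 rewrite J_D; [|by apply: itgZ; exact: bmf_itg..].
 rewrite !J_Z; [|exact: bmf_itg..].
 by rewrite gc_mean// mulr0 add0r (lawX k (gK_bmf yb)) -(lawX 1 (gK_bmf yb)).
have i12 : itg P (fun w => B1 * (mm (x - X j w) + h) * (B1 * (mm (y - X k w) + h))).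
 by apply: bmf_itg; apply: bmfM; apply: bmfM; [exact: bmf_cst|apply: bmfD => //; exact: bmf_cst|exact: bmf_cst|apply: bmfD => //; exact: bmf_cst].
have h12 : `|J P (fun w => gK x (X j w) * gK y (X k w))| <= B1 ^+ 2 * (S + 3 * mu ^+ 2).
 apply: le_trans (J_abs (bmf_meas (bmfM b1 b2)) i12 _) _.
  by move=> w; rewrite normrM ler_pM// gK_mm.
 rewrite (_ : (fun w => _) = (fun w => B1 ^+ 2 * (mm (x - X j w) * mm (y - X k w) + (h * mm (x - X j w) + (h * mm (y - X k w) + h ^+ 2))))); last first.
  by apply/funext => w; ring.
 have i3 := bmf_itg P b3; have i4 := bmf_itg P b4; have i34 := bmf_itg P (bmfM b3 b4).
 have ih := itg_cst P (h ^+ 2).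
 rewrite J_Z; last by apply: itgD => //; apply: itgD; [exact: itgZ|apply: itgD => //; exact: itgZ].
 rewrite J_D//; last by apply: itgD; [exact: itgZ|apply: itgD => //; exact: itgZ].
 rewrite J_D; [|exact: itgZ|by apply: itgD => //; exact: itgZ].
 rewrite J_D//; last exact: itgZ.
 rewrite (J_Z _ i3) (J_Z _ i4) (Ex_cst P (h ^+ 2)) ler_wpM2l ?sqr_ge0//; apply: lerD => //.
 have := ler_pM (ltW h0) (J_ge0 P (fun w => proj1 (andP (mm_01 (x - X j w))))) hmu (EmmX x j).
 have := ler_pM (ltW h0) (J_ge0 P (fun w => proj1 (andP (mm_01 (y - X k w))))) hmu (EmmX y k).
 have := ler_pM (ltW h0) (ltW h0) hmu hmu.
 by rewrite !expr2; lra.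
rewrite e; apply: le_trans (ler_normB _ _) _.
have : `|Eg x * Eg y| <= (2 * B1 * mu) * (2 * B1 * mu) by rewrite normrM ler_pM// Eg_mu.
by move: h12; rewrite !expr2; lra.
Qed.

(** Given the past, the envelope at the later time has mean at most [nu rho], wherever [X j] lies;
    the points [x] and [y] may coincide. The products of means are absorbed through
    [mu <= nu rho]. *)
Lemma cov_lag x y j k : `|x| <= bx -> `|y| <= bx -> (j < k)%N -> `|J P (fun w => gc x j w * gc y k w)| <= B1 ^+ 2 * (8 * (mu * nu rho)).
Proof.
move=> xb yb jk; have [mu0 hmu] := mu_ge.
have pm : pastb j 1 (fun w => mm (x - X j w)).
 split; last by move=> w; case/andP: (mm_01 (x - X j w)) => *; rewrite ger0_norm.
 apply: (measurableT_comp mm_meas).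
 apply: (@meas_D _ _ (sigT Z (past j)) (fun=> x) (fun w => - X j w)); first exact: measurable_cst.
 exact: (@meas_N _ _ (sigT Z (past j)) _ (X_past (leqnn j))).
have bphi : bmf (fun v : R => mm (y - v)).
 apply: (@bmf_intro _ _ _ 1); first by apply: (measurableT_comp mm_meas); mf.
 by move=> v; case/andP: (mm_01 (y - v)) => *; rewrite ger0_norm.
have mz := zeta_meas j k.
have hc v : J P (fun w => mm (y - (v + zeta j k w))) <= nu rho.
 apply: (@E_mm (fun w => v + zeta j k w)) => //; first by mf.
 move=> u u0; rewrite (_ : (fun w => _) = (fun w => `|zeta j k w - (y - v)| <= u)); first exact: zeta_ball.
 by apply/funext => w; congr (`|_| <= _); ring.
have hb := cond_bound (ltnW jk) pm (fun w => proj1 (andP (mm_01 (x - X j w)))) bphi hc.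
apply: le_trans (cov_mm xb yb (S := nu rho * mu) _) _.
 apply: le_trans hb _; rewrite ler_wpM2l//; exact: le_trans mu0 (nu_ge rho0).
have hm := ler_wpM2l mu0 (nu_ge rho0).
by rewrite ler_wpM2l ?sqr_ge0//; move: hm; rewrite expr2; lra.
Qed.

Lemma cov_same x y k D : `|x| <= bx -> `|y| <= bx -> 0 < D -> D <= `|x - y| ->
 `|J P (fun w => gc x k w * gc y k w)| <= B1 ^+ 2 * (4 * h / D * mu + 7 * mu ^+ 2).
Proof.
move=> xb yb D0 Dxy; apply: cov_mm => //.
have [i1 i2] := (bmf_itg P (bmm x k), bmf_itg P (bmm y k)).
apply: le_trans (_ : J P (fun w => 2 * h / D * (mm (x - X k w) + mm (y - X k w))) <= _); last first.
 rewrite J_Z ?J_D//; last exact: itgD.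
 rewrite (_ : 4 * h / D * mu = 2 * h / D * (mu + mu)); last by ring.
 by rewrite ler_wpM2l ?lerD ?EmmX// divr_ge0 ?mulr_ge0// ltW.
apply: J_le; [exact/bmf_itg/bmfM|by apply: itgZ; exact: itgD|move=> w].
have [/andP[m1 _] /andP[m2 _]] := (mm_01 (x - X k w), mm_01 (y - X k w)).
have far (v : R) : D / 2 <= `|v| -> mm v <= 2 * h / D.
 move=> hv; rewrite /mm ler_pdivrMr// mulrAC ler_pdivlMr// -mulrA mulrCA ler_pM2l//.
 have : `|v| <= Num.max h `|v| by rewrite le_max lexx orbT.
 by move: (Num.max _ _) => M hM; lra.
have hd : 0 <= 2 * h / D by rewrite divr_ge0 ?mulr_ge0// ltW.
have [hx|hx] := leP (D / 2) `|x - X k w|.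
 have l := far _ hx; apply: le_trans (_ : 2 * h / D * mm (y - X k w) <= _); first by rewrite ler_wpM2r.
 by rewrite ler_wpM2l// lerDr.
have hy : D / 2 <= `|y - X k w|.
 have := ler_normB (x - X k w) (y - X k w); rewrite (_ : _ - _ - _ = x - y); last by ring.
 by lra.
have l := far _ hy; rewrite mulrC; apply: le_trans (_ : 2 * h / D * mm (x - X k w) <= _); first by rewrite ler_wpM2r.
by rewrite ler_wpM2l// lerDl.
Qed.

(** * Decorrelation beyond [q] lags and variances *)

Section decorrelation.
Variables (rr Rr : R).
Hypotheses (rr0 : 0 < rr) (Rr0 : 0 < Rr) (rrE : rho ^+ q * Rr <= rr).

(** Mean error of replacing [X k] by [zeta j k]: a Lipschitz part, the chance that [X k] is within
    [rr] of the cut at [theta] or [- theta], and the chance that [|X j|] exceeds [Rr]. *)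
Definition e1 := B * rr * (1 + theta / h) + 4 * B1 * (C1 * rr + C2 / Rr).

Lemma e1_ge0 : 0 <= e1.
Proof.
have t0 := divr_ge0 theta0 (ltW h0); have r0 := ltW rr0; have c0' := divr_ge0 C20 (ltW Rr0).
have b1 := B1_ge0; rewrite /e1; apply: addr_ge0; apply: mulr_ge0; [exact: mulr_ge0|exact: addr_ge0|exact: mulr_ge0|].
by apply: addr_ge0 => //; exact: mulr_ge0.
Qed.

(** The truncation makes [gK x] discontinuous; a displacement of at most [rr] crosses the cut only
    if [y] is within [rr] of [theta] or [- theta]. *)
Let gK_diff x y z : `|x| <= bx -> `|y - z| <= rr ->
 `|gK x y - gK x z| <= B * rr * (1 + theta / h) +
  2 * B1 * ((if `|y - theta| <= rr then 1 else 0) + (if `|y - - theta| <= rr then 1 else 0)).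
Proof.
move=> xb yz; have g1 := gK_abs y xb; have g2 := gK_abs z xb.
have t0 := divr_ge0 theta0 (ltW h0); have r0 := ltW rr0.
have p0 : 0 <= B * rr * (1 + theta / h) by apply: mulr_ge0; rewrite ?mulr_ge0 ?addr_ge0.
have i0 (b : bool) : 0 <= (if b then 1 else 0 : R) <= 1 by case: b; rewrite !lexx ?ler01.
have near : ((`|y| <= theta) != (`|z| <= theta)) ->
  1 <= (if `|y - theta| <= rr then 1 else 0) + (if `|y - - theta| <= rr then 1 else 0) :> R.
 move=> ne; have : (`|y - theta| <= rr) || (`|y - - theta| <= rr).
  move: yz ne; rewrite !ler_norml; case/andP => a1 a2; move: a1 a2.
  have [y0|y0] := leP 0 y.
   move=> a1 a2 ne; apply/orP; left; move: ne.
   by case: (leP (- theta) y); case: (leP y theta); case: (leP (- theta) z); case: (leP z theta) => //=; intros; have tt := theta0; apply/andP; split; lra.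
  move=> a1 a2 ne; apply/orP; right; move: ne.
  by case: (leP (- theta) y); case: (leP y theta); case: (leP (- theta) z); case: (leP z theta) => //=; intros; have tt := theta0; apply/andP; split; lra.
 have := i0 (`|y - theta| <= rr); have := i0 (`|y - - theta| <= rr).
 by case: (`|y - theta| <= rr); case: (`|y - - theta| <= rr) => // *; lra.
have q0 : 0 <= 2 * B1 * ((if `|y - theta| <= rr then 1 else 0) + (if `|y - - theta| <= rr then 1 else 0)).
 apply: mulr_ge0; first by rewrite mulr_ge0.
 by apply: addr_ge0; case: ifP.
have gz (v : R) : (`|v| <= theta) = false -> gK x v = 0 by rewrite /gK => ->; rewrite mulr0 mul0r.
case hy : (`|y| <= theta); case hz : (`|z| <= theta).
- apply: le_trans (_ : B * rr * (1 + theta / h) <= _); last by rewrite lerDl.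
 rewrite /gK hy hz !mulr1.
 rewrite (_ : _ - _ = (y - z) * Kf ((x - y) / h) + z * (Kf ((x - y) / h) - Kf ((x - z) / h))); last by ring.
 apply: le_trans (ler_normD _ _) _; rewrite !normrM (_ : B * rr * _ = rr * B + theta * (B * (rr / h))); last by ring.
 apply: lerD; first exact: ler_pM.
 rewrite ler_pM//; apply: le_trans (K3 _ _) _; rewrite ler_wpM2l//.
 rewrite (_ : _ / h - _ = - (y - z) / h); last by ring.
 by rewrite normrM normrN (gtr0_norm (_ : 0 < h^-1)) ?invr_gt0// ler_wpM2r// invr_ge0 ltW.
- rewrite (gz z hz) subr0; apply: le_trans g1 _; apply: le_trans (_ : 2 * B1 * 1 <= _); first by rewrite mulr1.
 have := near _; rewrite hy hz => /(_ isT) n1; apply: ler_wpDl => //.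
 by rewrite ler_wpM2l// mulr_ge0.
- rewrite (gz y hy) sub0r normrN; apply: le_trans g2 _; apply: le_trans (_ : 2 * B1 * 1 <= _); first by rewrite mulr1.
 have := near _; rewrite hy hz => /(_ isT) n1; apply: ler_wpDl => //.
 by rewrite ler_wpM2l// mulr_ge0.
- by rewrite (gz y hy) (gz z hz) subr0 normr0 addr_ge0.
Qed.

Let zK x j k w := gK x (zeta j k w) - Eg x.

Let zK_future x j k : `|x| <= bx -> futureb j (4 * B1) (zK x j k).
Proof.
move=> xb; split; last by move=> w; apply: le_trans (ler_normB _ _) _; have := gK_abs (zeta j k w) xb; have := Eg_abs xb; lra.
have mg := bmf_meas (gK_bmf xb); have mzf := @zeta_future j k.
apply: (@meas_D _ _ (sigT Z (future j)) (fun w => gK x (zeta j k w)) (fun=> - Eg x)); last exact: measurable_cst.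
exact: (measurableT_comp mg mzf).
Qed.

Lemma gc_past x k : `|x| <= bx -> pastb k (4 * B1) (gc x k).
Proof.
move=> xb; split; last by move=> w; exact: gc_abs.
have mg := bmf_meas (gK_bmf xb); have mXp := X_past (leqnn k).
apply: (@meas_D _ _ (sigT Z (past k)) (fun w => gK x (X k w)) (fun=> - Eg x)); last exact: measurable_cst.
exact: (measurableT_comp mg mXp).
Qed.

Let gc_zK x j k : `|x| <= bx -> (j + q <= k)%N -> J P (fun w => `|gc x k w - zK x j k w|) <= e1.
Proof.
move=> xb jk; have mX := X_meas k; have mXj := X_meas j.
have bz := futureb_bmf (zK_future j k xb); have bg := gc_bmf k xb.
have b1 (t : R) : bmf (fun w => if `|X k w - t| <= rr then 1 else 0 : R) by apply: bmf_pr; mf.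
have b3 : bmf (fun w => if Rr < `|X j w| then 1 else 0 : R) by apply: bmf_pr; mf.
have i1 := bmf_itg P (b1 theta); have i2 := bmf_itg P (b1 (- theta)); have i3 := bmf_itg P b3.
have ic := itg_cst P (B * rr * (1 + theta / h)).
have i12 := itgD i1 i2.
apply: le_trans (_ : J P (fun w => (B * rr * (1 + theta / h) +
  2 * B1 * ((if `|X k w - theta| <= rr then 1 else 0) + (if `|X k w - - theta| <= rr then 1 else 0))) +
  4 * B1 * (if Rr < `|X j w| then 1 else 0)) <= _); last first.
 rewrite J_D; [|apply: itgD => //; exact: itgZ|exact: itgZ].
 rewrite J_D//; last exact: itgZ.
 rewrite (Ex_cst P (B * rr * (1 + theta / h))) (J_Z _ i12) (J_Z _ i3) (J_D i1 i2).
 have p1 : J P (fun w => if `|X k w - theta| <= rr then 1 else 0) <= C1 * rr := ball k theta rr0.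
 have p2 : J P (fun w => if `|X k w - - theta| <= rr then 1 else 0) <= C1 * rr := ball k (- theta) rr0.
 have p3 : J P (fun w => if Rr < `|X j w| then 1 else 0) <= C2 / Rr := tail j Rr0.
 rewrite /e1 -addrA lerD2l [leRHS](_ : _ = 2 * B1 * (C1 * rr + C1 * rr) + 4 * B1 * (C2 / Rr)); last by ring.
 by apply: lerD; rewrite ler_wpM2l// ?lerD// mulr_ge0.
apply: J_le; [apply: bmf_itg; apply: bmf_norm; exact: bmfB|by apply: itgD; [apply: itgD => //; exact: itgZ|exact: itgZ]|move=> w].
rewrite /gc /zK opprB addrA subrK.
have [hj|hj] := ltP Rr `|X j w|.
 rewrite mulr1; apply: ler_wpDl; last first.
  by apply: le_trans (ler_normB _ _) _; have := gK_abs (X k w) xb; have := gK_abs (zeta j k w) xb; lra.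
 have t0 := divr_ge0 theta0 (ltW h0); have r0 := ltW rr0; have b1' := B1_ge0.
 apply: addr_ge0; apply: mulr_ge0; [exact: mulr_ge0|exact: addr_ge0|exact: mulr_ge0|].
 by apply: addr_ge0; case: ifP.
rewrite (mulr0 (4 * B1)) addr0; apply: (gK_diff xb).
have jk' : (j <= k)%N := leq_trans (leq_addr _ _) jk.
rewrite (X_split w jk') addrK normrM ger0_norm ?exprn_ge0//; apply: le_trans rrE; apply: ler_pM => //; rewrite ?exprn_ge0//.
rewrite -(subnKC (_ : q <= k - j)%N); last by rewrite leq_subRL.
by rewrite exprD ler_piMr ?exprn_ge0// exprn_ile1.
Qed.

(** Replacing [f] by [f'], independent of the past, costs [M * e] in the joint expectation and again
    in the product of expectations. *)
Let dec j M M' Psi f f' e : pastb j M Psi -> bmf f -> futureb j M' f' -> J P (fun w => `|f w - f' w|) <= e ->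
 `|J P (fun w => Psi w * f w) - J P Psi * J P f| <= 2 * M * e.
Proof.
move=> pp bf ff he; have bp := pastb_bmf pp; have bf' := futureb_bmf ff; have [_ pb] := pp.
have M0 : 0 <= M by apply: le_trans (pb point); exact: normr_ge0.
have bd := bmfB bf bf'; have ba := bmf_norm bd.
have d1 : `|J P (fun w => Psi w * (f w - f' w))| <= M * e.
 apply: le_trans (_ : J P (fun w => M * `|f w - f' w|) <= _); last by rewrite (J_Z _ (bmf_itg P ba)) ler_wpM2l.
 apply: J_abs; [exact: bmf_meas (bmfM bp bd)|exact/itgZ/bmf_itg|by move=> w; rewrite normrM ler_wpM2r].
have d2 : `|J P f - J P f'| <= e.
 rewrite -(J_B (bmf_itg P bf) (bmf_itg P bf')); apply: le_trans he.
 by apply: J_abs; [exact: bmf_meas|exact: bmf_itg|].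
have d3 : `|J P Psi| <= M by apply: Ex_bound; [exact: bmf_meas|].
rewrite (_ : J P (fun w => Psi w * f w) - _ = J P (fun w => Psi w * (f w - f' w)) - J P Psi * (J P f - J P f')); last first.
 rewrite (_ : (fun w => Psi w * (_ - _)) = (fun w => Psi w * f w - Psi w * f' w)); last by apply/funext => w; rewrite mulrBr.
 by rewrite (J_B (bmf_itg P (bmfM bp bf)) (bmf_itg P (bmfM bp bf'))) (indep_mul pp ff); ring.
apply: le_trans (ler_normB _ _) _; rewrite normrM.
have : `|J P Psi| * `|J P f - J P f'| <= M * e by apply: ler_pM.
lra.
Qed.

Lemma gc_dec1 x j k M Psi : `|x| <= bx -> (j + q <= k)%N -> pastb j M Psi ->
 `|J P (fun w => Psi w * gc x k w)| <= 2 * M * e1.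
Proof.
move=> xb jk pp.
have := dec pp (gc_bmf k xb) (zK_future j k xb) (gc_zK xb jk).
by rewrite gc_mean// mulr0 subr0.
Qed.

Lemma gc_dec2 x y j k k' M Psi : `|x| <= bx -> `|y| <= bx -> (j + q <= k)%N -> (j + q <= k')%N -> pastb j M Psi ->
 `|J P (fun w => Psi w * (gc x k w * gc y k' w)) - J P Psi * J P (fun w => gc x k w * gc y k' w)| <= 2 * M * (8 * B1 * e1).
Proof.
move=> xb yb jk jk' pp.
have [fx fy] := (zK_future j k xb, zK_future j k' yb).
have [bx' by'] := (gc_bmf k xb, gc_bmf k' yb).
have [bzx bzy] := (futureb_bmf fx, futureb_bmf fy).
apply: (@dec j M (4 * B1 * (4 * B1)) Psi _ (fun w => zK x j k w * zK y j k' w)) => //; first exact: bmfM.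
 split; last by move=> w; rewrite normrM ler_pM//; [exact: fx.2|exact: fy.2].
 by apply: (@meas_M _ _ (sigT Z (future j)) (zK x j k) (zK y j k')); [exact: fx.1|exact: fy.1].
have [ax ay] := (bmf_norm (bmfB bx' bzx), bmf_norm (bmfB by' bzy)).
have iab := itgD (bmf_itg P ax) (bmf_itg P ay).
apply: le_trans (_ : J P (fun w => 4 * B1 * (`|gc x k w - zK x j k w| + `|gc y k' w - zK y j k' w|)) <= _); last first.
 rewrite (J_Z _ iab) (J_D (bmf_itg P ax) (bmf_itg P ay)) [leRHS](_ : _ = 4 * B1 * (e1 + e1)); last by ring.
 by rewrite ler_wpM2l ?lerD ?gc_zK// mulr_ge0.
apply: J_le; [by apply: bmf_itg; apply: bmf_norm; apply: bmfB; exact: bmfM|exact: itgZ|move=> w].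
rewrite (_ : _ - _ = (gc x k w - zK x j k w) * gc y k' w + zK x j k w * (gc y k' w - zK y j k' w)); last by ring.
apply: le_trans (ler_normD _ _) _; rewrite !normrM mulrDr; apply: lerD.
 by rewrite mulrC ler_wpM2r// gc_abs.
by rewrite ler_wpM2r//; exact: fx.2.
Qed.

Lemma gc_same x y k : `|x| <= bx -> `|y| <= bx -> J P (fun w => gc x k w * gc y k w) = J P (fun w => gc x 1 w * gc y 1 w).
Proof.
move=> xb yb; have b : bmf (fun v : R => (gK x v - Eg x) * (gK y v - Eg y)).
 by apply: bmfM; (apply: bmfB; [exact: gK_bmf|exact: bmf_cst]).
by rewrite /gc (lawX k b) -(lawX 1 b).
Qed.

Let c1 := B1 ^+ 2 * (8 * (mu * nu rho)).
Let c2 := 8 * B1 * e1.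

Let cross x n : `|x| <= bx -> `|J P (fun w => (\sum_(i < n) gc x i.+1 w) * gc x n.+1 w)| <= n%:R * c2 + q%:R * c1.
Proof.
move=> xb; have bg k := gc_bmf k xb.
have [mu0 _] := mu_ge.
have c10 : 0 <= c1 by apply: mulr_ge0; [exact: sqr_ge0|apply: mulr_ge0 => //; apply: mulr_ge0 => //; exact: le_trans mu0 (nu_ge rho0)].
have c20' : 0 <= c2 by rewrite /c2; apply: mulr_ge0; [exact: mulr_ge0|exact: e1_ge0].
rewrite (_ : (fun w => _) = (fun w => \sum_(i < n) gc x i.+1 w * gc x n.+1 w)); last by apply/funext => w; rewrite mulr_suml.
rewrite J_sum; last by move=> i _; apply: bmf_itg; exact: bmfM.
apply: le_trans (ler_norm_sum _ _ _) _.
rewrite -(big_mkord xpredT (fun i => `|J P (fun w => gc x i.+1 w * gc x n.+1 w)|)) (big_cat_nat (n := (n - q)%N))//=; last exact: leq_subr.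
apply: lerD.
 apply: le_trans (_ : \sum_(0 <= i < n - q) c2 <= _).
  rewrite !big_nat; apply: ler_sum => i /andP[_ hi]; rewrite /c2.
  rewrite [leRHS](_ : _ = 2 * (4 * B1) * e1); last by ring.
  have hq : (i.+1 + q <= n.+1)%N by exact: sub_lt_add.
  by apply: gc_dec1 (gc_past _ xb).
 by rewrite sumr_const_nat subn0 -(mulr_natl c2) ler_wpM2r// ler_nat leq_subr.
apply: le_trans (_ : \sum_(n - q <= i < n) c1 <= _).
 by rewrite !big_nat; apply: ler_sum => i /andP[_ hi]; apply: cov_lag.
by rewrite sumr_const_nat -(mulr_natl c1) ler_wpM2r// ler_nat; exact: subn_sub_le.
Qed.

(** Cross terms are split at lag [q]: at most [q] close ones, each bounded by [c1], and distant
    ones, each bounded by [c2]. *)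
Lemma gc_var_sum x n : `|x| <= bx ->
 `|J P (fun w => (\sum_(i < n) gc x i.+1 w) ^+ 2) - n%:R * J P (fun w => gc x 1 w * gc x 1 w)| <= n%:R * (2 * (n%:R * c2 + q%:R * c1)).
Proof.
move=> xb; have bg k := gc_bmf k xb.
have c20' : 0 <= c2 by rewrite /c2; apply: mulr_ge0; [exact: mulr_ge0|exact: e1_ge0].
elim: n => [|n ih].
 rewrite !mul0r subr0 (_ : (fun w => _) = fun=> 0); last by apply/funext => w; rewrite big_ord0 expr2 mulr0.
 by rewrite (Ex_cst P 0) normr0.
have bs : bmf (fun w => \sum_(i < n) gc x i.+1 w) by apply: bmf_sum => i.
have is2 : itg P (fun w => (\sum_(i < n) gc x i.+1 w) ^+ 2) by apply: bmf_itg; exact: (bmfM bs bs).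
have isg := bmf_itg P (bmfM bs (bg n.+1)); have igg := bmf_itg P (bmfM (bg n.+1) (bg n.+1)).
rewrite (_ : (fun w => _) = (fun w => (\sum_(i < n) gc x i.+1 w) ^+ 2 + (2 * ((\sum_(i < n) gc x i.+1 w) * gc x n.+1 w) + gc x n.+1 w * gc x n.+1 w))); last first.
 by apply/funext => w; rewrite big_ord_recr/=; ring.
rewrite (J_D is2); last by apply: itgD => //; exact: itgZ.
rewrite J_D//; last exact: itgZ.
rewrite (J_Z _ isg) gc_same// -(natr1 n) (mulrDl n%:R 1) mul1r.
set S := J P _ in ih *; set v := J P _ in ih *; set u := J P _.
rewrite (_ : _ - _ = (S - n%:R * v) + 2 * u); last by ring.
apply: le_trans (ler_normD _ _) _; rewrite (mulrDl n%:R 1) mul1r; apply: lerD.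
 apply: le_trans ih _; rewrite ler_wpM2l// ler_wpM2l// lerD2r ler_wpM2r// lerDl//.
rewrite normrM ger0_norm// ler_wpM2l//; apply: le_trans (cross n xb) _.
by rewrite lerD2r ler_wpM2r// lerDl.
Qed.

(** Near [x - h * y0] the argument of the kernel is near [y0]; by the Lipschitz bound the kernel
    stays above [bt / 2] on a window of length [h * (bt / (2 * B))], where the observation is at
    least [aa]. The squared mean is subtracted. *)
Lemma gc_var_lower x y0 bt aa L : `|x| <= bx -> 0 <= bt -> bt <= `|Kf y0| -> 0 < B -> 0 <= aa -> aa <= x - h * y0 ->
 x - h * y0 + h * (bt / (2 * B)) <= theta ->
 L <= pr P (fun w => x - h * y0 <= X 1 w <= x - h * y0 + h * (bt / (2 * B))) ->
 (aa * (bt / 2)) ^+ 2 * L - (2 * B1 * mu) ^+ 2 <= J P (fun w => gc x 1 w * gc x 1 w).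
Proof.
move=> xb bt0 bK Bp aa0 az zt hL; have mX := X_meas 1.
have bg := bgX 1 xb; have i2 := bmf_itg P (bmfM bg bg); have bgc := gc_bmf 1 xb.
have -> : J P (fun w => gc x 1 w * gc x 1 w) = J P (fun w => gK x (X 1 w) * gK x (X 1 w)) - Eg x ^+ 2.
 rewrite (_ : (fun w => gc x 1 w * _) = (fun w => gK x (X 1 w) * gK x (X 1 w) - (Eg x * gc x 1 w + Eg x * gK x (X 1 w)))); last first.
  by apply/funext => w; rewrite /gc; ring.
 have [j1 j2] := (bmf_itg P bgc, bmf_itg P bg).
 rewrite (J_B i2); last by apply: itgD; exact: itgZ.
 rewrite J_D; [|exact: itgZ..].
 by rewrite (J_Z _ j1) (J_Z _ j2) gc_mean// mulr0 add0r -/(Eg x) expr2.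
apply: lerB; last first.
 rewrite -(real_normK (num_real (Eg x))) lerXn2r ?nnegrE ?Eg_mu//.
 by have [mu0 _] := mu_ge; apply: mulr_ge0 => //; exact: mulr_ge0.
have bI : bmf (fun w => if x - h * y0 <= X 1 w <= x - h * y0 + h * (bt / (2 * B)) then 1 else 0 : R) by apply: bmf_pr; mf.
apply: le_trans (ler_wpM2l (sqr_ge0 _) hL) _.
rewrite /pr -(J_Z _ (bmf_itg P bI)); apply: J_le => //; first exact/itgZ/bmf_itg.
move=> w; case: ifP; last by rewrite mulr0 -expr2 sqr_ge0.
case/andP => l1 l2; rewrite mulr1 -expr2 -(real_normK (num_real (gK x (X 1 w)))).
have ab0 : 0 <= aa * (bt / 2) by rewrite !mulr_ge0.
rewrite lerXn2r ?nnegrE//.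
have X0' : 0 <= X 1 w by apply: le_trans l1; exact: le_trans az.
have -> : gK x (X 1 w) = X 1 w * Kf ((x - X 1 w) / h).
 by rewrite /gK ger0_norm// (le_trans l2 zt) mulr1.
rewrite normrM ger0_norm//; apply: ler_pM => //; [by rewrite divr_ge0|exact: le_trans l1|].
have := ler_normB (Kf ((x - X 1 w) / h)) (Kf ((x - X 1 w) / h) - Kf y0); rewrite opprB addrC subrK => h3.
have h4 : `|Kf ((x - X 1 w) / h) - Kf y0| <= bt / 2.
 apply: le_trans (K3 _ _) _; rewrite -ler_pdivlMl//.
 rewrite (_ : _ / h - y0 = - ((X 1 w - (x - h * y0)) / h)); last by field; rewrite gt_eqF.
 rewrite normrN ger0_norm; last by rewrite divr_ge0 ?(ltW h0)// subr_ge0.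
 by rewrite ler_pdivrMr// (_ : B^-1 * _ * h = h * (bt / (2 * B))) ?lerBlDl//; field; rewrite gt_eqF.
by have := le_trans bK h3; lra.
Qed.

(** * Normal approximation of the normalised sums *)

Section clt.
Variables (N n : nat) (x : 'I_N -> R) (D sl b c : R).
Hypotheses (n0 : (0 < n)%N) (xb : forall l, `|x l| <= bx) (D0 : 0 < D)
 (xD : forall l m, l != m -> D <= `|x l - x m|) (sl0 : 0 < sl) (b0 : 0 < b) (cp : 0 < c).
Let ev := 2 * (n%:R * c2 + q%:R * c1).
Hypothesis sV : forall l, sl <= J P (fun w => gc (x l) 1 w * gc (x l) 1 w) - ev.

Definition gsum l w := \sum_(i < n) gc (x l) i.+1 w.
Definition svar l := n%:R^-1 * J P (fun w => gsum l w ^+ 2).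
Definition tau l := Num.sqrt (n%:R * svar l)^-1.
Definition tmax := Num.sqrt (n%:R * sl)^-1.

Let nR : 0 < n%:R :> R. Proof. by rewrite ltr0n. Qed.

Let svar_V l : `|J P (fun w => gc (x l) 1 w * gc (x l) 1 w) - svar l| <= ev.
Proof.
have := gc_var_sum n (xb l); rewrite -/(gsum l) -/c1 -/c2 -/ev; set S := J P _; set v := J P _ => hS.
rewrite distrC /svar -/S (_ : _ - v = n%:R^-1 * (S - n%:R * v)); last by field; rewrite gt_eqF.
by rewrite normrM gtr0_norm ?invr_gt0// ler_pdivrMl.
Qed.

Lemma svar_ge l : sl <= svar l.
Proof. by have := sV l; have := svar_V l; rewrite ler_norml => /andP[_]; lra. Qed.

Let svar_gt0 l : 0 < svar l. Proof. exact: lt_le_trans (svar_ge l). Qed.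

Let tau_sq l : tau l ^+ 2 = (n%:R * svar l)^-1.
Proof. by rewrite sqr_sqrtr// invr_ge0 ltW// mulr_gt0. Qed.

Let tmax_sq : tmax ^+ 2 = (n%:R * sl)^-1.
Proof. by rewrite sqr_sqrtr// invr_ge0 ltW// mulr_gt0. Qed.

Let tau_ge0 l : 0 <= tau l. Proof. exact: sqrtr_ge0. Qed.
Let tmax_ge0 : 0 <= tmax. Proof. exact: sqrtr_ge0. Qed.

Let tau_le l : tau l <= tmax.
Proof.
apply: ler_wsqrtr; rewrite lef_pV2 ?posrE ?(mulr_gt0 nR)//.
by rewrite ler_pM2l// svar_ge.
Qed.

Let w k om l := gc (x l) k.+1 om * tau l.
Let eta0 := 2 * e1 * tmax + 16 * B1 * e1 * tmax ^+ 2.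
Let eta := tmax ^+ 2 * (B1 ^+ 2 * (8 * (mu * nu rho) + 7 * mu ^+ 2 + 4 * h / D * mu) + ev).

Let tt l m : 0 <= tau l * tau m <= tmax ^+ 2.
Proof. by rewrite (mulr_ge0 (tau_ge0 l) (tau_ge0 m))/= expr2; exact: ler_pM. Qed.

Let nu0 : 0 <= nu rho. Proof. by have [mu0 _] := mu_ge; exact: le_trans mu0 (nu_ge rho0). Qed.
Let c1_ge0 : 0 <= c1.
Proof. by have [mu0 _] := mu_ge; apply: mulr_ge0; [exact: sqr_ge0|apply: mulr_ge0 => //; exact: mulr_ge0]. Qed.
Let c2_ge0 : 0 <= c2.
Proof. by rewrite /c2; apply: mulr_ge0; [exact: mulr_ge0|exact: e1_ge0]. Qed.
Let ev_ge0 : 0 <= ev.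
Proof. by apply: mulr_ge0 => //; apply: addr_ge0; exact: mulr_ge0. Qed.
Let hD_ge0 : 0 <= 4 * h / D * mu.
Proof. by have [mu0 _] := mu_ge; apply: mulr_ge0 => //; apply: divr_ge0; [apply: mulr_ge0 => //|]; exact: ltW. Qed.

Let eta_ge (u v : R) l m : 0 <= v <= B1 ^+ 2 * (8 * (mu * nu rho) + 7 * mu ^+ 2 + 4 * h / D * mu) + ev -> `|u| <= tau l * tau m * v -> `|u| <= eta.
Proof.
move=> /andP[v0 v1] hu; apply: le_trans hu _; have /andP[t0 t1] := tt l m.
by rewrite /eta; exact: ler_pM.
Qed.

Let w_past j k l : (k < j)%N -> measurable_fun [set: sigT Z (past j)] (fun om : sigT Z (past j) => w k om l).
Proof.
move=> kj; have mg := bmf_meas (gK_bmf (xb l)); have mXp := X_past kj.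
apply: (@meas_M _ _ (sigT Z (past j)) (gc (x l) k.+1) (fun=> tau l)); last exact: measurable_cst.
apply: (@meas_D _ _ (sigT Z (past j)) (fun om => gK (x l) (X k.+1 om)) (fun=> - Eg (x l))); last exact: measurable_cst.
exact: (measurableT_comp mg mXp).
Qed.

Let psum_past j G M : cmeas G -> (forall v, `|G v| <= M) -> pastb j M (fun om => G (psum w j om)).
Proof.
move=> mG GM; split => //; apply: (mG _ (sigT Z (past j)) (fun om l => psum w j om l)) => l.
apply: (@meas_sum _ _ (sigT Z (past j))) => i; exact: w_past.
Qed.

Let tau_J (f : Omega -> R) s : bmf f -> J P (fun om => f om * s) = J P f * s.
Proof. by move=> bf; rewrite J_Zr//; exact: bmf_itg. Qed.

Let bgg l m k k' : bmf (fun om => gc (x l) k' om * gc (x m) k om).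
Proof. by apply: bmfM; exact: gc_bmf. Qed.

Let ww_pt k' k l m om : w k' om l * w k om m = gc (x l) k'.+1 om * gc (x m) k.+1 om * (tau l * tau m).
Proof. by rewrite /w mulrACA. Qed.

Let wwE k' k l m : J P (fun om => w k' om l * w k om m) = J P (fun om => gc (x l) k'.+1 om * gc (x m) k.+1 om) * (tau l * tau m).
Proof.
transitivity (J P (fun om => gc (x l) k'.+1 om * gc (x m) k.+1 om * (tau l * tau m))).
 by congr (J P _); apply/funext => om; exact: ww_pt.
exact: tau_J (bgg l m k.+1 k'.+1).
Qed.

Let GwwE (g : Omega -> R) k' k l m : bmf g -> J P (fun om => g om * (w k' om l * w k om m)) =
 J P (fun om => g om * (gc (x l) k'.+1 om * gc (x m) k.+1 om)) * (tau l * tau m).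
Proof.
move=> bg; transitivity (J P (fun om => g om * (gc (x l) k'.+1 om * gc (x m) k.+1 om) * (tau l * tau m))).
 by congr (J P _); apply/funext => om; rewrite -mulrA -ww_pt.
exact: tau_J (bmfM bg (bgg l m k.+1 k'.+1)).
Qed.

Let GwE (g : Omega -> R) k l : bmf g -> J P (fun om => g om * w k om l) = J P (fun om => g om * gc (x l) k.+1 om) * tau l.
Proof.
move=> bg; transitivity (J P (fun om => g om * gc (x l) k.+1 om * tau l)).
 by congr (J P _); apply/funext => om; rewrite -mulrA.
exact: tau_J (bmfM bg (gc_bmf k.+1 (xb l))).
Qed.

Let zero_dec (c' : R) k l : J P (fun om => c' * w k om l) = 0.
Proof.
rewrite (GwE k l (bmf_cst c')) J_Z; last exact/bmf_itg/gc_bmf.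
by rewrite gc_mean// mulr0 mul0r.
Qed.

(** [lindeberg] for the normalised increments, followed by [radem_gauss]. Increment number [k]
    involves [X k.+1], so [psum j] depends only on innovations up to [j]. *)
Lemma gsum_clt :
 `|J P (fun om => softind c b (fun l => gsum l om * tau l)) - Ns 1 (softind_1 c b) 0 ^+ N| <=
 n%:R * step_err N n q (40 * b ^+ 3) b (5 * b ^+ 2) (4 * B1 * tmax) eta eta0 +
 N%:R * (n%:R * (3 * (40 * b ^+ 3) * (Num.sqrt n%:R^-1) ^+ 3)).
Proof.
have bb : 0 <= b by exact: ltW.
have e1g := e1_ge0; have [mu0 hmu] := mu_ge.
have t2 : 0 <= tmax ^+ 2 by exact: sqr_ge0.
have Bp := B1_ge0.
have p1 : 0 <= 2 * e1 * tmax by apply: mulr_ge0 => //; exact: mulr_ge0.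
have p2 : 0 <= 16 * B1 * e1 * tmax ^+ 2 by apply: mulr_ge0 => //; apply: mulr_ge0 => //; exact: mulr_ge0.
have eta00 : 0 <= eta0 by exact: addr_ge0.
have p4 : 0 <= 4 * B1 by exact: mulr_ge0.
have B2mu : 0 <= B1 ^+ 2 * (8 * (mu * nu rho)) by exact: c1_ge0.
have B2mm : 0 <= B1 ^+ 2 * (7 * mu ^+ 2) by apply: mulr_ge0; [exact: sqr_ge0|apply: mulr_ge0 => //; exact: sqr_ge0].
have B2hD : 0 <= B1 ^+ 2 * (4 * h / D * mu) by apply: mulr_ge0 => //; exact: sqr_ge0.
have eta_ge0 : 0 <= eta by apply: mulr_ge0; [exact: sqr_ge0|rewrite !mulrDr !addr_ge0].
have bgc l k := gc_bmf k (xb l).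
have v1 : 0 <= B1 ^+ 2 * (8 * (mu * nu rho)) <= B1 ^+ 2 * (8 * (mu * nu rho) + 7 * mu ^+ 2 + 4 * h / D * mu) + ev.
  by rewrite B2mu /= !mulrDr -!addrA lerDl; apply: addr_ge0 => //; exact: addr_ge0.
have v3 : 0 <= B1 ^+ 2 * (4 * h / D * mu + 7 * mu ^+ 2) <= B1 ^+ 2 * (8 * (mu * nu rho) + 7 * mu ^+ 2 + 4 * h / D * mu) + ev.
 rewrite !mulrDr; apply/andP; split; first exact: addr_ge0.
 apply: le_trans (_ : B1 ^+ 2 * (8 * (mu * nu rho)) + B1 ^+ 2 * (7 * mu ^+ 2) + B1 ^+ 2 * (4 * h / D * mu) <= _); last by rewrite lerDl.
 by rewrite (addrC (B1 ^+ 2 * (4 * h / D * mu))) -addrA lerDr.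
have v2 : 0 <= ev <= B1 ^+ 2 * (8 * (mu * nu rho) + 7 * mu ^+ 2 + 4 * h / D * mu) + ev.
  by rewrite ev_ge0 /= lerDr !mulrDr; apply: addr_ge0 => //; exact: addr_ge0.
(* For [j = 0] the partial sum is empty and decorrelation holds with error 0. *)
have wcst j (G : ('I_N -> R) -> R) : j = 0%N -> exists g, forall om, G (psum w j om) = g.
 move=> ->; exists (G (fun=> 0)) => om; congr G; apply/funext => l; exact: big_ord0.
have hl := @lindeberg _ _ _ P N n q w (40 * b ^+ 3) b (5 * b ^+ 2) (4 * B1 * tmax) eta eta0.
have := hl _ _ _ _ eta_ge0 eta00 n0 _ _ _ _ _ _ _ _ _ (smooth_softind N cp b0).
have -> : (fun om => softind c b (psum w n om)) = (fun om => softind c b (fun l => gsum l om * tau l)).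
 by apply/funext => om; congr softind; apply/funext => l; rewrite /psum /gsum mulr_suml.
move=> H; apply: le_trans (ler_distD (iter n (radem (Num.sqrt n%:R^-1)) (softind (N := N) c b) (fun=> 0)) _ _) _.
apply: lerD; last exact: radem_gauss.
apply: H.
- by rewrite mulr_ge0// exprn_ge0.
- by [].
- by rewrite mulr_ge0// sqr_ge0.
- exact: mulr_ge0.
- by move=> k l; rewrite /w; apply: meas_M; [exact: bmf_meas|exact: measurable_cst].
- by move=> k om l; rewrite normrM (ger0_norm (tau_ge0 l)) ler_pM// gc_abs.
- move=> j k l G M mG GM kn hj; have M0 : 0 <= M by apply: le_trans (GM (fun=> 0)); exact: normr_ge0.
 have le0 : 2 * M * e1 * tau l <= eta0 * M.
  apply: le_trans (_ : 2 * e1 * tmax * M <= _); last by rewrite ler_wpM2r// lerDl.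
  rewrite (_ : 2 * M * e1 * tau l = 2 * e1 * tau l * M); last by ring.
  by rewrite ler_wpM2r//; apply: ler_wpM2l => //; exact: mulr_ge0.
 have le1 : 0 <= 2 * M * e1 * tau l by rewrite mulr_ge0//; apply: mulr_ge0 => //; exact: mulr_ge0.
 apply: le_trans le0; case/orP: hj => [/eqP j0|hj].
  have [g hg] := wcst _ G j0.
  have -> : (fun om => G (psum w j om) * w k om l) = (fun om => g * w k om l) by apply/funext => om; rewrite hg.
  by rewrite zero_dec normr0.
 have pp := psum_past j mG GM; rewrite (GwE k l (pastb_bmf pp)).
 rewrite normrM (ger0_norm (tau_ge0 l)); apply: ler_wpM2r; first exact: tau_ge0.
 exact: (gc_dec1 (xb l) (leqW hj) pp).
- move=> j k' k l m G M mG GM kn hj; have M0 : 0 <= M by apply: le_trans (GM (fun=> 0)); exact: normr_ge0.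
 have /andP[t0 t1] := tt l m.
 have pp := psum_past j mG GM; have bG := pastb_bmf pp.
 have E := congr2 (fun u v : R => u - J P (fun om => G (psum w j om)) * v) (GwwE k' k l m bG) (wwE k' k l m).
 rewrite {}E mulrA -mulrBl normrM (ger0_norm t0).
 case/orP: hj => [/eqP j0|hj].
  have [g hg] := wcst _ G j0.
  have -> : (fun om => G (psum w j om) * (gc (x l) k'.+1 om * gc (x m) k.+1 om)) =
    (fun om => g * (gc (x l) k'.+1 om * gc (x m) k.+1 om)) by apply/funext => om; rewrite hg.
  have -> : (fun om => G (psum w j om)) = fun=> g by apply/funext => om.
  by rewrite (Ex_cst P g) (J_Z _ (bmf_itg P (bgg l m k.+1 k'.+1))) subrr normr0 mul0r mulr_ge0.
 case/andP: kn => kk _.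
 apply: le_trans (ler_pM _ t0 (gc_dec2 (xb l) (xb m) (leqW hj) (leqW (leq_trans hj kk)) pp) t1) _ => //.
 rewrite (_ : 2 * M * (8 * B1 * e1) * tmax ^+ 2 = 16 * B1 * e1 * tmax ^+ 2 * M); last by ring.
 by rewrite ler_wpM2r// lerDr.
- move=> k' k l m /andP[kk _].
 rewrite wwE.
 have /andP[t0 _] := tt l m.
 apply: (@eta_ge _ _ l m v1).
 rewrite normrM (ger0_norm t0) (mulrC _ (tau l * tau m)); apply: ler_wpM2l; first exact: t0.
 exact: (@cov_lag (x l) (x m) k'.+1 k.+1 (xb l) (xb m) kk).
- move=> k l m kn.
 rewrite wwE.
 have /andP[t0 _] := tt l m.
 (* On the diagonal the error is the gap [ev] between the variance of one summand and [svar]; off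
    the diagonal the separation [D] of the points enters. *)
 case: eqVneq => [lm|lm].
  apply: (@eta_ge _ _ l m v2).
  rewrite -lm (gc_same k.+1 (xb l) (xb l)) -(expr2 (tau l)) tau_sq.
  have iv : 0 < (n%:R * svar l)^-1 by rewrite invr_gt0; exact: mulr_gt0.
  rewrite (_ : _ - n%:R^-1 = (n%:R * svar l)^-1 * (J P (fun w => gc (x l) 1 w * gc (x l) 1 w) - svar l)); last first.
   by field; rewrite !gt_eqF.
  by rewrite normrM (gtr0_norm iv); apply: ler_wpM2l; [exact: ltW|exact: svar_V].
 rewrite subr0; apply: (@eta_ge _ _ l m v3).
 rewrite normrM (ger0_norm t0) (mulrC _ (tau l * tau m)); apply: ler_wpM2l; first exact: t0.
 exact: (cov_same k.+1 (xb l) (xb m) D0 (xD lm)).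
Qed.

End clt.
End decorrelation.
End kernel_moments.
End autoregression.

Ltac pos := repeat first [assumption | exact: expR_ge0 | apply: mulr_ge0 | apply: addr_ge0 | apply: exprn_ge0 | by []].

(** * Bookkeeping of the error terms *)

Section error_terms.
Context {R : realType}.
Implicit Types (n N q : nat).

(** From [y <= expR y] at [y = gam / 10 * L], raised to the power 10. Ten powers cover the [L ^+ 9]
    of the error terms and one more for the rate. *)
Lemma ln_pow_decay (gam L : R) : 0 < gam -> 0 <= L -> L ^+ 10 * expR (- (gam * L)) <= (10 / gam) ^+ 10.
Proof.
move=> g0 L0; rewrite expRN ler_pdivrMr ?expR_gt0//.
have h : gam / 10 * L <= expR (gam / 10 * L) by apply: le_trans (expR_ge1Dx _); rewrite lerDr.
have gl : 0 <= gam / 10 * L by rewrite mulr_ge0// divr_ge0// ltW.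
have h10 : (gam / 10 * L) ^+ 10 <= expR (gam * L).
 rewrite (_ : gam * L = 10%:R * (gam / 10 * L)); last by field.
 by rewrite expRM_natl lerXn2r// nnegrE expR_ge0.
have -> : L ^+ 10 = (10 / gam) ^+ 10 * (gam / 10 * L) ^+ 10 by field; rewrite gt_eqF.
by rewrite ler_wpM2l// exprn_ge0// divr_ge0// ltW.
Qed.

Lemma step_errM n N q (K B1 B2 e0 eta eta0 : R) : (0 < n)%N ->
 n%:R * step_err N n q K B1 B2 e0 eta eta0 =
 K * (n%:R * e0 ^+ 3) * (1 + 2 * q%:R + q%:R ^+ 2) - K * (n%:R * e0 ^+ 3) * 0 + B1 * (n%:R * N%:R * eta0) +
 B2 * (n%:R * N%:R ^+ 2 * eta0) * (1 + q%:R) + B2 * (n%:R * eta) * (1 + q%:R) + K * q%:R * e0 + K * (n%:R * Num.sqrt n%:R^-1 ^+ 3).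
Proof.
move=> n0; have nz : n%:R != 0 :> R by rewrite pnatr_eq0 -lt0n.
by rewrite /step_err; move: (Num.sqrt _) => s; field.
Qed.

Lemma sum_bound (G G3 Z t1 t2 t3 t4 t5 t6 t7 t8 t9 t10 t11 : R) : 0 <= G -> G <= G3 ->
 t1 <= 160 * G -> t2 <= 1 * G -> t3 <= 10 * G -> t4 <= 10 * G -> t5 <= 40 * G -> t6 <= 40 * G -> t7 <= 120 * G ->
 t8 <= 3 * G -> t9 <= 1 * G -> t10 <= 2 * G3 -> t11 <= Z ->
 t1 + t2 + t3 + t4 + t5 + t6 + t7 + t8 + t9 + (t11 + t10) <= 1000 * G3 + Z.
Proof. lra. Qed.

(** Sharpness [L ^+ 3] times shift [(L ^+ 2)^-1] is [L], so the errors of the soft indicator carry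
    [expR (- L) = 1 / n]. All terms containing [N] or powers of [e0] keep a surplus of at least
    [n^(-1/5)]; the covariance term keeps [n^-gam]. *)
Lemma error_bound (Q gam L e0 eta eta0 : R) n N q : 1 <= Q -> 0 < gam -> gam <= 1 / 5 -> 1 <= L -> n%:R = expR L ->
 N%:R <= Q * expR (L / 5) -> q%:R <= Q -> 0 <= e0 <= Q * expR (- (2 / 5 * L)) -> 0 <= eta0 <= Q * expR (- (3 * L)) ->
 0 <= eta <= Q * (expR (- L) * (L ^+ 2 * expR (- (gam * L)))) ->
 n%:R * step_err N n q (40 * (L ^+ 3) ^+ 3) (L ^+ 3) (5 * (L ^+ 3) ^+ 2) e0 eta eta0 +
 N%:R * (n%:R * (3 * (40 * (L ^+ 3) ^+ 3) * (Num.sqrt n%:R^-1) ^+ 3)) +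
 3 * N%:R * expR (- (L ^+ 3 * (L ^+ 2)^-1)) + expR (- (L ^+ 3 * (L ^+ 2)^-1)) +
 (4 * (L ^+ 2)^-1 * expR (2 * (L ^+ 2)^-1 * (2 * L) + 3 / 2) * (1 + 2 * L) +
  N%:R * (2 * expR (1 / 2) * expR (- (2 * L - 2 * (L ^+ 2)^-1)))) <=
 (1000 * Q ^+ 5 * (10 / gam) ^+ 10 * expR 3 + 12 * expR 6) / L.
Proof.
move=> Q1 g0 g5 L1 nE hN hq /andP[e00 he0] /andP[h00 h0] /andP[eta_ge heta].
have L0 : 0 < L by exact: lt_le_trans L1.
have Q0 : 0 <= Q by exact: le_trans Q1.
have n0 : (0 < n)%N by rewrite -(ltr0n R) nE expR_gt0.
pose y := expR (- (gam * L)); have y0 : 0 <= y by exact: expR_ge0.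
pose a := expR (L / 5); have a0 : 0 < a by exact: expR_gt0.
have ex (k : R) : 1 / 5 <= k -> expR (- (k * L)) <= y.
 by move=> hk; rewrite ler_expR lerN2 ler_wpM2r ?(ltW L0)// (le_trans g5).
have N0 : 0 <= N%:R :> R by []. have q0 : 0 <= q%:R :> R by [].
have Nn0 : 0 <= n%:R :> R by [].
have Lu : L ^+ 3 * (L ^+ 2)^-1 = L by field; rewrite gt_eqF.
rewrite Lu.
have s3 : Num.sqrt (n%:R^-1) ^+ 3 = expR (- (3 / 2 * L)).
 have -> : n%:R^-1 = expR (- (L / 2)) ^+ 2 :> R by rewrite nE -expRN -expRM_natl; congr expR; field.
 by rewrite sqrtr_sqr ger0_norm ?expR_ge0// -expRM_natl; congr expR; field.
have e5 (u v : R) : expR u * expR v = expR (u + v) by rewrite expRD.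
have F1 : n%:R * e0 ^+ 3 <= Q ^+ 3 * y.
 apply: le_trans (_ : n%:R * (Q * expR (- (2 / 5 * L))) ^+ 3 <= _); first by rewrite ler_wpM2l// lerXn2r// nnegrE// mulr_ge0// expR_ge0.
 rewrite exprMn -expRM_natl mulrCA nE e5 ler_wpM2l ?exprn_ge0//.
 by rewrite (_ : L + _ = - (1 / 5 * L)) ?ex//; field.
have F2 : n%:R * N%:R * eta0 <= Q ^+ 2 * y.
 apply: le_trans (_ : n%:R * (Q * a) * (Q * expR (- (3 * L))) <= _); first by rewrite ler_pM// ?mulr_ge0// ler_wpM2l.
 rewrite (_ : n%:R * _ * _ = Q ^+ 2 * (n%:R * a * expR (- (3 * L)))); last by ring.
 rewrite nE !e5 ler_wpM2l ?exprn_ge0// (_ : L + _ + _ = - (9 / 5 * L)) ?ex//; last by field.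
 by lra.
have F3 : n%:R * N%:R ^+ 2 * eta0 <= Q ^+ 3 * y.
 apply: le_trans (_ : n%:R * (Q * a) ^+ 2 * (Q * expR (- (3 * L))) <= _).
  by rewrite ler_pM// ?mulr_ge0 ?exprn_ge0// ler_wpM2l// lerXn2r// nnegrE// mulr_ge0// ltW.
 rewrite (_ : n%:R * _ * _ = Q ^+ 3 * (n%:R * a * a * expR (- (3 * L)))); last by ring.
 rewrite nE !e5 ler_wpM2l ?exprn_ge0// (_ : L + _ + _ + _ = - (8 / 5 * L)) ?ex//; last by field.
 by lra.
have F4 : n%:R * eta <= Q * (L ^+ 2 * y).
 apply: le_trans (ler_wpM2l Nn0 heta) _.
 rewrite (_ : n%:R * _ = Q * (L ^+ 2 * y) * (expR L * expR (- L))); last by rewrite nE /y; ring.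
 by rewrite e5 addrN expR0 mulr1.
have F5 : e0 <= Q * y by apply: le_trans he0 _; rewrite ler_wpM2l// ex//; lra.
have F6 : n%:R * Num.sqrt (n%:R^-1) ^+ 3 <= y.
 by rewrite s3 nE e5 (_ : L + _ = - (1 / 2 * L)) ?ex//; [lra|by field].
have F7 : N%:R * (n%:R * Num.sqrt (n%:R^-1) ^+ 3) <= Q * y.
 apply: le_trans (_ : Q * a * (n%:R * Num.sqrt (n%:R^-1) ^+ 3) <= _); first by rewrite ler_wpM2r// mulr_ge0// exprn_ge0// sqrtr_ge0.
 rewrite -mulrA ler_wpM2l// s3 nE !e5 (_ : L / 5 + _ = - (3 / 10 * L)) ?ex//; [lra|by field].
have F8 : N%:R * expR (- L) <= Q * y.
 apply: le_trans (_ : Q * a * expR (- L) <= _); first by rewrite ler_wpM2r ?expR_ge0.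
 rewrite -mulrA ler_wpM2l// e5 (_ : L / 5 - L = - (4 / 5 * L)) ?ex//; [lra|by field].
have F9 : expR (- L) <= y by rewrite -(mul1r L) ex//; lra.
have iL : (L ^+ 2)^-1 <= 1 by rewrite invf_le1 ?exprn_gt0// exprn_ege1.
have iL0 : 0 <= (L ^+ 2)^-1 by rewrite invr_ge0 exprn_ge0// ltW.
have F10 : N%:R * (2 * expR (1 / 2) * expR (- (2 * L - 2 * (L ^+ 2)^-1))) <= Q * y * (2 * expR 3).
 apply: le_trans (_ : Q * a * (2 * expR (1 / 2) * (expR 2 * expR (- (2 * L)))) <= _).
  apply: ler_pM; [by []|by rewrite !mulr_ge0 ?expR_ge0|exact: hN|].
  by rewrite ler_wpM2l ?mulr_ge0 ?expR_ge0// e5 ler_expR; lra.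
 rewrite (_ : Q * a * _ = Q * (a * expR (- (2 * L))) * (2 * (expR (1 / 2) * expR 2))); last by ring.
 apply: ler_pM; [by rewrite !mulr_ge0 ?expR_ge0|by rewrite !mulr_ge0 ?expR_ge0| |].
  rewrite ler_wpM2l// e5 (_ : L / 5 + _ = - (9 / 5 * L)) ?ex//; [lra|by field].
 by rewrite ler_pM2l// e5 ler_expR; lra.
have F11 : 4 * (L ^+ 2)^-1 * expR (2 * (L ^+ 2)^-1 * (2 * L) + 3 / 2) * (1 + 2 * L) <= 12 * expR 6 / L.
 have l4 : 2 * (L ^+ 2)^-1 * (2 * L) <= 4.
  rewrite (_ : _ * _ * _ = 4 / L); last by field; rewrite gt_eqF.
  by rewrite ler_pdivrMr//; lra.
 apply: le_trans (_ : 4 * (L ^+ 2)^-1 * expR 6 * (3 * L) <= _).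
  apply: ler_pM; [by rewrite !mulr_ge0 ?expR_ge0|lra| |lra].
  by rewrite ler_wpM2l ?mulr_ge0// ler_expR; lra.
 by rewrite le_eqVlt; apply/orP; left; apply/eqP; field; rewrite gt_eqF.
(* Common majorant of all terms except the anticoncentration one of order [1 / L]: at most five
   factors [Q] and nine factors [L] occur. *)
pose G := Q ^+ 5 * (L ^+ 9 * y).
have L9 (k : nat) : (k <= 9)%N -> L ^+ k <= L ^+ 9 by move=> k9; rewrite ler_weXn2l.
have Qk (k : nat) : (k <= 5)%N -> Q ^+ k <= Q ^+ 5 by move=> k5; rewrite ler_weXn2l.
have L9_ge0 k : 0 <= L ^+ k by rewrite exprn_ge0// ltW.
have Q_ge0 k : 0 <= Q ^+ k by rewrite exprn_ge0.
have GE (i j : nat) X f : (i <= 5)%N -> (j <= 9)%N -> 0 <= X -> X <= Q ^+ i * (L ^+ j * y) * f -> 0 <= f -> X <= f * G.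
 move=> hi hj X0 hX f0; apply: le_trans hX _; rewrite mulrC ler_wpM2l//.
 by apply: ler_pM; rewrite ?mulr_ge0// ?Qk// ler_wpM2r// L9.
have L00 := ltW L0.
have A40 : 0 <= 40 * (L ^+ 3) ^+ 3 by pos.
have A5 : 0 <= 5 * (L ^+ 3) ^+ 2 by pos.
have s00 : 0 <= Num.sqrt (n%:R^-1 : R) by exact: sqrtr_ge0.
have ns : 0 <= n%:R * Num.sqrt (n%:R^-1 : R) ^+ 3 by pos.
have c1 : 40 * (L ^+ 3) ^+ 3 * (n%:R * e0 ^+ 3) * (1 + 2 * q%:R + q%:R ^+ 2) <= 160 * G.
 apply: le_trans (_ : 40 * (L ^+ 3) ^+ 3 * (Q ^+ 3 * y) * (4 * Q ^+ 2) <= _).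
  have q2 : q%:R ^+ 2 <= Q ^+ 2 by rewrite lerXn2r ?nnegrE.
  have Q2 : Q <= Q ^+ 2 by rewrite expr2 ler_peMr.
  apply: ler_pM; [by pos|by pos|by apply: ler_wpM2l => //; pos|lra].
 by rewrite le_eqVlt; apply/orP; left; apply/eqP; rewrite /G; ring.
have c2 : L ^+ 3 * (n%:R * N%:R * eta0) <= 1 * G.
 apply: (GE 2%N 3%N); [by []|by []|by pos| |by pos]; apply: le_trans (ler_wpM2l _ F2) _; first by pos.
 by rewrite le_eqVlt; apply/orP; left; apply/eqP; ring.
have q1 : 1 + q%:R <= 2 * Q by lra.
have c3 : 5 * (L ^+ 3) ^+ 2 * (n%:R * N%:R ^+ 2 * eta0) * (1 + q%:R) <= 10 * G.
 apply: (GE 4%N 6%N); [by []|by []|by pos| |by pos].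
 apply: le_trans (_ : 5 * (L ^+ 3) ^+ 2 * (Q ^+ 3 * y) * (2 * Q) <= _).
  by apply: ler_pM; [pos|pos|apply: ler_wpM2l => //; pos|].
 by rewrite le_eqVlt; apply/orP; left; apply/eqP; ring.
have c4 : 5 * (L ^+ 3) ^+ 2 * (n%:R * eta) * (1 + q%:R) <= 10 * G.
 apply: (GE 2%N 8%N); [by []|by []|by pos| |by pos].
 apply: le_trans (_ : 5 * (L ^+ 3) ^+ 2 * (Q * (L ^+ 2 * y)) * (2 * Q) <= _).
  by apply: ler_pM; [pos|pos|apply: ler_wpM2l => //; pos|].
 by rewrite le_eqVlt; apply/orP; left; apply/eqP; ring.
have c5 : 40 * (L ^+ 3) ^+ 3 * q%:R * e0 <= 40 * G.
 apply: (GE 2%N 9%N); [by []|by []|by pos| |by pos].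
 apply: le_trans (_ : 40 * (L ^+ 3) ^+ 3 * Q * (Q * y) <= _).
  by apply: ler_pM; [pos|pos|apply: ler_wpM2l => //; pos|].
 by rewrite le_eqVlt; apply/orP; left; apply/eqP; ring.
have s0 : 0 <= Num.sqrt (n%:R^-1 : R) by exact: sqrtr_ge0.
have c6 : 40 * (L ^+ 3) ^+ 3 * (n%:R * Num.sqrt (n%:R^-1) ^+ 3) <= 40 * G.
 apply: (GE 0%N 9%N); [by []|by []|by pos| |by pos]; apply: le_trans (ler_wpM2l _ F6) _; first by pos.
 by rewrite le_eqVlt; apply/orP; left; apply/eqP; ring.
have QG (X : R) : X <= Q * y -> L ^+ 9 * X <= G.
 move=> hX; apply: le_trans (ler_wpM2l (L9_ge0 9%N) hX) _; rewrite /G mulrCA.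
 by apply: ler_wpM2r; [pos|have := Qk 1%N isT; rewrite expr1].
have c7 : N%:R * (n%:R * (3 * (40 * (L ^+ 3) ^+ 3) * (Num.sqrt n%:R^-1) ^+ 3)) <= 120 * G.
 rewrite (_ : N%:R * _ = 120 * (L ^+ 9 * (N%:R * (n%:R * Num.sqrt n%:R^-1 ^+ 3)))); last by ring.
 by rewrite ler_pM2l//; exact: QG.
have c8 : 3 * N%:R * expR (- L) <= 3 * G.
 apply: (GE 1%N 0%N); [by []|by []|by pos| |by []]; rewrite -mulrA; apply: le_trans (ler_wpM2l _ F8) _ => //.
 by rewrite le_eqVlt; apply/orP; left; apply/eqP; ring.
have c9 : expR (- L) <= 1 * G.
 by apply: (GE 0%N 0%N); [by []|by []|by pos|rewrite !expr0 !mul1r mulr1|by []].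
have c10 : N%:R * (2 * expR (1 / 2) * expR (- (2 * L - 2 * (L ^+ 2)^-1))) <= 2 * expR 3 * G.
 apply: (GE 1%N 0%N); [by []|by []|by pos| |by pos]; apply: le_trans F10 _.
 by rewrite le_eqVlt; apply/orP; left; apply/eqP; ring.
have G0 : 0 <= G by rewrite !mulr_ge0.
have E3 : 1 <= expR 3 :> R by apply: le_trans (expR_ge1Dx _); lra.
have GL : G <= Q ^+ 5 * (10 / gam) ^+ 10 / L.
 rewrite ler_pdivlMr// /G -mulrA ler_wpM2l// mulrAC -exprSr; exact: ln_pow_decay (ltW L0).
rewrite (step_errM _ _ _ _ _ _ _ _ n0).
have GE3 : G <= expR 3 * G by rewrite ler_peMl.
apply: le_trans (_ : 1000 * (expR 3 * G) + 12 * expR 6 / L <= _).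
 rewrite (mulr0 (40 * _ * _)) subr0; rewrite -(mulrA 2 (expR 3)) in c10.
 exact: (sum_bound G0 GE3 c1 c2 c3 c4 c5 c6 c7 c8 c9 c10 F11).
have := ler_wpM2l (expR_ge0 3) GL; set X := Q ^+ 5 * _ / L => hX.
apply: le_trans (_ : 1000 * (expR 3 * X) + 12 * expR 6 / L <= _); first by rewrite lerD2r ler_pM2l.
rewrite /X; move: ((10 / gam) ^+ 10) (Q ^+ 5) (expR 3) (expR 6) => g1 g2 g3 g6.
by rewrite le_eqVlt; apply/orP; left; apply/eqP; ring.
Qed.

End error_terms.

(** * The rate for the maximum, with uniform constants *)

Lemma exp_half_pow {R : realType} n (L : R) : (0 < n)%N -> n%:R = expR L ->
 (2^-1 : R) ^+ (trunc_log 2 n).+1 <= expR (- L) /\ ((trunc_log 2 n)%:R : R) <= 2 * L.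
Proof.
move=> n0 nE; have e2 : expR (1 / 2) <= 2 :> R.
 have := expR_ge1Dx (- (1 / 2 : R)); rewrite expRN (_ : 1 + - (1 / 2) = 2^-1); last by field.
 by rewrite lef_pV2 ?posrE ?expR_gt0.
split.
 rewrite expRN exprVn lef_pV2 ?posrE ?expR_gt0 ?exprn_gt0// -nE -natrX ler_nat.
 exact: ltnW (trunc_log_ltn _ _).
have h : (2 ^ trunc_log 2 n)%:R <= n%:R :> R by rewrite ler_nat trunc_logP.
have : expR ((trunc_log 2 n)%:R * (1 / 2)) <= expR L.
 rewrite expRM_natl -nE; apply: le_trans h; rewrite natrX lerXn2r// nnegrE ?expR_ge0//.
rewrite ler_expR; lra.
Qed.

Ltac posi := repeat first [assumption | exact: expR_ge0 | apply: divr_ge0 | apply: mulr_ge0 | apply: addr_ge0 | apply: exprn_ge0 | apply: ltW; assumption | by []].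
Ltac spos := repeat first [assumption | exact: expR_gt0 | apply: divr_gt0 | apply: mulr_gt0 | apply: exprn_gt0 | by []].

(** [C] and [L0] are fixed before the probability space, the kernel and the points, so that one rate
    serves all [n]. [L] stands for [ln n] and [hb] for the size [h^(- alpha)] of the kernel. *)
Lemma max_rate {R : realType} (bx C1 C2 kB kb M aa cL u0 Qn gam : R) (q : nat) :
 1 <= bx -> 0 <= C1 -> 0 <= C2 -> 0 < kB -> 0 < kb -> 0 <= M -> 0 < aa -> 0 < cL -> 0 < u0 -> 0 <= Qn -> 0 < gam -> gam <= 1 / 5 ->
 exists C L0 : R, 1 <= L0 /\ forall d (Omega : measurableType d) (P : probability Omega R) (rho : R) (Z X : nat -> Omega -> R),
 0 <= rho -> rho <= 1 -> (forall i, measurable_fun setT (Z i)) -> mutually_independent P Z ->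
 (forall k w, X k w = \sum_(i < k.+1) rho ^+ (k - i) * Z i w) ->
 (forall k (f : R -> R), bmf f -> J P (fun w => f (X k w)) = J P (fun w => f (X 0%N w))) ->
 (forall k x u, 0 < u -> pr P (fun w => `|X k w - x| <= u) <= C1 * u) ->
 (forall k c, 0 < c -> pr P (fun w => c < `|X k w|) <= C2 / c) ->
 (forall z u, aa <= z <= bx + aa -> 0 < u <= u0 -> cL * u <= pr P (fun w => z <= X 1%N w <= z + u)) ->
 forall (n N : nat) (L h theta D hb y0 : R) (Kf : R -> R) (x : 'I_N -> R),
 n%:R = expR L -> L0 <= L -> N%:R <= Qn * expR (L / 5) -> 0 < hb -> 0 < D ->
 rho <= expR (- (gam * L)) -> rho ^+ q <= expR (- (12 * L)) ->
 expR (- (L / 5)) <= h -> h <= expR (- (gam * L)) -> h / D <= expR (- (gam * L)) ->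
 h * M <= aa -> h * (kb / (2 * kB)) <= u0 -> bx + aa + kb / (2 * kB) <= theta -> theta <= expR L ->
 measurable_fun setT Kf -> (forall v, `|Kf v| <= kB * hb) -> (forall v, `|v * Kf v| <= kB * hb) ->
 (forall v v', `|Kf v - Kf v'| <= kB * hb * `|v - v'|) -> `|y0| <= M -> kb * hb <= `|Kf y0| ->
 (forall l, 2 * aa <= x l <= bx) -> (forall l m, l != m -> D <= `|x l - x m|) ->
 [/\ forall l, 0 < svar P X h theta Kf n x l &
 forall d' (T' : measurableType d') (Q : probability T' R) (Y : 'I_N -> T' -> R) t, std_normal_vector Q Y ->
 `|fine (P [set w | \big[Num.max/0]_(l < N) `|gsum P X h theta Kf n x l w * tau P X h theta Kf n x l| <= t]) -
  fine (Q [set w | \big[Num.max/0]_(l < N) `|Y l w| <= t])| <= C / L].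
Proof.
move=> bx1 C10 C20 kB0 kb0 M0 aa0 cL0 u00 Qn0 g0 g5.
pose be := bx * kB; pose kap := kb / (2 * kB).
(* [kv * (hb ^+ 2 * h)] is the main term of [gc_var_lower]; half of it survives as [sl]. *)
pose kv := (aa * (kb / 2)) ^+ 2 * (cL * kap).
(* [Ka] governs the normalised summands, [b1 ^+ 2 * tm ^+ 2 = Ka / h / n]; [kL * L] bounds the
   logarithmic factor in [nu]; [ke] comes from the decorrelation error [e1]. *)
pose Ka := 2 * be ^+ 2 / kv; pose kL := 6 * A0 C1 C2 + 2; pose ke := 2 + 4 * (C1 + C2).
pose kev := 16 * ke + 32 * q%:R * kL ^+ 2; pose k1 := kev + 4 * kL ^+ 2; pose k2 := 23 * kL ^+ 2 + 4 * kL + kev.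
pose Q := 1 + Qn + q%:R + 4 * (1 + Ka) + ke * (18 * (1 + Ka)) + Ka * k2.
have bx0 : 0 < bx by exact: lt_le_trans bx1.
have be0 : 0 < be by exact: mulr_gt0.
have kap0 : 0 < kap by rewrite /kap divr_gt0// mulr_gt0.
have kv0 : 0 < kv by rewrite /kv; spos.
have Ka0 : 0 < Ka by rewrite /Ka divr_gt0// mulr_gt0// exprn_gt0.
have A00 : 0 <= A0 C1 C2 by exact: A0_ge0.
have kL0 : 0 < kL by rewrite /kL ltr_wpDl// mulr_ge0.
have ke0 : 0 < ke by rewrite /ke; lra.
have q0 : 0 <= q%:R :> R by [].
have kL2 : 0 < kL ^+ 2 by exact: exprn_gt0.
have qk : 0 <= q%:R * kL ^+ 2 by rewrite mulr_ge0// ltW.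
have kev0 : 0 < kev by rewrite /kev -mulrA; move: qk ke0; lra.
have k10 : 0 < k1 by rewrite /k1; lra.
have k20 : 0 < k2 by rewrite /k2; lra.
have ek : 0 < ke * (18 * (1 + Ka)) by rewrite mulr_gt0//; lra.
have Kk : 0 < Ka * k2 by exact: mulr_gt0.
have Q1 : 1 <= Q by rewrite /Q; clear -ek Kk Ka0 Qn0 q0; lra.
pose G10 := (10 / gam) ^+ 10.
(* The threshold on [L] makes the squared mean and the covariance errors at most half of the main
   variance term, see [Ly]. *)
exists (1000 * Q ^+ 5 * G10 * expR 3 + 12 * expR 6), (1 + 2 * be ^+ 2 * k1 * G10 / kv).
have G100 : 0 <= G10 by rewrite exprn_ge0// divr_ge0// ltW.
have C0 : 1 <= 1 + 2 * be ^+ 2 * k1 * G10 / kv by rewrite lerDl; posi.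
split=> //.
move=> d Omega P rho Z X rho0 rho1 mZ iZ XE lawX ball tail low n N L h theta D hb y0 Kf x nE LL hN hb0 D0 rhoy rhoq hL hy hD hM hk th1 th2 mK K1 K2 K3 y0M Ky xb xD.
have L1 : 1 <= L by exact: le_trans LL.
have L0 : 0 < L by exact: lt_le_trans L1.
have n0 : (0 < n)%N by rewrite -(ltr0n R) nE expR_gt0.
have h0 : 0 < h by exact: lt_le_trans (expR_gt0 _) hL.
pose y := expR (- (gam * L)); have y0' : 0 < y by exact: expR_gt0.
have y1 : y <= 1 by rewrite -expR0 ler_expR oppr_le0 mulr_ge0// ltW.
have h1 : h <= 1 by exact: le_trans y1.
pose Jn := (trunc_log 2 n).+1; have [J1 J2] := exp_half_pow n0 nE.
have Jh : (2^-1) ^+ Jn <= h by apply: le_trans J1 _; apply: le_trans hL; rewrite ler_expR lerN2; lra.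
have Jn3 : Jn%:R <= 3 * L by rewrite /Jn -(natr1 (trunc_log 2 n)); lra.
have B0 : 0 < kB * hb by exact: mulr_gt0.
have xbx l : `|x l| <= bx by have /andP[l1 l2] := xb l; rewrite ger0_norm//; apply: le_trans l1; lra.
have theta0 : 0 <= theta by apply: le_trans th1; rewrite -/kap; lra.
(* Displacement [n^-6] and truncation [n^6], compatible because [rho ^+ q <= n^-12]. *)
pose rr := expR (- (6 * L)); pose Rr := expR (6 * L).
have rr0 : 0 < rr by exact: expR_gt0.
have Rr0 : 0 < Rr by exact: expR_gt0.
have rrE : rho ^+ q * Rr <= rr.
 apply: le_trans (_ : expR (- (12 * L)) * Rr <= _); first by rewrite ler_pM2r.
 by rewrite -expRD ler_expR; clear -L0; lra.
(* Compound quantities become opaque variables with a defining equation, substituted back before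
   [gsum_clt] is applied. *)
have [b1 b1D] : {z : R | z = B1 (kB * hb) bx} by eexists.
have b1E : b1 = be * hb by rewrite b1D /B1 /be mulrA.
have b10 : 0 < b1 by rewrite b1E mulr_gt0.
have [m mD] : {z : R | z = mu C1 C2 h Jn} by eexists.
have [v vD] : {z : R | z = nu C1 C2 h Jn rho} by eexists.
have [e eD] : {z : R | z = e1 C1 C2 h theta (kB * hb) bx rr Rr} by eexists.
have [m0 hm] : 0 <= m /\ h <= m by rewrite mD; exact: mu_ge.
have LpL : 2 * A0 C1 C2 * Jn%:R + 2 <= kL * L.
 have : A0 C1 C2 * Jn%:R <= A0 C1 C2 * (3 * L) by rewrite ler_wpM2l.
 rewrite /kL; lra.
have Lp0 : 0 <= 2 * A0 C1 C2 * Jn%:R + 2 by posi.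
have mle : m <= kL * L * h by rewrite mD /mu /nu addr0 ler_wpM2r// ltW.
have vle : v <= kL * L * (2 * y).
 by rewrite vD /nu ler_pM// ?addr_ge0 ?(ltW h0)//; move: rhoy hy; rewrite -/y; lra.
have v0 : 0 <= v by rewrite vD /nu mulr_ge0// addr_ge0// ltW.
have e0 : 0 <= e by rewrite eD; apply: e1_ge0 => //; exact: ltW.
have ele : e <= b1 * (ke * expR (- (4 * L))).
 rewrite eD /e1 -b1D.
 have rE : C1 * rr + C2 / Rr = (C1 + C2) * rr by rewrite /Rr -expRN -/rr mulrDl.
 have rr4 : rr <= expR (- (4 * L)) by rewrite ler_expR; lra.
 have ib : h^-1 <= expR (L / 5) by rewrite -[expR _]invrK -expRN lef_pV2 ?posrE ?expR_gt0.
 have th : rr * (1 + theta / h) <= 2 * expR (- (4 * L)).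
  rewrite mulrDr mulr1; have : rr * (theta / h) <= expR (- (4 * L)).
   apply: le_trans (_ : rr * (expR L * expR (L / 5)) <= _).
    by rewrite ler_pM2l// ler_pM// ?invr_ge0 ?ltW.
   by rewrite -!expRD ler_expR; clear -L0; lra.
  lra.
 have Bb : kB * hb <= b1 by rewrite b1D /B1 ler_peMl// ltW.
 have p1 : kB * hb * rr * (1 + theta / h) <= b1 * (2 * expR (- (4 * L))).
  by rewrite -mulrA ler_pM ?(ltW B0)// mulr_ge0 ?(ltW rr0)// addr_ge0// divr_ge0// ltW.
 have p2 : 4 * b1 * (C1 * rr + C2 / Rr) <= b1 * (4 * (C1 + C2) * expR (- (4 * L))).
  rewrite rE (_ : 4 * b1 * _ = b1 * (4 * (C1 + C2) * rr)); last by ring.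
  by rewrite ler_pM2l// ler_wpM2l//; posi.
 rewrite (_ : b1 * (ke * _) = b1 * (2 * expR (- (4 * L))) + b1 * (4 * (C1 + C2) * expR (- (4 * L)))); last by rewrite /ke; ring.
 exact: lerD.
(* Common scale of the second-order errors: [m * v], [m ^+ 2] and [4 * h / D * m] are all at most a
   constant times [w]. *)
have [w wD] : {z : R | z = L ^+ 2 * (h * y)} by eexists.
have w0 : 0 <= w by rewrite wD !mulr_ge0 ?exprn_ge0 ?(ltW L0) ?(ltW h0) ?(ltW y0').
have L2 : 1 <= L ^+ 2 by exact: exprn_ege1.
have hyw : h * y <= w by rewrite wD ler_peMl// mulr_ge0 ?(ltW h0) ?(ltW y0').
have mv : m * v <= 2 * kL ^+ 2 * w.
 apply: le_trans (ler_pM m0 v0 mle vle) _; rewrite wD le_eqVlt; apply/orP; left; apply/eqP; ring.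
have mm2 : m ^+ 2 <= kL ^+ 2 * w.
 apply: le_trans (_ : (kL * L * h) * (kL * L * y) <= _); last by rewrite wD le_eqVlt; apply/orP; left; apply/eqP; ring.
 by rewrite expr2; apply: ler_pM => //; apply: le_trans mle _; apply: ler_wpM2l => //; posi.
have mhD : 4 * h / D * m <= 4 * kL * w.
 apply: le_trans (_ : (4 * y) * (kL * L * h) <= _).
  rewrite ler_pM//; first by rewrite divr_ge0 ?mulr_ge0 ?(ltW h0) ?(ltW D0).
  by rewrite -mulrA ler_pM2l.
 rewrite (_ : 4 * y * _ = 4 * kL * (L * (h * y))); last by ring.
 rewrite wD expr2 -(mulrA L L); apply: ler_wpM2l; first by posi.
 by apply: ler_wpM2l; [exact: ltW|rewrite ler_peMl//; posi].
have [ev evD] : {z : R | z = 2 * (n%:R * (8 * b1 * e) + q%:R * (b1 ^+ 2 * (8 * (m * v))))} by eexists.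
have b2 : 0 < b1 ^+ 2 by exact: exprn_gt0.
have ev0 : 0 <= ev by rewrite evD; posi.
have evle : ev <= b1 ^+ 2 * (kev * w).
 have p1 : n%:R * (8 * b1 * e) <= b1 ^+ 2 * (8 * ke * w).
  apply: le_trans (_ : n%:R * (8 * b1 * (b1 * (ke * expR (- (4 * L))))) <= _).
   by rewrite ler_wpM2l// ler_wpM2l// mulr_ge0// ltW.
  rewrite (_ : n%:R * _ = b1 ^+ 2 * (8 * ke * (n%:R * expR (- (4 * L))))); last by ring.
  rewrite ler_pM2l// ler_wpM2l ?mulr_ge0 ?(ltW ke0)//; apply: le_trans hyw.
  apply: le_trans (_ : expR (- (L / 5)) * expR (- (1 / 5 * L)) <= _); first by rewrite nE -!expRD ler_expR; lra.
  by apply: ler_pM; rewrite ?expR_ge0// ler_expR lerN2 ler_wpM2r// ltW.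
 have p2 : q%:R * (b1 ^+ 2 * (8 * (m * v))) <= b1 ^+ 2 * (16 * q%:R * kL ^+ 2 * w).
  apply: le_trans (_ : q%:R * (b1 ^+ 2 * (8 * (2 * kL ^+ 2 * w))) <= _); last by rewrite le_eqVlt; apply/orP; left; apply/eqP; ring.
  by rewrite ler_wpM2l// ler_pM2l// ler_pM2l.
 rewrite (_ : b1 ^+ 2 * (kev * w) = 2 * (b1 ^+ 2 * (8 * ke * w) + b1 ^+ 2 * (16 * q%:R * kL ^+ 2 * w))); last by rewrite /kev; ring.
 by rewrite evD ler_pM2l// lerD.
have Ly : be ^+ 2 * k1 * (L ^+ 2 * y) <= kv / 2.
 have l10 : L ^+ 10 * y <= G10 := ln_pow_decay g0 (ltW L0).
 have l3 : L ^+ 2 * y * L <= G10.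
  apply: le_trans l10; rewrite mulrAC -exprSr; apply: ler_wpM2r; [exact: ltW|by apply: ler_weXn2l].
 have bk : 0 < be ^+ 2 * k1 by rewrite mulr_gt0// exprn_gt0.
 have l4 : 2 * be ^+ 2 * k1 * G10 / kv <= L by apply: le_trans LL; rewrite lerDr.
 have l5 : L ^+ 2 * y <= G10 / L by rewrite ler_pdivlMr.
 apply: le_trans (ler_wpM2l (ltW bk) l5) _.
 rewrite mulrA ler_pdivrMr//; move: l4; rewrite ler_pdivrMr//; clear; lra.
have [sl slD] : {z : R | z = kv / 2 * (hb ^+ 2 * h)} by eexists.
have hh0 : 0 < hb ^+ 2 * h by rewrite mulr_gt0// exprn_gt0.
have sl0 : 0 < sl by rewrite slD mulr_gt0// divr_gt0.
have sV l : sl <= J P (fun w => gc P X h theta Kf (x l) 1 w * gc P X h theta Kf (x l) 1 w) - ev.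
 have /andP[x1 x2] := xb l.
 have hy0 : h * `|y0| <= aa by apply: le_trans hM; rewrite ler_pM2l.
 have hy2 : `|h * y0| <= aa by rewrite normrM gtr0_norm.
 have [z1 z2] : - aa <= h * y0 /\ h * y0 <= aa by move: hy2; rewrite ler_norml => /andP[].
 have ratio : kb * hb / (2 * (kB * hb)) = kap by rewrite /kap; field; rewrite !gt_eqF.
 have hkt : h * kap <= kap by rewrite ler_piMl// ltW.
 have V := @gc_var_lower _ _ _ P rho C1 C2 Z X rho0 rho1 C10 C20 mZ XE lawX ball h theta (kB * hb) bx Kf Jn h0 h1 Jh (ltW B0) bx1 mK K1 K2 K3
  (x l) y0 (kb * hb) aa (cL * (h * kap)) (xbx l).
 rewrite ratio in V.
 have {}V := V (ltW (mulr_gt0 kb0 hb0)) Ky B0 (ltW aa0).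
 have {}V : (aa * (kb * hb / 2)) ^+ 2 * (cL * (h * kap)) - (2 * b1 * m) ^+ 2 <= J P (fun w => gc P X h theta Kf (x l) 1 w * gc P X h theta Kf (x l) 1 w).
  have z3 : aa <= x l - h * y0 by clear -x1 z2; lra.
  have z4 : x l - h * y0 <= bx + aa by clear -x2 z1; lra.
  have z5 : x l - h * y0 + h * kap <= theta by have := th1; rewrite -/kap; clear -z4 hkt; lra.
  by rewrite b1D mD; apply: V => //; apply: low; [rewrite z3 z4|rewrite mulr_gt0].
 rewrite lerBrDr; apply: le_trans V.
 rewrite (_ : (aa * _) ^+ 2 * _ = 2 * sl); last by rewrite slD /kv; field.
 have : (2 * b1 * m) ^+ 2 + ev <= sl.
  apply: le_trans (_ : b1 ^+ 2 * (k1 * w) <= _).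
   rewrite exprMn exprMn (_ : b1 ^+ 2 * (k1 * w) = 2 ^+ 2 * b1 ^+ 2 * (kL ^+ 2 * w) + b1 ^+ 2 * (kev * w)); last by rewrite /k1; ring.
   by rewrite lerD// ler_pM2l// mulr_gt0// exprn_gt0.
  rewrite b1E (_ : _ * (k1 * w) = be ^+ 2 * k1 * (L ^+ 2 * y) * (hb ^+ 2 * h)); last by rewrite wD; ring.
  by rewrite slD ler_pM2r.
 clear; lra.
have [tm tmD] : {z : R | z = tmax n sl} by eexists.
have nR0 : 0 < n%:R :> R by rewrite ltr0n.
have tm0 : 0 <= tm by rewrite tmD; exact: sqrtr_ge0.
have tm2 : b1 ^+ 2 * tm ^+ 2 = Ka / h * expR (- L).
 rewrite tmD /tmax sqr_sqrtr; last by rewrite invr_ge0 mulr_ge0// ltW.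
 rewrite expRN -nE slD /Ka b1E; by field; rewrite !gt_eqF.
have ih : h^-1 <= expR (L / 5) by rewrite -[expR _]invrK -expRN lef_pV2 ?posrE ?expR_gt0.
have bt2 : b1 ^+ 2 * tm ^+ 2 <= Ka * expR (- (4 / 5 * L)).
 rewrite tm2 -mulrA ler_pM2l//; apply: le_trans (_ : expR (L / 5) * expR (- L) <= _); first by rewrite ler_wpM2r ?expR_ge0.
 by rewrite -expRD ler_expR; clear -L0; lra.
have bt1 : b1 * tm <= (1 + Ka) * expR (- (2 / 5 * L)).
 have p0 : 0 <= (1 + Ka) * expR (- (2 / 5 * L)) by rewrite mulr_ge0 ?expR_ge0//; clear -Ka0; lra.
 rewrite -(ler_pXn2r (n := 2))// ?nnegrE ?mulr_ge0 ?(ltW b10)//.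
 rewrite exprMn; apply: le_trans bt2 _; rewrite exprMn -expRM_natl (_ : 2%:R * - (2 / 5 * L) = - (4 / 5 * L)); last by field.
 rewrite ler_pM2r ?expR_gt0// expr2; have : 0 <= Ka * Ka by rewrite mulr_ge0// ltW.
 clear -Ka0; lra.
have [eta etaD] : {z : R | z = tm ^+ 2 * (b1 ^+ 2 * (8 * (m * v) + 7 * m ^+ 2 + 4 * h / D * m) + ev)} by eexists.
have [eta0 eta0D] : {z : R | z = 2 * e * tm + 16 * b1 * e * tm ^+ 2} by eexists.
have t20 : 0 <= tm ^+ 2 by exact: sqr_ge0.
have hDm : 0 <= 4 * h / D * m by rewrite mulr_ge0// divr_ge0 ?mulr_ge0 ?(ltW h0) ?(ltW D0).
have eta_b : 0 <= eta <= Q * (expR (- L) * (L ^+ 2 * y)).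
 apply/andP; split.
  by rewrite etaD mulr_ge0// addr_ge0// mulr_ge0 ?(ltW b2)// !addr_ge0// ?mulr_ge0// sqr_ge0.
 apply: le_trans (_ : tm ^+ 2 * (b1 ^+ 2 * (k2 * w)) <= _).
  rewrite etaD ler_wpM2l// (_ : b1 ^+ 2 * (k2 * w) = b1 ^+ 2 * (8 * (2 * kL ^+ 2 * w) + 7 * (kL ^+ 2 * w) + 4 * kL * w) + b1 ^+ 2 * (kev * w)); last by rewrite /k2; ring.
  by rewrite lerD// ler_pM2l// !lerD// ler_pM2l.
 have -> : tm ^+ 2 * (b1 ^+ 2 * (k2 * w)) = b1 ^+ 2 * tm ^+ 2 * (k2 * w) by ring.
 rewrite tm2; have -> : Ka / h * expR (- L) * (k2 * w) = Ka * k2 * (expR (- L) * (L ^+ 2 * y)).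
  rewrite wD (_ : Ka / h * expR (- L) * (k2 * (L ^+ 2 * (h * y))) = Ka * k2 * (expR (- L) * (L ^+ 2 * y)) * (h^-1 * h)); last by ring.
  by rewrite mulVf ?mulr1// gt_eqF.
 rewrite ler_wpM2r//; first by rewrite !mulr_ge0 ?expR_ge0 ?exprn_ge0 ?(ltW L0) ?(ltW y0').
 by rewrite /Q; clear -ek Kk Ka0 Qn0 q0; lra.
have eta0_b : 0 <= eta0 <= Q * expR (- (3 * L)).
 apply/andP; split; first by rewrite eta0D addr_ge0// !mulr_ge0// ltW.
 have e4 : expR (- (4 * L)) <= expR (- (3 * L)) by rewrite ler_expR; clear -L0; lra.
 have x1 : expR (- (2 / 5 * L)) <= 1 by apply: le_trans (_ : expR 0 <= _); [rewrite ler_expR; clear -L0; lra|rewrite expR0].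
 have x2 : expR (- (4 / 5 * L)) <= 1 by apply: le_trans (_ : expR 0 <= _); [rewrite ler_expR; clear -L0; lra|rewrite expR0].
 have b1' : b1 * tm <= 1 + Ka by apply: le_trans bt1 _; rewrite ler_piMr//; clear -Ka0; lra.
 have b2' : b1 ^+ 2 * tm ^+ 2 <= Ka by apply: le_trans bt2 _; rewrite ler_piMr// ltW.
 apply: le_trans (_ : 2 * (b1 * (ke * expR (- (4 * L)))) * tm + 16 * b1 * (b1 * (ke * expR (- (4 * L)))) * tm ^+ 2 <= _).
  rewrite eta0D; apply: lerD; rewrite ler_wpM2r//; first by rewrite ler_pM2l.
  by rewrite ler_wpM2l// mulr_ge0// ltW.
 rewrite (_ : _ + _ = ke * (2 * (b1 * tm) + 16 * (b1 ^+ 2 * tm ^+ 2)) * expR (- (4 * L))); last by ring.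
 apply: ler_pM; [by posi|exact: expR_ge0| |exact: e4].
 apply: le_trans (_ : ke * (18 * (1 + Ka)) <= _); first by rewrite ler_pM2l//; clear -b1' b2' Ka0; lra.
 by rewrite /Q; clear -ek Kk Ka0 Qn0 q0; lra.
have e0_b : 0 <= 4 * b1 * tm <= Q * expR (- (2 / 5 * L)).
 apply/andP; split; first by rewrite !mulr_ge0// ltW.
 rewrite -mulrA; apply: le_trans (_ : 4 * ((1 + Ka) * expR (- (2 / 5 * L))) <= _); first by rewrite ler_pM2l.
 by rewrite mulrA ler_pM2r ?expR_gt0// /Q; clear -ek Kk Ka0 Qn0 q0; lra.
have QN : N%:R <= Q * expR (L / 5) by apply: le_trans hN _; rewrite ler_pM2r ?expR_gt0// /Q; clear -ek Kk Ka0 Qn0 q0; lra.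
have Qq : q%:R <= Q by rewrite /Q; clear -ek Kk Ka0 Qn0 q0; lra.
have b3 : 0 < L ^+ 3 by exact: exprn_gt0.
subst eta eta0 tm ev e v m b1.
have clt c (c0 : 0 < c) := @gsum_clt _ _ _ P rho C1 C2 Z X rho0 rho1 C10 C20 mZ iZ XE lawX ball tail h theta (kB * hb) bx Kf Jn q h0 h1 Jh theta0 (ltW B0) bx1 mK K1 K2 K3
 rr Rr rr0 Rr0 rrE N n x D sl (L ^+ 3) c n0 xbx D0 xD sl0 b3 c0 sV.
have mX k : measurable_fun setT (X k).
 rewrite (_ : X k = fun om => \sum_(i < k.+1) rho ^+ (k - i) * Z i om); last by apply/funext => om; exact: XE.
 by mf.
split.
 move=> l; apply: lt_le_trans sl0 _.
 first [by eapply svar_ge; eassumption | exact: (@svar_ge _ _ _ P rho C1 C2 Z X rho0 rho1 C10 C20 mZ iZ XE lawX ball tail h theta (kB * hb) bx Kf Jn q h0 h1 Jh theta0 (ltW B0) bx1 mK K1 K2 K3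
  rr Rr rr0 Rr0 rrE N n x sl n0 xbx sV l)].
move=> d' T' QQ Y t nY.
have mS l : measurable_fun setT (fun w => gsum P X h theta Kf n x l w * tau P X h theta Kf n x l).
 by rewrite /gsum /gc /gK; mf.
have u0' : 0 <= (L ^+ 2)^-1 by rewrite invr_ge0 exprn_ge0// ltW.
apply: le_trans (@max_compare _ _ _ P N _ mS _ _ _ b3 u0' clt _ _ QQ Y t (2 * L) nY _) _; first by rewrite mulr_ge0// ltW.
exact: (error_bound Q1 g0 g5 L1 nE QN Qq e0_b eta0_b eta_b).
Qed.

(** * Functions supported in the unit interval *)

Section compact_support.
Context {R : realType} (f : R -> R).
Hypotheses (f0 : forall t, 1 < `|t| -> f t = 0) (df : forall t, derivable f t 1) (df' : forall t, derivable (derive1 f) t 1).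

Let cont (g : R -> R) : (forall t, derivable g t 1) -> continuous g.
Proof. by move=> dg t; exact: dd_cont1 (dd_derivable (dg t)). Qed.

Let bounded (g : R -> R) : continuous g -> (forall t, 1 < `|t| -> g t = 0) -> exists2 M, 0 <= M & forall t, `|g t| <= M.
Proof.
move=> cg g0; have ab : (-1 : R) <= 1 by lra.
have cn : {within `[(-1 : R), 1], continuous (fun t => `|g t|)}.
 by apply: continuous_subspaceT => t; apply: cvg_norm; exact: cg.
have [c _ hc] := EVT_max ab cn; exists `|g c| => // t.
have [h|h] := leP `|t| 1; last by rewrite g0// normr0.
by apply: hc; rewrite in_itv/= -ler_norml.
Qed.

(** Compactness bounds both functions once the derivative is known to vanish outside [[-1, 1]].
    There [dd_quad] applies, as the increment is nonzero only at distance at least [|t| - 1]. *)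
Lemma support_bounds : exists2 M, 0 <= M & forall t, `|f t| <= M /\ `|derive1 f t| <= M.
Proof.
have [M M0 fM] := bounded (cont df) f0.
have d0 t : 1 < `|t| -> derive1 f t = 0.
 move=> t1; apply: dd_derive1; have e0 : 0 < `|t| - 1 by rewrite subr_gt0.
 apply: (@dd_quad _ f t 0 (M / (`|t| - 1) ^+ 2)) => y; rewrite (f0 t1) mulr0 !subr0.
 have Me : 0 <= M / (`|t| - 1) ^+ 2 by rewrite divr_ge0// exprn_ge0// ltW.
 have [h|h] := ltP 1 `|t + y|; first by rewrite f0// normr0 mulr_ge0// sqr_ge0.
 have hy : `|t| - 1 <= `|y|.
  by have := ler_normB (t + y) y; rewrite addrK; lra.
 apply: le_trans (fM _) _; rewrite mulrAC ler_pdivlMr ?exprn_gt0// ler_wpM2l//.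
 by rewrite -(real_normK (num_real y)) lerXn2r ?nnegrE ?(ltW e0).
have [M' M'0 fM'] := bounded (cont df') d0.
exists (Num.max M M'); first by rewrite le_max M0.
by move=> t; split; rewrite le_max ?fM ?fM' ?orbT.
Qed.

Lemma support_lip M t u : (forall t, `|derive1 f t| <= M) -> t <= u -> `|f u - f t| <= M * (u - t).
Proof. by move=> hM tu; apply: (dd_lip tu (g := derive1 f)) => // x _; exact: dd_derivable. Qed.

Lemma support_edge : f 1 = 0.
Proof.
have [M M0 fM] := support_bounds; apply/eqP; rewrite -normr_le0; apply/ler_addgt0Pr => e e0; rewrite add0r.
have d0 : 0 < e / (M + 1) by rewrite divr_gt0// ltr_wpDl.
have := @support_lip M 1 (1 + e / (M + 1)) (fun t => (fM t).2); rewrite lerDl (ltW d0) f0; last first.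
 by rewrite ger0_norm ?ltrDl// addr_ge0// ltW.
move=> /(_ isT); rewrite sub0r normrN addrC addKr => /le_trans; apply.
rewrite mulrCA ler_piMr ?(ltW e0)// ler_pdivrMr ?ltr_wpDl//; lra.
Qed.

(** A derivative bounded by [M] keeps [f] above 1/2 up to this [t]. A positive point is wanted
    because [Kern_lower] compares the exponent at [t0 / h] with a logarithm. *)
Lemma support_near0 : f 0 = 1 -> exists2 t, 0 < t < 1 & f t != 0.
Proof.
move=> f01; have [M M0 fM] := support_bounds.
have m1 : 0 < 2 * (M + 1) by lra.
exists (2 * (M + 1))^-1; first by rewrite invr_gt0 m1/= invf_lt1//; lra.
have t0 : 0 <= (2 * (M + 1))^-1 by rewrite invr_ge0 ltW.
have := support_lip (fun t => (fM t).2) t0; rewrite f01 subr0 => h; apply/eqP => e.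
have hm : M * (2 * (M + 1))^-1 <= 1 / 2 by rewrite ler_pdivrMr//; lra.
by move: h; rewrite e sub0r normrN normr1; lra.
Qed.
End compact_support.

Lemma cosB1_abs {R : realType} (y : R) : `|cos y - 1| <= `|y|.
Proof.
have H z : 0 <= z -> `|cos z - 1| <= z :> R.
 move=> z0; have := @dd_lip R cos (fun x => - sin x * 1) 1 0 z z0 (fun x _ => dd_cos (dd_id x)).
 by rewrite cos0 subr0 mul1r; apply => x _; rewrite mulr1 normrN ler_norml sin_geN1 sin_le1.
have [y0|y0] := leP 0 y; first by rewrite (ger0_norm y0) H.
by rewrite -cosN (ltr0_norm y0) H// oppr_ge0 ltW.
Qed.

(** * The deconvolution kernel of the model *)

Section deconvolution.
Context {R : realType} (alpha eps : R) (F : probability R R) (W : R -> R) (Ck Ch : R).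
Hypotheses (al1 : 1 <= alpha) (F1 : F (`]0%R, +oo[%classic) = 1%E) (eps0 : 0 < eps).
Hypothesis mom : (\int[lebesgue_measure]_(x in `]0%R, +oo[%classic)
    (Num.max 1 (`|x| `^ (2 + eps)) * kf alpha F x)%:E < +oo)%E.
Hypotheses (cre : continuous (phik_re alpha F)) (cim : continuous (phik_im alpha F)).
Hypotheses (krb : forall t, `|phik_re alpha F t| <= Ck / (1 + `|t|)) (kib : forall t, `|phik_im alpha F t| <= Ck / (1 + `|t|)).
Hypothesis holder : forall x : R, 0 < x <= 1 -> `|kf alpha F x - alpha| <= Ch * Num.sqrt x.
Hypothesis iW : itg (@lebesgue_measure R) W.
Hypotheses (W1 : RintR W = 1) (W0 : forall u, 1 < `|u| -> phiW_re W u = 0 /\ phiW_im W u = 0).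
Hypotheses (dr : forall u, derivable (phiW_re W) u 1) (di : forall u, derivable (phiW_im W) u 1).
Hypotheses (dr' : forall u, derivable (derive1 (phiW_re W)) u 1) (di' : forall u, derivable (derive1 (phiW_im W)) u 1).

(** The squared modulus of [phi] is [expR (2 * phiA)], so dividing by it leaves [expR (- phiA)];
    outside [[-1, 1]] the integrand vanishes with the transform of [W]. *)
Lemma KnE h x : Kn alpha F W h x = (2 * pi)^-1 * Kern (phiA alpha F) (phiB alpha F) (phiW_re W) (phiW_im W) h x.
Proof.
rewrite /Kn /Kern; congr (_ * _); rewrite -[LHS]/(J leb (fun t : R => _)); congr J; apply/funext => t /=.
rewrite indicE; case: (boolP (t \in _)) => [_|].
 rewrite mul1r /pk /qk /phi_re /phi_im; move: (phiA _ _ _) (phiB _ _ _) => A B.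
 have cs := cos2Dsin2 B; have eA : expR A != 0 by rewrite gt_eqF// expR_gt0.
 rewrite !exprMn -mulrDr cs mulr1 expRN; by field.
rewrite notin_setE /= in_itv/= -ler_norml => /negP; rewrite -ltNge => h1.
by have [-> ->] := W0 h1; rewrite !(mul0r, addr0, subr0, subrr, mulr0).
Qed.

Lemma Kn_facts : exists kB kb M, [/\ 0 < kB, 0 < kb, 0 <= M & forall h, 0 < h <= 1 ->
 [/\ forall v, `|Kn alpha F W h v| <= kB * hal alpha h, forall v, `|v * Kn alpha F W h v| <= kB * hal alpha h,
  forall v v', `|Kn alpha F W h v - Kn alpha F W h v'| <= kB * hal alpha h * `|v - v'| &
  exists2 y0, `|y0| <= M & kb * hal alpha h <= `|Kn alpha F W h y0|]].
Proof.
have al0 : 0 < alpha by exact: lt_le_trans al1.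
have [CA _ asy] : exists2 C : R, 0 < C & forall t, `|phiA alpha F t + alpha * ln (1 + `|t|)| <= C.
 by apply: phiA_asymp; eassumption.
have dA t : dd (phiA alpha F) t (- phik_im alpha F t) by exact: (dd_phiA al0 eps0 mom).
have dB t : dd (phiB alpha F) t (phik_re alpha F t) by exact: (dd_phiB al0 eps0 mom).
have Ae t : phiA alpha F (- t) = phiA alpha F t by apply: phiA_even.
have Bo t : phiB alpha F (- t) = - phiB alpha F t by exact: (phiB_odd al0 mom).
have r0 t : 1 < `|t| -> phiW_re W t = 0 by move=> /W0[].
have i0 t : 1 < `|t| -> phiW_im W t = 0 by move=> /W0[].
have [Mr Mr0 hr] := support_bounds r0 dr dr'; have [Mi Mi0 hi] := support_bounds i0 di di'.
pose Cw := Mr + Mi.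
have ddr (t : R) : dd (phiW_re W) t (derive1 (phiW_re W) t) by apply: dd_derivable; exact: dr.
have ddi (t : R) : dd (phiW_im W) t (derive1 (phiW_im W) t) by apply: dd_derivable; exact: di.
have cr : continuous (derive1 (phiW_re W)).
 apply: (dd_cont (g := derive1 (derive1 (phiW_re W)))) => t; apply: dd_derivable; exact: dr'.
have ci : continuous (derive1 (phiW_im W)).
 apply: (dd_cont (g := derive1 (derive1 (phiW_im W)))) => t; apply: dd_derivable; exact: di'.
have ae t : phiW_re W (- t) = phiW_re W t.
 by rewrite /phiW_re; congr RintR; apply/funext => x; rewrite mulNr cosN.
have bo t : phiW_im W (- t) = - phiW_im W t.
 have mW : measurable_fun setT W by have /itgP/integrableP[/measurable_EFinP] := iW.
 have i1 : itg leb (fun x : R => sin (t * x) * W x).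
  apply: itg_dom (itg_norm iW) => [|x]; first by mf.
  by rewrite normrM ler_piMl// ler_norml sin_geN1 sin_le1.
 transitivity (J leb (fun x : R => - (sin (t * x) * W x))); last by rewrite (J_N i1).
 by transitivity (J leb (fun x : R => sin (- t * x) * W x)) => //; congr J; apply/funext => x; rewrite mulNr sinN mulNr.
have aC t : `|phiW_re W t| <= Cw by apply: le_trans (hr t).1 _; rewrite lerDl.
have bC t : `|phiW_im W t| <= Cw by apply: le_trans (hi t).1 _; rewrite lerDr.
have a'C t : `|derive1 (phiW_re W) t| <= Cw by apply: le_trans (hr t).2 _; rewrite lerDl.
have b'C t : `|derive1 (phiW_im W) t| <= Cw by apply: le_trans (hi t).2 _; rewrite lerDr.
have e1 := support_edge r0 dr dr'; have e2 := support_edge i0 di di'.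
have re0 : phiW_re W 0 = 1.
 by rewrite /phiW_re -[RHS]W1; congr RintR; apply/funext => x; rewrite mul0r cos0 mul1r.
have [t0 /andP[t00 t01] ht0] := support_near0 r0 dr dr' re0.
have [C KB] : exists C, forall h x y, 0 < h <= 1 ->
 [/\ `|Kern (phiA alpha F) (phiB alpha F) (phiW_re W) (phiW_im W) h x| <= C * hal alpha h,
  `|x * Kern (phiA alpha F) (phiB alpha F) (phiW_re W) (phiW_im W) h x| <= C * hal alpha h &
  `|Kern (phiA alpha F) (phiB alpha F) (phiW_re W) (phiW_im W) h x - Kern (phiA alpha F) (phiB alpha F) (phiW_re W) (phiW_im W) h y| <= C * hal alpha h * `|x - y|].
 by eexists => h x y h01; eapply Kern_bounds; eassumption.
have ht1 : 0 < phiW_re W t0 ^+ 2 + phiW_im W t0 ^+ 2.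
 by rewrite ltr_wpDr ?sqr_ge0// lt_neqAle sqr_ge0 andbT eq_sym expf_neq0.
have [M [c [M0 c0 KL]]] : exists M c, [/\ 0 < M, 0 < c & forall h, 0 < h <= 1 -> exists2 y, `|y| <= M &
  c * hal alpha h <= `|Kern (phiA alpha F) (phiB alpha F) (phiW_re W) (phiW_im W) h y|].
 by eapply Kern_lower; first [exact t00 | exact t01 | exact ht1 | eassumption].
have pi0 : 0 < (2 * pi : R)^-1 by rewrite invr_gt0 mulr_gt0// pi_gt0.
exists ((2 * pi)^-1 * (`|C| + 1)), ((2 * pi)^-1 * c), M.
have kC (X h : R) : X <= C * hal alpha h -> (2 * pi)^-1 * X <= (2 * pi)^-1 * (`|C| + 1) * hal alpha h.
 move=> hX; rewrite -mulrA ler_pM2l//; apply: le_trans hX _; rewrite ler_wpM2r ?ltW ?hal_gt0//.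
 by have := ler_norm C; lra.
split; [by rewrite mulr_gt0// ltr_wpDl|exact: mulr_gt0|exact: ltW|move=> h h01]; split.
- by move=> v; rewrite KnE normrM (gtr0_norm pi0); apply: kC; have [] := KB h v 0 h01.
- by move=> v; rewrite KnE mulrCA normrM (gtr0_norm pi0); apply: kC; have [] := KB h v 0 h01.
- move=> v v'; rewrite !KnE -mulrBr normrM (gtr0_norm pi0).
 have [_ _ l] := KB h v v' h01; rewrite -!mulrA ler_pM2l// mulrA; apply: le_trans l _.
 rewrite ler_wpM2r// ler_wpM2r ?ltW ?hal_gt0//; by have := ler_norm C; lra.
- by have [y hy l] := KL h h01; exists y => //; rewrite KnE normrM (gtr0_norm pi0) -mulrA ler_pM2l.
Qed.
End deconvolution.

(** For [p = 0] the Hölder exponent [r] exceeds 1/2. For [p >= 1] differentiability of [ksharp] at 0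
    gives a linear bound near 0, and away from 0 boundedness by [alpha] suffices, at the cost of
    [alpha / sqrt e]. *)
Lemma holder_at0 {R : realType} (alpha r : R) (F : probability R R) p : 0 < alpha -> F (`]0%R, +oo[%classic) = 1%E ->
 1 / 2 < r -> (forall i, (i < p)%N -> forall x, derivable (derive1n i (ksharp alpha F)) x 1) ->
 (exists C : R, forall x y, `|derive1n p (ksharp alpha F) x - derive1n p (ksharp alpha F) y| <= C * `|x - y| `^ (r - p%:R)) ->
 exists Ch, forall x : R, 0 < x <= 1 -> `|kf alpha F x - alpha| <= Ch * Num.sqrt x.
Proof.
move=> al0 F1 hr dk [C hC]; have k0 : ksharp alpha F 0 = alpha by rewrite /ksharp normr0 k_0.
have kE x : 0 < x -> kf alpha F x = ksharp alpha F x by move=> x0; rewrite /ksharp gtr0_norm.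
case: p dk hC => [|p] dk hC.
 exists `|C| => x /andP[x0 x1]; rewrite kE// -[X in _ - X]k0.
 have := hC x 0; rewrite /= !subr0 (gtr0_norm x0) => /le_trans; apply.
 apply: ler_pM => //; [|exact: powR_ge0|exact: ler_norm|].
  have := le_trans (normr_ge0 _) (hC 1 0); rewrite !subr0 normr1 powR1 mulr1//.
 rewrite -powR12_sqrt ?(ltW x0)//; apply: ger_powR; rewrite ?x0//; lra.
have := dk 0%N isT 0 => /= /cvg_ex[l hl].
have : nbhs (0 : R) (fun y : R => y != 0 -> `|l - y^-1 *: (ksharp alpha F (y *: 1 + 0) - ksharp alpha F 0)| < 1).
 exact: (@cvgr_dist_lt _ _ _ _ _ _ _ hl 1 ltr01).
move=> /nbhs_ballP[e /= e0 he].
exists (`|l| + 1 + alpha / Num.sqrt e) => x /andP[x0 x1]; rewrite kE// -[X in _ - X]k0.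
have s0 : 0 < Num.sqrt x by rewrite sqrtr_gt0.
have se : 0 < Num.sqrt e by rewrite sqrtr_gt0.
have xs : x <= Num.sqrt x.
 by rewrite -{1}(sqr_sqrtr (ltW x0)) expr2 ler_piMl ?(ltW s0)// -sqrtr1 ler_wsqrtr.
have [xe|xe] := ltP x e.
 have : `|l - x^-1 *: (ksharp alpha F (x *: 1 + 0) - ksharp alpha F 0)| < 1.
  by apply: he; [rewrite /ball/= sub0r normrN gtr0_norm|rewrite gt_eqF].
 rewrite addr0 -[x *: 1]/(x * 1) mulr1 => h.
 have h2 : `|x^-1 * (ksharp alpha F x - ksharp alpha F 0)| <= `|l| + 1.
  have := ler_normB l (l - x^-1 *: (ksharp alpha F x - ksharp alpha F 0)); rewrite opprB addrC subrK.
  by move=> /le_trans; apply; rewrite lerD2l ltW.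
 move: h2; rewrite normrM gtr0_norm ?invr_gt0// ler_pdivrMl// => /le_trans; apply.
 rewrite mulrC; apply: ler_pM => //; rewrite ?addr_ge0 ?(ltW x0)//.
 by rewrite lerDl divr_ge0 ?ltW.
rewrite k0; apply: le_trans (_ : alpha <= _).
 have h2 : 0 <= kf alpha F x by apply: k_ge0.
 have h1 : kf alpha F x <= alpha by apply: k_le.
 rewrite -kE// ler_norml.
 by apply/andP; split; lra.
rewrite mulrDl; apply: ler_wpDl; first by rewrite mulr_ge0 ?addr_ge0 ?(ltW s0).
by rewrite mulrAC ler_pdivlMr// ler_pM2l// ler_wsqrtr.
Qed.

(** * The standardized statistic *)

Section standardized_sum.
Context {R : realType} {d} {Omega : measurableType d} (P : probability Omega R).
Variables (lam alpha : R) (F : probability R R) (X0 : Omega -> R) (E U : nat -> Omega -> R) (W : R -> R).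

Lemma Ex_J (f : Omega -> R) : fine ('E_P[f])%E = J P f.
Proof. by rewrite unlock. Qed.

Lemma var_J (f : Omega -> R) : J P f = 0 -> fine ('V_P[f])%E = J P (fun w => f w ^+ 2).
Proof.
move=> f0; rewrite /variance covariance.unlock Ex_J; congr J; apply/funext => w /=.
transitivity ((f w - fine ('E_P[f])%E) * (f w - fine ('E_P[f])%E)) => //.
by rewrite Ex_J f0 subr0 expr2.
Qed.

(** The sum is centred, so its variance is the second moment [svar], and the two factors [sqrt n]
    combine into [tau]. *)
Lemma WnE n N (Delta theta h : R) (x : 'I_N -> R) l w :
 let X := ouX lam Delta X0 E U in let K := Kn alpha F W h in (0 < n)%N ->
 (forall k, bmf (gc P X h theta K (x l) k)) -> (forall k, J P (gc P X h theta K (x l) k) = 0) ->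
 0 < svar P X h theta K n x l ->
 Wn P lam X0 E U alpha F W n Delta theta h (x l) w = gsum P X h theta K n x l w * tau P X h theta K n x l.
Proof.
move=> X K n0 bg mg s0; have nR : 0 < n%:R :> R by rewrite ltr0n.
have SE : sqrtn_h_Zn P lam X0 E U alpha F W n Delta theta h (x l) = fun w => (Num.sqrt n%:R)^-1 * gsum P X h theta K n x l w.
 by apply/funext => w'; rewrite /sqrtn_h_Zn /gsum big_add1 big_mkord; congr (_ * _); apply: eq_bigr => i _; rewrite Ex_J.
have bs : bmf (gsum P X h theta K n x l) by apply: bmf_sum => i; exact: bg.
have mS : J P (fun w => (Num.sqrt n%:R)^-1 * gsum P X h theta K n x l w) = 0.
 rewrite J_Z; last exact: bmf_itg.
 rewrite /gsum J_sum; last by move=> i _; exact/bmf_itg/bg.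
 by rewrite big1 ?mulr0// => i _; exact: mg.
rewrite /Wn SE var_J//.
have -> : J P (fun w => ((Num.sqrt n%:R)^-1 * gsum P X h theta K n x l w) ^+ 2) = svar P X h theta K n x l.
 rewrite /svar -J_Z; last exact: bmf_itg (bmfM bs bs).
 by congr J; apply/funext => w'; rewrite exprMn exprVn sqr_sqrtr// ltW.
rewrite /tau; move: (svar P X h theta K n x l) s0 (gsum P X h theta K n x l w) => s s0 g.
rewrite invfM sqrtrM ?invr_ge0 ?(ltW nR)// !sqrtrV ?(ltW nR) ?(ltW s0)//.
by rewrite (mulrC _ g) mulrA.
Qed.
End standardized_sum.

(** * Number of design points and proof of the theorem *)

Lemma sep_count {R : realType} N (x : 'I_N -> R) (g a b : R) : 0 <= g -> a <= b -> (forall k, a <= x k <= b) ->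
 (forall k l : 'I_N, (k < l)%N -> x k + g <= x l) -> N%:R * g <= b - a + g.
Proof.
case: N x => [|N] x g0 ab xab hx; first by rewrite mul0r addr_ge0// subr_ge0.
have h k (kN : (k < N.+1)%N) : a + k%:R * g <= x (Ordinal kN).
 elim: k kN => [|k ih] kN; first by rewrite mul0r addr0; case/andP: (xab (Ordinal kN)).
 have := ih (ltnW kN); have := hx (Ordinal (ltnW kN)) (Ordinal kN) (ltnSn k).
 by rewrite -(natr1 k) (mulrDl k%:R 1); lra.
have := h N (ltnSn N); have /andP[_ xb] := xab (Ordinal (ltnSn N)).
by rewrite -(natr1 N) (mulrDl N%:R 1); lra.
Qed.

Theorem mainTheorem4 (R : realType)
  (* probability space carrying the model *)
  (d : measure_display) (Omega : measurableType d) (P : probability Omega R)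
  (lam alpha : R) (F : probability R R)
  (X0 : Omega -> R) (E U : nat -> Omega -> R)
  (W : R -> R) (r : R) (p : nat) (delta : R)
  (Delta h theta : nat -> R)
  (a b : R) (N : nat -> nat) (xs : forall n : nat, 'I_(N n) -> R) :
  (* ---- the model ---- *)
  0 < lam ->
  measurable_fun [set: Omega] X0 ->
  (forall j, measurable_fun [set: Omega] (E j)) ->
  (forall j, measurable_fun [set: Omega] (U j)) ->
  (* X0, (E_j), (U_j) mutually independent *)
  mutually_independent P
    (fun i : option (nat + nat) => match i with
       | None => X0 | Some (inl j) => E j | Some (inr j) => U j end) ->
  (* interarrival times of the Poisson process N: i.i.d. Exp(alpha) *)
  (forall j (A : set R), measurable A -> P (E j @^-1` A) = exponential_prob alpha A) ->
  (* jump sizes i.i.d. with distribution F, positive *)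
  (forall j (A : set R), measurable A -> P (U j @^-1` A) = F A) ->
  F (`]0%R, +oo[%classic) = 1%E ->
  (* stationarity: X0 ~ pi, the law with characteristic function phi *)
  (forall t : R, 'E_P[fun w => cos (t * X0 w)]%E = (phi_re alpha F t)%:E /\
                 'E_P[fun w => sin (t * X0 w)]%E = (phi_im alpha F t)%:E) ->
  (* ---- Assumption A ---- *)
  (* (i) *)
  (exists eps : R, 0 < eps /\
     (\int[lebesgue_measure]_(x in `]0%R, +oo[%classic)
        (Num.max 1 (`|x| `^ (2 + eps)) * kf alpha F x)%:E < +oo)%E) ->
  (* (ii)  k(0) = alpha (automatic from positivity of F) with 2 < alpha < oo *)
  2 < alpha ->
  (* (iii) *)
  1 / 2 < r -> p%:R < r -> r <= p%:R + 1 ->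
  (forall i, (i < p)%N -> forall x, derivable (derive1n i (ksharp alpha F)) x 1) ->
  (exists C : R, forall x y,
     `|derive1n p (ksharp alpha F) x - derive1n p (ksharp alpha F) y|
       <= C * `|x - y| `^ (r - p%:R)) ->
  (* (iv) *)
  (forall u, derivable (phik_re alpha F) u 1 /\ derivable (phik_im alpha F) u 1 /\
             derivable (derive1 (phik_re alpha F)) u 1 /\
             derivable (derive1 (phik_im alpha F)) u 1) ->
  (exists C : R, forall u,
     Num.sqrt (phik_re alpha F u ^+ 2 + phik_im alpha F u ^+ 2) <= C * (1 + `|u|)^-1 /\
     Num.sqrt (derive1 (phik_re alpha F) u ^+ 2 + derive1 (phik_im alpha F) u ^+ 2)
       <= C * ((1 + `|u|) ^+ 2)^-1 /\
     Num.sqrt (derive1n 2 (phik_re alpha F) u ^+ 2 + derive1n 2 (phik_im alpha F) u ^+ 2)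
       <= C * ((1 + `|u|) ^+ 2)^-1) ->
  (* (v) *)
  lebesgue_measure.-integrable [set: R] (fun x => (W x)%:E) ->
  RintR W = 1 ->
  lebesgue_measure.-integrable [set: R] (fun x => (`|x| ^+ p.+1 * `|W x|)%:E) ->
  (forall l, (1 <= l <= p)%N -> RintR (fun x => x ^+ l * W x) = 0) ->
  (forall u, 1 < `|u| -> phiW_re W u = 0 /\ phiW_im W u = 0) ->
  (forall i, (i < 3)%N -> forall u,
     derivable (derive1n i (phiW_re W)) u 1 /\ derivable (derive1n i (phiW_im W)) u 1) ->
  continuous (derive1n 3 (phiW_re W)) -> continuous (derive1n 3 (phiW_im W)) ->
  (* (vi) *)
  (exists c : R, 0 < c /\ \forall n \near \oo, c * ln n%:R <= Delta n) ->
  (fun n => n%:R / Delta n) @ \oo --> +oo ->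
  0 < delta -> delta < 1 / 12 ->
  (forall n, 0 < h n) ->
  h @ \oo --> (0 : R) ->
  (fun n => ((ln n%:R) ^+ 5 / n%:R) `^ (1 / (2 + 2 * alpha - delta)) / h n)
    @ \oo --> (0 : R) ->
  (fun n => h n / ((n%:R * ln n%:R)^-1 `^ (1 / (1 + 2 * r + 2 * alpha - delta))))
    @ \oo --> (0 : R) ->
  (* theta_n ~ n^{1/2} (log n)^{-3} *)
  (fun n => theta n / (Num.sqrt n%:R * ((ln n%:R) ^+ 3)^-1)) @ \oo --> (1 : R) ->
  (* ---- design points ---- *)
  0 < a -> a <= b ->
  (forall n (k : 'I_(N n)), a <= xs n k <= b) ->
  (forall n (k l : 'I_(N n)), (k < l)%N -> xs n k < xs n l) ->
  (forall M : R, \forall n \near \oo, forall k l : 'I_(N n), k != l ->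
       M * h n `^ (1 - 2 * delta) <= `|xs n k - xs n l|) ->
  (* ---- conclusion: sup_t |...| -> 0 ---- *)
  forall eps : R, 0 < eps -> \forall n \near \oo,
    forall (d' : measure_display) (Omega' : measurableType d')
           (Q : probability Omega' R) (Y : 'I_(N n) -> Omega' -> R),
      std_normal_vector Q Y ->
      forall t : R,
        `| fine (P [set w | \big[Num.max/0]_(l < N n)
                     `|Wn P lam X0 E U alpha F W n (Delta n) (theta n) (h n) (xs n l) w|
                   <= t])
         - fine (Q [set w | \big[Num.max/0]_(l < N n) `|Y l w| <= t]) | <= eps.
Proof.
move=> lam0 mX0 mE mU ind lawE lawU F1 cfX [ep [ep0 mom]] al2 r12 pr0 rp dk hold dphik [Cp hCp] iW W1 iW2 W0' Wsupp dW cW3 ciW3 [c [c0 hc]] nD d0 d12 h0 hlim hlow hup hth a0 ab xab xinc xsep eps eps1.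
have al0 : 0 < alpha by lra.
have al1 : 1 <= alpha by lra.
have cre : continuous (phik_re alpha F).
 by apply: (dd_cont (g := derive1 (phik_re alpha F))) => t; apply: dd_derivable; have [] := dphik t.
have cim : continuous (phik_im alpha F).
 by apply: (dd_cont (g := derive1 (phik_im alpha F))) => t; apply: dd_derivable; have [_ []] := dphik t.
have krb t : `|phik_re alpha F t| <= Cp / (1 + `|t|).
 by have [h1 _] := hCp t; apply: le_trans h1; rewrite -sqrtr_sqr ler_wsqrtr// lerDl sqr_ge0.
have kib t : `|phik_im alpha F t| <= Cp / (1 + `|t|).
 by have [h1 _] := hCp t; apply: le_trans h1; rewrite -sqrtr_sqr ler_wsqrtr// lerDr sqr_ge0.
have [Ch holder] := holder_at0 al0 F1 r12 dk hold.
have iW' : itg (@lebesgue_measure R) W by apply/itgP.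
have dr (u : R) : derivable (phiW_re W) u 1 := proj1 (dW 0%N isT u).
have di (u : R) : derivable (phiW_im W) u 1 := proj2 (dW 0%N isT u).
have dr' (u : R) : derivable (derive1 (phiW_re W)) u 1 := proj1 (dW 1%N isT u).
have di' (u : R) : derivable (derive1 (phiW_im W)) u 1 := proj2 (dW 1%N isT u).
have [kB [kb [M [kB0 kb0 M0 KF]]]] : exists kB kb M, [/\ 0 < kB, 0 < kb, 0 <= M & forall h, 0 < h <= 1 ->
 [/\ forall v, `|Kn alpha F W h v| <= kB * hal alpha h, forall v, `|v * Kn alpha F W h v| <= kB * hal alpha h,
  forall v v', `|Kn alpha F W h v - Kn alpha F W h v'| <= kB * hal alpha h * `|v - v'| &
  exists2 y0, `|y0| <= M & kb * hal alpha h <= `|Kn alpha F W h y0|]].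
 exact: (Kn_facts al1 ep0 mom cre cim krb kib holder iW' W1 Wsupp dr di dr' di').
have cfX0 t : J P (fun w => cos (t * X0 w)) = phi_re alpha F t /\ J P (fun w => sin (t * X0 w)) = phi_im alpha F t.
 by have [e1 e2] := cfX t; split; rewrite -Ex_J ?e1 ?e2.
have [CA _ asy] : exists2 C : R, 0 < C & forall t, `|phiA alpha F t + alpha * ln (1 + `|t|)| <= C.
 by apply: phiA_asymp; eassumption.
have [C1 C10 ball0] := @small_ball R d Omega P alpha CA (phiA alpha F) (phiB alpha F) X0 (ltW al2) mX0 cfX0 asy.
pose D0 := J (@lebesgue_measure R) (fun x : R => \1_(`]0, +oo[%classic) x * kf alpha F x).
have D00 : 0 <= D0.
 by apply: J_ge0 => x; apply: mulr_ge0; [rewrite indicE|apply: k_ge0].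
have A0 t : phiA alpha F t <= 0.
 have : 0 <= J (@lebesgue_measure R) (fun x : R => - (\1_(`]0, +oo[%classic) x * ((cos (t * x) - 1) / x * kf alpha F x))).
  apply: J_ge0 => x; rewrite -mulrN; apply: mulr_ge0; first by rewrite indicE.
  have [x0|x0] := ltP x 0; first by rewrite (_ : kf alpha F x = 0) ?mulr0 ?oppr0// /kf leNgt x0.
  rewrite -!mulNr opprB; apply: mulr_ge0; last by apply: k_ge0.
  by rewrite divr_ge0// subr_ge0 cos_le1.
 rewrite phiAE J_N ?oppr_ge0//.
 have [M' hM'] : exists M' : R, forall x : R, 0 < x -> `|(cos (t * x) - 1) / x| <= M'.
  exists `|t| => x x0; rewrite normrM normfV (gtr0_norm x0) ler_pdivrMr//.
  by apply: le_trans (cosB1_abs _) _; rewrite normrM (gtr0_norm x0).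
 by apply: (itg_bk al0 mom _ hM'); mf.
have AD t : `|phiA alpha F t| <= D0 * `|t| by rewrite mulrC; exact: (phiA_abs al0 mom).
have BD t : `|phiB alpha F t| <= D0 * `|t| by rewrite mulrC; exact: (phiB_abs al0 mom).
have tail0 u : 0 < u -> pr P (fun w => u < `|X0 w|) <= 16 * D0 / u.
 exact: (@tail_bound R d Omega P D0 (phiA alpha F) (phiB alpha F) X0 mX0 cfX0 A0 AD BD).
(* As soon as [h * |y0| <= aa], the point [x - h * y0] stays in [[aa, bx + aa]], at positive
   distance from 0. *)
pose aa := a / 2; pose bx := 1 + b.
have aa0 : 0 < aa by rewrite /aa divr_gt0.
have b0 : 0 < b by exact: lt_le_trans ab.
have bx1 : 1 <= bx by rewrite /bx; lra.
have aabx : aa <= bx + aa by rewrite /bx; lra.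
have [cL [u0 [cL0 u00 low0]]] := small_ball_lower al0 F1 ep0 mom cre cim mX0 mE mU ind lawE lawU cfX0 lam0 tail0 aa0 aabx.
have lc0 : 0 < lam * c by exact: mulr_gt0.
(* [rho] is at most [n^(- lam c)], so this fixed number of lags gives [rho ^+ q <= n^-12]. *)
have [q _ hq] := nbhs_infty_ger (12 / (lam * c)).
have {}hq : 12 <= q%:R * (lam * c) by have := hq q (leqnn q); rewrite /= ler_pdivrMr.
pose e2 := 1 / (1 + 2 * r + 2 * alpha - delta).
have e20 : 0 < e2 by rewrite /e2 divr_gt0//; lra.
(* The four candidates serve in turn the bounds on [rho], on [h], on [h] divided by the separation,
   and the surplus 1/5 in [error_bound]. *)
pose gam := Num.min (Num.min (lam * c) e2) (Num.min (2 * delta * e2) (1 / 5)).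
have z1 : 0 < 2 * delta * e2 by rewrite mulr_gt0// mulr_gt0.
have z2 : 0 < 1 / 5 :> R by rewrite divr_gt0.
have g0 : 0 < gam by rewrite /gam !lt_min lc0 e20 z1 z2.
have gE : [/\ gam <= lam * c, gam <= e2, gam <= 2 * delta * e2 & gam <= 1 / 5].
 by rewrite /gam; split; rewrite !ge_min lexx ?orbT.
have [g1 g2 g3 g5] := gE.
pose kap := kb / (2 * kB).
have kap0 : 0 < kap by rewrite /kap divr_gt0// mulr_gt0.
have Qn0 : 0 <= 1 + (b - a) by lra.
have C20 : 0 <= 16 * D0 by rewrite mulr_ge0.
have [C [L0 [L01 rate]]] := @max_rate R bx C1 (16 * D0) kB kb M aa cL u0 (1 + (b - a)) gam q
 bx1 (ltW C10) C20 kB0 kb0 M0 aa0 cL0 u00 Qn0 g0 g5.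
pose T0 := bx + aa + kap; have T00 : 0 < T0 by rewrite /T0; lra.
pose G := (10 / (1 / 2)) ^+ 10 : R.
have G0 : 0 < G by rewrite /G exprn_gt0// !divr_gt0.
(* [L0] is for the rate, [|C| / eps] brings it below [eps], 2 gives [L >= 2], and the last term
   lifts the truncation level above [T0]. *)
pose Lm := L0 + `|C| / eps + 2 + 2 * (T0 * G).
have Ce : 0 <= `|C| / eps by rewrite divr_ge0// ltW.
have TG : 0 < T0 * G by exact: mulr_gt0.
pose hs := Num.min (Num.min (aa / (M + 1)) (u0 / kap)) 1.
have M1 : 0 < M + 1 by lra.
have z3 : 0 < aa / (M + 1) by rewrite divr_gt0.
have z4 : 0 < u0 / kap by rewrite divr_gt0.
have hs0 : 0 < hs by rewrite /hs !lt_min z3 z4 /=.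
have half : 0 < 1 / 2 :> R by rewrite divr_gt0.
have N2 : \forall n \near \oo, `|0 - h n| <= hs by (move/cvgrPdist_le: hlim; apply).
have N3 : \forall n \near \oo, `|0 - ((ln n%:R) ^+ 5 / n%:R) `^ (1 / (2 + 2 * alpha - delta)) / h n| <= 1 by (move/cvgrPdist_le: hlow; apply).
have N4 : \forall n \near \oo, `|0 - h n / ((n%:R * ln n%:R)^-1 `^ (1 / (1 + 2 * r + 2 * alpha - delta)))| <= 1 by (move/cvgrPdist_le: hup; apply).
have N5 : \forall n \near \oo, `|1 - theta n / (Num.sqrt n%:R * ((ln n%:R) ^+ 3)^-1)| <= 1 / 2 by (move/cvgrPdist_le: hth; apply).
have N6 := xsep 1.
clear hlow hup hth hlim nD xsep.
near=> n => d' Omega' Q Y nY t.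
have nl : expR Lm <= n%:R by near: n; exact: nbhs_infty_ger.
have n0R : 0 < n%:R :> R by exact: lt_le_trans (expR_gt0 _) nl.
have n0 : (0 < n)%N by rewrite -(ltr0n R).
pose L : R := ln n%:R.
have nE : n%:R = expR L by rewrite /L lnK// posrE.
have LL : Lm <= L by rewrite -ler_expR -nE.
have [LL0 [LC [L2 LT]]] : L0 <= L /\ `|C| / eps <= L /\ 2 <= L /\ 2 * (T0 * G) <= L.
 by have LL' : L0 + `|C| / eps + 2 + 2 * (T0 * G) <= L := LL; clear -LL' L01 Ce TG; split; [|split; [|split]]; lra.
have Lp : 0 < L by exact: lt_le_trans L2.
have Dn : c * ln n%:R <= Delta n by near: n; exact: hc.
have h0n := h0 n.
have hsn : `|h n| <= hs by (rewrite -normrN -sub0r; near: n; exact: N2).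
have {hsn}[hM [hk h1]] : h n <= aa / (M + 1) /\ h n <= u0 / kap /\ h n <= 1.
 by move: hsn; rewrite gtr0_norm// /hs !le_min => /andP[/andP[]].
have hl1 : `|((ln n%:R) ^+ 5 / n%:R) `^ (1 / (2 + 2 * alpha - delta)) / h n| <= 1 by (rewrite -normrN -sub0r; near: n; exact: N3).
have hu1 : `|h n / ((n%:R * ln n%:R)^-1 `^ (1 / (1 + 2 * r + 2 * alpha - delta)))| <= 1 by (rewrite -normrN -sub0r; near: n; exact: N4).
have ht1 : `|1 - theta n / (Num.sqrt n%:R * ((ln n%:R) ^+ 3)^-1)| <= 1 / 2 by near: n; exact: N5.
have xs1 : forall k l : 'I_(N n), k != l -> 1 * h n `^ (1 - 2 * delta) <= `|xs n k - xs n l| by near: n; exact: N6.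
have L1 : 1 <= L by apply: le_trans L2; rewrite ler1n.
have inE : (n%:R)^-1 = expR (- L) by rewrite expRN nE.
(* The lower rate of [h] is a power of [n] with exponent [- 1 / (2 + 2 * alpha - delta)], and this
   denominator exceeds 5 since [alpha > 2]. *)
have hL : expR (- (L / 5)) <= h n.
 move: hl1; rewrite ger0_norm; last by rewrite divr_ge0 ?powR_ge0// ltW.
 rewrite ler_pdivrMr// (mul1r (h n)) => hl2; apply: (le_trans _ hl2).
 have e10 : 0 < 2 + 2 * alpha - delta by clear -al2 d12; lra.
 apply: le_trans (_ : (expR (- L)) `^ (1 / (2 + 2 * alpha - delta)) <= _).
  rewrite -expRM ler_expR mulNr lerN2 ler_wpM2l ?(ltW Lp)//.
  by rewrite mul1r lef_pV2 ?posrE//; clear -al2 d12; lra.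
 apply: ge0_ler_powR; rewrite ?nnegrE ?expR_ge0 ?divr_ge0 ?exprn_ge0 ?(ltW Lp) ?(ltW e10)//.
 by rewrite -inE ler_peMl ?invr_ge0// exprn_ege1.
have hy2 : h n <= expR (- (e2 * L)).
 have p0 : 0 < (n%:R * L)^-1 `^ e2 by rewrite powR_gt0// invr_gt0 mulr_gt0.
 move: hu1; rewrite -/L -/e2 ger0_norm; last by rewrite divr_ge0 ?powR_ge0// ltW.
 rewrite ler_pdivrMr// (mul1r (_ `^ _)) => hu2; apply: le_trans hu2 _.
 rewrite (_ : - (e2 * L) = - L * e2); last by ring.
 rewrite expRM -inE; apply: (ge0_ler_powR (ltW e20)); rewrite ?nnegrE ?invr_ge0 ?mulr_ge0 ?(ltW Lp)//.
 by rewrite lef_pV2 ?posrE ?mulr_gt0// ler_peMr// ltW.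
have hy : h n <= expR (- (gam * L)).
 by apply: le_trans hy2 _; rewrite ler_expR lerN2 ler_wpM2r// ltW.
pose Ds := h n `^ (1 - 2 * delta).
have Ds0 : 0 < Ds by rewrite powR_gt0.
have lnh : ln (h n) <= - (e2 * L) by rewrite -ler_expR lnK ?posrE.
have DsE : Ds = expR ((1 - 2 * delta) * ln (h n)) by rewrite /Ds /powR gt_eqF.
(* The ratio is [h^(2 * delta)], itself a negative power of [n]: this is where the separation at
   scale [h^(1 - 2 * delta)] enters. *)
have hD : h n / Ds <= expR (- (gam * L)).
 rewrite DsE -expRN -{1}(lnK (_ : h n \is Num.pos)) ?posrE// -expRD ler_expR.
 rewrite (_ : _ + _ = 2 * delta * ln (h n)); last by ring.
 apply: le_trans (_ : 2 * delta * - (e2 * L) <= _); first by rewrite ler_wpM2l// mulr_ge0// ltW.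
 by rewrite mulrN lerN2 mulrA ler_wpM2r// ltW.
have hDs : h n <= Ds.
 have : h n / Ds <= 1 by apply: le_trans hD _; rewrite -expR0 ler_expR oppr_le0 mulr_ge0// ltW.
 by rewrite ler_pdivrMr// mul1r.
have xD k l : k != l -> Ds <= `|xs n k - xs n l| by move=> kl; have := xs1 k l kl; rewrite mul1r.
(* The gaps are at least [Ds >= h], so [sep_count] bounds the number of points by a multiple of
   [1 / h], hence of [n^(1/5)]. *)
have hN : (N n)%:R <= (1 + (b - a)) * expR (L / 5).
 have sc : (N n)%:R * h n <= b - a + h n.
  apply: (sep_count (x := xs n) (ltW h0n) ab (xab n)) => k l kl.
  have lk : l != k by rewrite -(inj_eq val_inj)/= gtn_eqF.
  have := xD l k lk; rewrite ger0_norm; last by rewrite subr_ge0 ltW// xinc.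
  by have := hDs; clear; lra.
 have : (N n)%:R <= (b - a + h n) / h n by rewrite ler_pdivlMr.
 move=> /le_trans; apply; apply: ler_pM; rewrite ?invr_ge0 ?(ltW h0n)//; [clear -h0n ab; lra|clear -h1; lra|].
 by rewrite -[expR _]invrK -expRN lef_pV2 ?posrE ?expR_gt0.
pose rho := expR (- (lam * Delta n)).
have lD : 0 < lam * Delta n by rewrite mulr_gt0//; apply: lt_le_trans Dn; exact: mulr_gt0.
have lcD : lam * c * L <= lam * Delta n by rewrite -mulrA ler_pM2l.
have rho0 : 0 <= rho by exact: expR_ge0.
have rho1 : rho <= 1 by rewrite /rho -[leRHS]expR0 ler_expR oppr_le0 ltW.
have rhoy : rho <= expR (- (gam * L)).
 by rewrite /rho ler_expR lerN2; apply: le_trans lcD; rewrite ler_wpM2r// ltW.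
have rhoq : rho ^+ q <= expR (- (12 * L)).
 rewrite /rho -expRM_natl ler_expR mulrN lerN2; apply: le_trans (_ : q%:R * (lam * c * L) <= _); last by rewrite ler_wpM2l.
 by rewrite mulrA ler_wpM2r// ltW.
have hM' : h n * M <= aa.
 apply: le_trans (_ : aa / (M + 1) * (M + 1) <= _); last by rewrite divfK// gt_eqF.
 by apply: ler_pM; rewrite ?(ltW h0n)// lerDl.
have hk' : h n * kap <= u0 by rewrite -ler_pdivlMr.
pose sq := expR (L / 2) / L ^+ 3.
have sE : Num.sqrt n%:R * ((ln n%:R) ^+ 3)^-1 = sq.
 rewrite /sq -/L; congr (_ / _).
 have -> : n%:R = expR (L / 2) ^+ 2 by rewrite nE -expRM_natl; congr expR; field.
 by rewrite sqrtr_sqr ger0_norm// expR_ge0.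
have sq0 : 0 < sq by rewrite /sq divr_gt0 ?expR_gt0 ?exprn_gt0.
have [th1 th2] : 1 / 2 * sq <= theta n /\ theta n <= 3 / 2 * sq.
 move: ht1; rewrite sE distrC ler_norml => /andP[].
 by rewrite lerBrDr lerBlDr ler_pdivlMr// ler_pdivrMr// => l1 l2; clear -l1 l2; split; lra.
(* From [L ^+ 10 <= G * expR (L / 2)]: the truncation level, of order [expR (L / 2) / L ^+ 3], grows
   at least like [L]. *)
have sqL : L <= G * sq.
 have := ln_pow_decay half (ltW Lp).
 rewrite -/G expRN ler_pdivrMr ?expR_gt0// (_ : 1 / 2 * L = L / 2); last by field.
 move=> hG; rewrite /sq mulrA ler_pdivlMr ?exprn_gt0//; apply: le_trans hG.
 by rewrite -exprS ler_weXn2l.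
have th3 : T0 <= theta n.
 apply: le_trans th1; have : 2 * (T0 * G) <= G * sq by exact: le_trans LT sqL.
 rewrite (_ : 2 * (T0 * G) = G * (2 * T0)); last by ring.
 by rewrite ler_pM2l// => hq2; clear -hq2; lra.
have th4 : theta n <= expR L.
 apply: le_trans th2 _; have e2L : 2 <= expR (L / 2) by apply: le_trans (expR_ge1Dx _); clear -L2; lra.
 have sqe : sq <= expR (L / 2) by rewrite /sq ler_pdivrMr ?exprn_gt0// ler_peMr ?expR_ge0// exprn_ege1.
 have -> : expR L = expR (L / 2) * expR (L / 2) by rewrite -expRD; congr expR; field.
 have : 2 * expR (L / 2) <= expR (L / 2) * expR (L / 2) by rewrite ler_wpM2r// expR_ge0.
 by have := expR_gt0 (L / 2); clear -sqe; lra.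
have h01 : 0 < h n <= 1 by rewrite h0n h1.
have [K1 K2 K3 [y0 y0M Ky]] := KF (h n) h01.
have hb0 : 0 < hal alpha (h n) by exact: hal_gt0.
pose X := ouX lam (Delta n) X0 E U; pose Z := innov lam (Delta n) X0 E U; pose K := Kn alpha F W (h n).
have mZ i : measurable_fun setT (Z i) by exact: (innov_meas _ _ mX0 mE mU).
have mX k : measurable_fun setT (X k) by exact: (ouX_meas _ _ mX0 mE mU).
have iZ : mutually_independent P Z by move=> JJ BB; exact: (innov_indep al0 F1 ep0 mom cre cim mX0 mE mU ind lawE lawU cfX0 lD).
have XE k w : X k w = \sum_(i < k.+1) rho ^+ (k - i) * Z i w by exact: ouX_sum.
have lawX k (f : R -> R) : bmf f -> J P (fun w => f (X k w)) = J P (fun w => f (X 0%N w)).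
 move=> bf; apply: (J_law (mX k) mX0 _ bf) => A mA.
 exact: (ouX_law al0 F1 ep0 mom cre cim mX0 mE mU ind lawE lawU cfX0 lD).
have lawp k (f : R -> bool) : measurable_fun setT f -> pr P (fun w => f (X k w)) = pr P (fun w => f (X0 w)).
 by move=> mf0; exact: (lawX k (fun v : R => if f v then 1 else 0) (bmf_pr mf0)).
have ball k x u : 0 < u -> pr P (fun w => `|X k w - x| <= u) <= C1 * u.
 by move=> u0'; rewrite (lawp k (fun v : R => `|v - x| <= u)); [exact: ball0|mf].
have tail k u : 0 < u -> pr P (fun w => u < `|X k w|) <= 16 * D0 / u.
 by move=> u0'; rewrite (lawp k (fun v : R => u < `|v|)); [exact: tail0|mf].
have low z u : aa <= z <= bx + aa -> 0 < u <= u0 -> cL * u <= pr P (fun w => z <= X 1%N w <= z + u).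
 by move=> hz hu; rewrite (lawp 1%N (fun v : R => z <= v <= z + u)); [exact: low0|mf].
have mK : measurable_fun setT K.
 apply: continuous_measurable_fun => v; apply/cvgrPdist_le => e e0.
 have Bh : 0 < kB * hal alpha (h n) by exact: mulr_gt0.
 apply/nbhs_ballP; exists (e / (kB * hal alpha (h n))) => /=; first by rewrite divr_gt0.
 move=> v' vv'; apply: le_trans (K3 v v') _.
 have : `|v - v'| < e / (kB * hal alpha (h n)) := vv'.
 by rewrite ltr_pdivlMr// (mulrC `|v - v'|) => /ltW.
have xb l : 2 * aa <= xs n l <= bx.
 by have /andP[x1 x2] := xab n l; rewrite /aa /bx; apply/andP; split; clear -x1 x2; lra.
have xbx l : `|xs n l| <= bx by have /andP[x1 x2] := xb l; rewrite ger0_norm//; apply: le_trans x1; rewrite mulr_ge0// ltW.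
have [sv main] := rate d Omega P rho Z X rho0 rho1 mZ iZ XE lawX ball tail low n (N n) L (h n) (theta n) Ds (hal alpha (h n)) y0 K (xs n)
 nE LL0 hN hb0 Ds0 rhoy rhoq hL hy hD hM' hk' th3 th4 mK K1 K2 K3 y0M Ky xb xD.
have B0 : 0 <= kB * hal alpha (h n) by rewrite mulr_ge0// ltW.
have bg l k : bmf (gc P X (h n) (theta n) K (xs n l) k).
 exact: (gc_bmf P rho0 rho1 (ltW C10) C20 mZ XE (theta n) h0n h1 B0 bx1 mK K1 K2 k (xbx l)).
have mg l k : J P (gc P X (h n) (theta n) K (xs n l) k) = 0.
 exact: (gc_mean rho0 rho1 (ltW C10) C20 mZ XE lawX (theta n) h0n h1 B0 bx1 mK K1 K2 k (xbx l)).
have SE : [set w | \big[Num.max/0]_(l < N n) `|Wn P lam X0 E U alpha F W n (Delta n) (theta n) (h n) (xs n l) w| <= t] =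
  [set w | \big[Num.max/0]_(l < N n) `|gsum P X (h n) (theta n) K n (xs n) l w * tau P X (h n) (theta n) K n (xs n) l| <= t].
 apply: eq_set => w; congr (is_true (_ <= _)); apply: eq_bigr => l _; congr (`|_|).
 by apply: WnE; [exact: n0|exact: bg|exact: mg|exact: sv].
rewrite SE; apply: le_trans (main d' Omega' Q Y t nY) _.
rewrite ler_pdivrMr//; apply: le_trans (ler_norm C) _.
by rewrite mulrC -ler_pdivrMr.
Unshelve. all: by end_near.
Qed.
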